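(* Let $b=b(t)$ be a periodic, non-constant, smooth, positive function defined on $\mathbb{R}$ and satisfying Assumption ISIN. Assume that the Riemannian manifold $M$ possesses intrinsic self coherence structure and that for the associated function $f(t)$, $t\in\mathbb{R}$, the Nakanishi–Ohta condition does not hold, that is, $$\int_0^\infty \exp\left(\int_0^s f(r)\,dr\right)ds<\infty\quad\text{or}\quad \int_{-\infty}^0 \exp\left(\int_0^s f(r)\,dr\right)ds<\infty .$$ Then for every $n$, $s$, and for every positive $\delta$ there are initial data $u_0^i,u_1^i\in C_0^\infty(\mathbb{R}^n)$, $i=1,\ldots,m$, such that $$\sum_{i=1}^m\left(\|u_0^i\|_{(s+1)}+\|u_1^i\|_{(s)}\right)\le\delta ,$$ but the solution $u=(u^1,\ldots,u^m)\in C^2(\mathbb{R}_+\times\mathbb{R}^n)$ of the wave map system $$u^i_{tt}-n\frac{\dot b(t)}{b(t)}u^i_t-b^2(t)\Delta u^i+\sum_{j,k=1}^m\Gamma^i_{j,k}(u^1,\ldots,u^m)\left(u^j_tu^k_t-b^2(t)\nabla u^j\cdot\nabla u^k\right)=0,\quad i=1,\ldots,m,$$ with the prescribed data $u^i(0,x)=u^i_0(x)$, $u^i_t(0,x)=u^i_1(x)$, $i=1,\ldots,m$, $x\in\mathbb{R}^n$, does not exist.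
   Context: Notation. $n$ is the spatial dimension; $\Delta$ and $\nabla$ are the Laplacian and the gradient in $x\in\mathbb{R}^n$; $\dot b=db/dt$; $\|\cdot\|_{(s)}$ is the norm of the Sobolev space $H^s(\mathbb{R}^n)$. $M$ is an $m$-dimensional Riemannian manifold with metric $h$, and the wave map is written as the displayed system in a global chart of $M$, where $$\Gamma^i_{j,k}(u)=\frac12\sum_{l=1}^m h^{il}\left(\frac{\partial h_{kl}}{\partial u^j}+\frac{\partial h_{jl}}{\partial u^k}-\frac{\partial h_{kj}}{\partial u^l}\right)$$ are the Christoffel symbols of $(M,h)$ and $(h^{il})$ is the inverse matrix of $(h_{il})$. Intrinsic self coherence structure (distinguished geodesic). $M$ possesses intrinsic self coherence structure if in some chart the straight half-line $\{(a_1t,\ldots,a_mt): t\in(0,\infty)\}$ is covered by the geodesics. In terms of Christoffel symbols: if a segment of the straight line $\{(a_1t,\ldots,a_mt):t\in\mathbb{R}\}$ in the chart is covered by a smooth non-constant geodesic, then there is a function $f(t)$ such that $$\sum_{j,k=1}^m\Gamma^i_{j,k}(a_1t,\ldots,a_mt)\,a_ja_k=a_i f(t),\qquad i=1,\ldots,m,$$ for all $t$ in the corresponding interval of $\mathbb{R}$; conversely, if this relation holds with a continuously differentiable $f$ at all points of a segment of the line, then there is a geodesic covering that segment. The associated function $f(t)$, $t\in\mathbb{R}$, in the claim is the function $f$ of this relation. Nakanishi–Ohta condition for $f$: $\int_0^\infty\exp\left(\int_0^s f(r)\,dr\right)ds=\infty$ and $\int_{-\infty}^0\exp\left(\int_0^s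 f(r)\,dr\right)ds=\infty$. Assumption ISIN. There exists a nonempty open instability interval $\Lambda\subset(0,\infty)$ for the ordinary differential equation $$y_{tt}(t)+\left(\lambda b^2(t)-q(t)\right)y(t)=0,\qquad q(t)=\frac n4\left(\frac n4-1\right)\left(\frac{\dot b(t)}{b(t)}\right)^2-\frac n2\,\frac{\ddot b(t)}{b(t)},$$ with the parameter $\lambda\in\mathbb{R}$. Here an instability interval is understood in the usual sense of Floquet theory: for $\lambda\in\Lambda$ the monodromy matrix over one period has real eigenvalues $\mu_0,\mu_0^{-1}$ with $|\mu_0|>1$. *)

(* Defs.v *)
From HB Require Import structures.
From mathcomp Require Import all_boot all_order all_algebra.
From mathcomp Require Import all_classical all_reals all_analysis.
Import numFieldNormedType.Exports.
Import Order.TTheory GRing.Theory Num.Theory.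

Set Implicit Arguments.
Unset Strict Implicit.
Unset Printing Implicit Defensive.

Local Open Scope ring_scope.
Local Open Scope classical_set_scope.

(* Meant for finite-dimensional [V] and for sets [A] contained in the closure of
   their interior, such as open sets and closed half-spaces.  Derivatives are
   taken in the interior of [A] only, but must extend continuously to [A].
   Asking this for every direction [v], instead of a basis, is the same thing in
   finite dimension. *)
Fixpoint Ck (R : realType) (V W : normedModType R) (k : nat)
    (A : set V) (f : V -> W) : Prop :=
  {within A, continuous f} /\
  (if k is k'.+1 then
     forall v : V, exists g : V -> W,
       Ck k' A g /\ (forall x, A° x -> is_derive x v f (g x))
   else True).

Definition smooth (R : realType) (V W : normedModType R)
    (A : set V) (f : V -> W) : Prop :=
  forall k, Ck k A f.

Definition test_function (R : realType) (n : nat) (u : 'rV[R]_n -> R) : Prop :=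
  smooth (W := R^o) [set: 'rV[R]_n] u /\ compact (closure [set x | u x != 0]).

(* The integral over R^n as an iterated one-dimensional Lebesgue integral.  By
   Tonelli and Fubini it is the integral against n-dimensional Lebesgue measure
   for the integrands used below, which are continuous and either nonnegative or
   compactly supported. *)
Fixpoint integral_Rn (R : realType) (n : nat) : ('rV[R]_n -> \bar R) -> \bar R :=
  match n with
  | 0 => fun F => F 0
  | n'.+1 => fun F =>
      (\int[lebesgue_measure]_(t in [set: R])
         integral_Rn (fun x : 'rV[R]_n' => F (row_mx (t%:M : 'rV[R]_1) x)))%E
  end.

Definition dot (R : realType) (n : nat) (x y : 'rV[R]_n) : R :=
  \sum_(k < n) x 0 k * y 0 k.

(* |û(xi)|^2 for the transform û(xi) = \int exp(- i <x, xi>) u(x) dx of a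
   real-valued [u]. *)
Definition fourier_sqnorm (R : realType) (n : nat)
    (u : 'rV[R]_n -> R) (xi : 'rV[R]_n) : R :=
  fine (integral_Rn (fun x => (u x * cos (dot x xi))%:E)) ^+ 2 +
  fine (integral_Rn (fun x => (u x * sin (dot x xi))%:E)) ^+ 2.

(* The factor (2 pi)^-n makes [sobolev_norm 0] the L^2 norm. *)
Definition sobolev_norm (R : realType) (n : nat) (s : R) (u : 'rV[R]_n -> R)
    : \bar R :=
  sqrte (((2 * pi) ^- n)%:E *
         integral_Rn (fun xi =>
           ((1 + dot xi xi) `^ s * fourier_sqnorm u xi)%:E))%E.

Definition hill_potential (R : realType) (n : nat) (b : R -> R) (t : R) : R :=
  n%:R / 4 * (n%:R / 4 - 1) * (derive1 b t / b t) ^+ 2 -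
  n%:R / 2 * (derive1n 2 b t / b t).

Definition hill_solution (R : realType) (n : nat) (b : R -> R) (lambda : R)
    (y dy : R -> R) : Prop :=
  forall t : R,
    is_derive t (1 : R) y (dy t) /\
    is_derive t (1 : R) dy (- ((lambda * b t ^+ 2 - hill_potential n b t) * y t)).

Definition is_monodromy (R : realType) (n : nat) (b : R -> R) (T lambda : R)
    (X : 'M[R]_2) : Prop :=
  exists y1 dy1 y2 dy2 : R -> R,
    [/\ hill_solution n b lambda y1 dy1,
        hill_solution n b lambda y2 dy2,
        (y1 0 = 1 /\ dy1 0 = 0),
        (y2 0 = 0 /\ dy2 0 = 1) &
        X = block_mx (y1 T)%:M (y2 T)%:M (dy1 T)%:M (dy2 T)%:M :> 'M[R]_(1 + 1)].

(* As the eigenvalues [mu] and [mu^-1] of the 2 x 2 matrix differ, there are no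
   others. *)
Definition floquet_unstable (R : realType) (n : nat) (b : R -> R) (T lambda : R)
    : Prop :=
  exists (X : 'M[R]_2) (mu : R),
    [/\ is_monodromy n b T lambda X,
        eigenvalue X mu, eigenvalue X mu^-1 & 1 < `|mu|].

Definition ISIN (R : realType) (n : nat) (b : R -> R) (T : R) : Prop :=
  exists Lambda : set R,
    [/\ Lambda !=set0, open Lambda, is_interval Lambda,
        Lambda `<=` [set lambda | 0 < lambda] &
        forall lambda, Lambda lambda -> floquet_unstable n b T lambda].

(* A manifold with a global chart: its image is the open set [Omega] of R^m, and
   [h u] is the Gram matrix of the metric at the point with coordinates [u]. *)
Definition riemannian_metric (R : realType) (m : nat)
    (Omega : set 'rV[R]_m) (h : 'rV[R]_m -> 'M[R]_m) : Prop :=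
  [/\ open Omega,
      (forall i j, smooth (W := R^o) Omega (fun u => h u i j)),
      (forall u, Omega u -> (h u)^T = h u) &
      (forall u (v : 'rV[R]_m), Omega u -> v != 0 -> 0 < (v *m h u *m v^T) 0 0)].

Definition christoffel (R : realType) (m : nat) (h : 'rV[R]_m -> 'M[R]_m)
    (i j k : 'I_m) (u : 'rV[R]_m) : R :=
  let d (l p q : 'I_m) : R :=
    'D_(delta_mx 0 l) (fun v : 'rV[R]_m => h v p q : R^o) u in
  2^-1 * \sum_(l < m) invmx (h u) i l * (d j k l + d k j l - d l k j).

Definition geodesic (R : realType) (m : nat)
    (Omega : set 'rV[R]_m) (h : 'rV[R]_m -> 'M[R]_m)
    (I : set R) (g : R -> 'rV[R]_m) : Prop :=
  [/\ smooth (V := R^o) I g,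
      (forall t, I t -> Omega (g t)) &
      forall t, I t -> forall i : 'I_m,
        derive1n 2 g t 0 i +
        \sum_(j < m) \sum_(k < m)
          christoffel h i j k (g t) * derive1 g t 0 j * derive1 g t 0 k = 0].

Definition intrinsic_self_coherence (R : realType) (m : nat)
    (Omega : set 'rV[R]_m) (h : 'rV[R]_m -> 'M[R]_m) (a : 'rV[R]_m) : Prop :=
  a != 0 /\
  exists (I : set R) (g : R -> 'rV[R]_m),
    [/\ open I, is_interval I,
        geodesic Omega h I g,
        (exists t1 t2, [/\ I t1, I t2 & g t1 != g t2]) &
        [set t *: a | t in [set t : R | 0 < t]] `<=` g @` I].

(* As [a != 0], at most one [f] satisfies these equations; it is smooth when the
   metric is. *)
Definition associated_function (R : realType) (m : nat)
    (Omega : set 'rV[R]_m) (h : 'rV[R]_m -> 'M[R]_m) (a : 'rV[R]_m)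
    (f : R -> R) : Prop :=
  forall t : R, Omega (t *: a) /\
    forall i : 'I_m,
      \sum_(j < m) \sum_(k < m)
        christoffel h i j k (t *: a) * a 0 j * a 0 k = a 0 i * f t.

(* The oriented integral of [f] from 0 to [s]. *)
Definition integral_from0 (R : realType) (f : R -> R) (s : R) : R :=
  if 0 <= s then \int[lebesgue_measure]_(r in `[0, s]) f r
  else - \int[lebesgue_measure]_(r in `[s, 0]) f r.

Section WaveMap.
Context (R : realType) (n : nat).

Local Notation ST := (R^o * 'rV[R]_n)%type.

Definition half_space : set ST := [set p | 0 <= p.1].

Definition Dt (u : ST -> R) (p : ST) : R :=
  'D_((1, 0) : ST) (u : ST -> R^o) p.

Definition Dx (k : 'I_n) (u : ST -> R) (p : ST) : R :=
  'D_((0, delta_mx 0 k) : ST) (u : ST -> R^o) p.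

Definition laplacian (u : ST -> R) (p : ST) : R :=
  \sum_(k < n) Dx k (Dx k u) p.

Definition grad_dot (u v : ST -> R) (p : ST) : R :=
  \sum_(k < n) Dx k u p * Dx k v p.

(* [u i] is the i-th coordinate of the map in the chart.  Its values at negative
   times are irrelevant, hence the one-sided time derivative in the second
   initial condition.  The system is imposed for t > 0; by continuity it then
   holds for the one-sided derivatives at t = 0. *)
Definition wave_map_solution (m : nat)
    (Omega : set 'rV[R]_m) (h : 'rV[R]_m -> 'M[R]_m) (b : R -> R)
    (u0 u1 : 'I_m -> 'rV[R]_n -> R) (u : 'I_m -> ST -> R) : Prop :=
  [/\ (forall i, Ck (W := R^o) 2 half_space (u i)),
      (forall p, half_space p -> Omega (\row_i u i p)),
      (forall (t : R) (x : 'rV[R]_n) (i : 'I_m), 0 < t ->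
         let p : ST := (t, x) in
         Dt (Dt (u i)) p - n%:R * (derive1 b t / b t) * Dt (u i) p
         - b t ^+ 2 * laplacian (u i) p
         + \sum_(j < m) \sum_(k < m)
             christoffel h i j k (\row_l u l p) *
             (Dt (u j) p * Dt (u k) p - b t ^+ 2 * grad_dot (u j) (u k) p) = 0),
      (forall i x, u i (0, x) = u0 i x) &
      (forall i x,
         (t^-1 * (u i (t, x) - u i (0, x))) @[t --> (0 : R)^'+] --> u1 i x)].

End WaveMap.

(* Main.v *)
Require Import Defs.
From mathcomp Require Import all_boot all_order all_algebra.
From mathcomp Require Import all_classical all_reals all_analysis measurable_realfun.
From mathcomp Require Import ring lra zify.
Import numFieldNormedType.Exports.
Import Order.TTheory GRing.Theory Num.Theory.
Local Open Scope ring_scope.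
Local Open Scope classical_set_scope.
Set Implicit Arguments.
Unset Strict Implicit.
Unset Printing Implicit Defensive.

(** The failing half of the Nakanishi-Ohta condition says that the geodesic on
    the line through 0 and a runs off to infinity in the chart, in one of its
    two directions, at a finite value of its affine parameter. Put G(x) =
    \int_0^x exp (\int_0^s f) ds, which is this parameter, and Phi = G^-1. If w
    solves the linear equation w_tt - n (b'/b) w_t - b^2 Lap w = 0, then Phi(w)
    a solves the wave map system: the equation Phi'' = - f(Phi) Phi'^2 of the
    geodesic is what makes the quadratic terms cancel (geodesic_jet_solves). As
    one half-line integral is finite, the range of G is bounded on one side. The
    largest symmetric interval ]-g, g[ in that range has an end which G does not
    attain (critical_amplitude), so a wave whose amplitude reaches g at the
    right sign drives Phi(w) to infinity.

    It remains to make a small wave reach the amplitude g. The mode S of w =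
    kappa S(t) cos (z x_0), with S(0) = 0, obeys a Hill equation with period T.
    Since b is not constant, some frequency z has S(t)^2 / (1 + t)^n unbounded
    (superdiffusive_mode). For n >= 2 this is exponential growth at a frequency
    whose monodromy has trace greater than 2 in absolute value. Such a frequency
    exists by a Borg-type argument: if all traces were at most 2, then \int b^n
    \int b^(2-n) <= (\int b)^2 over a period (borg_trace), against the strict
    Cauchy-Schwarz inequality. For n = 1 the mode z = 0 grows linearly, which is
    enough. The data are u_0 = 0 and u_1 = a kappa b(0)^n cos (z x_0) times a
    plateau of width L. If the amplitude g is to be reached at time t_0, then
    kappa is g / |S(t_0)| and finite speed of propagation asks for L comparable
    to 1 + t_0. The Sobolev norm of such a wave packet is of order kappa L^(n/2)
    (packet_sobolev_bound), which is as small as desired for suitable t_0, S^2 /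
    (1 + t)^n being unbounded.

    Finally, a C^2 solution with these data must equal Phi(w) a in the cone over
    the plateau up to the time ts when |kappa S| first reaches g. This is an
    energy estimate for the difference of two solutions (cone_uniqueness and
    wave_map_uniqueness), the Christoffel symbols being locally Lipschitz. On
    the axis x = 0 one then has G(u_i / a_i) = kappa S for t < ts, hence at ts
    by continuity, and there sg kappa S = g is a value which sg G does not take
    (no_wave_map_solution). *)

(** * Rules for directional derivatives *)

(** Directional derivatives are derivatives along a line, so that one-variable
    calculus applies to them. *)
Lemma is_derive_line (R : realType) (V W : normedModType R) (f : V -> W)
    (x v : V) (l : W) :
  is_derive x v f l <-> is_derive (0 : R^o) (1 : R^o) (fun h : R^o => f (h *: v + x)) l.
Proof.
have E : 'D_v f x = 'D_(1 : R^o) (fun h : R^o => f (h *: v + x)) 0.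
  rewrite /derive; set g1 := (X in X @ _); set g2 := (X in _ = lim (X @ _)).
  suff -> : g1 = g2 by [].
  apply: funext => h; rewrite /g1 /g2 /=.
  by rewrite addr0 scale0r add0r [_%:A]mulr1.
split => -[dv <-].
  by rewrite E; apply: (DeriveDef (proj1 (derivable1P f x v) dv) erefl).
by rewrite -E; apply: (DeriveDef (proj2 (derivable1P f x v) dv) erefl).
Qed.

Lemma is_derive_chain (R : realType) (V : normedModType R) (f : R -> R)
    (g : V -> R^o) (x v : V) (a c : R) :
  is_derive (g x : R^o) (1 : R^o) (f : R^o -> R^o) a -> is_derive x v g c ->
  is_derive x v (fun y => f (g y) : R^o) (a * c).
Proof.
move=> fa /is_derive_line gc; apply/is_derive_line.
apply: (@is_derive1_comp _ f (fun h : R => g (h *: v + x))) => //.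
by rewrite scale0r add0r.
Qed.

Section derivative_rules.
Variables (R : realType) (V : normedModType R).
Implicit Types (f g : V -> R^o) (x v : V).

Lemma isd_cst x v (c : R) : is_derive x v (fun _ => c : R^o) 0.
Proof. exact: is_derive_cst. Qed.

Lemma isd_add x v f g a c : is_derive x v f a -> is_derive x v g c ->
  is_derive x v (fun y => f y + g y : R^o) (a + c).
Proof. by move=> fa gc; exact: is_deriveD. Qed.

Lemma isd_opp x v f a : is_derive x v f a -> is_derive x v (fun y => - f y : R^o) (- a).
Proof. by move=> fa; exact: is_deriveN. Qed.

Lemma isd_sub x v f g a c : is_derive x v f a -> is_derive x v g c ->
  is_derive x v (fun y => f y - g y : R^o) (a - c).
Proof. by move=> fa gc; exact: is_deriveB. Qed.

Lemma isd_mul x v f g a c : is_derive x v f a -> is_derive x v g c ->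
  is_derive x v (fun y => f y * g y : R^o) (a * g x + f x * c).
Proof.
move=> fa gc; have H := @is_deriveM _ _ f g x v a c fa gc.
by apply: is_derive_eq H _; rewrite addrC /GRing.scale /= [g x * a]mulrC.
Qed.

Lemma isd_sqr x v f a : is_derive x v f a ->
  is_derive x v (fun y => f y ^+ 2 : R^o) (2 * f x * a).
Proof.
move=> fa; have := isd_mul fa fa.
have -> : (fun y => f y * f y) = (fun y => f y ^+ 2) by apply: funext => y; rewrite expr2.
by move=> H; apply: is_derive_eq H _; ring.
Qed.

Lemma isd_exp n x v f a : is_derive x v f a ->
  is_derive x v (fun y => f y ^+ n.+1 : R^o) (n.+1%:R * f x ^+ n * a).
Proof.
move=> fa; elim: n => [|n IH].
  have -> : (fun y => f y ^+ 1) = f by apply: funext => y; rewrite expr1.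
  by apply: is_derive_eq fa _; rewrite expr0; ring.
have := isd_mul fa IH.
have -> : (fun y => f y * f y ^+ n.+1) = (fun y => f y ^+ n.+2).
  by apply: funext => y; rewrite -exprS.
move=> H; apply: is_derive_eq H _; rewrite exprS -[in RHS]natr1; ring.
Qed.

Lemma isd_inv x v f a : f x != 0 -> is_derive x v f a ->
  is_derive x v (fun y => (f y)^-1 : R^o) (- a / f x ^+ 2).
Proof.
move=> f0 [df <-]; apply: (DeriveDef (derivableV f0 df)).
by rewrite (deriveV f0 df) /GRing.scale /=; field.
Qed.

Lemma isd_sum (I : Type) (r : seq I) (P : pred I) x v (f : I -> V -> R^o) (a : I -> R) :
  (forall i, P i -> is_derive x v (f i) (a i)) ->
  is_derive x v (fun y => \sum_(i <- r | P i) f i y : R^o) (\sum_(i <- r | P i) a i).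
Proof.
move=> fa; elim: r => [|i r IH].
  rewrite big_nil (_ : (fun y => _) = fun=> 0); first exact: isd_cst.
  by apply: funext => y; rewrite big_nil.
rewrite big_cons (_ : (fun y => _) =
    if P i then (fun y => f i y + \sum_(j <- r | P j) f j y) else (fun y => \sum_(j <- r | P j) f j y)).
  by case: ifP => // Pi; exact: isd_add (fa _ Pi) IH.
by apply: funext => y; rewrite big_cons; case: ifP.
Qed.

Lemma isd_ext x v f g a : (forall y, f y = g y) -> is_derive x v f a -> is_derive x v g a.
Proof. by move=> /funext ->. Qed.

End derivative_rules.

Lemma isd_id (R : realType) (x : R) : is_derive x 1 (fun y : R => y) 1.
Proof. exact: is_derive_id. Qed.

Lemma isd_cos (R : realType) (V : normedModType R) (x v : V) (f : V -> R^o) a :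
  is_derive x v f a -> is_derive x v (fun y => cos (f y) : R^o) (- sin (f x) * a).
Proof. by move=> fa; apply: is_derive_chain fa; exact: is_derive_cos. Qed.

Lemma isd_sin (R : realType) (V : normedModType R) (x v : V) (f : V -> R^o) a :
  is_derive x v f a -> is_derive x v (fun y => sin (f y) : R^o) (cos (f x) * a).
Proof. by move=> fa; apply: is_derive_chain fa; exact: is_derive_sin. Qed.

Lemma isd_expR (R : realType) (V : normedModType R) (x v : V) (f : V -> R^o) a :
  is_derive x v f a -> is_derive x v (fun y => expR (f y) : R^o) (expR (f x) * a).
Proof. by move=> fa; apply: is_derive_chain fa; exact: is_derive_expR. Qed.

Ltac isder_rec :=
  first
  [ eassumption
  | notypeclasses refine (isd_cst _ _ _)
  | notypeclasses refine (isd_id _)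
  | notypeclasses refine (isd_sqr _); isder_rec
  | notypeclasses refine (isd_exp _ _); isder_rec
  | notypeclasses refine (isd_add _ _); isder_rec
  | notypeclasses refine (isd_sub _ _); isder_rec
  | notypeclasses refine (isd_opp _); isder_rec
  | notypeclasses refine (isd_mul _ _); isder_rec
  | notypeclasses refine (isd_cos _); isder_rec
  | notypeclasses refine (isd_sin _); isder_rec
  | notypeclasses refine (isd_expR _); isder_rec
  | match goal with H : _ |- _ => notypeclasses refine (H _) end
  | idtac ].
(** Computes a derivative by structural recursion and leaves the equality of the
    result with the stated value. *)
Ltac isder := notypeclasses refine (is_derive_eq _ _); [ isder_rec | cbv beta delta [Datatypes.id] ].

Lemma is_derive_cont (R : realType) (f : R -> R) (x l : R) :
  is_derive x 1 f l -> {for x, continuous f}.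
Proof.
by move=> [df _]; apply/differentiable_continuous/derivable1_diffP.
Qed.

Lemma mvt (R : realType) (f df : R -> R) (a b : R) : a <= b ->
  (forall x, a <= x <= b -> is_derive x 1 f (df x)) ->
  exists2 c, a <= c <= b & f b - f a = df c * (b - a).
Proof.
move=> ab fd.
have [||c + ->] := @MVT_segment _ f df a b ab.
- by move=> x; rewrite in_itv /= => /andP[/ltW ax /ltW xb]; apply: fd; rewrite ax.
- apply: derivable_within_continuous => x; rewrite in_itv /= => /fd.
  by case.
by rewrite in_itv /= => cab; exists c.
Qed.

Lemma deriv_ge0_le (R : realType) (f df : R -> R) (a b : R) : a <= b ->
  (forall x, a <= x <= b -> is_derive x 1 f (df x)) ->
  (forall x, a <= x <= b -> 0 <= df x) -> f a <= f b.
Proof.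
move=> ab fd d0; have [c cab E] := mvt ab fd.
by rewrite -subr_ge0 E mulr_ge0 ?d0 // subr_ge0.
Qed.

Lemma deriv_norm_le (R : realType) (f df : R -> R) (a b M : R) : a <= b ->
  (forall x, a <= x <= b -> is_derive x 1 f (df x)) ->
  (forall x, a <= x <= b -> `|df x| <= M) -> `|f b - f a| <= M * (b - a).
Proof.
move=> ab fd dM; have [c cab ->] := mvt ab fd.
by rewrite normrM (ger0_norm (_ : 0 <= b - a)) ?subr_ge0 // ler_wpM2r ?dM // subr_ge0.
Qed.

Lemma deriv_norm_le_abs (R : realType) (f df : R -> R) (a b M : R) :
  (forall x, `|x - a| <= `|b - a| -> is_derive x 1 f (df x)) ->
  (forall x, `|x - a| <= `|b - a| -> `|df x| <= M) -> `|f b - f a| <= M * `|b - a|.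
Proof.
move=> fd dM; have [ab|/ltW ba] := leP a b.
  rewrite (ger0_norm (_ : 0 <= b - a)) ?subr_ge0 //.
  have H x : a <= x <= b -> `|x - a| <= `|b - a|.
    by move=> /andP[ax xb]; rewrite !ger0_norm ?subr_ge0 // lerB.
  by apply: (@deriv_norm_le _ f df) => // x /H; [exact: fd|exact: dM].
rewrite distrC [`|b - a|]distrC (ger0_norm (_ : 0 <= a - b)) ?subr_ge0 //.
have H x : b <= x <= a -> `|x - a| <= `|b - a|.
  by move=> /andP[ax xb]; rewrite distrC [`|b - a|]distrC !ger0_norm ?subr_ge0 // lerB.
by apply: (@deriv_norm_le _ f df) => // x /H; [exact: fd|exact: dM].
Qed.

Lemma deriv_norm_le0 (R : realType) (f df : R -> R) (b M : R) :
  (forall x : R, is_derive x 1 f (df x)) ->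
  (forall x, `|x| <= `|b| -> `|df x| <= M) -> `|f b - f 0| <= M * `|b|.
Proof.
move=> fd dM; have := @deriv_norm_le_abs R f df 0 b M; rewrite subr0; apply => //.
by move=> x; rewrite subr0; exact: dM.
Qed.

Lemma integral_from0_is_derive (R : realType) (f : R -> R) (t : R) :
  continuous f -> is_derive t 1 (integral_from0 f) (f t).
Proof.
move=> cf.
pose a := - (`|t| + 1); pose u := `|t| + 1.
pose F x := \int[lebesgue_measure]_(r in `[a, x]) f r.
have a0 : a < 0 by rewrite /a oppr_lt0 ltr_wpDl.
have u0 : 0 < u by rewrite /u ltr_wpDl.
have tu : a < t < u.
  by rewrite /a /u -ltr_norml ltrDl.
have intf y z : lebesgue_measure.-integrable `[y, z] (EFin \o f).
  apply: continuous_compact_integrable; first exact: segment_compact.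
  exact: continuous_subspaceT.
have obnd y z : \int[lebesgue_measure]_(r in `]y, z]) f r =
     \int[lebesgue_measure]_(r in `[y, z]) f r.
  apply: Rintegral_itv_obnd_cbnd.
  by apply: integrableS (intf y z) => //; exact: subset_itv_oc_cc.
have FE s : a <= s -> integral_from0 f s = F s - F 0.
  move=> as_; rewrite /integral_from0; case: ifPn => [s0|].
    by rewrite /F Rintegral_itvB ?obnd // bnd_simp // ltW.
  rewrite -ltNge => s0; rewrite -[RHS]opprB; congr (- _).
  by rewrite /F Rintegral_itvB ?obnd // bnd_simp // ltW.
case/andP: tu => at0 tu.
have [dF F'] := @continuous_FTC1_closed R f a t u tu (intf a u) at0 (cf t).
apply: (@near_eq_is_derive _ _ _ (fun s => F s - F 0)).
  have : \forall s \near t, a < s by exact: lt_nbhsr.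
  by apply: filterS => s /ltW /FE ->.
rewrite -F' derive1E -[X in is_derive _ _ _ X]subr0.
by apply: is_deriveB; exact: DeriveDef.
Qed.

Lemma integral_from00 (R : realType) (f : R -> R) : integral_from0 f 0 = 0.
Proof.
rewrite /integral_from0 lexx set_itv1 /Rintegral integral_set1 //.
Qed.

Lemma norm_cvg_le (R : realType) (T : Type) (F : set_system T) (u : T -> R) (l M : R) :
  ProperFilter F -> u x @[x --> F] --> l -> (\forall x \near F, `|u x| <= M) -> `|l| <= M.
Proof.
move=> FF ul uM.
have cl : closed [set x : R | `|x| <= M].
  rewrite (_ : [set x | _] = (fun x : R => `|x|) @^-1` [set x | x <= M]) //.
  by apply: closed_comp; [move=> x _; exact: norm_continuous|exact: closed_le].
exact: (@closed_cvg _ _ _ _ u (fun x : R => `|x| <= M) cl uM l ul).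
Qed.

(** The error of the difference quotients is bounded by the mean value
    inequality for F k, uniformly in k, so that the limit in k can be taken
    first. This is what turns Picard iterates into a solution. *)
Lemma is_derive_limit (R : realType) (f df : R -> R) (F dF : nat -> R -> R) (t : R) :
  (forall k (s : R), is_derive s 1 (F k) (dF k s)) ->
  (forall s, F k s @[k --> \oo] --> f s) ->
  (forall e : R, 0 < e -> \forall k \near \oo, forall s, `|s - t| < 1 -> `|dF k s - df s| <= e) ->
  {for t, continuous df} -> is_derive t 1 f (df t).
Proof.
move=> dFk Ff unif cdf.
suff H : (fun h : R => h^-1 *: (f (h + t) - f t)) @ 0^' --> df t.
  have E : (fun h : R => h^-1 *: ((f \o shift t) (h *: (1:R^o)) - f t)) =
           (fun h : R => h^-1 *: (f (h + t) - f t)).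
    by apply: funext => h /=; rewrite [_%:A]mulr1.
  apply: DeriveDef; first by rewrite /derivable E; apply/cvg_ex; exists (df t).
  by rewrite /derive E; apply/cvg_lim.
apply/cvgrPdist_le => e e0.
have e20 : 0 < e / 2 by rewrite divr_gt0.
have [d /= d0 cd] : exists2 d : R, 0 < d & forall s, `|s - t| < d -> `|df s - df t| <= e / 2.
  move/cvgrPdist_le: cdf => /(_ _ e20) /nbhs_ballP[d /= d0 H].
  exists d => // s sd; rewrite distrC; apply: H.
  by rewrite /ball /= distrC.
near=> h.
have h0 : h != 0 by near: h; exact: nbhs_dnbhs_neq.
have hd : `|h| < Num.min d 1.
  near: h; apply: dnbhs0_lt; by rewrite lt_min d0 ltr01.
have [hd1 hd2] : `|h| < d /\ `|h| < 1 by move: hd; rewrite lt_min => /andP[].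
have key : `|f (h + t) - f t - df t * h| <= e * `|h|.
  have Fl : (F k (h + t) - F k t - df t * h) @[k --> \oo] --> f (h + t) - f t - df t * h.
    apply: cvgB; last exact: cvg_cst.
    by apply: cvgB; exact: Ff.
  apply: norm_cvg_le Fl _.
  apply: filterS (unif _ e20) => k Hk.
  have := @deriv_norm_le_abs R (fun s => F k s - df t * s) (fun s => dF k s - df t) t (h + t) e.
  rewrite addrK.
  have -> : F k (h + t) - df t * (h + t) - (F k t - df t * t) = F k (h + t) - F k t - df t * h.
    ring.
  apply.
    by move=> s _; have Fs := dFk k s; isder; ring.
  move=> s sh.
  have s1 : `|s - t| < 1 by apply: le_lt_trans sh _.
  have sd : `|s - t| < d by apply: le_lt_trans sh _.
  have -> : dF k s - df t = (dF k s - df s) + (df s - df t) by ring.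
  apply: (le_trans (ler_normD _ _)).
  rewrite [e in X in _ <= X]splitr.
  by apply: lerD; [exact: Hk|exact: cd].
have -> : df t - h^-1 *: (f (h + t) - f t) = - (h^-1 * (f (h + t) - f t - df t * h)).
  by rewrite mulrBr mulrCA mulVf // mulr1 opprB.
rewrite normrN normrM normfV ler_pdivrMl ?normr_gt0 //.
by rewrite [X in _ <= X]mulrC.
Unshelve. all: by end_near. Qed.

(** * Linear systems of two equations and Floquet growth *)

Lemma segment_bounded (R : realType) (p : R -> R) (a c : R) : continuous p ->
  exists2 M : R, 0 < M & forall t, a <= t <= c -> `|p t| <= M.
Proof.
move=> cp; have [ac|ca] := leP a c; last first.
  exists 1 => // t /andP[/le_trans /[apply]]; rewrite leNgt ca //.
have cn : {within `[a, c], continuous (fun t => `|p t|)}.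
  apply: continuous_subspaceT => t.
  by apply: continuous_comp; [exact: cp|exact: norm_continuous].
have [x _ xM] := EVT_max ac cn.
exists (`|p x| + 1); first by rewrite ltr_wpDl.
move=> t tac; apply: (le_trans (xM t _)); last by rewrite lerDl.
by rewrite in_itv.
Qed.

Lemma geometric_cvg (R : realType) (u : nat -> R) (C : R) :
  (forall k, `|u k.+1 - u k| <= C / 2 ^+ k) ->
  exists l : R, u k @[k --> \oo] --> l /\ forall k, `|u k - l| <= 2 * C / 2 ^+ k.
Proof.
move=> uC.
have g0 : (fun k => 2 * C / 2 ^+ k) @ \oo --> (0 : R).
  have := @cvg_geometric R (2 * C) (2^-1) _.
  rewrite /geometric /=; under eq_fun do rewrite exprVn; apply.
  by rewrite ger0_norm ?invr_ge0 // invf_lt1 // ltr1n.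
pose a k := u k - 2 * C / 2 ^+ k; pose b k := u k + 2 * C / 2 ^+ k.
have half k : 2 * C / 2 ^+ k.+1 = C / 2 ^+ k.
  by rewrite exprS; field; rewrite expf_neq0.
have dbl k : 2 * C / 2 ^+ k = C / 2 ^+ k + C / 2 ^+ k by rewrite -mulrA mulr_natl mulr2n.
have a1 k : a k <= a k.+1.
  have := uC k; rewrite ler_norml => /andP[h _].
  rewrite /a half dbl; move: h; set x := C / _; move: (u k) (u k.+1) => y z h; lra.
have b1 k : b k.+1 <= b k.
  have := uC k; rewrite ler_norml => /andP[_ h].
  rewrite /b half dbl; move: h; set x := C / _; move: (u k) (u k.+1) => y z h; lra.
have C0 k : 0 <= 2 * C / 2 ^+ k.
  have := le_trans (normr_ge0 _) (uC k); rewrite dbl => h; exact: addr_ge0.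
have am : {homo a : i j / (i <= j)%N >-> i <= j} by apply: homo_leq => //; exact: le_trans.
have bm : {homo b : i j / (i <= j)%N >-> j <= i}.
  by apply: homo_leq => //; [move=> y x z /[swap]; exact: le_trans].
have ab j k : a j <= b k.
  apply: (le_trans (am _ _ (leq_maxl j k))); apply: (le_trans _ (bm _ _ (leq_maxr j k))).
  by rewrite /a /b; have := C0 (maxn j k); move: (u _) => y; lra.
have ub : has_ubound (range a) by exists (b 0%N) => _ [j _ <-].
have acv := nondecreasing_cvgn am ub; set l := sup _ in acv.
have ucv : u k @[k --> \oo] --> l.
  have E : (a \+ (fun k : nat => 2 * C / 2 ^+ k) = u) by apply: funext => k; rewrite /a /= subrK.
  have H := cvgD acv g0; rewrite addr0 in H.
  have -> : (fun k => u k) = (a \+ (fun k : nat => 2 * C / 2 ^+ k)) by [].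
  exact: H.
exists l; split=> // k.
have h1 : a k <= l.
  by apply: ub_le_sup => //; exists k.
have h2 : l <= b k.
  by apply: ge_sup; [exists (a 0%N), 0%N|move=> _ [j _ <-]].
by rewrite ler_norml; move: h1 h2; rewrite /a /b; move: (u k) (2 * C / _) => y z; lra.
Qed.

Section linear_ode.
Variable R : realType.
Implicit Types (p q v w : R -> R).

(** In the norm weighted by exp (- 2 M s), integration against a coefficient
    bounded by M is a contraction with factor 1/2, on intervals of any length.
    *)
Lemma exp_bound_pos (G g : R -> R) (M c t : R) : 0 < M -> 0 <= c -> 0 <= t ->
  (forall s : R, is_derive s 1 G (g s)) -> G 0 = 0 ->
  (forall s, 0 <= s <= t -> `|g s| <= M * (c * expR (2 * M * s))) ->
  `|G t| <= c / 2 * expR (2 * M * t).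
Proof.
move=> M0 c0 t0 dG G0 gb.
rewrite ler_norml; apply/andP; split.
  have := @deriv_ge0_le R (fun s => c / 2 * expR (2 * M * s) + G s)
     (fun s => M * (c * expR (2 * M * s)) + g s) 0 t t0.
  rewrite G0 addr0 mulr0 expR0 mulr1 => H.
  have : c / 2 <= c / 2 * expR (2 * M * t) + G t.
    apply: H => s st; first by have Gs := dG s; isder; field.
    by have := gb s st; rewrite ler_norml => /andP[]; lra.
  have : 0 <= c / 2 by rewrite divr_ge0.
  lra.
have := @deriv_ge0_le R (fun s => c / 2 * expR (2 * M * s) - G s)
     (fun s => M * (c * expR (2 * M * s)) - g s) 0 t t0.
rewrite G0 subr0 mulr0 expR0 mulr1 => H.
have : c / 2 <= c / 2 * expR (2 * M * t) - G t.
  apply: H => s st; first by have Gs := dG s; isder; field.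
  by have := gb s st; rewrite ler_norml => /andP[_ ?]; rewrite subr_ge0.
have : 0 <= c / 2 by rewrite divr_ge0.
lra.
Qed.

Lemma exp_bound (G g : R -> R) (M c t : R) : 0 < M -> 0 <= c ->
  (forall s : R, is_derive s 1 G (g s)) -> G 0 = 0 ->
  (forall s, `|s| <= `|t| -> `|g s| <= M * (c * expR (2 * M * `|s|))) ->
  `|G t| <= c / 2 * expR (2 * M * `|t|).
Proof.
move=> M0 c0 dG G0 gb; have [t0|/ltW t0] := leP 0 t.
  rewrite (ger0_norm t0); apply: (@exp_bound_pos G g) => // s /andP[s0 st].
  by have := gb s; rewrite (ger0_norm s0) (ger0_norm t0); exact.
have t0' : 0 <= - t by rewrite oppr_ge0.
rewrite (ler0_norm t0) -[t in G t]opprK.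
apply: (@exp_bound_pos (fun s => G (- s)) (fun s => - g (- s))) => //.
- move=> s.
  have H := @is_derive_chain R R^o G (fun s : R => - s) s 1 (g (- s)) (- 1) (dG _) (isd_opp (isd_id s)).
  by apply: is_derive_eq H _; rewrite mulrN1.
- by rewrite oppr0.
move=> s /andP[s0 st]; rewrite normrN.
have := gb (- s); rewrite normrN (ger0_norm s0) (ler0_norm t0); exact.
Qed.

Definition lin_sol p q v w := forall t : R,
  is_derive t 1 v (p t * w t) /\ is_derive t 1 w (q t * v t).

Lemma cont_mul (p w : R -> R) : continuous p -> continuous w ->
  continuous (fun s => p s * w s).
Proof. by move=> cp cw s; apply: cvgM; [exact: cp|exact: cw]. Qed.

Lemma deriv_continuous (f df : R -> R) :
  (forall t : R, is_derive t 1 f (df t)) -> continuous f.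
Proof. by move=> fd t; exact: is_derive_cont (fd t). Qed.

(** Picard iteration in the exponentially weighted norm; its differences halve
    at each step. *)
Lemma lin_ode_exists p q (v0 w0 : R) : continuous p -> continuous q ->
  exists v w, [/\ lin_sol p q v w, v 0 = v0 & w 0 = w0].
Proof.
move=> cp cq.
pose step (vw : (R -> R) * (R -> R)) :=
  ((fun t => v0 + integral_from0 (fun s => p s * vw.2 s) t),
   (fun t => w0 + integral_from0 (fun s => q s * vw.1 s) t)).
pose seq_ k := iter k step ((fun=> v0), (fun=> w0)).
pose V k := (seq_ k).1; pose W k := (seq_ k).2.
have cVW k : continuous (V k) /\ continuous (W k).
  elim: k => [|k [cV cW]]; first by split; exact: cst_continuous.
  by split; apply: (deriv_continuous (fun t => isd_add (isd_cst _ _ _)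
    (integral_from0_is_derive t (cont_mul _ _)))).
have dV k (t : R) : is_derive t 1 (V k.+1) (p t * W k t).
  have [cV cW] := cVW k.
  apply: (is_derive_eq (isd_add (isd_cst _ _ _)
    (integral_from0_is_derive t (cont_mul _ _)))) => //.
  by rewrite add0r.
have dW k (t : R) : is_derive t 1 (W k.+1) (q t * V k t).
  have [cV cW] := cVW k.
  apply: (is_derive_eq (isd_add (isd_cst _ _ _)
    (integral_from0_is_derive t (cont_mul _ _)))) => //.
  by rewrite add0r.
have V0 k : V k 0 = v0 by case: k => // k; rewrite /V /= integral_from00 addr0.
have W0 k : W k 0 = w0 by case: k => // k; rewrite /W /= integral_from00 addr0.
have bnd (tau : R) : exists2 C, 0 <= C & forall k t, `|t| <= tau ->
    `|V k.+1 t - V k t| <= C / 2 ^+ k /\ `|W k.+1 t - W k t| <= C / 2 ^+ k.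
  have [M1 M10 pM] := segment_bounded (- tau) tau cp.
  have [M2 M20 qM] := segment_bounded (- tau) tau cq.
  pose M := Num.max M1 M2.
  have M0 : 0 < M by rewrite lt_max M10.
  have pM' t : `|t| <= tau -> `|p t| <= M.
    by rewrite ler_norml => /pM h; rewrite le_max h.
  have qM' t : `|t| <= tau -> `|q t| <= M.
    by rewrite ler_norml => /qM h; rewrite le_max h orbT.
  pose c := 2 * (`|v0| + `|w0|).
  have c0 : 0 <= c by rewrite mulr_ge0 // addr_ge0.
  have key k t : `|t| <= tau ->
     `|V k.+1 t - V k t| <= c / 2 ^+ k * expR (2 * M * `|t|) /\
     `|W k.+1 t - W k t| <= c / 2 ^+ k * expR (2 * M * `|t|).
    elim: k t => [|k IH] t tt.
      have h (f : R -> R) (f0 x0 : R) (df : R -> R) : (forall s : R, is_derive s 1 f (df s)) -> f 0 = f0 ->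
          (forall s, `|s| <= tau -> `|df s| <= M * x0) -> x0 <= `|v0| + `|w0| -> 0 <= x0 ->
          `|f t - f0| <= c / 2 ^+ 0 * expR (2 * M * `|t|).
        move=> fd f00 db x1c x00.
        have -> : c / 2 ^+ 0 = (2 * c) / 2 by rewrite expr0; field.
        apply: (@exp_bound (fun s => f s - f0) df) => //.
        - by rewrite mulr_ge0.
        - by move=> s; have fs := fd s; isder; ring.
        - by rewrite f00 subrr.
        move=> s st; apply: (le_trans (db s (le_trans st tt))).
        rewrite ler_pM2l //; apply: (le_trans x1c).
        have e1 : 1 <= expR (2 * M * `|s|).
          by rewrite -expR0 ler_expR !mulr_ge0 // ltW.
        apply: (@le_trans _ _ (2 * c * 1)); last by rewrite ler_wpM2l // mulr_ge0.
        rewrite /c; have := normr_ge0 v0; have := normr_ge0 w0; lra.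
      split.
        apply: (h _ v0 `|w0| (fun s => p s * w0) (dV 0%N)) => //.
        - by move=> s st; rewrite normrM ler_wpM2r // pM'.
        - by rewrite lerDr.
      apply: (h _ w0 `|v0| (fun s => q s * v0) (dW 0%N)) => //.
      - by move=> s st; rewrite normrM ler_wpM2r // qM'.
      - by rewrite lerDl.
    have -> : c / 2 ^+ k.+1 = (c / 2 ^+ k) / 2 by rewrite exprS; field; rewrite expf_neq0.
    have c20 : 0 <= c / 2 ^+ k by rewrite divr_ge0 // exprn_ge0.
    split.
      apply: (@exp_bound (fun s => V k.+2 s - V k.+1 s) (fun s => p s * W k.+1 s - p s * W k s)) => //.
      - by rewrite !V0 subrr.
      move=> s st; have st' := le_trans st tt.
      rewrite -mulrBr normrM ler_pM ?pM' //.
      by have [_] := IH s st'.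
    apply: (@exp_bound (fun s => W k.+2 s - W k.+1 s) (fun s => q s * V k.+1 s - q s * V k s)) => //.
    - by rewrite !W0 subrr.
    move=> s st; have st' := le_trans st tt.
    rewrite -mulrBr normrM ler_pM ?qM' //.
    by have [] := IH s st'.
  exists (c * expR (2 * M * `|tau|)); first by rewrite mulr_ge0 // expR_ge0.
  move=> k t tt.
  have le1 : c / 2 ^+ k * expR (2 * M * `|t|) <= c * expR (2 * M * `|tau|) / 2 ^+ k.
    rewrite [X in _ <= X]mulrAC ler_wpM2l ?divr_ge0 ?exprn_ge0 //.
    rewrite ler_expR ler_wpM2l ?mulr_ge0 ?(ltW M0) //.
    by apply: (le_trans tt); exact: ler_norm.
  by have [h1 h2] := key k t tt; split; [exact: le_trans h1 le1|exact: le_trans h2 le1].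
have cvgV t : exists l : R, V k t @[k --> \oo] --> l.
  have [C C0 H] := bnd `|t|.
  have [l [h _]] := geometric_cvg (fun k => (H k t (lexx _)).1).
  by exists l.
have cvgW t : exists l : R, W k t @[k --> \oo] --> l.
  have [C C0 H] := bnd `|t|.
  have [l [h _]] := geometric_cvg (fun k => (H k t (lexx _)).2).
  by exists l.
have [v vP] := choice cvgV; have [w wP] := choice cvgW.
have unif (tau : R) : exists2 C, 0 <= C & forall k t, `|t| <= tau ->
    `|V k t - v t| <= C / 2 ^+ k /\ `|W k t - w t| <= C / 2 ^+ k.
  have [C C0 H] := bnd tau; exists (2 * C); first by rewrite mulr_ge0.
  move=> k t tt; split.
    have [l [h h']] := geometric_cvg (fun k => (H k t tt).1).
    by rewrite (cvg_unique _ (vP t) h).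
  have [l [h h']] := geometric_cvg (fun k => (H k t tt).2).
  by rewrite (cvg_unique _ (wP t) h).
have unifV (tau : R) : exists2 C, 0 <= C & forall k t, `|t| <= tau -> `|V k t - v t| <= C / 2 ^+ k.
  by have [C C0 H] := unif tau; exists C => // k t /(H k)[].
have unifW (tau : R) : exists2 C, 0 <= C & forall k t, `|t| <= tau -> `|W k t - w t| <= C / 2 ^+ k.
  by have [C C0 H] := unif tau; exists C => // k t /(H k)[].
have small (C e : R) : 0 < e -> \forall k \near \oo, C / 2 ^+ k <= e.
  move=> e0.
  have g0 : (fun k => C / 2 ^+ k) @ \oo --> (0 : R).
    have := @cvg_geometric R C (2^-1) _.
    rewrite /geometric /=; under eq_fun do rewrite exprVn; apply.
    by rewrite ger0_norm ?invr_ge0 // invf_lt1 // ltr1n.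
  move/cvgrPdist_le: g0 => /(_ e e0); apply: filterS => k.
  by rewrite sub0r normrN => /(le_trans (ler_norm _)).
have cvw : continuous v /\ continuous w.
  have gen (F : nat -> R -> R) (f : R -> R) : (forall k, continuous (F k)) ->
      (forall tau : R, exists2 C, 0 <= C & forall k t, `|t| <= tau -> `|F k t - f t| <= C / 2 ^+ k) ->
      continuous f.
    move=> cF unifF t; apply/cvgrPdist_le => e e0.
    have [C C0 H] := unifF (`|t| + 1).
    have e30 : 0 < e / 3 by rewrite divr_gt0.
    have [k _ /(_ k (leqnn k)) kC] := small C (e / 3) e30.
    have := cF k t; move/cvgrPdist_le => /(_ _ e30) Fk.
    near=> s.
    have st : `|s| <= `|t| + 1.
      have : `|t - s| <= 1 by near: s; apply: cvgr_dist_le; [exact: cvg_id|].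
      rewrite distrC => h; rewrite -[s](subrK t) addrC.
      by apply: (le_trans (ler_normD _ _)); rewrite lerD2l.
    have tt : `|t| <= `|t| + 1 by rewrite lerDl.
    have h1 := le_trans (H k s st) kC; have h2 := le_trans (H k t tt) kC.
    have h3 : `|F k t - F k s| <= e / 3 by near: s.
    have -> : f t - f s = - (F k t - f t) + (F k t - F k s) + (F k s - f s) by ring.
    apply: (le_trans (ler_normD _ _)).
    have h4 := ler_normD (- (F k t - f t)) (F k t - F k s); rewrite normrN in h4.
    lra.
  split; [apply: (gen V)|apply: (gen W)].
  - by move=> k; case: (cVW k).
  - exact: unifV.
  - by move=> k; case: (cVW k).
  - exact: unifW.
have uprod (g : R -> R) (F : nat -> R -> R) (f : R -> R) (t : R) : continuous g ->
    (forall tau : R, exists2 C, 0 <= C & forall k t, `|t| <= tau -> `|F k t - f t| <= C / 2 ^+ k) ->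
    forall e : R, 0 < e -> \forall k \near \oo, forall s, `|s - t| < 1 ->
       `|g s * F k s - g s * f s| <= e.
  move=> cg uF e e0.
  have [M M0 gM] := segment_bounded (- (`|t| + 1)) (`|t| + 1) cg.
  have [C C0 H] := uF (`|t| + 1).
  apply: filterS (small C (e / M) (divr_gt0 e0 M0)) => k kC s st.
  have ss : `|s| <= `|t| + 1.
    rewrite -[s](subrK t) addrC; apply: (le_trans (ler_normD _ _)).
    by rewrite lerD2l ltW.
  rewrite -mulrBr normrM.
  have -> : e = M * (e / M) by rewrite mulrC divfK // gt_eqF.
  rewrite ler_pM // ?gM -?ler_norml //.
  exact: le_trans (H k s ss) kC.
exists v, w; split.
- move=> t; split.
    apply: (@is_derive_limit R v (fun s => p s * w s) (fun k => V k.+1) (fun k s => p s * W k s)).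
    + by move=> s; have := vP s; rewrite -(cvg_shiftS (V^~ s)).
    + exact: uprod.
    + by apply: cont_mul => //; case: cvw.
  apply: (@is_derive_limit R w (fun s => q s * v s) (fun k => W k.+1) (fun k s => q s * V k s)).
  + by move=> s; have := wP s; rewrite -(cvg_shiftS (W^~ s)).
  + exact: uprod.
  + by apply: cont_mul => //; case: cvw.
- have := vP 0; rewrite (_ : (fun k => V k 0) = fun=> v0); last by apply: funext.
  by move=> h; apply: (cvg_unique _ h (cvg_cst v0)).
- have := wP 0; rewrite (_ : (fun k => W k 0) = fun=> w0); last by apply: funext.
  by move=> h; apply: (cvg_unique _ h (cvg_cst w0)).
Unshelve. all: by end_near. Qed.

(** The function eta s - E(s) exp (- K s) is nondecreasing. *)
Lemma gronwall (E dE : R -> R) (K eta tau : R) : 0 <= K -> 0 <= eta -> 0 <= tau ->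
  (forall t : R, 0 <= t <= tau -> is_derive t 1 E (dE t)) ->
  (forall t, 0 <= t <= tau -> dE t <= K * E t + eta) -> E 0 <= 0 ->
  forall t, 0 <= t <= tau -> E t <= eta * t * expR (K * t).
Proof.
move=> K0 e0 tau0 dEP dEle E0 t /andP[t0 tt].
have := @deriv_ge0_le R (fun s => eta * s - E s * expR (- (K * s)))
  (fun s => eta - (dE s - K * E s) * expR (- (K * s))) 0 t t0.
rewrite !mulr0 oppr0 expR0 mulr1 sub0r => H.
have {}H : - E 0 <= eta * t - E t * expR (- (K * t)).
  apply: H => s /andP[s0 st]; have sT : 0 <= s <= tau by rewrite s0 (le_trans st).
    by have Es := dEP s sT; isder; ring.
  have h1 := dEle s sT.
  have h2 : (dE s - K * E s) * expR (- (K * s)) <= eta * 1.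
    apply: (@le_trans _ _ (eta * expR (- (K * s)))).
      by rewrite ler_wpM2r ?expR_ge0 //; lra.
    by rewrite ler_wpM2l // -expR0 ler_expR oppr_le0 mulr_ge0.
  lra.
rewrite -ler_pdivrMr ?expR_gt0 // -expRN; lra.
Qed.

Lemma sqr_mul_le (c x y M : R) : `|c| <= M -> 2 * x * (c * y) <= M * (x ^+ 2 + y ^+ 2).
Proof.
move=> cM; have M0 : 0 <= M := le_trans (normr_ge0 _) cM.
have h : `|2 * x * (c * y)| <= M * (x ^+ 2 + y ^+ 2).
  rewrite (_ : 2 * x * (c * y) = c * (2 * (x * y))); last by ring.
  rewrite normrM ler_pM // normrM ger0_norm // normrM -[x ^+ 2]real_normK ?num_real //.
  rewrite -[y ^+ 2]real_normK ?num_real //.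
  have := sqr_ge0 (`|x| - `|y|); lra.
exact: le_trans (ler_norm _) h.
Qed.

(** Gronwall for the squared distance of the two solutions. Only the second
    coefficient differs, because only it carries the spectral parameter. *)
Lemma lin_sol_dep p q q' v w v' w' (M mu tau : R) : 0 <= tau ->
  lin_sol p q v w -> lin_sol p q' v' w' -> v 0 = v' 0 -> w 0 = w' 0 ->
  (forall t, 0 <= t <= tau -> `|p t| <= M /\ `|q t| <= M) ->
  (forall t, 0 <= t <= tau -> `|(q t - q' t) * v' t| <= mu) ->
  forall t, 0 <= t <= tau ->
   (v t - v' t) ^+ 2 + (w t - w' t) ^+ 2 <= mu ^+ 2 * t * expR ((2 * M + 1) * t).
Proof.
move=> tau0 S S' v0 w0 pq qq t tt.
have M0 : 0 <= M by have [/(le_trans (normr_ge0 _))] := pq t tt.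
apply: (@gronwall (fun s => (v s - v' s) ^+ 2 + (w s - w' s) ^+ 2)
  (fun s => 2 * (v s - v' s) * (p s * w s - p s * w' s) + 2 * (w s - w' s) * (q s * v s - q' s * v' s))
  _ _ tau) => //.
- lra.
- exact: sqr_ge0.
- move=> s _; have [[a1 a2] [b1 b2]] := (S s, S' s).
  by isder; ring.
- move=> s st; have [pM qM] := pq s st; have h := qq s st.
  rewrite -mulrBr.
  have -> : q s * v s - q' s * v' s = q s * (v s - v' s) + (q s - q' s) * v' s by ring.
  have h1 := sqr_mul_le (v s - v' s) (w s - w' s) pM.
  have h2 := sqr_mul_le (w s - w' s) (v s - v' s) qM.
  set z := (q s - q' s) * v' s in h *.
  have h3 : z ^+ 2 <= mu ^+ 2.
    by rewrite -[z ^+ 2]real_normK ?num_real // ler_pXn2r ?nnegrE // (le_trans _ h).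
  have h4 := sqr_ge0 (w s - w' s - z); have h5 := sqr_ge0 (v s - v' s).
  move: h1 h2 h3 h4 h5; move: (v s - v' s) (w s - w' s) => x y; lra.
- by rewrite v0 w0 !subrr expr0n /= addr0.
Qed.

Lemma lin_sol_unique p q v w v' w' : continuous p -> continuous q ->
  lin_sol p q v w -> lin_sol p q v' w' -> v 0 = v' 0 -> w 0 = w' 0 ->
  forall t, 0 <= t -> v t = v' t /\ w t = w' t.
Proof.
move=> cp cq S S' v0 w0 t t0.
have [M1 M10 pM] := segment_bounded 0 t cp.
have [M2 M20 qM] := segment_bounded 0 t cq.
have tt : 0 <= t <= t by rewrite t0 lexx.
have := @lin_sol_dep p q q v w v' w' (M1 + M2) 0 t t0 S S' v0 w0 _ _ t tt.
rewrite expr0n /= !mul0r => H.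
have {H} : (v t - v' t) ^+ 2 + (w t - w' t) ^+ 2 <= 0.
  apply: H => s st; last by rewrite subrr mul0r normr0.
  by have := pM s st; have := qM s st; lra.
have := sqr_ge0 (v t - v' t); have := sqr_ge0 (w t - w' t) => h1 h2 h3.
have /eqP : (v t - v' t) ^+ 2 = 0 by lra.
have /eqP : (w t - w' t) ^+ 2 = 0 by lra.
by rewrite !sqrf_eq0 !subr_eq0 => /eqP -> /eqP ->.
Qed.

Lemma lin_sol_comb p q v w v' w' (a c : R) : lin_sol p q v w -> lin_sol p q v' w' ->
  lin_sol p q (fun t => a * v t + c * v' t) (fun t => a * w t + c * w' t).
Proof.
by move=> S S' t; have [[a1 a2] [b1 b2]] := (S t, S' t); split; isder; ring.
Qed.

Lemma lin_sol_shift p q v w (T : R) :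
  (forall t, p (t + T) = p t) -> (forall t, q (t + T) = q t) ->
  lin_sol p q v w -> lin_sol p q (fun t => v (t + T)) (fun t => w (t + T)).
Proof.
move=> pT qT S t; have [a1 a2] := S (t + T).
have dT : is_derive t (1 : R) (fun t : R => t + T) 1 by isder; ring.
split.
  have H := @is_derive_chain R R^o v (fun t => t + T) t 1 _ _ a1 dT.
  by apply: is_derive_eq H _; rewrite pT mulr1.
have H := @is_derive_chain R R^o w (fun t => t + T) t 1 _ _ a2 dT.
by apply: is_derive_eq H _; rewrite qT mulr1.
Qed.

(** The coefficient matrix has trace zero, so the determinant of two solutions
    is constant. *)
Lemma wronskian p q v w v' w' : lin_sol p q v w -> lin_sol p q v' w' ->
  forall t, v t * w' t - v' t * w t = v 0 * w' 0 - v' 0 * w 0.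
Proof.
move=> S S' t.
have dW s : is_derive s (1 : R) (fun s => v s * w' s - v' s * w s) 0.
  by have [[a1 a2] [b1 b2]] := (S s, S' s); isder; ring.
exact: (is_derive_0_is_cst _ _ dW).
Qed.

(** With D the trace of the monodromy matrix, whose determinant is 1,
    Cayley-Hamilton gives S((k+2)T) = D S((k+1)T) - S(kT). Writing |D| = mu +
    1/mu with mu > 1, the ratio of two consecutive terms stays at least mu in
    absolute value, since it is at least |D| minus the inverse of the preceding
    one. *)
Lemma floquet_growth p q (C Cw S Sw : R -> R) (T : R) : continuous p -> continuous q ->
  0 < T ->
  (forall t, p (t + T) = p t) -> (forall t, q (t + T) = q t) ->
  lin_sol p q C Cw -> lin_sol p q S Sw ->
  C 0 = 1 -> Cw 0 = 0 -> S 0 = 0 -> Sw 0 = 1 ->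
  2 < `|C T + Sw T| -> S T != 0 ->
  exists2 mu : R, 1 < mu & forall k, mu ^+ k * `|S T| <= `|S (k.+1%:R * T)|.
Proof.
move=> cp cq T0 pT qT sC sS C0 Cw0 S0 Sw0 D2 ST.
pose s k := S (k%:R * T); pose r k := Sw (k%:R * T).
have step v w : lin_sol p q v w -> forall t, 0 <= t ->
    v (t + T) = v T * C t + w T * S t /\ w (t + T) = v T * Cw t + w T * Sw t.
  move=> sv t t0; apply: (lin_sol_unique cp cq (lin_sol_shift pT qT sv) (lin_sol_comb (v T) (w T) sC sS)) => //.
  - by rewrite add0r C0 S0 mulr1 mulr0 addr0.
  - by rewrite add0r Cw0 Sw0 mulr1 mulr0 add0r.
have shiftk k : lin_sol p q (fun t => S (t + k%:R * T)) (fun t => Sw (t + k%:R * T)).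
  elim: k => [|k IH].
    rewrite (_ : (fun t => S _) = S); last by apply: funext => t; rewrite mul0r addr0.
    by rewrite (_ : (fun t => Sw _) = Sw) //; apply: funext => t; rewrite mul0r addr0.
  have := lin_sol_shift pT qT IH.
  have E t : t + T + k%:R * T = t + k.+1%:R * T by rewrite -natr1; ring.
  by under eq_fun do rewrite E; under [X in lin_sol _ _ _ X]eq_fun do rewrite E.
have rec k : s k.+1 = s k * C T + r k * S T /\ r k.+1 = s k * Cw T + r k * Sw T.
  have := lin_sol_unique cp cq (shiftk k) (lin_sol_comb (s k) (r k) sC sS) _ _ (ltW T0).
  rewrite !add0r C0 S0 Cw0 Sw0 !mulr1 !mulr0 addr0 add0r.
  have -> : T + k%:R * T = k.+1%:R * T by rewrite -natr1; ring.
  exact.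
have det : C T * Sw T - S T * Cw T = 1.
  by rewrite (wronskian sC sS) C0 Sw0 S0 Cw0 mulr1 mul0r subr0.
pose D := C T + Sw T.
have rec2 k : s k.+2 = D * s k.+1 - s k.
  have [e1 _] := rec k.+1; have [e2 e3] := rec k.
  rewrite e1 e3 e2 /D.
  by rewrite -[X in _ = _ - X]mulr1 -det; ring.
have Dmu : exists2 mu : R, 1 < mu & mu + mu^-1 = `|D|.
  pose d := `|D|; pose x := Num.sqrt (d ^+ 2 - 4).
  have d2 : 2 < d by [].
  have h0 : 0 <= d ^+ 2 - 4.
    have : 0 < (d - 2) * (d + 2) by apply: mulr_gt0; lra.
    lra.
  have x0 : 0 <= x := sqrtr_ge0 _.
  have xx : x ^+ 2 = d ^+ 2 - 4 by rewrite sqr_sqrtr.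
  exists ((d + x) / 2); first by rewrite /d; lra.
  have nz : d + x != 0 by rewrite gt_eqF //; lra.
  have -> : ((d + x) / 2)^-1 = (d - x) / 2.
    apply: (mulfI (_ : (d + x) / 2 != 0)); first by rewrite mulf_neq0 // invr_neq0.
    rewrite mulfV; last by rewrite mulf_neq0 // invr_neq0.
    have -> : (d + x) / 2 * ((d - x) / 2) = (d ^+ 2 - x ^+ 2) / 4 by field.
    by rewrite xx; field.
  by rewrite /d; field.
case: Dmu => mu mu1 muE; exists mu => // k.
have mu0 : 0 < mu by exact: lt_trans mu1.
have s0 : s 0%N = 0 by rewrite /s mul0r.
have s1 : s 1%N = S T by rewrite /s mul1r.
have grow j : mu * `|s j| <= `|s j.+1|.
  elim: j => [|j IH]; first by rewrite s0 normr0 mulr0.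
  have h : `|D| * `|s j.+1| - `|s j| <= `|s j.+2|.
    by rewrite rec2 -normrM; exact: lerB_dist.
  apply: le_trans h; rewrite -muE mulrDl.
  have : `|s j| <= mu^-1 * `|s j.+1| by rewrite ler_pdivlMl.
  lra.
elim: k => [|k IH]; first by rewrite expr0 mul1r -/(s 1%N) s1.
rewrite exprS -mulrA; apply: le_trans (grow k.+1).
by rewrite ler_pM2l.
Qed.

End linear_ode.

(** * Estimates along characteristics *)

Section characteristics.
Variable R : realType.

(** One step of the iteration below: a source that is controlled by 2 d + m only
    contributes m/2 to the new bound. *)
Lemma charac_step (y dy : R -> R) (K m d t : R) : 0 < K -> 0 <= t -> 0 <= m -> 0 <= d ->
  (forall s : R, 0 <= s <= t -> is_derive s 1 y (dy s)) ->
  (forall s, 0 <= s <= t -> `|dy s| <= K / 2 * ((2 * d + m) * expR (K * s))) ->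
  `|y 0| <= d -> `|y t| <= (2 * d + m / 2) * expR (K * t).
Proof.
move=> K0 t0 m0 d0 yd dyb y0.
have e1 : 1 <= expR (K * t) by rewrite -expR0 ler_expR mulr_ge0 // ltW.
have h0 : 0 <= d * (expR (K * t) - 1) by rewrite mulr_ge0 // subr_ge0.
have h1 : 0 <= m * (expR (K * t) - 1) by rewrite mulr_ge0 // subr_ge0.
move: y0; rewrite !ler_norml => /andP[y1 y2]; apply/andP; split.
  have := @deriv_ge0_le R (fun s => (2 * d + m) / 2 * expR (K * s) + y s)
    (fun s => K / 2 * ((2 * d + m) * expR (K * s)) + dy s) 0 t t0.
  rewrite mulr0 expR0 mulr1 => H.
  suff : (2 * d + m) / 2 + y 0 <= (2 * d + m) / 2 * expR (K * t) + y t by lra.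
  apply: H => s st; first by have ys := yd s st; isder; field.
  by have := dyb s st; rewrite ler_norml => /andP[]; lra.
have := @deriv_ge0_le R (fun s => (2 * d + m) / 2 * expR (K * s) - y s)
    (fun s => K / 2 * ((2 * d + m) * expR (K * s)) - dy s) 0 t t0.
rewrite mulr0 expR0 mulr1 => H.
suff : (2 * d + m) / 2 - y 0 <= (2 * d + m) / 2 * expR (K * t) - y t by lra.
apply: H => s st; first by have ys := yd s st; isder; field.
by have := dyb s st; rewrite ler_norml => /andP[]; lra.
Qed.

(** The Riemann invariants q(1) and q(-1) are transported along the two
    characteristics x = c - sg X(t) and are coupled through kap. Instead of
    Gronwall for a supremum, which would need its continuity in time, an a
    priori bound M0 is improved: inserting the bound 2 d + M0 / 2^j into the
    characteristic equations gives the same bound with j + 1. *)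
Lemma riemann_bound (q : R -> R -> R -> R) (kap X : R -> R) (k l T d M0 : R) :
  0 <= k -> 0 <= d -> 0 <= M0 ->
  (forall s, 0 <= s <= T -> `|kap s| <= k) ->
  X 0 = 0 -> {homo X : s t / s <= t} ->
  (forall sg c s : R, `|sg| = 1 -> is_derive s (1 : R) (fun s => q sg s (c - sg * X s))
     (kap s * (q 1 s (c - sg * X s) + q (-1) s (c - sg * X s)))) ->
  (forall sg x, `|sg| = 1 -> `|x| <= l -> `|q sg 0 x| <= d) ->
  (forall sg t x, `|sg| = 1 -> 0 <= t <= T -> `|x| <= l - X t -> `|q sg t x| <= M0) ->
  forall sg t x, `|sg| = 1 -> 0 <= t <= T -> `|x| <= l - X t ->
    `|q sg t x| <= 2 * d * expR ((4 * k + 1) * t).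
Proof.
move=> k0 d0 M00 kapk X0 Xm qd qi qb.
set K := 4 * k + 1.
have K0 : 0 < K by rewrite /K; lra.
have e1 t : 0 <= t -> 1 <= expR (K * t) by move=> t0; rewrite -expR0 ler_expR mulr_ge0 // ltW.
have iter_b j : forall sg t x, `|sg| = 1 -> 0 <= t <= T -> `|x| <= l - X t ->
    `|q sg t x| <= (2 * d + M0 / 2 ^+ j) * expR (K * t).
  elim: j => [|j IH] sg t x sg1 tT xl.
    case/andP: (tT) => t0 _.
    apply: (le_trans (qb sg t x sg1 tT xl)); rewrite expr0 divr1.
    rewrite -[M0 in X in X <= _]mulr1; apply: ler_pM => //; last exact: e1.
    by rewrite lerDr mulr_ge0.
  case/andP: (tT) => t0 tT'.
  have -> : M0 / 2 ^+ j.+1 = (M0 / 2 ^+ j) / 2 by rewrite exprS; field; rewrite expf_neq0.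
  set m := M0 / 2 ^+ j.
  have m0 : 0 <= m by rewrite divr_ge0 // exprn_ge0.
  pose c := x + sg * X t.
  have pos s : 0 <= s <= t -> `|c - sg * X s| <= l - X s.
    move=> /andP[s0 st]; rewrite (_ : c - _ = x + sg * (X t - X s)); last by rewrite /c; ring.
    apply: (le_trans (ler_normD _ _)); rewrite normrM sg1 mul1r ger0_norm ?subr_ge0 ?Xm //.
    lra.
  have := @charac_step (fun s => q sg s (c - sg * X s))
    (fun s => kap s * (q 1 s (c - sg * X s) + q (-1) s (c - sg * X s))) K m d t K0 t0 m0 d0.
  rewrite (_ : c - sg * X t = x); last by rewrite /c; ring.
  apply.
  - by move=> s _; exact: qd.
  - move=> s st; have sT : 0 <= s <= T by case/andP: st => -> /le_trans ->.
    have h1 := IH 1 s _ (normr1 _) sT (pos s st).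
    have h2 := IH (-1) s _ (normrN1 _) sT (pos s st).
    rewrite normrM; apply: (@le_trans _ _ (k * (2 * ((2 * d + m) * expR (K * s))))).
      rewrite ler_pM ?kapk //; apply: (le_trans (ler_normD _ _)); rewrite -/m in h1 h2; lra.
    have : 0 <= (2 * d + m) * expR (K * s) by rewrite mulr_ge0 ?expR_ge0 //; lra.
    rewrite /K; lra.
  apply: qi => //; have := pos 0; rewrite X0 subr0; apply.
  by rewrite lexx.
move=> sg t x sg1 tT xl; apply/ler_addgt0Pr => e e0.
pose E := expR (K * t).
have E0 : 0 < E by exact: expR_gt0.
have g0 : (fun j => M0 / 2 ^+ j) @ \oo --> (0 : R).
  have := @cvg_geometric R M0 (2^-1) _.
  rewrite /geometric /=; under eq_fun do rewrite exprVn; apply.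
  by rewrite ger0_norm ?invr_ge0 // invf_lt1 // ltr1n.
move/cvgrPdist_le: g0 => /(_ (e / E) (divr_gt0 e0 E0)) [j _ /(_ j (leqnn j))] /=.
rewrite sub0r normrN => /(le_trans (ler_norm _)) jE.
apply: (le_trans (iter_b j sg t x sg1 tT xl)).
rewrite mulrDl lerD2l -/E -ler_pdivlMr //.
Qed.

End characteristics.

(** * Even trigonometric approximation of the square function *)

Section arcsine_series.
Variable R : realType.

(** The coefficients that make the second derivatives of the partial sums
    telescope; see arcsine_partial. *)
Fixpoint arccoef (N : nat) : R :=
  if N is N'.+1 then arccoef N' * (N'.+1.*2)%:R / (N'.+1.*2.-1)%:R else 2.

Lemma arccoef_bound N : 0 <= arccoef N <= 2 * N.+1%:R.
Proof.
elim: N => [|N /andP[IH1 IH2]]; first by rewrite /= mulr1 lexx andbT.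
apply/andP; split => /=; first by rewrite !mulr_ge0 // invr_ge0.
rewrite -mulrA; apply: (@le_trans _ _ (2 * N.+1%:R * ((N.*2.+2)%:R / (N.*2.+1)%:R))).
  by rewrite ler_wpM2r // divr_ge0.
rewrite mulrA ler_pdivrMr ?ltr0n // -!natrM ler_nat; lia.
Qed.

(** Multiplication by (1 - cos (z x)) / 2 preserves cosine sums and does not
    increase the sum of the absolute values of their coefficients. *)
Lemma cosine_product (l : seq (R * R)) (z : R) : exists l' : seq (R * R),
  (forall x, \sum_(p <- l') p.2 * cos (p.1 * x) =
     (\sum_(p <- l) p.2 * cos (p.1 * x)) * ((1 - cos (z * x)) / 2)) /\
  \sum_(p <- l') `|p.2| <= \sum_(p <- l) `|p.2|.
Proof.
exists (flatten [seq [:: (p.1, p.2 / 2); (p.1 + z, - p.2 / 4); (p.1 - z, - p.2 / 4)] | p <- l]).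
split.
  move=> x; rewrite big_flatten /= big_map mulr_suml; apply: eq_bigr => p _.
  rewrite !big_cons big_nil /= mulrDl mulrBl cosD cosB; by field.
rewrite big_flatten /= big_map; apply: ler_sum => p _.
rewrite !big_cons big_nil /= !normrM !normrN !normfV !normr_nat.
by have := normr_ge0 p.2; lra.
Qed.

Lemma sin2k_cosines (k : nat) : exists l : seq (R * R),
  (forall x, \sum_(p <- l) p.2 * cos (p.1 * x) = sin x ^+ k.*2) /\
  \sum_(p <- l) `|p.2| <= 1.
Proof.
elim: k => [|k [l [lE l1]]].
  exists [:: (0, 1)]; split; last by rewrite big_seq1 normr1.
  by move=> x; rewrite big_seq1 /= mul0r cos0 mulr1 expr0.
have [l' [l'E l'1]] := cosine_product l 2.
exists l'; split; last exact: le_trans l'1 l1.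
move=> x; rewrite l'E lE doubleS !exprS mulrA -expr2 mulrC; congr (_ * _).
rewrite mulr_natl cos_mulr2n sin2cos2 -mulr_natl; by field.
Qed.

(** Partial sums of arcsin(y)^2 = (1/2) sum_(k >= 1) (2 y)^(2k) / (k^2 C(2k, k))
    at y = sin x, whose sum is x^2 for |x| <= pi/2. As the Taylor coefficients
    are nonnegative, the total coefficient mass of the cosine sum is at most its
    value at pi/2. The second derivative differs from that of x^2 by one term
    only. *)
Lemma arcsine_partial (N : nat) : exists (l : seq (R * R)) (F dF : R -> R),
  [/\ (forall x, F x = \sum_(p <- l) p.2 * cos (p.1 * x)),
      \sum_(p <- l) `|p.2| <= F (pi / 2),
      (F 0 = 0 /\ dF 0 = 0),
      (forall x : R, is_derive x 1 F (dF x)) &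
      (forall x : R, is_derive x 1 dF (2 - arccoef N * sin x ^+ N.*2))].
Proof.
elim: N => [|N [l [F [dF [FE lF [F0 dF0] Fd dFd]]]]].
  exists [::], (fun=> 0), (fun=> 0); split.
  - by move=> x; rewrite big_nil.
  - by rewrite big_nil.
  - by [].
  - by move=> x; exact: isd_cst.
  - by move=> x; apply: is_derive_eq (isd_cst _ _ _) _; rewrite /= expr0; ring.
have [l' [l'E l'1]] := sin2k_cosines N.+1.
pose a := arccoef N / ((N.+1.*2)%:R * (N.+1.*2.-1)%:R).
have a0 : 0 <= a by rewrite divr_ge0 ?mulr_ge0 //; case/andP: (arccoef_bound N).
exists (l ++ [seq (p.1, a * p.2) | p <- l']).
exists (fun x => F x + a * sin x ^+ N.+1.*2).
exists (fun x => dF x + a * ((N.+1.*2)%:R * sin x ^+ N.*2.+1 * cos x)); split.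
- move=> x; rewrite big_cat /= -FE big_map -l'E mulr_sumr; congr (_ + _).
  by apply: eq_bigr => p _; rewrite mulrA.
- rewrite big_cat big_map /= sin_pihalf expr1n mulr1 lerD //.
  rewrite (eq_bigr (fun p => a * `|p.2|)); last first.
    by move=> p _; rewrite normrM ger0_norm.
  by rewrite -mulr_sumr -[a in X in _ <= X]mulr1 ler_wpM2l.
- by rewrite F0 dF0 sin0 doubleS !expr0n /= !mulr0 mul0r mulr0 !addr0.
- move=> x; have fx := Fd x; rewrite doubleS; isder; ring.
move=> x; have fx := dFd x; isder.
rewrite /= doubleS /a /=.
have h1 : ((N.*2.+2)%:R : R) != 0 by rewrite pnatr_eq0.
have h2 : ((N.*2.+1)%:R : R) != 0 by rewrite pnatr_eq0.
have sc : cos x * cos x = 1 - sin x ^+ 2 by rewrite -expr2 cos2sin2.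
rewrite !exprS.
have -> : ((N.*2.+2)%:R : R) = (N.*2.+1)%:R + 1 by rewrite natr1.
set y := sin x in sc *; set z := cos x in sc *; set s := y ^+ N.*2.
set d : R := (N.*2.+1)%:R in h2 *; set A := arccoef N.
have h3 : d + 1 != 0 by rewrite natr1.
clearbody d y z s A.
transitivity (2 - A * s + A * s * (z * z) - A * s * y ^+ 2 / d); first by field; rewrite h2 h3.
by rewrite sc; field.
Qed.

(** The constant (pi/2)^2, which bounds the coefficient mass for every N, is the
    sharp one: it is the value of x^2 at the end pi/2 of the interval of
    approximation. This sharpness is what makes the trace inequality below
    sharp. *)
Lemma arcsine_partial_bounds (N : nat) (t0 : R) : 0 <= t0 < pi / 2 ->
  exists (l : seq (R * R)) (F dF : R -> R),
  [/\ (forall x, F x = \sum_(p <- l) p.2 * cos (p.1 * x)),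
      \sum_(p <- l) `|p.2| <= (pi / 2) ^+ 2,
      (forall x : R, is_derive x 1 F (dF x)) &
      (forall x, `|x| <= t0 -> `|dF x - 2 * x| <= 8 * N.+1%:R * sin t0 ^+ N.*2 /\
          `|F x - x ^+ 2| <= 16 * N.+1%:R * sin t0 ^+ N.*2)].
Proof.
move=> /andP[t00 t0pi].
have [l [F [dF [FE lF [F0 dF0] Fd dFd]]]] := arcsine_partial N.
have /andP[c0 cN] := arccoef_bound N.
have pi2 : (pi / 2 : R) < 2 := pihalf_lt2 R.
have pi0 : 0 < (pi / 2 : R) by rewrite divr_gt0 ?pi_gt0.
have sge0 x : 0 <= arccoef N * sin x ^+ N.*2.
  by rewrite mulr_ge0 // -mul2n exprM exprn_ge0 // sqr_ge0.
exists l, F, dF; split => //.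
- apply: (le_trans lF).
  have dFle x : 0 <= x -> dF x <= 2 * x.
    move=> x0.
    have := @deriv_ge0_le R (fun s => 2 * s - dF s) (fun s => arccoef N * sin s ^+ N.*2) 0 x x0.
    rewrite dF0 mulr0 subr0 => H.
    suff : 0 <= 2 * x - dF x by lra.
    apply: H => [s _|s _]; last exact: sge0.
    by have fs := dFd s; isder; ring.
  have := @deriv_ge0_le R (fun s => s ^+ 2 - F s) (fun s => 2 * s - dF s) 0 (pi / 2) (ltW pi0).
  rewrite F0 expr0n /= subr0 => H.
  suff : 0 <= (pi / 2) ^+ 2 - F (pi / 2) by lra.
  apply: H => [s _|s /andP[s0 _]]; last by rewrite subr_ge0 dFle.
  by have fs := Fd s; isder; ring.
set r := sin t0 ^+ N.*2.
have r0 : 0 <= r by rewrite /r -mul2n exprM exprn_ge0 // sqr_ge0.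
have sin_le x : `|x| <= t0 -> sin x ^+ N.*2 <= r.
  move=> xt0; rewrite /r -mul2n !exprM lerXn2r ?nnegrE ?sqr_ge0 //.
  rewrite !sin2cos2 lerD2l lerN2 ler_pXn2r ?nnegrE //.
  - rewrite -[cos x]cos_norm; have [->//|xt] := eqVneq `|x| t0.
    apply: ltW; rewrite ltr_cos ?in_itv /= ?normr_ge0 ?t00 //=; try lra.
  - by apply: cos_ge0_pihalf; lra.
  - by apply: cos_ge0_pihalf; move: xt0; rewrite ler_norml; lra.
have dFb x : `|x| <= t0 -> `|dF x - 2 * x| <= 8 * N.+1%:R * r.
  move=> xt0.
  have := @deriv_norm_le0 R (fun s => dF s - 2 * s) (fun s => - (arccoef N * sin s ^+ N.*2)) x (2 * N.+1%:R * r).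
  rewrite dF0 mulr0 subr0 subr0 => H.
  apply: (le_trans (H _ _)).
  - by move=> s; have fs := dFd s; isder; ring.
  - move=> s sx; rewrite normrN ger0_norm ?sge0 // ler_pM ?sin_le ?(le_trans sx) //.
    by rewrite -mul2n exprM exprn_ge0 // sqr_ge0.
  - have h : `|x| <= 2 by lra.
    have := ler_wpM2l (_ : 0 <= 2 * N.+1%:R * r) h => /(_ _).
    have p0 : 0 <= 2 * N.+1%:R * r by rewrite !mulr_ge0.
    move=> /(_ p0) h'; apply: (le_trans h'); have : 0 <= N.+1%:R * r by rewrite mulr_ge0.
    move: (N.+1%:R * r) (mulrA 2 N.+1%:R r) => u; lra.
move=> x xt0; split; first exact: dFb.
have := @deriv_norm_le0 R (fun s => F s - s ^+ 2) (fun s => dF s - 2 * s) x (8 * N.+1%:R * r).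
rewrite F0 expr0n /= subr0 subr0 => H.
apply: (le_trans (H _ _)).
- by move=> s; have fs := Fd s; isder; ring.
- by move=> s sx; apply: dFb; exact: le_trans xt0.
have h : `|x| <= 2 by lra.
have p0 : 0 <= 8 * N.+1%:R * r by rewrite !mulr_ge0.
apply: (le_trans (ler_wpM2l p0 h)); lra.
Qed.

Lemma linear_geometric_small (x e : R) : 0 <= x < 1 -> 0 < e ->
  exists N, N.+1%:R * x ^+ N.*2 < e.
Proof.
move=> /andP[x0 x1] e0.
have b N : N.+1%:R * x ^+ N <= (1 - x)^-1.
  rewrite -[_^-1]mul1r ler_pdivlMr ?subr_gt0 //.
  have h : N.+1%:R * x ^+ N <= \sum_(i < N.+1) x ^+ i.
    rewrite mulr_natl -[X in _ *+ X]card_ord -sumr_const; apply: ler_sum => i _.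
    by apply: ler_wiXn2l; [|exact: ltW|rewrite -ltnS].
  apply: (@le_trans _ _ ((\sum_(i < N.+1) x ^+ i) * (1 - x))).
    by rewrite ler_wpM2r // subr_ge0 ltW.
  have := subrX1 x N.+1 => E.
  have -> : (\sum_(i < N.+1) x ^+ i) * (1 - x) = 1 - x ^+ N.+1.
    by apply/eqP; rewrite -eqr_opp opprB E; apply/eqP; ring.
  by rewrite gerBl exprn_ge0.
have x1' : 0 < 1 - x by rewrite subr_gt0.
have g0 : (fun N => x ^+ N) @ \oo --> (0 : R).
  by apply: cvg_expr; rewrite ger0_norm.
move/cvgrPdist_lt: g0 => /(_ (e * (1 - x)) (mulr_gt0 e0 x1')) [N _ /(_ N (leqnn N))] /=.
rewrite sub0r normrN ger0_norm ?exprn_ge0 // => h.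
exists N; rewrite -addnn exprD mulrA.
apply: (@le_lt_trans _ _ ((1 - x)^-1 * x ^+ N)); first by rewrite ler_wpM2r ?exprn_ge0.
by rewrite mulrC ltr_pdivrMr.
Qed.

End arcsine_series.

(** * Superposition of modes and domain of dependence *)

Section plane_waves.
Variable R : realType.
Variables (al be b rho drho X : R -> R) (T : R).
Hypotheses (T0 : 0 < T) (ca : continuous al) (cb : continuous be).
Hypotheses (cdrho : continuous drho) (rho0 : forall t, 0 < rho t).
Hypotheses (drhoP : forall t : R, is_derive t 1 rho (drho t)).
Hypotheses (XP : forall t : R, is_derive t 1 X (b t)) (b0 : forall t, 0 < b t) (X0 : X 0 = 0).
Hypotheses (rb : forall t, rho t * be t = b t) (ra : forall t, rho t * b t = al t).

Let Xhomo : {homo X : s t / s <= t}.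
Proof.
by move=> s t st; apply: (@deriv_ge0_le R X b s t st) => x _ //; exact: ltW.
Qed.

Section bounded_fields.
Variable l : R.
Definition strip_bounded (f : R -> R -> R) := exists M, forall s x, 0 <= s <= T -> `|x| <= l -> `|f s x| <= M.

Lemma strip_bounded_add f g : strip_bounded f -> strip_bounded g -> strip_bounded (fun s x => f s x + g s x).
Proof.
move=> [M Mf] [N Ng]; exists (M + N) => s x sT xl.
by apply: (le_trans (ler_normD _ _)); rewrite lerD ?Mf ?Ng.
Qed.

Lemma strip_bounded_mul f g : strip_bounded f -> strip_bounded g -> strip_bounded (fun s x => f s x * g s x).
Proof.
move=> [M Mf] [N Ng]; exists (M * N) => s x sT xl.
by rewrite normrM ler_pM ?Mf ?Ng.
Qed.

Lemma strip_bounded_t f : continuous f -> strip_bounded (fun s _ => f s).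
Proof. by move=> cf; have [M _ Mf] := segment_bounded 0 T cf; exists M => s x /Mf. Qed.

Lemma strip_bounded_x f : continuous f -> strip_bounded (fun _ x => f x).
Proof.
move=> cf; have [M _ Mf] := segment_bounded (- l) l cf.
by exists M => s x _; rewrite ler_norml => /Mf.
Qed.

Lemma strip_bounded_cst c : strip_bounded (fun _ _ => c).
Proof. by exists `|c| => s x. Qed.

Lemma strip_bounded_sum (I : Type) (r : seq I) (f : I -> R -> R -> R) :
  (forall i, strip_bounded (f i)) -> strip_bounded (fun s x => \sum_(i <- r) f i s x).
Proof.
move=> fb; elim: r => [|i r [M IH]].
  by exists 0 => s x _ _; rewrite big_nil normr0.
have [N fN] := fb i; exists (N + M) => s x sT xl; rewrite big_cons.
by apply: (le_trans (ler_normD _ _)); rewrite lerD ?fN ?IH.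
Qed.
End bounded_fields.

Section one_wave.
Variables (V W : R -> R -> R) (p0 r0 p2 r2 : R -> R) (L : seq (R * R)) (g : R).
Hypotheses (VW : forall z, lin_sol al (fun t => - z ^+ 2 * be t) (V z) (W z)).
Hypotheses (dp0 : forall t : R, is_derive t 1 p0 (al t * r0 t))
  (dr0 : forall t : R, is_derive t 1 r0 0)
  (dp2 : forall t : R, is_derive t 1 p2 (al t * r2 t))
  (dr2 : forall t : R, is_derive t 1 r2 (be t * p0 t)).

(** The pair (V, W) is the first order form V_t = al W, W_t = be V_xx of the
    wave equation. This is the W-component of a superposition of plane waves
    minus g times the explicit solution (p0 x^2 + 2 p2, r0 x^2 + 2 r2). *)
Definition wtot s x := \sum_(p <- L) p.2 * (W p.1 s * cos (p.1 * x)) - g * (r0 s * x ^+ 2 + 2 * r2 s).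
(** The x-derivative of the V-component of the same solution. *)
Definition vxtot s x := \sum_(p <- L) p.2 * (- (p.1 * V p.1 s * sin (p.1 * x))) - g * (2 * p0 s * x).
(** The Riemann invariants rho W + sg V_x: rho is chosen so that both fields
    move with speed b. *)
Definition qtot sg s x := rho s * wtot s x + sg * vxtot s x.

Lemma qtot_charac (sg c s : R) : `|sg| = 1 ->
  is_derive s 1 (fun s => qtot sg s (c - sg * X s))
    (drho s / (2 * rho s) * (qtot 1 s (c - sg * X s) + qtot (-1) s (c - sg * X s))).
Proof.
move=> sg1; have sgsg : sg * sg = 1.
  by rewrite -expr2 -real_normK ?num_real // sg1 expr1n.
have dX := XP s; have d1 := drhoP s; have d2 := dp0 s; have d3 := dr0 s; have d4 := dp2 s; have d5 := dr2 s.
pose x := c - sg * X s.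
have dw : is_derive s 1 (fun s => wtot s (c - sg * X s))
   (\sum_(p <- L) p.2 * (- p.1 ^+ 2 * be s * V p.1 s * cos (p.1 * x) + W p.1 s * p.1 * sg * b s * sin (p.1 * x))
     - g * (- 2 * r0 s * x * sg * b s + 2 * be s * p0 s)).
  apply: isd_sub.
    apply: isd_sum => p _; have [e1 e2] := VW p.1 s; isder; rewrite /x; ring.
  isder; rewrite /x; ring.
have dvx : is_derive s 1 (fun s => vxtot s (c - sg * X s))
   (\sum_(p <- L) p.2 * (- (p.1 * (al s * W p.1 s) * sin (p.1 * x)) + p.1 ^+ 2 * V p.1 s * sg * b s * cos (p.1 * x))
     - g * (2 * al s * r0 s * x - 2 * p0 s * sg * b s)).
  apply: isd_sub.
    apply: isd_sum => p _; have [e1 e2] := VW p.1 s; isder; rewrite /x; ring.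
  isder; rewrite /x; ring.
have H := isd_add (isd_mul d1 dw) (isd_mul (isd_cst s 1 sg) dvx).
apply: is_derive_eq H _; clear dw dvx; rewrite -/x; clearbody x.
have -> : drho s / (2 * rho s) * (qtot 1 s x + qtot (-1) s x) = drho s * wtot s x.
  by rewrite /qtot; field; rewrite gt_eqF.
set S1 := \sum_(p <- L) _; set S2 := \sum_(p <- L) _.
have E1 : rho s * S1 + sg * S2 = 0.
  rewrite !mulr_sumr -big_split /= big1 // => p _.
  transitivity (p.2 * (- p.1 ^+ 2 * (rho s * be s) * V p.1 s * cos (p.1 * x) + W p.1 s * p.1 * sg * (rho s * b s) * sin (p.1 * x) - sg * p.1 * al s * W p.1 s * sin (p.1 * x) + p.1 ^+ 2 * V p.1 s * (sg * sg) * b s * cos (p.1 * x))); first by ring.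
  by rewrite rb ra sgsg; ring.
transitivity (drho s * wtot s x + (rho s * S1 + sg * S2) - g * (2 * (rho s * be s) * p0 s - 2 * (rho s * b s) * r0 s * x * sg + 2 * al s * r0 s * x * sg - 2 * p0 s * (sg * sg) * b s)); first by ring.
by rewrite E1 rb ra sgsg; ring.
Qed.

Lemma qtot_bounded sg l : strip_bounded l (qtot sg).
Proof.
have cV z : continuous (V z) by move=> t; have [h _] := VW z t; exact: is_derive_cont h.
have cW z : continuous (W z) by move=> t; have [_ h] := VW z t; exact: is_derive_cont h.
have c0 : continuous p0 by exact: deriv_continuous dp0.
have c1 : continuous r0 by exact: deriv_continuous dr0.
have c2 : continuous r2 by exact: deriv_continuous dr2.
have c3 : continuous rho by exact: deriv_continuous drhoP.
have cc z : continuous (fun x : R => cos (z * x)).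
  by apply: (@deriv_continuous _ _ (fun x => - sin (z * x) * z)) => x; isder; ring.
have cs z : continuous (fun x : R => sin (z * x)).
  by apply: (@deriv_continuous _ _ (fun x => cos (z * x) * z)) => x; isder; ring.
have cx : continuous (fun x : R => x) by move=> x; exact: cvg_id.
have cx2 : continuous (fun x : R => x ^+ 2).
  by apply: (@deriv_continuous _ _ (fun x => 2 * x)) => x; isder; ring.
rewrite /qtot /wtot /vxtot.
have H1 : strip_bounded l (fun s x => \sum_(p <- L) p.2 * (W p.1 s * cos (p.1 * x)) - g * (r0 s * x ^+ 2 + 2 * r2 s)).
  have h1 : strip_bounded l (fun s x => \sum_(p <- L) p.2 * (W p.1 s * cos (p.1 * x))).
    apply: strip_bounded_sum => p; apply: (strip_bounded_mul (strip_bounded_cst _ _)).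
    exact: strip_bounded_mul (strip_bounded_t _ (cW _)) (strip_bounded_x _ (cc _)).
  have h2 : strip_bounded l (fun s x => - g * (r0 s * x ^+ 2 + 2 * r2 s)).
    apply: (strip_bounded_mul (strip_bounded_cst _ _)); apply: strip_bounded_add.
      exact: strip_bounded_mul (strip_bounded_t _ c1) (strip_bounded_x _ cx2).
    exact: strip_bounded_mul (strip_bounded_cst _ _) (strip_bounded_t _ c2).
  have [M HM] := strip_bounded_add h1 h2; exists M => s x sT xl; rewrite -mulNr; exact: HM.
have H2 : strip_bounded l (fun s x => \sum_(p <- L) p.2 * (- (p.1 * V p.1 s * sin (p.1 * x))) - g * (2 * p0 s * x)).
  have h1 : strip_bounded l (fun s x => \sum_(p <- L) p.2 * ((- p.1) * V p.1 s * sin (p.1 * x))).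
    apply: strip_bounded_sum => p; apply: (strip_bounded_mul (strip_bounded_cst _ _)).
    exact: strip_bounded_mul (strip_bounded_mul (strip_bounded_cst _ _) (strip_bounded_t _ (cV _))) (strip_bounded_x _ (cs _)).
  have h2 : strip_bounded l (fun s x => - g * (2 * p0 s * x)).
    apply: (strip_bounded_mul (strip_bounded_cst _ _)).
    exact: strip_bounded_mul (strip_bounded_mul (strip_bounded_cst _ _) (strip_bounded_t _ c0)) (strip_bounded_x _ cx).
  have [M HM] := strip_bounded_add h1 h2; exists M => s x sT xl; rewrite -mulNr.
  have := HM s x sT xl; congr (`| _ + _ | <= M).
  by apply: eq_bigr => p _; rewrite !mulNr.
exact: strip_bounded_add (strip_bounded_mul (strip_bounded_t _ c3) H1) (strip_bounded_mul (strip_bounded_cst _ _) H2).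
Qed.

End one_wave.

(** At the point x = 0 and time T the solution only sees the data on |x| <=
    X(T). There the cosine sum is close to g x^2, and so the superposed modes at
    time T are close to the quadratic solution, whose value at x = 0 is 2 g p2
    or 2 g r2. *)
Lemma wave_domain_of_dependence : exists2 C : R, 0 <= C &
  forall (V W : R -> R -> R) (p0 r0 p2 r2 : R -> R) (L : seq (R * R)) (g a0 c0 e : R),
  (forall z, lin_sol al (fun t => - z ^+ 2 * be t) (V z) (W z)) ->
  (forall z, V z 0 = a0 /\ W z 0 = c0) -> `|a0| <= 1 -> `|c0| <= 1 ->
  (forall t : R, is_derive t 1 p0 (al t * r0 t)) -> p0 0 = a0 ->
  (forall t : R, is_derive t 1 r0 0) -> r0 0 = c0 ->
  (forall t : R, is_derive t 1 p2 (al t * r2 t)) -> p2 0 = 0 ->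
  (forall t : R, is_derive t 1 r2 (be t * p0 t)) -> r2 0 = 0 ->
  (forall x, `|x| <= X T -> `|\sum_(p <- L) p.2 * cos (p.1 * x) - g * x ^+ 2| <= e /\
      `|\sum_(p <- L) p.2 * (- (p.1 * sin (p.1 * x))) - g * (2 * x)| <= e) ->
  `|\sum_(p <- L) p.2 * V p.1 T - 2 * g * p2 T| <= C * e /\
  `|\sum_(p <- L) p.2 * W p.1 T - 2 * g * r2 T| <= C * e.
Proof.
have c3 : continuous rho by exact: deriv_continuous drhoP.
have cr : continuous (fun s => (rho s)^-1).
  apply: (@deriv_continuous _ _ (fun s => - drho s / rho s ^+ 2)) => s.
  by apply: isd_inv => //; rewrite gt_eqF.
have ck : continuous (fun s => drho s / (2 * rho s)).
  move=> s; have E : (fun s => drho s / (2 * rho s)) = (fun s => drho s * (2^-1 * (rho s)^-1)).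
    by apply: funext => u; rewrite invfM.
  rewrite E; apply: cvgM; first exact: cdrho.
  by apply: cvgM; [exact: cvg_cst|exact: cr].
have [k k0 kP] := segment_bounded 0 T ck.
have [Mr Mr0 MrP] := segment_bounded 0 T cr.
have [Ma Ma0 MaP] := segment_bounded 0 T ca.
pose E := expR ((4 * k + 1) * T).
pose C1 := 2 * (rho 0 + 1) * E * Mr.
have C10 : 0 <= C1.
  rewrite /C1 !mulr_ge0 ?expR_ge0 ?(ltW Mr0) //.
  by have := rho0 0; lra.
exists (1 + C1 + Ma * C1 * T).
  have h1 := ltW Ma0; have h2 := ltW T0.
  have h3 : 0 <= Ma * C1 * T := mulr_ge0 (mulr_ge0 h1 C10) h2.
  lra.
move=> V W p0 r0 p2 r2 L g a0 c0 e VW VW0 a01 c01 dp0 p00 dr0 r00 dp2 p20 dr2 r20 He.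
have XT0 : `|0 : R| <= X T by rewrite normr0; have := Xhomo (ltW T0); rewrite X0.
have e0 : 0 <= e.
  have [h _] := He 0 XT0.
  exact: le_trans (normr_ge0 _) h.
pose q := qtot V W p0 r0 r2 L g.
pose d := (rho 0 + 1) * e.
have d0 : 0 <= d by rewrite mulr_ge0 //; have := rho0 0; lra.
have [M1 HM1] := @qtot_bounded V W p0 r0 r2 L g VW dp0 dr0 dr2 1 (X T).
have [M2 HM2] := @qtot_bounded V W p0 r0 r2 L g VW dp0 dr0 dr2 (-1) (X T).
have sgP (sg : R) : `|sg| = 1 -> sg = 1 \/ sg = -1.
  by move=> /eqP; rewrite eqr_norml ler01 andbT => /orP[/eqP|/eqP]; [left|right].
have bound : forall sg t x, `|sg| = 1 -> 0 <= t <= T -> `|x| <= X T - X t ->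
    `|q sg t x| <= 2 * d * expR ((4 * k + 1) * t).
  apply: (@riemann_bound R q (fun s => drho s / (2 * rho s)) X k (X T) T d (`|M1| + `|M2|)) => //.
  - exact: ltW.
  - by move=> sg c s sg1; exact: (@qtot_charac V W p0 r0 p2 r2 L g VW dp0 dr0 dp2 dr2).
  - move=> sg x sg1 /He[h1 h2].
    rewrite /q /qtot /wtot /vxtot r20 p00 r00.
    have -> : \sum_(p <- L) p.2 * (W p.1 0 * cos (p.1 * x)) - g * (c0 * x ^+ 2 + 2 * 0) =
        c0 * (\sum_(p <- L) p.2 * cos (p.1 * x) - g * x ^+ 2).
      rewrite mulrBr mulr_sumr mulr0 addr0; congr (_ - _); last by ring.
      by apply: eq_bigr => p _; have [_ ->] := VW0 p.1; ring.
    have -> : \sum_(p <- L) p.2 * - (p.1 * V p.1 0 * sin (p.1 * x)) - g * (2 * a0 * x) =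
        a0 * (\sum_(p <- L) p.2 * (- (p.1 * sin (p.1 * x))) - g * (2 * x)).
      rewrite mulrBr mulr_sumr; congr (_ - _); last by ring.
      by apply: eq_bigr => p _; have [-> _] := VW0 p.1; ring.
    apply: (le_trans (ler_normD _ _)); rewrite !normrM sg1 mul1r (_ : d = rho 0 * e + e); last by rewrite /d; ring.
    rewrite (ger0_norm (ltW (rho0 0))); apply: lerD.
      rewrite ler_wpM2l ?(ltW (rho0 0)) // -[e]mul1r ler_pM //.
    by rewrite -[e]mul1r ler_pM.
  - move=> sg t x sg1 tT xl.
    have xl' : `|x| <= X T.
      apply: (le_trans xl); rewrite gerBl; have /andP[t0 _] := tT.
      by have := Xhomo t0; rewrite X0.
    have [->|->] := sgP sg sg1.
      apply: (le_trans (HM1 t x tT xl')); apply: (le_trans (ler_norm _)).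
      by rewrite lerDl.
    apply: (le_trans (HM2 t x tT xl')); apply: (le_trans (ler_norm _)).
    by rewrite lerDr.
have wb t : 0 <= t <= T -> `|wtot W r0 r2 L g t 0| <= C1 * e.
  move=> tT; have [t0 tT'] := andP tT.
  have x0 : `|0 : R| <= X T - X t by rewrite normr0 subr_ge0 Xhomo.
  have h1 := bound 1 t 0 (normr1 _) tT x0.
  have h2 := bound (-1) t 0 (normrN1 _) tT x0.
  have -> : wtot W r0 r2 L g t 0 = (q 1 t 0 + q (-1) t 0) / 2 * (rho t)^-1.
    by rewrite /q /qtot; field; rewrite gt_eqF.
  rewrite normrM (_ : C1 * e = (2 * d * E) * Mr); last by rewrite /C1 /d; ring.
  apply: ler_pM => //; last exact: MrP.
  have h3 : expR ((4 * k + 1) * t) <= E.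
    by rewrite ler_expR ler_wpM2l //; have := ltW k0; lra.
  have h4 := ler_wpM2l (_ : 0 <= 2 * d) h3.
  rewrite normrM (ger0_norm (_ : 0 <= 2^-1)) ?invr_ge0 // ler_pdivrMr //.
  apply: (le_trans (ler_normD _ _)).
  have d20 : 0 <= 2 * d by rewrite mulr_ge0.
  have := h4 d20; lra.
have wE t : wtot W r0 r2 L g t 0 = \sum_(p <- L) p.2 * W p.1 t - 2 * g * r2 t.
  rewrite /wtot; congr (_ - _); last by ring.
  by apply: eq_bigr => p _; rewrite mulr0 cos0 mulr1.
have TT : 0 <= T <= T by rewrite ltW //=.
have Ce : 0 <= C1 * e by exact: mulr_ge0.
have MCe : 0 <= Ma * C1 * T * e := mulr_ge0 (mulr_ge0 (mulr_ge0 (ltW Ma0) C10) (ltW T0)) e0.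
split; last first.
  rewrite -wE; apply: (le_trans (wb T TT)); rewrite !mulrDl; lra.
have dv (t : R) : is_derive t 1 (fun t => \sum_(p <- L) p.2 * V p.1 t - 2 * g * p2 t) (al t * wtot W r0 r2 L g t 0).
  have h1 : is_derive t 1 (fun t => \sum_(p <- L) p.2 * V p.1 t) (\sum_(p <- L) p.2 * (al t * W p.1 t)).
    by apply: isd_sum => p _; have [e1 e2] := VW p.1 t; isder; ring.
  have h2 : is_derive t 1 (fun t => 2 * g * p2 t) (2 * g * (al t * r2 t)).
    by have e1 := dp2 t; isder; ring.
  apply: is_derive_eq (isd_sub h1 h2) _.
  rewrite wE mulrBr mulr_sumr; congr (_ - _); last by ring.
  by apply: eq_bigr => p _; ring.
have := @deriv_norm_le R _ _ 0 T (Ma * (C1 * e)) (ltW T0) (fun t _ => dv t).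
rewrite subr0 p20 mulr0 subr0 => H.
have v0e : `|\sum_(p <- L) p.2 * V p.1 0| <= e.
  have [h _] := He 0 XT0.
  have -> : \sum_(p <- L) p.2 * V p.1 0 = a0 * (\sum_(p <- L) p.2 * cos (p.1 * 0) - g * 0 ^+ 2).
    rewrite expr0n /= mulr0 subr0 mulr_sumr; apply: eq_bigr => p _.
    by have [-> _] := VW0 p.1; rewrite mulr0 cos0; ring.
  by rewrite normrM -[e]mul1r ler_pM.
rewrite -[X in `|X|](subrK (\sum_(p <- L) p.2 * V p.1 0)).
apply: (le_trans (ler_normD _ _)).
have : `|(\sum_(p <- L) p.2 * V p.1 T - 2 * g * p2 T) - \sum_(p <- L) p.2 * V p.1 0| <= Ma * (C1 * e) * T.
  apply: H => t tT; rewrite normrM ler_pM ?MaP ?wb //.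
rewrite !mulrDl; lra.
Qed.

End plane_waves.

(** * Borg trace inequality for a periodic propagation speed *)

Section periodic.
Variable R : realType.

Lemma flat_derivative (f df : R -> R) (a c : R) : a < c ->
  (forall t : R, is_derive t 1 f (df t)) -> (forall t, 0 <= df t) -> f c <= f a ->
  forall t, a < t < c -> df t = 0.
Proof.
move=> ac fd df0 fca t /andP[at_ tc].
have mono s u : s <= u -> f s <= f u.
  by move=> su; apply: (@deriv_ge0_le R f df s u su) => // x _; exact: df0.
have fE s : a < s < c -> f s = f a.
  by move=> /andP[/ltW /mono h1 /ltW /mono h2]; apply/eqP; rewrite eq_le h1 (le_trans h2).
have H : is_derive t 1 (fun=> f a : R) (df t).
  apply: near_eq_is_derive (fd t).
  have : \forall s \near t, a < s < c.
    by have := @near_in_itvoo R a c t; rewrite in_itv /= at_ tc => /(_ isT); apply: filterS => s; rewrite in_itv.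
  by apply: filterS => s; exact: fE.
by have [_ <-] := H; rewrite derive_cst.
Qed.

Lemma periodic_nat (b : R -> R) (T : R) : (forall t, b (t + T) = b t) ->
  forall k t, b (t + k%:R * T) = b t.
Proof.
move=> bT; elim=> [|k IH] t; first by rewrite mul0r addr0.
by rewrite -natr1 mulrDl mul1r addrA bT IH.
Qed.

Lemma periodic_reduce (b : R -> R) (T : R) : 0 < T -> (forall t, b (t + T) = b t) ->
  forall t, exists2 s, 0 <= s < T & b t = b s.
Proof.
move=> T0 bT t; pose k := Num.floor (t / T).
have /andP[k1 k2] : k%:~R <= t / T < (k + 1)%:~R by exact: floor_itv.
exists (t - k%:~R * T).
  rewrite ler_pdivlMr // in k1; rewrite ltr_pdivrMr // in k2.
  rewrite intrD mulrDl mul1r in k2.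
  by rewrite subr_ge0 k1 ltrBlDr addrC k2.
case: k {k1 k2} => k.
  by rewrite -[in LHS](subrK (k%:R * T) t) periodic_nat.
by rewrite NegzE mulrNz mulNr opprK periodic_nat.
Qed.

Lemma periodic_bounded (b : R -> R) (T : R) : 0 < T -> (forall t, b (t + T) = b t) ->
  continuous b -> exists2 M, 0 < M & forall t, `|b t| <= M.
Proof.
move=> T0 bT cb; have [M M0 bM] := segment_bounded 0 T cb.
exists M => // t; have [s /andP[s0 sT] ->] := periodic_reduce T0 bT t.
by apply: bM; rewrite s0 ltW.
Qed.

End periodic.

Section instability.
Variable R : realType.
Variables (b db : R -> R) (T : R) (n' : nat).
Hypotheses (bd : forall t : R, is_derive t 1 b (db t)) (cdb : continuous db).
Hypotheses (b0 : forall t, 0 < b t) (T0 : 0 < T) (bT : forall t, b (t + T) = b t).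

(** The mode equation S_tt - n (b_t / b) S_t + z^2 b^2 S = 0 becomes S_t = alpha
    W, W_t = - z^2 beta S with W = b^-n S_t. Here n = n'.+1. *)
Definition alpha t := b t ^+ n'.+1.
Definition beta t := b t ^+ 2 / b t ^+ n'.+1.

Lemma cont_b : continuous b. Proof. exact: deriv_continuous bd. Qed.

Lemma cont_alpha : continuous alpha.
Proof.
by apply: (@deriv_continuous _ _ (fun t => n'.+1%:R * b t ^+ n' * db t)) => t; exact: isd_exp.
Qed.

Lemma cont_beta : continuous beta.
Proof.
have bn t : b t ^+ n'.+1 != 0 by rewrite expf_neq0 // gt_eqF.
have h (t : R) := @isd_inv R R^o t 1 (fun t => b t ^+ n'.+1) _ (bn t) (isd_exp n' (bd t)).
have H t := isd_mul (isd_sqr (bd t)) (h t).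
exact: deriv_continuous H.
Qed.

Lemma beta_gt0 t : 0 < beta t.
Proof. by rewrite divr_gt0 // exprn_gt0. Qed.

Lemma alpha_gt0 t : 0 < alpha t.
Proof. by rewrite exprn_gt0. Qed.

Lemma alpha_per t : alpha (t + T) = alpha t. Proof. by rewrite /alpha bT. Qed.
Lemma beta_per t : beta (t + T) = beta t. Proof. by rewrite /beta bT. Qed.

Definition mode (z : R) (v w : R -> R) := lin_sol alpha (fun t => - z ^+ 2 * beta t) v w.

Lemma cont_q z : continuous (fun t => - z ^+ 2 * beta t).
Proof. by apply: cont_mul; [exact: cst_continuous|exact: cont_beta]. Qed.

Lemma mode_exists z v0 w0 : exists v w, [/\ mode z v w, v 0 = v0 & w 0 = w0].
Proof. exact: (lin_ode_exists v0 w0 cont_alpha (@cont_q z)). Qed.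

Let rho t := b t ^+ n'.
Let X := integral_from0 b.
Let N1 := integral_from0 alpha.
Let N2 := integral_from0 beta.

Let Xd (t : R) : is_derive t 1 X (b t). Proof. exact: integral_from0_is_derive cont_b. Qed.
Let N1d (t : R) : is_derive t 1 N1 (alpha t). Proof. exact: integral_from0_is_derive cont_alpha. Qed.
Let N2d (t : R) : is_derive t 1 N2 (beta t). Proof. exact: integral_from0_is_derive cont_beta. Qed.

Let rb t : rho t * beta t = b t.
Proof.
rewrite /rho /beta [b t ^+ n'.+1]exprS; field.
by rewrite expf_neq0 ?gt_eqF.
Qed.

Let ra t : rho t * b t = alpha t.
Proof. by rewrite /rho /alpha exprS mulrC. Qed.

Let pos_int (f : R -> R) (F : R -> R) : (forall t : R, is_derive t 1 F (f t)) ->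
  (forall t, 0 < f t) -> F 0 = 0 -> 0 < F T.
Proof.
move=> Fd f0 F0; rewrite ltNge; apply/negP => FT.
have := @flat_derivative R F f 0 T T0 Fd (fun t => ltW (f0 t)).
rewrite F0 => /(_ FT (T / 2)) h.
by have := f0 (T / 2); rewrite h ?ltxx // divr_gt0 //= ltr_pdivrMr // ltr_pMr // ltr1n.
Qed.

(** Equality in Cauchy-Schwarz for (alpha^(1/2), beta^(1/2)) forces alpha / beta
    = b^(2 n') to be constant: the derivative of the nonnegative quadratic
    expression H is beta (rho y - 1)^2, while H(0) = 0 and H(T) <= 0 if the
    strict inequality fails. *)
Lemma cauchy_schwarz_strict : (0 < n')%N -> (exists t1 t2, b t1 != b t2) ->
  X T ^+ 2 < N1 T * N2 T.
Proof.
move=> n0 nonconst; rewrite ltNge; apply/negP => le.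
have N1T : 0 < N1 T by apply: (pos_int N1d alpha_gt0); exact: integral_from00.
have XT : 0 < X T by apply: (pos_int Xd b0); exact: integral_from00.
pose y := X T / N1 T.
have y0 : 0 < y by rewrite divr_gt0.
pose H t := N1 t * y ^+ 2 - 2 * X t * y + N2 t.
have Hd (t : R) : is_derive t 1 H (beta t * (rho t * y - 1) ^+ 2).
  have h1 := N1d t; have h2 := N2d t; have h3 := Xd t.
  rewrite /H; isder.
  rewrite -(ra t) -(rb t); ring.
have H0 : H 0 = 0 by rewrite /H /N1 /N2 /X !integral_from00; ring.
have HT : H T <= H 0.
  rewrite H0 /H /y.
  have -> : N1 T * (X T / N1 T) ^+ 2 - 2 * X T * (X T / N1 T) + N2 T = (N1 T * N2 T - X T ^+ 2) / N1 T.
    by field; rewrite gt_eqF.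
  by rewrite pmulr_lle0 ?invr_gt0 // subr_le0.
have flat t : 0 < t < T -> rho t = y^-1.
  move=> tT; have := flat_derivative T0 Hd _ HT tT.
  move=> h; have /eqP : beta t * (rho t * y - 1) ^+ 2 = 0.
    by apply: h => s; rewrite mulr_ge0 ?sqr_ge0 // ltW // beta_gt0.
  rewrite mulf_eq0 gt_eqF ?beta_gt0 //= sqrf_eq0 subr_eq0 => /eqP e.
  by rewrite -[LHS](mulfK (lt0r_neq0 y0)) e mul1r.
pose c := b (T / 2).
have T2 : 0 < T / 2 < T by rewrite divr_gt0 //= ltr_pdivrMr // ltr_pMr // ltr1n.
have bc t : 0 < t < T -> b t = c.
  move=> tT; apply/eqP; have := flat t tT; rewrite -(flat _ T2) /rho => /eqP.
  by rewrite eqrXn2 // ?(ltW (b0 _)) // -lt0n.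
have bc0 : b 0 = c.
  apply/eqP/negPn/negP => b0c.
  have : \forall t \near 0, b t != c.
    have : 0 < `|b 0 - c| by rewrite normr_gt0 subr_eq0.
    move=> h; have := @cont_b 0 => /cvgrPdist_lt /(_ _ h); apply: filterS => t ht.
    by apply: contraTneq ht => ->; rewrite ltxx.
  move=> /nbhs_ballP[e /= e0 he].
  pose t := Num.min (e / 2) (T / 2).
  have t0 : 0 < t by rewrite lt_min !divr_gt0.
  have te : t < e.
    apply: (@le_lt_trans _ _ (e / 2)); first by rewrite ge_min lexx.
    by rewrite ltr_pdivrMr // ltr_pMr // ltr1n.
  have tT : t < T.
    apply: (@le_lt_trans _ _ (T / 2)); first by rewrite ge_min lexx orbT.
    by case/andP: T2.
  have : b t != c by apply: he; rewrite /ball /= sub0r normrN gtr0_norm.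
  by rewrite bc ?eqxx // t0.
have ball_ t : b t = c.
  have [s /andP[s0 sT] ->] := periodic_reduce T0 bT t.
  by move: s0; rewrite le_eqVlt => /orP[/eqP <- //|s0]; apply: bc; rewrite s0.
by case: nonconst => t1 [t2]; rewrite !ball_ eqxx.
Qed.

Let trace_arith (g x y u v s1 s2 : R) : `|s1 - 2 * g * u| <= y -> `|s2 - 2 * g * v| <= y ->
  `|s1 + s2| <= 2 * x -> g * (u + v) - x <= y.
Proof.
rewrite !ler_norml => /andP[h1 _] /andP[h3 _] /andP[_ h6].
have -> : g * (u + v) = g * u + g * v by ring.
have E1 : 2 * g * u = 2 * (g * u) by ring.
have E2 : 2 * g * v = 2 * (g * v) by ring.
rewrite E1 in h1; rewrite E2 in h3.
by move: (g * u) (g * v) h1 h3 h6 => U V; lra.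
Qed.

Let freq_arith (o k r : R) : 0 < o -> 0 <= r ->
  k * ((16 + 4 * o) * r) <= (16 + 4 * o) * (k + 1) * r.
Proof.
move=> o0 r0; have h : 0 <= (16 + 4 * o) * r by rewrite mulr_ge0 // ltW // ltr_wpDl // mulr_gt0.
rewrite (_ : _ * (k + 1) * r = k * ((16 + 4 * o) * r) + (16 + 4 * o) * r); last by ring.
by rewrite lerDl.
Qed.

(** Let F be a cosine sum close to (om x / 2)^2 on |x| <= X(T), with coefficient
    mass at most (pi/2)^2. Evolve it once as initial position and once as
    initial velocity; adding the position of the first evolution to the velocity
    of the second at x = 0 and time T gives, on the one hand, the combination of
    the traces with the coefficients of F, which is at most 2 (pi/2)^2. On the
    other hand, it is close to 2 (om/2)^2 N1(T) N2(T) by the domain of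
    dependence. This holds for every om with om X(T) < pi, and om X(T) -> pi
    gives the claim. *)
Lemma borg_trace : (forall z v w v' w', mode z v w -> mode z v' w' ->
     v 0 = 1 -> w 0 = 0 -> v' 0 = 0 -> w' 0 = 1 -> `|v T + w' T| <= 2) ->
  N1 T * N2 T <= X T ^+ 2.
Proof.
move=> stable.
have XT : 0 < X T by apply: (pos_int Xd b0); exact: integral_from00.
have [C Cm] := choice (fun z => mode_exists z 1 0).
have {Cm} [Cw CP] := choice Cm.
have [S Sm] := choice (fun z => mode_exists z 0 1).
have {Sm} [Sw SP] := choice Sm.
pose A := N1 T * N2 T.
rewrite leNgt; apply/negP => AX.
pose drho t := n'%:R * b t ^+ n'.-1 * db t.
have drhoP (t : R) : is_derive t 1 rho (drho t).
  rewrite /rho /drho; case: (n') => [|k]; last exact: isd_exp.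
  rewrite mul0r mul0r (_ : (fun _ => _) = fun=> 1); first exact: isd_cst.
  by apply: funext => s; rewrite expr0.
have cdrho : continuous drho.
  apply: cont_mul; last exact: cdb.
  apply: cont_mul; first exact: cst_continuous.
  move=> t; apply: (@continuous_comp _ _ _ b (fun x => x ^+ n'.-1)); first exact: cont_b.
  exact: exprn_continuous.
have rho0 t : 0 < rho t by rewrite exprn_gt0.
have [K K0 HK] := @wave_domain_of_dependence R alpha beta b rho drho X T T0 cont_alpha
  cdrho rho0 drhoP Xd b0 (integral_from00 _) rb ra.
(* The frequency om = pi / L1 lies below pi / X(T), and close enough to it for
   eta below to be positive, L1^2 being halfway between X(T)^2 and A. *)
pose L1 := Num.sqrt ((A + X T ^+ 2) / 2).
have A0 : 0 < A by apply: le_lt_trans AX; exact: sqr_ge0.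
have L1sq : L1 ^+ 2 = (A + X T ^+ 2) / 2.
  by rewrite sqr_sqrtr // divr_ge0 // addr_ge0 ?sqr_ge0 // ltW.
have L10 : 0 < L1 by rewrite sqrtr_gt0 divr_gt0 // ltr_wpDr ?sqr_ge0.
have XL1 : X T < L1.
  have : X T ^+ 2 < L1 ^+ 2 by rewrite L1sq; rewrite -/A in AX; lra.
  by rewrite ltr_pXn2r ?nnegrE // ltW.
have L1A : L1 ^+ 2 < A by rewrite L1sq; rewrite -/A in AX; lra.
pose om := pi / L1.
have om0 : 0 < om by rewrite divr_gt0 // pi_gt0.
pose t0 := om * X T / 2.
have t0P : 0 <= t0 < pi / 2.
  apply/andP; split; first by rewrite divr_ge0 // mulr_ge0 // ltW.
  rewrite /t0 ltr_pM2r ?invr_gt0 // /om mulrAC ltr_pdivrMr // ltr_pM2l ?pi_gt0 //.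
pose eta := om ^+ 2 / 4 * A - (pi / 2) ^+ 2.
have eta0 : 0 < eta.
  rewrite /eta /om expr_div_n.
  have -> : pi ^+ 2 / L1 ^+ 2 / 4 * A - (pi / 2) ^+ 2 = (pi / 2) ^+ 2 / L1 ^+ 2 * (A - L1 ^+ 2).
    by field; rewrite gt_eqF.
  by rewrite mulr_gt0 ?subr_gt0 // divr_gt0 // exprn_gt0 // divr_gt0 // pi_gt0.
have sin01 : 0 <= sin t0 < 1.
  case/andP: t0P => h1 h2; rewrite sin_ge0_pi ?h1 /=; last first.
    by apply: (le_trans (ltW h2)); rewrite ler_pdivrMr // ler_peMr ?pi_ge0 // ler1n.
  rewrite -sin_pihalf ltr_sin // !in_itv /= ?(ltW h2) ?lexx ?andbT.
    by apply: le_trans h1; rewrite oppr_le0 divr_ge0 ?pi_ge0.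
  by rewrite ge0_cp // divr_ge0 ?pi_ge0.
pose cst := (16 + 4 * om) * (K + 1).
have cst0 : 0 < cst by rewrite mulr_gt0 //; [rewrite ltr_wpDr // mulr_ge0 // ltW|rewrite ltr_wpDl].
have [N HN] := linear_geometric_small sin01 (divr_gt0 eta0 cst0).
have [l [F [dF [FE lb Fd Fb]]]] := arcsine_partial_bounds N t0P.
pose r := N.+1%:R * sin t0 ^+ N.*2.
have r0 : 0 <= r.
  by rewrite mulr_ge0 // -mul2n exprM exprn_ge0 // sqr_ge0.
pose L := [seq (p.1 * om / 2, p.2) | p <- l].
pose e := (16 + 4 * om) * r.
have Fcos (x : R) : \sum_(p <- L) p.2 * cos (p.1 * x) = F (om * x / 2).
  rewrite FE /L big_map; apply: eq_bigr => p _ /=; congr (_ * cos _); by field.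
have dFsin (x : R) : \sum_(p <- L) p.2 * (- (p.1 * sin (p.1 * x))) = dF (om * x / 2) * (om / 2).
  have h1 : is_derive x 1 (fun x => \sum_(p <- L) p.2 * cos (p.1 * x)) (\sum_(p <- L) p.2 * (- (p.1 * sin (p.1 * x)))).
    by apply: isd_sum => p _; isder; ring.
  have h2 : is_derive x 1 (fun x => F (om * x / 2)) (dF (om * x / 2) * (om / 2)).
    have hd : is_derive x 1 (fun x : R => om * x / 2) (om / 2) by isder; field.
    exact: (@is_derive_chain R R^o F (fun x => om * x / 2) x 1 _ _ (Fd _) hd).
  rewrite (funext Fcos) in h1.
  by case: h1 => _ <-; case: h2.
have cond x : `|x| <= X T -> `|\sum_(p <- L) p.2 * cos (p.1 * x) - om ^+ 2 / 4 * x ^+ 2| <= e /\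
      `|\sum_(p <- L) p.2 * (- (p.1 * sin (p.1 * x))) - om ^+ 2 / 4 * (2 * x)| <= e.
  move=> xX; have th : `|om * x / 2| <= t0.
    have o2 : 0 < om / 2 by rewrite divr_gt0.
    rewrite (_ : om * x / 2 = om / 2 * x); last by ring.
    rewrite (_ : t0 = om / 2 * X T); last by rewrite /t0; ring.
    by rewrite normrM (gtr0_norm o2) ler_pM2l.
  have [h1 h2] := Fb _ th.
  have omr : 0 <= om * r by rewrite mulr_ge0 // ltW.
  rewrite Fcos dFsin; split.
    have -> : om ^+ 2 / 4 * x ^+ 2 = (om * x / 2) ^+ 2 by field.
    apply: (le_trans h2); rewrite -mulrA -/r /e; lra.
  have -> : dF (om * x / 2) * (om / 2) - om ^+ 2 / 4 * (2 * x) = (dF (om * x / 2) - 2 * (om * x / 2)) * (om / 2).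
    by field.
  have o20 : 0 < om / 2 by rewrite divr_gt0.
  rewrite normrM (gtr0_norm o20).
  have o2 : 0 <= om / 2 by rewrite divr_ge0 // ltW.
  apply: (le_trans (ler_wpM2r o2 h1)).
  rewrite (_ : _ * (om / 2) = 4 * (om * r)); last by rewrite /r; field.
  rewrite /e; lra.
pose p2C := integral_from0 (fun t => alpha t * N2 t).
pose r2S := integral_from0 (fun t => beta t * N1 t).
pose p2S := integral_from0 (fun t => alpha t * r2S t).
have cN1 : continuous N1 by exact: deriv_continuous N1d.
have cN2 : continuous N2 by exact: deriv_continuous N2d.
have p2Cd (t : R) : is_derive t 1 p2C (alpha t * N2 t).
  by apply: integral_from0_is_derive; apply: cont_mul => //; exact: cont_alpha.
have r2Sd (t : R) : is_derive t 1 r2S (beta t * N1 t).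
  by apply: integral_from0_is_derive; apply: cont_mul => //; exact: cont_beta.
have p2Sd (t : R) : is_derive t 1 p2S (alpha t * r2S t).
  apply: integral_from0_is_derive; apply: cont_mul; first exact: cont_alpha.
  exact: deriv_continuous r2Sd.
(* Both double integrals over the two halves of the square [0, T]^2 add up to
   the product. *)
have AE : p2C T + r2S T = A.
  have dd (t : R) : is_derive t 1 (fun t => p2C t + r2S t - N1 t * N2 t) 0.
    have e1 := p2Cd t; have e2 := r2Sd t; have e3 := N1d t; have e4 := N2d t.
    apply: is_derive_eq (isd_sub (isd_add e1 e2) (isd_mul e3 e4)) _.
    by move: (alpha t) (beta t) (N1 t) (N2 t) => x1 x2 x3 x4; ring.
  have := is_derive_0_is_cst T 0 dd.
  rewrite /p2C /r2S /N1 /N2 !integral_from00 mul0r addr0 subr0 => /eqP.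
  by rewrite subr_eq0 => /eqP.
have [hC _] := HK C Cw (fun=> 1) (fun=> 0) p2C N2 L (om ^+ 2 / 4) 1 0 e
  (fun z => let: And3 h _ _ := CP z in h) (fun z => let: And3 _ h1 h2 := CP z in conj h1 h2)
  ltac:(by rewrite normr1) ltac:(by rewrite normr0)
  ltac:(by move=> t; apply: is_derive_eq (isd_cst _ _ _) _; rewrite mulr0) erefl
  (fun t => isd_cst _ _ _) erefl p2Cd (integral_from00 _)
  ltac:(by move=> t; apply: is_derive_eq (N2d t) _; rewrite mulr1) (integral_from00 _) cond.
have [_ hS] := HK S Sw N1 (fun=> 1) p2S r2S L (om ^+ 2 / 4) 0 1 e
  (fun z => let: And3 h _ _ := SP z in h) (fun z => let: And3 _ h1 h2 := SP z in conj h1 h2)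
  ltac:(by rewrite normr0) ltac:(by rewrite normr1)
  ltac:(by move=> t; apply: is_derive_eq (N1d t) _; rewrite mulr1) (integral_from00 _)
  (fun t => isd_cst _ _ _) erefl p2Sd (integral_from00 _) r2Sd (integral_from00 _) cond.
have sumD : `|\sum_(p <- L) p.2 * C p.1 T + \sum_(p <- L) p.2 * Sw p.1 T| <= 2 * (pi / 2) ^+ 2.
  rewrite -big_split /=; apply: (le_trans (ler_norm_sum _ _ _)).
  apply: (@le_trans _ _ (\sum_(p <- L) 2 * `|p.2|)).
    apply: ler_sum => p _; rewrite -mulrDr normrM mulrC ler_wpM2r //.
    have [c1 c2 c3] := CP p.1; have [s1 s2 s3] := SP p.1.
    exact: (stable _ _ _ _ _ c1 s1).
  rewrite -mulr_sumr ler_pM2l // /L big_map; exact: lb.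
have key : eta <= K * e by rewrite /eta -AE; exact: trace_arith hC hS sumD.
have : K * e < eta.
  apply: (@le_lt_trans _ _ (cst * r)).
    exact: freq_arith om0 r0.
  by rewrite mulrC -ltr_pdivlMr.
by move=> /(le_lt_trans key); rewrite ltxx.
Qed.

End instability.

(** * A mode that outgrows the width of its cone *)

Lemma mul_lt_half (R : realType) (e M d : R) : 0 < e -> 0 <= M ->
  e * (2 * (M + 1)) <= d -> e * M < d.
Proof.
move=> e0 M0 h; have := mulr_ge0 (ltW e0) M0.
rewrite (_ : e * (2 * (M + 1)) = 2 * (e * M) + 2 * e) in h; last by ring.
lra.
Qed.

Section growth.
Variable R : realType.
Variables (b db : R -> R) (T : R) (n' : nat).
Hypotheses (bd : forall t : R, is_derive t 1 b (db t)) (cdb : continuous db).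
Hypotheses (b0 : forall t, 0 < b t) (T0 : 0 < T) (bT : forall t, b (t + T) = b t).

Local Notation al := (alpha b n').
Local Notation be := (beta b n').
Local Notation mode := (mode b n').

Let cal : continuous al. Proof. exact: (cont_alpha bd). Qed.
Let cbe : continuous be. Proof. exact: (cont_beta bd b0). Qed.

(** If S(T) = 0, the initial data of S is an eigenvector of the monodromy matrix
    and S may decay. But S(T) is not stationary in z^2: the Wronskian of the
    modes at z^2 and z^2 + eta is eta times \int beta S^2 up to an error of
    second order, so S(T) becomes nonzero for small eta > 0, whereas the trace
    stays large by continuity. *)
Lemma mode_perturb (z0 : R) C Cw S Sw : mode z0 C Cw -> mode z0 S Sw ->
  C 0 = 1 -> Cw 0 = 0 -> S 0 = 0 -> Sw 0 = 1 -> 2 < `|C T + Sw T| -> S T = 0 ->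
  exists z C' Cw' S' Sw', [/\ mode z C' Cw', mode z S' Sw',
    [/\ C' 0 = 1, Cw' 0 = 0, S' 0 = 0 & Sw' 0 = 1],
    2 < `|C' T + Sw' T| & S' T != 0].
Proof.
move=> mC mS C0 Cw0 S0 Sw0 D2 ST.
have cont v w : mode z0 v w -> continuous v by move=> h; apply: deriv_continuous (fun t => (h t).1).
have [Mb Mb0 MbP] := segment_bounded 0 T cbe.
have [Ma Ma0 MaP] := segment_bounded 0 T cal.
have [Mc Mc0 McP] := segment_bounded 0 T (cont _ _ mC).
have [Ms Ms0 MsP] := segment_bounded 0 T (cont _ _ mS).
(* Y T is the derivative of S(T) in the spectral parameter, up to a nonzero
   factor. *)
pose Y := integral_from0 (fun t => be t * S t ^+ 2).
have cS := cont _ _ mS.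
have Yd (t : R) : is_derive t 1 Y (be t * S t ^+ 2).
  apply: integral_from0_is_derive; apply: cont_mul => //.
  by move=> s; apply: cvgM; exact: cS.
(* Otherwise S vanishes on ]0, T[ together with Sw, against the Wronskian being
   1. *)
have YT : 0 < Y T.
  rewrite ltNge; apply/negP => YT.
  have S0T t : 0 < t < T -> S t = 0.
    move=> tT; have : be t * S t ^+ 2 = 0.
      apply: (flat_derivative T0 Yd _ _ tT); last by rewrite /Y integral_from00.
      by move=> s; rewrite mulr_ge0 ?sqr_ge0 // ltW // beta_gt0.
    by move/eqP; rewrite mulf_eq0 gt_eqF ?beta_gt0 //= sqrf_eq0 => /eqP.
  have T2 : 0 < T / 2 < T by rewrite divr_gt0 //= ltr_pdivrMr // ltr_pMr // ltr1n.
  have [dS _] := mS (T / 2).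
  have dS0 : is_derive (T / 2 : R) 1 (fun=> 0 : R) (al (T / 2) * Sw (T / 2)).
    apply: near_eq_is_derive dS.
    have : \forall s \near T / 2, 0 < s < T.
      have := @near_in_itvoo R 0 T (T / 2); rewrite in_itv /= T2 => /(_ isT).
      by apply: filterS => s; rewrite in_itv.
    by apply: filterS => s /S0T.
  have : al (T / 2) * Sw (T / 2) = 0 by have [_ <-] := dS0; rewrite derive_cst.
  move/eqP; rewrite mulf_eq0 gt_eqF ?alpha_gt0 //= => /eqP Sw2.
  have := wronskian mC mS (T / 2).
  by rewrite Sw2 S0T // C0 Sw0 S0 Cw0 !mulr0 mul0r !subr0 mulr1 => /eqP; rewrite eq_sym oner_eq0.
pose Q := Mb * (z0 ^+ 2 + 1).
have Q0 : 0 <= Q by apply: mulr_ge0; [exact: ltW|apply: addr_ge0; [exact: sqr_ge0|]].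
pose E := expR ((2 * (Ma + Q) + 1) * T).
pose M := Num.sqrt (T * E) * (Mb * (Mc + Ms)).
have M0 : 0 <= M.
  apply: mulr_ge0; first exact: sqrtr_ge0.
  by apply: mulr_ge0; [exact: ltW|apply: addr_ge0; exact: ltW].
have close (eta : R) : 0 < eta <= 1 -> forall v w v' w', mode (Num.sqrt (z0 ^+ 2 + eta)) v w ->
    mode z0 v' w' -> v 0 = v' 0 -> w 0 = w' 0 -> (forall t, 0 <= t <= T -> `|v' t| <= Mc + Ms) ->
    forall t, 0 <= t <= T -> `|v t - v' t| <= eta * M /\ `|w t - w' t| <= eta * M.
  move=> /andP[eta0 eta1] v w v' w' mv mv' v0 w0 vb t tT.
  have z2 : Num.sqrt (z0 ^+ 2 + eta) ^+ 2 = z0 ^+ 2 + eta.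
    by rewrite sqr_sqrtr // addr_ge0 ?sqr_ge0 // ltW.
  have [t0 tT'] := andP tT.
  have h := @lin_sol_dep R _ _ _ v w v' w' (Ma + Q) (eta * (Mb * (Mc + Ms))) T (ltW T0) mv mv' v0 w0 _ _ t tT.
  have {h} : (v t - v' t) ^+ 2 + (w t - w' t) ^+ 2 <= (eta * M) ^+ 2.
    apply: (@le_trans _ _ ((eta * (Mb * (Mc + Ms))) ^+ 2 * t * expR ((2 * (Ma + Q) + 1) * t))).
      apply: h => s sT.
        split; first by apply: (le_trans (MaP s sT)); rewrite lerDl.
        rewrite mulNr normrN normrM z2 ger0_norm ?addr_ge0 ?sqr_ge0 ?(ltW eta0) //.
        apply: (@le_trans _ _ Q); last by rewrite lerDr ltW.
        by rewrite mulrC /Q ler_pM ?MbP // ?addr_ge0 ?sqr_ge0 ?(ltW eta0) // lerD2l.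
      have -> : (- Num.sqrt (z0 ^+ 2 + eta) ^+ 2 * be s - - z0 ^+ 2 * be s) * v' s = - (eta * (be s * v' s)).
        by rewrite z2; ring.
      rewrite normrN normrM (gtr0_norm eta0) ler_pM2l // normrM ler_pM ?MbP ?vb //.
    have -> : (eta * M) ^+ 2 = (eta * (Mb * (Mc + Ms))) ^+ 2 * T * E.
      rewrite /M !exprMn sqr_sqrtr; first by ring.
      by rewrite mulr_ge0 ?expR_ge0 // ltW.
    apply: ler_pM; [by apply: mulr_ge0 => //; exact: sqr_ge0|exact: expR_ge0| |].
      by apply: ler_wpM2l => //; exact: sqr_ge0.
    rewrite ler_expR; apply: ler_wpM2l => //.
    by apply: addr_ge0 => //; apply: mulr_ge0 => //; apply: addr_ge0 => //; exact: ltW.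
  have em : 0 <= eta * M by rewrite mulr_ge0 // ltW.
  have a1 := sqr_ge0 (v t - v' t); have a2 := sqr_ge0 (w t - w' t).
  move=> h; split.
    rewrite -ler_sqr ?nnegrE // real_normK ?num_real //; apply: le_trans h; by rewrite lerDl.
  rewrite -ler_sqr ?nnegrE // real_normK ?num_real //; apply: le_trans h; by rewrite lerDr.
pose d := `|C T + Sw T| - 2.
have d0 : 0 < d by rewrite subr_gt0.
(* eta is made small enough to keep the trace above 2 and to dominate the error
   of second order. *)
pose P := Mb * Ms * M * T.
have P0 : 0 <= P by rewrite /P; apply: mulr_ge0; [apply: mulr_ge0 => //; apply: mulr_ge0|]; exact: ltW.
have M1 : 0 < 2 * (M + 1) by apply: mulr_gt0 => //; exact: ltr_wpDl.
have P1 : 0 < 2 * (P + 1) by apply: mulr_gt0 => //; exact: ltr_wpDl.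
pose eta := Num.min 1 (Num.min ((d / 2) / (2 * (M + 1))) (Y T / (2 * (P + 1)))).
have eta0 : 0 < eta.
  rewrite !lt_min ltr01 /=; apply/andP; split; [exact: divr_gt0 (divr_gt0 d0 (ltr0n _ 2)) M1|exact: divr_gt0 YT P1].
have eta1 : eta <= 1 by rewrite ge_min lexx.
have etaM : eta * M < d / 2.
  have h : eta <= (d / 2) / (2 * (M + 1)) by rewrite !ge_min lexx ?orbT.
  by rewrite ler_pdivlMr // in h; exact: mul_lt_half h.
have etaP : eta * P < Y T.
  have h : eta <= Y T / (2 * (P + 1)) by rewrite !ge_min lexx ?orbT.
  by rewrite ler_pdivlMr // in h; exact: mul_lt_half h.
have etaI : 0 < eta <= 1 by rewrite eta0.
clearbody eta.
pose z := Num.sqrt (z0 ^+ 2 + eta).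
have z2 : z ^+ 2 = z0 ^+ 2 + eta.
  by rewrite sqr_sqrtr // addr_ge0 ?sqr_ge0 // ltW.
have [C' [Cw' [mC' C'0 Cw'0]]] := mode_exists n' bd b0 z 1 0.
have [S' [Sw' [mS' S'0 Sw'0]]] := mode_exists n' bd b0 z 0 1.
have TT : 0 <= T <= T by rewrite lexx ltW.
have closeC := close eta etaI C' Cw' C Cw mC' mC.
have closeS := close eta etaI S' Sw' S Sw mS' mS.
rewrite C'0 Cw'0 C0 Cw0 in closeC; rewrite S'0 Sw'0 S0 Sw0 in closeS.
have {}closeC : forall t, 0 <= t <= T -> `|C' t - C t| <= eta * M /\ `|Cw' t - Cw t| <= eta * M.
  by apply: closeC => // t /McP /le_trans; apply; rewrite lerDl ltW.
have {}closeS : forall t, 0 <= t <= T -> `|S' t - S t| <= eta * M /\ `|Sw' t - Sw t| <= eta * M.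
  by apply: closeS => // t /MsP /le_trans; apply; rewrite lerDr ltW.
exists z, C', Cw', S', Sw'; split => //.
  have [h1 _] := closeC T TT; have [_ h2] := closeS T TT.
  have h3 : `|C T + Sw T| <= `|C' T + Sw' T| + (`|C' T - C T| + `|Sw' T - Sw T|).
    rewrite (_ : C T + Sw T = (C' T + Sw' T) - ((C' T - C T) + (Sw' T - Sw T))); last by ring.
    apply: (le_trans (ler_normB _ _)); rewrite lerD2l; exact: ler_normD.
  move: etaM h1 h2 h3; rewrite /d.
  move: (eta * M) `|C T + Sw T| `|C' T + Sw' T| `|C' T - C T| `|Sw' T - Sw T| => x1 x2 x3 x4 x5; lra.
apply/negP => /eqP S'T.
(* D is the Wronskian of the two modes, corrected to first order. *)
pose D t := Sw' t * S t - Sw t * S' t + eta * Y t.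
have Dd (t : R) : is_derive t 1 D (eta * (be t * (S t * (S t - S' t)))).
  have [e1 e2] := mS t; have [e3 e4] := mS' t; have e5 := Yd t.
  apply: is_derive_eq (isd_add (isd_sub (isd_mul e4 e1) (isd_mul e2 e3)) (isd_mul (isd_cst t 1 eta) e5)) _.
  by rewrite z2; ring.
have := @deriv_norm_le R D _ 0 T (eta * (Mb * (Ms * (eta * M)))) (ltW T0) (fun t _ => Dd t).
rewrite /D S'T ST S0 S'0 {1 2}/Y integral_from00 !mulr0 !subr0 !add0r subr0 => H.
have : `|eta * Y T| <= eta * (Mb * (Ms * (eta * M))) * T.
  apply: H => t tT; have [h1 _] := closeS t tT.
  rewrite normrM (gtr0_norm eta0) ler_pM2l // normrM ler_pM ?MbP // normrM ler_pM ?MsP //.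
  by rewrite distrC.
rewrite normrM (gtr0_norm eta0) (gtr0_norm YT) -mulrA ler_pM2l //.
rewrite leNgt => /negP; apply.
by rewrite (_ : Mb * (Ms * (eta * M)) * T = eta * P) // /P; ring.
Qed.

(** Take k = (n+1) j. By the Bernoulli inequality mu^k >= (1 + j d)^(n+1) with d
    = mu - 1, which has one more factor of order j than the left-hand side. *)
Lemma exp_beats_poly (mu c K : R) (n : nat) : 1 < mu -> 0 < c ->
  exists k, K * (1 + k.+1%:R * T) ^+ n <= (mu ^+ k * c) ^+ 2.
Proof.
move=> mu1 c0; pose d := mu - 1.
have d0 : 0 < d by rewrite subr_gt0.
pose A := 1 + T + n.+1%:R * T / d.
have A0 : 0 < A by rewrite !addr_gt0 // divr_gt0 // mulr_gt0.
have c2d : 0 < c ^+ 2 * d by rewrite mulr_gt0 // exprn_gt0.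
pose j := Num.bound (`|K| * A ^+ n / (c ^+ 2 * d)).
have jP : `|K| * A ^+ n <= c ^+ 2 * (1 + j%:R * d).
  have : `|K| * A ^+ n / (c ^+ 2 * d) <= j%:R.
    apply: ltW; apply: le_lt_trans (archi_boundP _); first by [].
    by rewrite divr_ge0 ?mulr_ge0 ?exprn_ge0 ?(ltW A0) // ltW.
  rewrite ler_pdivrMr // => h; apply: (le_trans h).
  rewrite (_ : c ^+ 2 * (1 + _) = j%:R * (c ^+ 2 * d) + c ^+ 2); last by ring.
  by rewrite lerDl sqr_ge0.
have bern : 1 + j%:R * d <= mu ^+ j.
  elim: (j) => [|i IH]; first by rewrite mul0r addr0 expr0.
  rewrite exprS (_ : mu = 1 + d); last by rewrite /d addrC subrK.
  apply: (@le_trans _ _ ((1 + d) * (1 + i%:R * d))).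
    rewrite (_ : (1 + d) * _ = 1 + i.+1%:R * d + d * (i%:R * d)); last by rewrite -natr1; ring.
    by rewrite lerDl; apply: mulr_ge0; [exact: ltW|apply: mulr_ge0; [|exact: ltW]].
  rewrite ler_pM2l; last by rewrite addr_gt0.
  by rewrite (_ : 1 + d = mu) // /d addrC subrK.
have B0 : 1 <= 1 + j%:R * d by rewrite lerDl mulr_ge0 // ltW.
exists (n.+1 * j)%N.
have le1 : 1 + (n.+1 * j).+1%:R * T <= A * (1 + j%:R * d).
  rewrite (_ : A * _ = 1 + T + n.+1%:R * j%:R * T + n.+1%:R * T / d + (1 + T) * (j%:R * d)); last first.
    by rewrite /A; field; rewrite gt_eqF.
  rewrite -natr1 natrM.
  have : 0 <= n.+1%:R * T / d by rewrite divr_ge0 ?mulr_ge0 // ltW.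
  have : 0 <= (1 + T) * (j%:R * d) by apply: mulr_ge0; [exact: addr_ge0 ler01 (ltW T0)|exact: mulr_ge0 (ler0n _ _) (ltW d0)].
  move: (n.+1%:R * T / d) ((1 + T) * (j%:R * d)) => x y; clear; lra.
apply: (@le_trans _ _ (`|K| * (A * (1 + j%:R * d)) ^+ n)).
  apply: (@le_trans _ _ (`|K| * (1 + (n.+1 * j).+1%:R * T) ^+ n)).
    rewrite ler_wpM2r ?ler_norm // exprn_ge0 // addr_ge0 // mulr_ge0 // ltW //.
  rewrite ler_wpM2l // lerXn2r ?nnegrE // ?(le_trans _ le1) // addr_ge0 // mulr_ge0 // ltW //.
rewrite exprMn mulrA.
apply: (@le_trans _ _ (c ^+ 2 * (1 + j%:R * d) ^+ n.+1)).
  by rewrite [_ ^+ n.+1]exprS mulrA; apply: ler_wpM2r => //; apply: exprn_ge0; exact: le_trans ler01 B0.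
rewrite exprMn mulrC ler_wpM2r ?exprn_ge0 ?(ltW c0) //.
rewrite mulnC exprM -[X in _ <= X]exprM.
apply: (@le_trans _ _ ((mu ^+ j) ^+ n.+1)).
  by rewrite lerXn2r ?nnegrE // ?(le_trans ler01) // (le_trans B0).
by apply: ler_weXn2l; [exact: le_trans B0 bern|rewrite leq_pmulr].
Qed.

(** For n = 1 Cauchy-Schwarz is an equality and gives no instability, but then S
    = \int b is a mode at z = 0 and S^2 is of order t^2, which beats t. For n >=
    2 the trace inequality contradicts strict Cauchy-Schwarz unless some
    frequency is unstable. *)
Lemma superdiffusive_mode : (exists t1 t2, b t1 != b t2) ->
  exists z S Sw, [/\ mode z S Sw, S 0 = 0, Sw 0 = 1 &
    forall K, exists2 t, 0 <= t & K * (1 + t) ^+ n'.+1 <= S t ^+ 2].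
Proof.
move=> nonconst; have [n0|n0] := posnP n'.
  have cb : continuous b by exact: deriv_continuous bd.
  have cbV : continuous (fun t => (b t)^-1).
    have H (t : R) := isd_inv (lt0r_neq0 (b0 t)) (bd t).
    exact: deriv_continuous H.
  have bVT t : (b (t + T))^-1 = (b t)^-1 by rewrite bT.
  have [M M0 MP] := periodic_bounded T0 bVT cbV.
  have bM t : M^-1 <= b t.
    have := MP t; rewrite gtr0_norm ?invr_gt0 // => h.
    by rewrite -[b t]invrK lef_pV2 // posrE ?invr_gt0.
  have Xd (t : R) : is_derive t 1 (integral_from0 b) (b t) by exact: integral_from0_is_derive.
  exists 0, (integral_from0 b), (fun=> 1); split => //.
  - move=> t; split.
      by apply: is_derive_eq (Xd t) _; rewrite /alpha n0 expr1 mulr1.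
    by apply: is_derive_eq (isd_cst _ _ _) _; rewrite expr0n /= oppr0 !mul0r.
  - exact: integral_from00.
  move=> K; pose t := Num.max 1 (2 * `|K| * M ^+ 2).
  have t1 : 1 <= t by rewrite le_max lexx.
  have tK : 2 * `|K| * M ^+ 2 <= t by rewrite le_max lexx orbT.
  have t0 : 0 <= t := le_trans ler01 t1.
  exists t => //.
  have XM : M^-1 * t <= integral_from0 b t.
    have := @deriv_ge0_le R (fun s => integral_from0 b s - M^-1 * s) (fun s => b s - M^-1) 0 t t0.
    rewrite integral_from00 mulr0 subrr subr_ge0; apply.
      by move=> s _; have e1 := Xd s; isder; ring.
    by move=> s _; rewrite subr_ge0.
  apply: (@le_trans _ _ ((M^-1 * t) ^+ 2)); last first.
    by rewrite lerXn2r ?nnegrE // ?(le_trans _ XM) // mulr_ge0 // invr_ge0 ltW.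
  rewrite n0 expr1 exprMn exprVn -[X in X <= _]mul1r -[X in X * _ <= _](mulVf (_ : M ^+ 2 != 0)); last first.
    by rewrite expf_neq0 // gt_eqF.
  rewrite -mulrA ler_wpM2l ?invr_ge0 ?sqr_ge0 // expr2.
  apply: (@le_trans _ _ (M ^+ 2 * (`|K| * (2 * t)))).
    rewrite ler_wpM2l ?sqr_ge0 //; apply: (@le_trans _ _ (`|K| * (1 + t))).
      by rewrite ler_wpM2r ?ler_norm // addr_ge0.
    by rewrite ler_wpM2l //; lra.
  rewrite (_ : _ * (_ * _) = 2 * `|K| * M ^+ 2 * t); last by ring.
  by rewrite ler_wpM2r.
have unst : exists z C Cw S Sw, [/\ mode z C Cw, mode z S Sw,
    [/\ C 0 = 1, Cw 0 = 0, S 0 = 0 & Sw 0 = 1] & 2 < `|C T + Sw T|].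
  apply: contrapT => H.
  have := cauchy_schwarz_strict bd b0 T0 bT n0 nonconst.
  rewrite ltNge => /negP; apply.
  apply: (borg_trace bd cdb b0 T0) => z v w v' w' mv mv' h1 h2 h3 h4.
  rewrite leNgt; apply/negP => h; apply: H.
  by exists z, v, w, v', w'.
have [z [C [Cw [S [Sw [mC mS [C0 Cw0 S0 Sw0] D2 ST]]]]]] : exists z C Cw S Sw,
    [/\ mode z C Cw, mode z S Sw, [/\ C 0 = 1, Cw 0 = 0, S 0 = 0 & Sw 0 = 1],
    2 < `|C T + Sw T| & S T != 0].
  case: unst => z [C [Cw [S [Sw [mC mS [C0 Cw0 S0 Sw0] D2]]]]].
  have [ST|ST] := eqVneq (S T) 0; first exact: mode_perturb mC mS C0 Cw0 S0 Sw0 D2 ST.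
  by exists z, C, Cw, S, Sw.
exists z, S, Sw; split => // K.
have qT t : - z ^+ 2 * be (t + T) = - z ^+ 2 * be t by rewrite beta_per.
have [mu mu1 grow] := floquet_growth cal (@cont_q _ _ _ _ bd b0 z) T0 (alpha_per n' bT) qT mC mS C0 Cw0 S0 Sw0 D2 ST.
have ST0 : 0 < `|S T| by rewrite normr_gt0.
have [k kP] := exp_beats_poly K n'.+1 mu1 ST0.
exists (k.+1%:R * T); first by rewrite mulr_ge0 // ltW.
apply: (le_trans kP); rewrite -[X in _ <= X]real_normK ?num_real //.
by rewrite lerXn2r ?nnegrE // mulr_ge0 // exprn_ge0 // ltW // (lt_trans ltr01).
Qed.

End growth.

(** * Integrals over a symmetric segment *)

Section matrix_limits.
Variable R : realType.

Lemma cvg_mx_entries (T : Type) (F : set_system T) (m n : nat) (f : T -> 'M[R]_(m, n)) (l : 'M[R]_(m, n)) :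
  Filter F -> (forall i j, f x i j @[x --> F] --> l i j) -> f x @[x --> F] --> l.
Proof.
move=> FF H A [P /= Pn PA].
have : \forall x \near F, forall i j, P i j (f x i j).
  apply: filter_forall => i; apply: filter_forall => j.
  by apply: H; exact: Pn.
by apply: filterS => x Px; exact: PA.
Qed.

Lemma cvg_entry (T : Type) (F : set_system T) (m n : nat) (f : T -> 'M[R]_(m, n)) (l : 'M[R]_(m, n)) i j :
  Filter F -> f x @[x --> F] --> l -> f x i j @[x --> F] --> l i j.
Proof.
move=> FF H; apply: (@cvg_comp _ _ _ f (fun M : 'M[R]_(m, n) => M i j)); first exact: H.
exact: coord_continuous.
Qed.

Lemma cvg_cons (T : Type) (F : set_system T) (n : nat) (f : T -> R) (g : T -> 'rV[R]_n) (a : R) (v : 'rV[R]_n) :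
  Filter F -> f x @[x --> F] --> a -> g x @[x --> F] --> v ->
  (row_mx (f x)%:M (g x) : 'rV[R]_(1 + n)) @[x --> F] --> (row_mx a%:M v : 'rV[R]_(1 + n)).
Proof.
move=> FF fa gv; apply: cvg_mx_entries => i j.
have E y w : (row_mx y%:M w : 'rV[R]_(1 + n)) i j = match fintype.split j with inl _ => y | inr k => w i k end.
  by rewrite mxE; case: (fintype.split j) => k //; rewrite mxE !ord1 mulr1n.
rewrite E; under eq_fun do rewrite E.
case: (fintype.split j) => k //; exact: cvg_entry.
Qed.

End matrix_limits.

Section segment_integral.
Variables (R : realType) (r : R).
Hypothesis r0 : 0 < r.

(** Written with a primitive instead of a Lebesgue integral: continuity and
    differentiation under the integral sign then follow from elementary
    estimates. *)
Definition int1 (f : R -> R) := integral_from0 f r - integral_from0 f (- r).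

Let rr : - r <= r. Proof. by have := r0; lra. Qed.

Lemma int1_primitive (f F : R -> R) : continuous f ->
  (forall t : R, is_derive t 1 F (f t)) -> int1 f = F r - F (- r).
Proof.
move=> cf Fd.
have dd (t : R) : is_derive t 1 (fun t => integral_from0 f t - F t) 0.
  by apply: is_derive_eq (isd_sub (integral_from0_is_derive t cf) (Fd t)) _; rewrite subrr.
have := is_derive_0_is_cst r (- r) dd.
rewrite /int1 => h; apply/eqP; rewrite -subr_eq0; apply/eqP.
by move: h; move: (integral_from0 f r) (integral_from0 f (- r)) => x y; lra.
Qed.

Lemma int1_add (f g : R -> R) : continuous f -> continuous g ->
  int1 (fun t => f t + g t) = int1 f + int1 g.
Proof.
move=> cf cg.
have dd (t : R) := isd_add (integral_from0_is_derive t cf) (integral_from0_is_derive t cg).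
rewrite (int1_primitive _ dd) /int1; first by ring.
by move=> t; apply: cvgD; [exact: cf|exact: cg].
Qed.

Lemma int1_scale (c : R) (f : R -> R) : continuous f -> int1 (fun t => c * f t) = c * int1 f.
Proof.
move=> cf.
have dd (t : R) : is_derive t 1 (fun t => c * integral_from0 f t) (c * f t).
  by have e := integral_from0_is_derive t cf; isder; ring.
rewrite (int1_primitive _ dd) /int1; first by ring.
by move=> t; apply: cvgM; [exact: cvg_cst|exact: cf].
Qed.

Lemma int1_le (f g : R -> R) : continuous f -> continuous g ->
  (forall t, `|t| <= r -> f t <= g t) -> int1 f <= int1 g.
Proof.
move=> cf cg fg.
have dd (t : R) := isd_sub (integral_from0_is_derive t cg) (integral_from0_is_derive t cf).
suff : integral_from0 g (- r) - integral_from0 f (- r) <= integral_from0 g r - integral_from0 f r.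
  rewrite /int1; lra.
by apply: (@deriv_ge0_le R _ _ (- r) r rr (fun t _ => dd t)) => t tr; rewrite subr_ge0 fg // ler_norml.
Qed.

Lemma int1_norm_le (f : R -> R) (e : R) : continuous f ->
  (forall t, `|t| <= r -> `|f t| <= e) -> `|int1 f| <= e * (2 * r).
Proof.
move=> cf fe.
have I1 (c : R) : int1 (fun=> c) = c * (2 * r).
  have dd (t : R) : is_derive t 1 (fun t : R => c * t) c by isder; ring.
  rewrite (int1_primitive _ dd); first by ring.
  exact: cst_continuous.
rewrite ler_norml -mulNr -!I1 !int1_le //; try exact: cst_continuous.
  by move=> t /fe; rewrite ler_norml => /andP[].
by move=> t /fe; rewrite ler_norml => /andP[].
Qed.

Lemma int1_eq0 (f : R -> R) : continuous f -> (forall t, 0 <= f t) -> int1 f <= 0 ->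
  forall t, `|t| < r -> f t = 0.
Proof.
move=> cf f0 I0 t; rewrite ltr_norml => tr.
have rr' : - r < r by have := r0; lra.
apply: (flat_derivative rr' (fun t => integral_from0_is_derive t cf) f0 _ tr).
by move: I0; rewrite /int1 subr_le0.
Qed.

(** Tube lemma for the compact segment. *)
Lemma uniform_near (X : topologicalType) (H : X -> R -> R) (s0 : X) (e : R) : 0 < e ->
  (forall t, {for (s0, t), continuous (fun p : X * R => H p.1 p.2)}) ->
  \forall s \near s0, forall t, `|t| <= r -> `|H s t - H s0 t| <= e.
Proof.
move=> e0 cH.
have K : compact `[- r, r] by exact: segment_compact.
have := (compact_near_coveringP _).1 K X (nbhs s0) (fun s t => `|H s t - H s0 t| <= e) _.
move=> /(_ _) h; have {}h : \forall s \near s0, `[-r, r] `<=` [set t | `|H s t - H s0 t| <= e].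
  apply: h => t _.
  have e20 : 0 < e / 2 by rewrite divr_gt0.
  have /cvgrPdist_le /(_ _ e20) [[A B] /= [A1 B1] AB] := cH t.
  exists (B, A) => // -[u s] [/= Bu As].
  have h1 : `|H s0 t - H s u| <= e / 2 by apply: (AB (s, u)).
  have h2 : `|H s0 t - H s0 u| <= e / 2.
    by apply: (AB (s0, u)); split => //=; exact: nbhs_singleton.
  rewrite (_ : H s u - H s0 u = (H s0 t - H s0 u) - (H s0 t - H s u)); last by ring.
  by apply: (le_trans (ler_normB _ _)); rewrite [e in X in _ <= X]splitr lerD.
by apply: filterS h => s h t; rewrite ler_norml => tr; apply: h; rewrite /= in_itv.
Qed.

Lemma int1_continuous (X : topologicalType) (H : X -> R -> R) (s0 : X) :
  (\forall s \near s0, continuous (H s)) ->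
  (forall t, {for (s0, t), continuous (fun p : X * R => H p.1 p.2)}) ->
  {for s0, continuous (fun s => int1 (H s))}.
Proof.
move=> cHs cH; apply/cvgrPdist_le => e e0.
have e1 : 0 < e / (2 * r) by rewrite divr_gt0 // mulr_gt0.
have c0 := nbhs_singleton cHs.
have U := uniform_near e1 cH.
near=> s.
have cs : continuous (H s) by near: s.
have us : forall t, `|t| <= r -> `|H s t - H s0 t| <= e / (2 * r) by near: s.
have cd : continuous (fun t => H s t - H s0 t).
  by move=> t; apply: cvgB; [exact: cs|exact: c0].
have -> : int1 (H s0) - int1 (H s) = - int1 (fun t => H s t - H s0 t).
  have -> : (fun t => H s t - H s0 t) = (fun t => H s t + (-1) * H s0 t).
    by apply: funext => t; rewrite mulN1r.
  rewrite int1_add // ?int1_scale //; first by ring.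
  by move=> t; apply: cvgM; [exact: cvg_cst|exact: c0].
rewrite normrN; apply: (le_trans (int1_norm_le cd us)).
by rewrite divfK // gt_eqF // mulr_gt0.
Unshelve. all: by end_near. Qed.

(** Differentiation under the integral sign; by the mean value theorem the
    difference quotient of H is a value of G nearby, and G is close to its value
    at s0 uniformly in t. *)
Lemma int1_is_derive (H G : R -> R -> R) (s0 : R) :
  (\forall s \near s0, continuous (H s)) -> (\forall s \near s0, continuous (G s)) ->
  (\forall s \near s0, forall t, is_derive s (1 : R) (H^~ t) (G s t)) ->
  (forall t, {for (s0, t), continuous (fun p : R * R => G p.1 p.2)}) ->
  is_derive s0 (1 : R) (fun s => int1 (H s)) (int1 (G s0)).
Proof.
move=> cHs cGs dH cG.
have cH0 := nbhs_singleton cHs; have cG0 := nbhs_singleton cGs.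
suff L : (fun h : R => h^-1 *: (int1 (H (h + s0)) - int1 (H s0))) @ 0^' --> int1 (G s0).
  have E : (fun h : R => h^-1 *: (((fun s => int1 (H s)) \o shift s0) (h *: (1:R^o)) - int1 (H s0))) =
           (fun h : R => h^-1 *: (int1 (H (h + s0)) - int1 (H s0))).
    by apply: funext => h /=; rewrite [_%:A]mulr1.
  apply: DeriveDef; first by rewrite /derivable E; apply/cvg_ex; exists (int1 (G s0)).
  by rewrite /derive E; apply/cvg_lim.
apply/cvgrPdist_le => e e0.
have e1 : 0 < e / (2 * r) by rewrite divr_gt0 // mulr_gt0.
have U := uniform_near e1 cG.
have [d /= d0 Hd] : exists2 d : R, 0 < d & forall s, `|s - s0| < d ->
    continuous (H s) /\ (forall t, is_derive s (1:R) (H^~ t) (G s t)) /\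
    forall t, `|t| <= r -> `|G s t - G s0 t| <= e / (2 * r).
  have : \forall s \near s0, continuous (H s) /\ (forall t, is_derive s (1:R) (H^~ t) (G s t)) /\
    forall t, `|t| <= r -> `|G s t - G s0 t| <= e / (2 * r).
    by near=> s; split; [near: s|split; near: s].
  move=> /nbhs_ballP[d /= d0 Hd]; exists d => // s sd; apply: Hd.
  by rewrite /ball /= distrC.
near=> h.
have h0 : h != 0 by near: h; exact: nbhs_dnbhs_neq.
have hd : `|h| < d by near: h; exact: dnbhs0_lt.
have [cH _] := Hd (h + s0) ltac:(by rewrite addrK).
pose D t := H (h + s0) t - H s0 t - h * G s0 t.
have cD : continuous D.
  move=> t; apply: cvgB; first by apply: cvgB; [exact: cH|exact: cH0].
  by apply: cvgM; [exact: cvg_cst|exact: cG0].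
have DE : int1 D = int1 (H (h + s0)) - int1 (H s0) - h * int1 (G s0).
  have -> : D = (fun t => (H (h + s0) t + (-1) * H s0 t) + (- h) * G s0 t).
    by apply: funext => t; rewrite /D; ring.
  have c1 : continuous (fun t => -1 * H s0 t).
    by move=> t; apply: cvgM; [exact: cvg_cst|exact: cH0].
  have c2 : continuous (fun t => - h * G s0 t).
    by move=> t; apply: cvgM; [exact: cvg_cst|exact: cG0].
  have c3 : continuous (fun t => H (h + s0) t + -1 * H s0 t).
    by move=> t; apply: cvgD; [exact: cH|exact: c1].
  by rewrite !int1_add // !int1_scale //; ring.
have DB t : `|t| <= r -> `|D t| <= (e / (2 * r)) * `|h|.
  move=> tr.
  have := @deriv_norm_le_abs R (fun s => H s t - G s0 t * s) (fun s => G s t - G s0 t) s0 (h + s0) (e / (2 * r)).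
  rewrite addrK (_ : H (h + s0) t - G s0 t * (h + s0) - (H s0 t - G s0 t * s0) = D t); last by rewrite /D; ring.
  apply=> s sh; have sd : `|s - s0| < d by exact: le_lt_trans hd.
    by have [_ [h1 _]] := Hd s sd; have e2 := h1 t; isder; ring.
  by have [_ [_ h2]] := Hd s sd; exact: h2.
have := int1_norm_le cD DB; rewrite DE => B.
have -> : int1 (G s0) - h^-1 *: (int1 (H (h + s0)) - int1 (H s0)) =
  - (h^-1 * (int1 (H (h + s0)) - int1 (H s0) - h * int1 (G s0))).
  by rewrite /GRing.scale /=; field.
rewrite normrN normrM normfV ler_pdivrMl ?normr_gt0 //.
apply: (le_trans B); rewrite mulrAC divfK; last by rewrite gt_eqF // mulr_gt0.
by rewrite mulrC.
Unshelve. all: by end_near. Qed.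

End segment_integral.

(** * Iterated integrals over a cube *)

Lemma cont_pair (X U V : topologicalType) (f : X -> U) (g : X -> V) (s : X) :
  {for s, continuous f} -> {for s, continuous g} -> {for s, continuous (fun x => (f x, g x))}.
Proof.
move=> cf cg A [[B C] /= [fB gC] BC].
have H : nbhs s (f @^-1` B `&` g @^-1` C) by apply: filterI; [exact: cf|exact: cg].
by apply: (filterS _ H) => x [h1 h2]; apply: BC.
Qed.

Section box_integral.
Variables (R : realType) (r : R).
Hypothesis r0 : 0 < r.

Fixpoint boxint (n : nat) : ('rV[R]_n -> R) -> R :=
  match n with
  | 0 => fun F => F 0
  | n'.+1 => fun F => int1 r (fun t => boxint (fun x : 'rV[R]_n' => F (row_mx (t%:M : 'rV[R]_1) x)))
  end.

Lemma boxint_continuous (n : nat) (X : topologicalType) (O : set X) (F : X -> 'rV[R]_n -> R) :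
  open O ->
  (forall s x, O s -> {for (s, x), continuous (fun p : X * 'rV[R]_n => F p.1 p.2)}) ->
  forall s, O s -> {for s, continuous (fun s => boxint (F s))}.
Proof.
elim: n X O F => [|n IH] X O F oO cF s Os.
  apply: (@continuous_comp _ _ _ (fun s : X => (s, 0 : 'rV[R]_0)) (fun p => F p.1 p.2)); last exact: cF.
  by apply: cont_pair; [exact: cvg_id|exact: cst_continuous].
have cH u t : O u -> {for (u, t), continuous (fun p : X * R =>
    boxint (fun x => F p.1 (row_mx (p.2%:M : 'rV[R]_1) x)))}.
  move=> Ou; apply: (IH (X * R)%type (fst @^-1` O) (fun p x => F p.1 (row_mx (p.2%:M : 'rV[R]_1) x))) => //.
    by apply: open_comp => // p _; exact: cvg_fst.
  move=> [u' t'] x /= Ou'.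
  apply: (@continuous_comp _ _ _ (fun q : (X * R) * 'rV[R]_n => (q.1.1, (row_mx (q.1.2%:M : 'rV[R]_1) q.2 : 'rV[R]_n.+1))) (fun p => F p.1 p.2)); last exact: cF.
  apply: cont_pair.
    by apply: (@cvg_comp _ _ _ fst fst); [exact: cvg_fst|exact: cvg_fst].
  apply: (@cvg_cons R _ _ n (fun q : (X * R) * 'rV[R]_n => q.1.2) snd t' x).
    by apply: (@cvg_comp _ _ _ fst snd); [exact: cvg_fst|exact: cvg_snd].
  exact: cvg_snd.
apply: (@int1_continuous R r r0 X (fun u t => boxint (fun x => F u (row_mx (t%:M : 'rV[R]_1) x)))).
  have : \forall u \near s, O u by exact: open_nbhs_nbhs.
  apply: filterS => u Ou t.
  apply: (@continuous_comp _ _ _ (fun t : R => (u, t)) (fun p : X * R => boxint (fun x => F p.1 (row_mx (p.2%:M : 'rV[R]_1) x)))); last exact: cH.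
  by apply: cont_pair; [exact: cst_continuous|exact: cvg_id].
by move=> t; exact: cH.
Qed.

Lemma cons_continuous (n : nat) (t : R) (x : 'rV[R]_n) :
  {for (t, x), continuous (fun p : R * 'rV[R]_n => (row_mx (p.1%:M : 'rV[R]_1) p.2 : 'rV[R]_n.+1))}.
Proof. by apply: (@cvg_cons R _ _ n fst snd t x); [exact: cvg_fst|exact: cvg_snd]. Qed.

Lemma slice_continuous (n : nat) (F : 'rV[R]_n.+1 -> R) : continuous F ->
  forall p, {for p, continuous (fun p : R * 'rV[R]_n => F (row_mx (p.1%:M : 'rV[R]_1) p.2))}.
Proof.
move=> cF [t x].
apply: (@continuous_comp _ _ _ (fun p : R * 'rV[R]_n => (row_mx (p.1%:M : 'rV[R]_1) p.2 : 'rV[R]_n.+1)) F); last exact: cF.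
exact: cons_continuous.
Qed.

Lemma slice1_continuous (n : nat) (F : 'rV[R]_n.+1 -> R) : continuous F ->
  forall t, continuous (fun x : 'rV[R]_n => F (row_mx (t%:M : 'rV[R]_1) x)).
Proof.
move=> cF t x.
apply: (@continuous_comp _ _ _ (fun x : 'rV[R]_n => (cst t x, id x)) (fun p : R * 'rV[R]_n => F (row_mx (p.1%:M : 'rV[R]_1) p.2))); last exact: slice_continuous.
by apply: cont_pair; [exact: cst_continuous|exact: cvg_id].
Qed.

Lemma inner_continuous (n : nat) (F : 'rV[R]_n.+1 -> R) : continuous F ->
  continuous (fun t : R => boxint (fun x : 'rV[R]_n => F (row_mx (t%:M : 'rV[R]_1) x))).
Proof.
move=> cF t; apply: (@boxint_continuous n R setT (fun t x => F (row_mx (t%:M : 'rV[R]_1) x))) => //.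
  exact: openT.
by move=> s x _; exact: slice_continuous.
Qed.

Lemma boxint_is_derive (n : nat) (O : set R) (F G : R -> 'rV[R]_n -> R) : open O ->
  (forall s x, O s -> {for (s, x), continuous (fun p : R * 'rV[R]_n => F p.1 p.2)}) ->
  (forall s x, O s -> {for (s, x), continuous (fun p : R * 'rV[R]_n => G p.1 p.2)}) ->
  (forall (s : R) x, O s -> is_derive s (1 : R) (F^~ x) (G s x)) ->
  forall s : R, O s -> is_derive s (1 : R) (fun s => boxint (F s)) (boxint (G s)).
Proof.
move=> oO; elim: n F G => [|n IH] F G cF cG dF s Os; first exact: dF.
have c2 (H : R -> 'rV[R]_n.+1 -> R) : (forall s x, O s -> {for (s, x), continuous (fun p : R * 'rV[R]_n.+1 => H p.1 p.2)}) ->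
   forall u t, O u -> {for (u, t), continuous (fun p : R * R =>
    boxint (fun x => H p.1 (row_mx (p.2%:M : 'rV[R]_1) x)))}.
  move=> cH u t Ou.
  apply: (@boxint_continuous n (R * R)%type (fst @^-1` O) (fun p x => H p.1 (row_mx (p.2%:M : 'rV[R]_1) x))) => //.
    by apply: open_comp => // p _; exact: cvg_fst.
  move=> [u' t'] x /= Ou'.
  apply: (@continuous_comp _ _ _ (fun q : (R * R) * 'rV[R]_n => (q.1.1, (row_mx (q.1.2%:M : 'rV[R]_1) q.2 : 'rV[R]_n.+1))) (fun p => H p.1 p.2)); last exact: cH.
  apply: cont_pair.
    by apply: (@cvg_comp _ _ _ fst fst); [exact: cvg_fst|exact: cvg_fst].
  apply: (@cvg_cons R _ _ n (fun q : (R * R) * 'rV[R]_n => q.1.2) snd t' x).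
    by apply: (@cvg_comp _ _ _ fst snd); [exact: cvg_fst|exact: cvg_snd].
  exact: cvg_snd.
have c1 (H : R -> 'rV[R]_n.+1 -> R) : (forall s x, O s -> {for (s, x), continuous (fun p : R * 'rV[R]_n.+1 => H p.1 p.2)}) ->
   forall u, O u -> continuous (fun t => boxint (fun x => H u (row_mx (t%:M : 'rV[R]_1) x))).
  move=> cH u Ou t.
  apply: (@continuous_comp _ _ _ (fun t : R => (u, t)) (fun p : R * R => boxint (fun x => H p.1 (row_mx (p.2%:M : 'rV[R]_1) x)))); last exact: c2.
  by apply: cont_pair; [exact: cst_continuous|exact: cvg_id].
have nO : \forall u \near s, O u by exact: open_nbhs_nbhs.
have cslice (H : R -> 'rV[R]_n.+1 -> R) : (forall s x, O s -> {for (s, x), continuous (fun p : R * 'rV[R]_n.+1 => H p.1 p.2)}) ->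
   forall t u x, O u -> {for (u, x), continuous (fun p : R * 'rV[R]_n => H p.1 (row_mx (t%:M : 'rV[R]_1) p.2))}.
  move=> cH t u x Ou.
  apply: (@continuous_comp _ _ _ (fun p : R * 'rV[R]_n => (p.1, (row_mx (t%:M : 'rV[R]_1) p.2 : 'rV[R]_n.+1))) (fun p => H p.1 p.2)); last exact: cH.
  apply: cont_pair; first exact: cvg_fst.
  by apply: (@cvg_cons R _ _ n (fun=> t) snd t x); [exact: cvg_cst|exact: cvg_snd].
apply: (@int1_is_derive R r r0 (fun u t => boxint (fun x => F u (row_mx (t%:M : 'rV[R]_1) x)))
   (fun u t => boxint (fun x => G u (row_mx (t%:M : 'rV[R]_1) x)))).
- by apply: filterS nO => u Ou; exact: c1.
- by apply: filterS nO => u Ou; exact: c1.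
- apply: filterS nO => u Ou t.
  apply: (IH (fun u x => F u (row_mx (t%:M : 'rV[R]_1) x)) (fun u x => G u (row_mx (t%:M : 'rV[R]_1) x))) => //.
  + by move=> s' x Os'; exact: cslice.
  + by move=> s' x Os'; exact: cslice.
- by move=> t; exact: c2.
Qed.

Lemma boxint_add (n : nat) (F G : 'rV[R]_n -> R) : continuous F -> continuous G ->
  boxint (fun x => F x + G x) = boxint F + boxint G.
Proof.
elim: n F G => [|n IH] F G cF cG //=.
rewrite -int1_add //; try exact: inner_continuous.
congr int1; apply: funext => t; rewrite -IH //; exact: slice1_continuous.
Qed.

Lemma boxint_scale (n : nat) (c : R) (F : 'rV[R]_n -> R) : continuous F ->
  boxint (fun x => c * F x) = c * boxint F.
Proof.
elim: n F => [|n IH] F cF //=.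
rewrite -int1_scale //; try exact: inner_continuous.
congr int1; apply: funext => t; rewrite -IH //; exact: slice1_continuous.
Qed.

Lemma boxint0 (n : nat) : boxint (fun _ : 'rV[R]_n => 0) = 0.
Proof.
elim: n => [|n IH] //=.
rewrite IH (@int1_primitive R r (fun=> 0) (fun=> 0)) ?subrr //; first exact: cst_continuous.
Qed.

Lemma boxint_le (n : nat) (F G : 'rV[R]_n -> R) : continuous F -> continuous G ->
  (forall x, F x <= G x) -> boxint F <= boxint G.
Proof.
elim: n F G => [|n IH] F G cF cG FG //=.
apply: int1_le => //; try exact: inner_continuous.
by move=> t _; apply: IH => //; exact: slice1_continuous.
Qed.

Lemma boxint_ge0 (n : nat) (F : 'rV[R]_n -> R) : continuous F -> (forall x, 0 <= F x) -> 0 <= boxint F.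
Proof.
by move=> cF F0; rewrite -(@boxint0 n); apply: boxint_le => //; exact: cst_continuous.
Qed.

Lemma row_mx_split (n : nat) (x : 'rV[R]_n.+1) :
  x = row_mx ((x 0 0)%:M : 'rV[R]_1) (rsubmx (x : 'rV[R]_(1 + n))).
Proof.
apply/rowP => i; rewrite mxE; case: fintype.splitP => j ij.
  by rewrite mxE ord1 mulr1n; congr (x _ _); apply: val_inj; rewrite /= ij ord1.
by rewrite mxE; congr (x _ _); apply: val_inj.
Qed.

Lemma cons_lift (n : nat) (t : R) (x : 'rV[R]_n) (j : 'I_n) :
  (row_mx (t%:M : 'rV[R]_1) x : 'rV[R]_n.+1) 0 (lift 0 j) = x 0 j.
Proof.
have -> : lift 0 j = rshift 1 j :> 'I_n.+1 by exact: val_inj.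
exact: (@row_mxEr _ 1 1 n).
Qed.

(** Induction on the dimension: a nonnegative continuous function of one
    variable with integral at most 0 vanishes inside the segment. *)
Lemma boxint_eq0 (n : nat) (F : 'rV[R]_n -> R) : continuous F -> (forall x, 0 <= F x) ->
  boxint F <= 0 -> forall x : 'rV[R]_n, (forall i, `|x 0 i| < r) -> F x = 0.
Proof.
elim: n F => [|n IH] F cF F0 JF x xr.
  by apply/eqP; rewrite eq_le F0 andbT (_ : x = 0) //; apply/rowP => -[].
have J0 t : 0 <= boxint (fun x : 'rV[R]_n => F (row_mx (t%:M : 'rV[R]_1) x)).
  by apply: boxint_ge0 => //; exact: slice1_continuous.
rewrite (row_mx_split x).
apply: (IH (fun y => F (row_mx ((x 0 0)%:M : 'rV[R]_1) y))) => //.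
- exact: slice1_continuous.
- by rewrite (int1_eq0 r0 (inner_continuous cF) J0 JF (xr 0)).
- by move=> i; rewrite mxE; exact: xr.
Qed.

(** In the direction of the derivative the fundamental theorem of calculus
    applies, and the boundary values vanish; the other variables are parameters.
    *)
Lemma boxint_divergence (n : nat) (k : 'I_n) (F G : 'rV[R]_n -> R) : continuous F -> continuous G ->
  (forall x : 'rV[R]_n, is_derive x (delta_mx 0 k) (F : 'rV[R]_n -> R^o) (G x)) ->
  (forall x : 'rV[R]_n, r <= `|x 0 k| -> F x = 0) -> boxint G = 0.
Proof.
elim: n k F G => [[]//|n IH] k F G cF cG dF F0 /=.
case: (unliftP 0 k) => [j|] kE.
  rewrite (_ : (fun t => _) = fun=> 0).
    rewrite (@int1_primitive R r (fun=> 0) (fun=> 0)) ?subrr //; first exact: cst_continuous.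
  apply: funext => t.
  apply: (IH j (fun x => F (row_mx (t%:M : 'rV[R]_1) x))); try exact: slice1_continuous.
    move=> x; apply/is_derive_line.
    have /is_derive_line := dF (row_mx (t%:M : 'rV[R]_1) x).
    congr (is_derive _ _ _ _); apply: funext => h; congr (F _).
    rewrite kE; apply/rowP => i; rewrite !mxE.
    case: fintype.splitP => i' iE.
      rewrite /=; case: eqP => [e|_]; last by rewrite mulr0 add0r.
      by have := congr1 val e; rewrite /= iE ord1.
    rewrite !mxE /=.
    have -> // : (i == lift 0 j) = (i' == j).
    by rewrite -!val_eqE /= iE /bump /= eqSS.
  by move=> x xr; apply: F0; rewrite kE cons_lift.
have dd (t : R) : is_derive t (1 : R) (fun t => boxint (fun x : 'rV[R]_n => F (row_mx (t%:M : 'rV[R]_1) x)))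
   (boxint (fun x : 'rV[R]_n => G (row_mx (t%:M : 'rV[R]_1) x))).
  apply: (@boxint_is_derive n setT (fun t x => F (row_mx (t%:M : 'rV[R]_1) x)) (fun t x => G (row_mx (t%:M : 'rV[R]_1) x))) => //.
  - exact: openT.
  - by move=> s x _; exact: slice_continuous.
  - by move=> s x _; exact: slice_continuous.
  move=> s x _; apply/is_derive_line.
  have /is_derive_line := dF (row_mx (s%:M : 'rV[R]_1) x).
  congr (is_derive _ _ _ _); apply: funext => h; congr (F _).
  rewrite kE; apply/rowP => i; rewrite !mxE.
  case: fintype.splitP => i' iE.
    have -> : i = 0 by apply: val_inj; rewrite /= iE ord1.
    by rewrite !mxE ord1 !mulr1n /GRing.scale /= !mulr1.
  rewrite (_ : (i == 0) = false) ?andbF ?mulr0 ?add0r //.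
  by apply/eqP => e; have := congr1 val e; rewrite /= iE.
rewrite (int1_primitive r (inner_continuous cG) dd).
have z t : `|t| = r -> boxint (fun x : 'rV[R]_n => F (row_mx (t%:M : 'rV[R]_1) x)) = 0.
  move=> tr; rewrite (_ : (fun x => _) = fun=> 0); first exact: boxint0.
  apply: funext => x; apply: F0; rewrite kE mxE; case: fintype.splitP => i' iE.
    by rewrite mxE ord1 mulr1n tr.
  by have := congr1 id iE.
by rewrite !z ?subrr // ?normrN gtr0_norm.
Qed.

End box_integral.

(** * Mixed derivatives and the positive part *)

Section mixed_derivatives.
Variables (R : realType) (V : normedModType R).

Lemma isd_along (f : V -> R^o) (q v : V) (s l : R) :
  is_derive (q + s *: v) v f l -> is_derive (s : R) (1 : R) (fun s : R => f (q + s *: v)) l.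
Proof.
move=> /is_derive_line H; apply/is_derive_line.
apply: isd_ext H => h /=; congr f.
by rewrite [h%:A]mulr1 scalerDl addrC -addrA [_ *: v + _]addrC.
Qed.

(** Both mixed derivatives are limits of the same second difference quotient, by
    the mean value theorem applied in the two orders. *)
Lemma mixed_derivatives (f fv fw fvw fwv : V -> R^o) (v w p : V) :
  (\forall q \near p, is_derive q v f (fv q)) -> (\forall q \near p, is_derive q w f (fw q)) ->
  (\forall q \near p, is_derive q w fv (fvw q)) -> (\forall q \near p, is_derive q v fw (fwv q)) ->
  {for p, continuous fvw} -> {for p, continuous fwv} -> fvw p = fwv p.
Proof.
move=> dv dw dvw dwv cvw cwv; apply/eqP; rewrite -subr_eq0 -normr_eq0 eq_le normr_ge0 andbT.
apply/ler_addgt0Pr => e e0; rewrite add0r.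
have e20 : 0 < e / 2 by rewrite divr_gt0.
have [d d0 H] : exists2 d : R, 0 < d & forall q, `|q - p| < d ->
   [/\ is_derive q v f (fv q), is_derive q w f (fw q), is_derive q w fv (fvw q) &
       is_derive q v fw (fwv q)] /\ `|fvw p - fvw q| <= e / 2 /\ `|fwv p - fwv q| <= e / 2.
  move/cvgrPdist_le: cvw => /(_ _ e20) h1; move/cvgrPdist_le: cwv => /(_ _ e20) h2.
  have : \forall q \near p, [/\ is_derive q v f (fv q), is_derive q w f (fw q), is_derive q w fv (fvw q) &
       is_derive q v fw (fwv q)] /\ `|fvw p - fvw q| <= e / 2 /\ `|fwv p - fwv q| <= e / 2.
    near=> q; split; first by split; near: q.
    by split; near: q.
  move=> /nbhs_ballP[d /= d0 Hd]; exists d => // q qd; apply: Hd.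
  by rewrite -ball_normE /ball_ /= distrC.
pose h := d / (2 * (`|v| + `|w| + 1)).
have vw0 : 0 < `|v| + `|w| + 1 by rewrite ltr_wpDl // addr_ge0.
have h0 : 0 < h by rewrite divr_gt0 // mulr_gt0.
have inb s t : 0 <= s <= h -> 0 <= t <= h -> `|p + s *: v + t *: w - p| < d.
  move=> /andP[s0 sh] /andP[t0 th].
  rewrite (_ : _ - p = s *: v + t *: w); last by rewrite addrAC [p + _]addrC addrK.
  apply: (le_lt_trans (ler_normD _ _)); rewrite !normrZ !ger0_norm //.
  apply: (@le_lt_trans _ _ (h * (`|v| + `|w| + 1))).
    rewrite !mulrDr mulr1 -[X in X <= _]addr0; apply: lerD; last exact: ltW.
    by apply: lerD; apply: ler_wpM2r.
  rewrite /h invfM mulrA divfK ?gt_eqF // ltr_pdivrMr //; lra.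
have hh : 0 <= h <= h by rewrite lexx ltW.
have zh : (0 : R) <= 0 <= h by rewrite lexx ltW.
have swap (a c : R) : p + a *: v + c *: w = p + c *: w + a *: v by rewrite addrAC.
(* The second difference quotient, evaluated in both orders. *)
have [s1 s1h E1] : exists2 s, 0 <= s <= h &
    (f (p + h *: v + h *: w) - f (p + h *: v)) - (f (p + 0 *: v + h *: w) - f (p + 0 *: v)) =
    (fv (p + s *: v + h *: w) - fv (p + s *: v)) * (h - 0).
  apply: (@mvt R (fun s => f (p + s *: v + h *: w) - f (p + s *: v))
    (fun s => fv (p + s *: v + h *: w) - fv (p + s *: v)) 0 h (ltW h0)) => s sh.
  apply: isd_sub.
    apply: (@isd_ext R R^o _ _ (fun y : R => f (p + h *: w + y *: v)) _ _ (fun y => f_equal f (esym (swap y h)))).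
    by apply: isd_along; rewrite -swap; have [[? _ _ _] _] := H _ (inb s h sh hh).
  apply: isd_along; have [[+ _ _ _] _] := H _ (inb s 0 sh zh).
  by rewrite scale0r addr0.
have [t1 t1h E2] : exists2 t, 0 <= t <= h &
    fv (p + s1 *: v + h *: w) - fv (p + s1 *: v + 0 *: w) = fvw (p + s1 *: v + t *: w) * (h - 0).
  apply: (@mvt R (fun t => fv (p + s1 *: v + t *: w)) (fun t => fvw (p + s1 *: v + t *: w)) 0 h (ltW h0)) => t th.
  by apply: isd_along; have [[_ _ ? _] _] := H _ (inb s1 t s1h th).
have [t2 t2h E3] : exists2 t, 0 <= t <= h &
    (f (p + h *: v + h *: w) - f (p + h *: w)) - (f (p + h *: v + 0 *: w) - f (p + 0 *: w)) =
    (fw (p + h *: v + t *: w) - fw (p + t *: w)) * (h - 0).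
  apply: (@mvt R (fun t => f (p + h *: v + t *: w) - f (p + t *: w))
    (fun t => fw (p + h *: v + t *: w) - fw (p + t *: w)) 0 h (ltW h0)) => t th.
  apply: isd_sub.
    by apply: isd_along; have [[_ ? _ _] _] := H _ (inb h t hh th).
  apply: isd_along; have [[_ + _ _] _] := H _ (inb 0 t zh th).
  by rewrite scale0r addr0.
have [s2 s2h E4] : exists2 s, 0 <= s <= h &
    fw (p + h *: v + t2 *: w) - fw (p + 0 *: v + t2 *: w) = fwv (p + s *: v + t2 *: w) * (h - 0).
  apply: (@mvt R (fun s => fw (p + s *: v + t2 *: w)) (fun s => fwv (p + s *: v + t2 *: w)) 0 h (ltW h0)) => s sh.
  apply: (@isd_ext R R^o _ _ (fun y : R => fw (p + t2 *: w + y *: v)) _ _ (fun y => f_equal fw (esym (swap y t2)))).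
  by apply: isd_along; rewrite -swap; have [[_ _ _ ?] _] := H _ (inb s t2 sh t2h).
rewrite !scale0r !addr0 !subr0 in E1 E2 E3 E4.
have E : fvw (p + s1 *: v + t1 *: w) = fwv (p + s2 *: v + t2 *: w).
  apply: (mulIf (lt0r_neq0 h0)); apply: (mulIf (lt0r_neq0 h0)).
  by rewrite -E2 -E4 -E1 -E3; ring.
have [_ [b1 _]] := H _ (inb s1 t1 s1h t1h).
have [_ [_ b2]] := H _ (inb s2 t2 s2h t2h).
rewrite E in b1; set x := fwv (p + s2 *: v + t2 *: w) in b1 b2.
rewrite (_ : fvw p - fwv p = (fvw p - x) - (fwv p - x)); last by ring.
by apply: (le_trans (ler_normB _ _)); rewrite [e in X in _ <= X]splitr lerD.
Unshelve. all: by end_near. Qed.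

End mixed_derivatives.

Section positive_part.
Variable R : realType.

(** Its square is C^1, with derivative 2 pospart; it serves as a cut-off at the
    boundary of the cone. *)
Definition pospart (y : R) : R := Num.max y 0.

Lemma pospart_ge0 y : 0 <= pospart y. Proof. by rewrite le_max lexx orbT. Qed.
Lemma pospart_pos y : 0 <= y -> pospart y = y. Proof. by move=> y0; rewrite /pospart; apply/max_idPl. Qed.
Lemma pospart_neg y : y <= 0 -> pospart y = 0. Proof. by move=> y0; rewrite /pospart; apply/max_idPr. Qed.

Lemma pospart_continuous : continuous pospart.
Proof. by move=> y; apply: continuous_max; [exact: cvg_id|exact: cvg_cst]. Qed.

Lemma pospart_sqr_is_derive (y : R) : is_derive y 1 (fun y : R => pospart y ^+ 2) (2 * pospart y).
Proof.
have [y0|y0|->] := ltgtP y 0.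
- rewrite (pospart_neg (ltW y0)) mulr0.
  apply: near_eq_is_derive (isd_cst y 1 (0:R)).
  have : \forall s \near y, s < 0 by exact: lt_nbhsl.
  by apply: filterS => s /ltW s0; rewrite pospart_neg // expr0n.
- rewrite (pospart_pos (ltW y0)).
  have H : is_derive y (1:R) (fun y : R => y ^+ 2) (2 * y) by isder; ring.
  apply: near_eq_is_derive H.
  have : \forall s \near y, 0 < s by exact: lt_nbhsr.
  by apply: filterS => s /ltW s0; rewrite pospart_pos.
rewrite (pospart_pos (lexx 0)) mulr0.
suff L : (fun h : R => h^-1 *: (pospart h ^+ 2 - pospart 0 ^+ 2)) @ 0^' --> (0 : R).
  have E : (fun h : R => h^-1 *: (((fun y : R => pospart y ^+ 2) \o shift 0) (h *: (1:R^o)) - pospart 0 ^+ 2)) =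
           (fun h : R => h^-1 *: (pospart h ^+ 2 - pospart 0 ^+ 2)).
    by apply: funext => h /=; rewrite [_%:A]mulr1 addr0.
  apply: DeriveDef; first by rewrite /derivable E; apply/cvg_ex; exists 0.
  by rewrite /derive E; apply/cvg_lim.
apply/cvgrPdist_le => e e0; near=> h.
have h0 : h != 0 by near: h; exact: nbhs_dnbhs_neq.
rewrite sub0r normrN (pospart_pos (lexx 0)) expr0n subr0 normrM normfV ler_pdivrMl ?normr_gt0 //.
have hp : pospart h <= `|h| by rewrite ge_max ler_norm normr_ge0.
rewrite normrX (ger0_norm (pospart_ge0 h)) expr2; apply: ler_pM; rewrite ?pospart_ge0 //.
apply: (le_trans hp); near: h; exact: dnbhs0_le.
Unshelve. all: by end_near. Qed.

End positive_part.

(** * Space-time derivatives and the energy density *)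

Section spacetime_derivatives.
Variables (R : realType) (n : nat).
Local Notation ST := (R^o * 'rV[R]_n)%type.

Definition dir_t : ST := (1, 0).
Definition dir_x (k : 'I_n) : ST := (0, delta_mx 0 k).

Lemma isd_affine (V : normedModType R) (f : V -> R^o) (p v : V) (l : R) :
  (forall h : R, f (h *: v + p) = h * l + f p) -> is_derive p v f l.
Proof.
move=> H; apply/is_derive_line.
have E : is_derive (0 : R) (1 : R) (fun h : R => h * l + f p) l by isder; ring.
by apply: isd_ext E => h; rewrite H.
Qed.

Lemma isd_time_t (g : R -> R) (p : ST) (l : R) : is_derive (p.1 : R) (1 : R) g l ->
  is_derive p dir_t (fun p : ST => g p.1 : R^o) l.
Proof.
move=> gl; have H : is_derive p dir_t (fun p : ST => p.1 : R^o) 1.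
  by apply: isd_affine => h /=; rewrite mulr1 /GRing.scale /= mulr1.
by apply: is_derive_eq (is_derive_chain gl H) _; rewrite mulr1.
Qed.

Lemma isd_time_x (g : R -> R) (p : ST) k : is_derive p (dir_x k) (fun p : ST => g p.1 : R^o) 0.
Proof. by apply: isd_affine => h /=; rewrite scaler0 add0r mulr0 add0r. Qed.

Lemma isd_space_t (g : 'rV[R]_n -> R) (p : ST) : is_derive p dir_t (fun p : ST => g p.2 : R^o) 0.
Proof. by apply: isd_affine => h /=; rewrite scaler0 add0r mulr0 add0r. Qed.

Lemma isd_coord_x (p : ST) k j : is_derive p (dir_x k) (fun p : ST => p.2 0 j : R^o) (j == k)%:R.
Proof. by apply: isd_affine => h /=; rewrite !mxE eqxx. Qed.

Lemma isd_norm2_x (p : ST) k :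
  is_derive p (dir_x k) (fun p : ST => \sum_(j < n) p.2 0 j ^+ 2 : R^o) (2 * p.2 0 k).
Proof.
have H : is_derive p (dir_x k) (fun p : ST => \sum_(j < n) p.2 0 j ^+ 2 : R^o) (\sum_(j < n) 2 * p.2 0 j * (j == k)%:R).
  by apply: isd_sum => j _; have h := isd_coord_x p k j; exact: isd_sqr h.
apply: is_derive_eq H _; rewrite (bigD1 k) //= eqxx mulr1 big1 ?addr0 // => j /negPf ->.
by rewrite mulr0.
Qed.

End spacetime_derivatives.

Section continuity_rules.
Variables (R : realType) (X : topologicalType) (p : X).
Implicit Types f g : X -> R.

Lemma ctp_add f g : {for p, continuous f} -> {for p, continuous g} -> {for p, continuous (fun x => f x + g x)}.
Proof. by move=> cf cg; apply: cvgD. Qed.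
Lemma ctp_sub f g : {for p, continuous f} -> {for p, continuous g} -> {for p, continuous (fun x => f x - g x)}.
Proof. by move=> cf cg; apply: cvgB. Qed.
Lemma ctp_mul f g : {for p, continuous f} -> {for p, continuous g} -> {for p, continuous (fun x => f x * g x)}.
Proof. by move=> cf cg; apply: cvgM. Qed.
Lemma ctp_cst (c : R) : {for p, continuous (fun=> c : R)}.
Proof. exact: cst_continuous. Qed.
Lemma ctp_opp f : {for p, continuous f} -> {for p, continuous (fun x => - f x)}.
Proof. by move=> cf; apply: cvgN. Qed.
Lemma ctp_at f : {for p, continuous f} -> continuous_at p f.
Proof. by []. Qed.
Lemma ctp_sqr f : {for p, continuous f} -> {for p, continuous (fun x => f x ^+ 2)}.
Proof. by move=> cf; apply: (ctp_mul cf cf). Qed.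
Lemma ctp_sum (I : Type) (r : seq I) (P : pred I) (f : I -> X -> R) :
  (forall i, P i -> {for p, continuous (f i)}) -> {for p, continuous (fun x => \sum_(i <- r | P i) f i x)}.
Proof.
move=> cf; elim: r => [|i r IH].
  rewrite (_ : (fun x => _) = fun=> 0); first exact: ctp_cst.
  by apply: funext => x; rewrite big_nil.
rewrite (_ : (fun x => _) = if P i then (fun x => f i x + \sum_(j <- r | P j) f j x) else (fun x => \sum_(j <- r | P j) f j x)).
  by case: ifP => // Pi; apply: ctp_add => //; exact: cf.
by apply: funext => x; rewrite big_cons; case: ifP.
Qed.
Lemma ctp_comp f (g : R -> R) : {for p, continuous f} -> continuous g -> {for p, continuous (fun x => g (f x))}.
Proof. by move=> cf cg; apply: continuous_comp => //; exact: cg. Qed.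
End continuity_rules.

(** Proves continuity at a point by recursion on the expression; the leaves are
    left to the user. *)
Ltac ctp := repeat
  lazymatch goal with
  | |- continuous_at ?p ?f => refine (@ctp_at _ _ p f _)
  | |- @prop_for _ ?p _ (inPhantom (forall x, @continuous_at _ _ _ ?f)) =>
    lazymatch f with
    | (fun _ => ?c) => exact (@ctp_cst _ _ p c)
    | (fun x => @Algebra.add _ (@?a x) (@Algebra.opp _ (@?c x))) => refine (@ctp_sub _ _ p a c _ _)
    | (fun x => @Algebra.add _ (@?a x) (@?c x)) => refine (@ctp_add _ _ p a c _ _)
    | (fun x => @Algebra.opp _ (@?a x)) => refine (@ctp_opp _ _ p a _)
    | (fun x => @GRing.mul _ (@?a x) (@?c x)) => refine (@ctp_mul _ _ p a c _ _)
    | (fun x => @GRing.exp _ (@?a x) 2) => refine (@ctp_sqr _ _ p a _)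
    | (fun x => bigop.body _ _ (fun i => @BigBody _ _ i _ _ (@?a i x))) =>
        refine (@ctp_sum _ _ p _ _ _ (fun i x => a i x) _); intros ? _
    end
  end.

(** At a point x of the cone of radius r, with weight P^2, where P stands for
    the positive part of r^2 - |x|^2: the first two lines are the time
    derivative of the weighted energy density, and the subtracted sum is the
    divergence of the weighted flux. The derivatives of second order cancel but
    for the wave operator A - b^2 Lap. The derivative of the weight in x is
    absorbed by that in t, because the cone shrinks at speed B >= n b. *)
Lemma energy_density_ineq (R : realType) (n m : nat) (z a A : 'I_m -> R) (y Yt Yx : 'I_m -> 'I_n -> R)
    (x : 'I_n -> R) (b db r P B K M Mb : R) :
  (0 < n)%N -> 0 < b -> n%:R * b <= B -> 0 <= r -> 0 <= P -> 0 <= K ->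
  `|2 * b * db| <= M -> `|b ^- 2| <= Mb ->
  (P != 0 -> forall k, `|x k| <= r) ->
  (P != 0 -> forall i, (A i - b ^+ 2 * \sum_(k < n) Yx i k) ^+ 2 <=
     K * \sum_(i < m) (a i ^+ 2 + z i ^+ 2 + \sum_(k < n) y i k ^+ 2)) ->
  2 * P * (2 * r * - B) * \sum_(i < m) (a i ^+ 2 + b ^+ 2 * \sum_(k < n) y i k ^+ 2 + z i ^+ 2) +
  P ^+ 2 * \sum_(i < m) (2 * a i * A i + 2 * b * db * \sum_(k < n) y i k ^+ 2 +
     b ^+ 2 * \sum_(k < n) (2 * y i k * Yt i k) + 2 * z i * a i) -
  \sum_(k < n) (2 * P * (- (2 * x k)) * (b ^+ 2 * \sum_(i < m) (2 * a i * y i k)) +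
     P ^+ 2 * (b ^+ 2 * \sum_(i < m) (2 * Yt i k * y i k + 2 * a i * Yx i k)))
  <= ((2 + m%:R * K + M) * (1 + Mb)) *
     (P ^+ 2 * \sum_(i < m) (a i ^+ 2 + b ^+ 2 * \sum_(k < n) y i k ^+ 2 + z i ^+ 2)).
Proof.
move=> n0 b0 nbB r0 P0 K0 bM bMb xr HA.
have [->|Pn0] := eqVneq P 0.
  rewrite expr0n /= !(mulr0, mul0r) big1 ?subr0 ?addr0 // => k _.
  by rewrite !(mulr0, mul0r) addr0.
have {}xr := xr Pn0; have {}HA := HA Pn0.
set q := \sum_(i < m) _ in HA.
set e := \sum_(i < m) (a i ^+ 2 + b ^+ 2 * \sum_(k < n) y i k ^+ 2 + z i ^+ 2).
have ysq i : 0 <= \sum_(k < n) y i k ^+ 2 by apply: sumr_ge0 => k _; exact: sqr_ge0.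
have q0 : 0 <= q by apply: sumr_ge0 => i _; rewrite !addr_ge0 ?sqr_ge0.
have M0 : 0 <= M := le_trans (normr_ge0 _) bM.
have Mb0 : 0 <= Mb := le_trans (normr_ge0 _) bMb.
have bB : b <= B.
  by apply: le_trans nbB; rewrite ler_peMl ?(ltW b0) // ler1n.
have qe : q <= (1 + Mb) * e.
  rewrite /q /e mulr_sumr; apply: ler_sum => i _.
  have h1 : \sum_(k < n) y i k ^+ 2 <= Mb * (b ^+ 2 * \sum_(k < n) y i k ^+ 2).
    rewrite mulrA ler_peMl // -ler_pdivrMr ?exprn_gt0 // div1r.
    exact: le_trans (ler_norm _) bMb.
  have h2 : 0 <= b ^+ 2 * \sum_(k < n) y i k ^+ 2 by rewrite mulr_ge0 ?sqr_ge0.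
  have h3 : 0 <= Mb * a i ^+ 2 by rewrite mulr_ge0 ?sqr_ge0.
  have h4 : 0 <= Mb * z i ^+ 2 by rewrite mulr_ge0 ?sqr_ge0.
  set Y := \sum_(k < n) y i k ^+ 2 in h1 h2 *.
  move: h1 h2 h3 h4; move: Y (b ^+ 2 * Y) (a i ^+ 2) (z i ^+ 2) => u v s t; lra.
have c1 : b ^+ 2 * \sum_(i < m) \sum_(k < n) (2 * x k * a i * y i k) <= r * B * e.
  rewrite /e !mulr_sumr; apply: ler_sum => i _.
  have : b ^+ 2 * \sum_(k < n) (2 * x k * a i * y i k) <= r * (n%:R * b * a i ^+ 2 + b * (b ^+ 2 * \sum_(k < n) y i k ^+ 2)).
    rewrite mulrDr !mulr_sumr.
    have -> : r * (n%:R * b * a i ^+ 2) = \sum_(k < n) (r * (b * a i ^+ 2)).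
      by rewrite sumr_const card_ord -mulr_natl; ring.
    rewrite -big_split /=; apply: ler_sum => k _.
    have -> : b ^+ 2 * (2 * x k * a i * y i k) = b * (2 * a i * (x k * (b * y i k))) by ring.
    have -> : r * (b * a i ^+ 2) + r * (b * (b ^+ 2 * y i k ^+ 2)) = b * (r * (a i ^+ 2 + (b * y i k) ^+ 2)) by ring.
    by rewrite ler_pM2l //; exact: sqr_mul_le.
  move=> H; apply: (le_trans H); rewrite -[r * B * _]mulrA; apply: ler_wpM2l => //.
  set Y := \sum_(k < n) y i k ^+ 2.
  have hY : 0 <= b ^+ 2 * Y by apply: mulr_ge0; [exact: sqr_ge0|exact: ysq].
  have hA := ler_wpM2r (sqr_ge0 (a i)) nbB; have hB := ler_wpM2r hY bB.
  have hz : 0 <= B * z i ^+ 2 by apply: mulr_ge0; [exact: le_trans (ltW b0) bB|exact: sqr_ge0].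
  rewrite !mulrDr; move: hA hB hz.
  by move: (n%:R * b * a i ^+ 2) (b * (b ^+ 2 * Y)) (B * a i ^+ 2) (B * (b ^+ 2 * Y)) (B * z i ^+ 2) => u v s t w; clear; lra.
have c2 : \sum_(i < m) (2 * a i * (A i - b ^+ 2 * \sum_(k < n) Yx i k) + 2 * b * db * \sum_(k < n) y i k ^+ 2 + 2 * z i * a i)
   <= (2 + m%:R * K + M) * q.
  have -> : (2 + m%:R * K + M) * q = \sum_(i < m) (K * q) + (2 + M) * q.
    by rewrite sumr_const card_ord -mulr_natl; ring.
  have -> : (2 + M) * q = \sum_(i < m) (2 + M) * (a i ^+ 2 + z i ^+ 2 + \sum_(k < n) y i k ^+ 2).
    by rewrite /q mulr_sumr.
  rewrite -big_split /=; apply: ler_sum => i _.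
  have h1 := HA i; set X := A i - _ in h1 *.
  have h2 := sqr_ge0 (a i - X); have h3 := sqr_ge0 (a i - z i).
  have h4 : 2 * b * db * \sum_(k < n) y i k ^+ 2 <= M * \sum_(k < n) y i k ^+ 2.
    by rewrite ler_wpM2r //; exact: le_trans (ler_norm _) bM.
  have h5 := ysq i; have h6 := sqr_ge0 (a i); have h7 := sqr_ge0 (z i).
  have h8 : 0 <= M * a i ^+ 2 by rewrite mulr_ge0.
  have h9 : 0 <= M * z i ^+ 2 by rewrite mulr_ge0.
  set Y := \sum_(k < n) y i k ^+ 2 in h4 h5 *.
  move: h1 h2 h3 h4 h5 h6 h7 h8 h9; clear.
  move: (K * q) Y (2 * b * db * Y) (a i) (z i) X => u v s a1 z1 X1; lra.
have -> : 2 * P * (2 * r * - B) * e +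
  P ^+ 2 * \sum_(i < m) (2 * a i * A i + 2 * b * db * \sum_(k < n) y i k ^+ 2 +
     b ^+ 2 * \sum_(k < n) (2 * y i k * Yt i k) + 2 * z i * a i) -
  \sum_(k < n) (2 * P * (- (2 * x k)) * (b ^+ 2 * \sum_(i < m) (2 * a i * y i k)) +
     P ^+ 2 * (b ^+ 2 * \sum_(i < m) (2 * Yt i k * y i k + 2 * a i * Yx i k))) =
  4 * P * (b ^+ 2 * \sum_(i < m) \sum_(k < n) (2 * x k * a i * y i k) - r * B * e) +
  P ^+ 2 * \sum_(i < m) (2 * a i * (A i - b ^+ 2 * \sum_(k < n) Yx i k) + 2 * b * db * \sum_(k < n) y i k ^+ 2 + 2 * z i * a i).
  have -> : \sum_(k < n) (2 * P * (- (2 * x k)) * (b ^+ 2 * \sum_(i < m) (2 * a i * y i k)) +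
     P ^+ 2 * (b ^+ 2 * \sum_(i < m) (2 * Yt i k * y i k + 2 * a i * Yx i k))) =
     \sum_(i < m) (- 4 * P * (b ^+ 2 * \sum_(k < n) (2 * x k * a i * y i k)) +
       P ^+ 2 * (b ^+ 2 * \sum_(k < n) (2 * y i k * Yt i k) + 2 * a i * (b ^+ 2 * \sum_(k < n) Yx i k))).
    transitivity (\sum_(k < n) \sum_(i < m) (- 4 * P * b ^+ 2 * (2 * x k * a i * y i k) +
        P ^+ 2 * (b ^+ 2 * (2 * y i k * Yt i k + 2 * a i * Yx i k)))).
      apply: eq_bigr => k _; rewrite !mulr_sumr -big_split /=; apply: eq_bigr => i _; ring.
    rewrite exchange_big /=; apply: eq_bigr => i _.
    rewrite big_split /= -!mulr_sumr; congr (_ + _); first by ring.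
    by congr (_ * _); rewrite big_split /= -mulr_sumr; ring.
  have -> : \sum_(i < m) (- 4 * P * (b ^+ 2 * \sum_(k < n) (2 * x k * a i * y i k)) +
       P ^+ 2 * (b ^+ 2 * \sum_(k < n) (2 * y i k * Yt i k) + 2 * a i * (b ^+ 2 * \sum_(k < n) Yx i k))) =
     - 4 * P * (b ^+ 2 * \sum_(i < m) \sum_(k < n) (2 * x k * a i * y i k)) +
     P ^+ 2 * \sum_(i < m) (b ^+ 2 * \sum_(k < n) (2 * y i k * Yt i k) + 2 * a i * (b ^+ 2 * \sum_(k < n) Yx i k)).
    by rewrite big_split /=; congr (_ + _); rewrite ?[b ^+ 2 * \sum_(i < m) _]mulr_sumr mulr_sumr.
  have -> : \sum_(i < m) (2 * a i * A i + 2 * b * db * \sum_(k < n) y i k ^+ 2 +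
     b ^+ 2 * \sum_(k < n) (2 * y i k * Yt i k) + 2 * z i * a i) =
    \sum_(i < m) (2 * a i * (A i - b ^+ 2 * \sum_(k < n) Yx i k) + 2 * b * db * \sum_(k < n) y i k ^+ 2 + 2 * z i * a i) +
    \sum_(i < m) (b ^+ 2 * \sum_(k < n) (2 * y i k * Yt i k) + 2 * a i * (b ^+ 2 * \sum_(k < n) Yx i k)).
    by rewrite -big_split /=; apply: eq_bigr => i _; ring.
  by ring.
have d1 : 4 * P * (b ^+ 2 * \sum_(i < m) \sum_(k < n) (2 * x k * a i * y i k) - r * B * e) <= 0.
  by rewrite mulr_ge0_le0 ?subr_le0 // mulr_ge0.
have d2 := ler_wpM2l (sqr_ge0 P) c2.
have k0 : 0 <= 2 + m%:R * K + M by rewrite !addr_ge0 // mulr_ge0.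
have d3 := ler_wpM2l (mulr_ge0 (sqr_ge0 P) k0) qe.
apply: (le_trans (lerD d1 d2)); rewrite add0r; apply: le_trans (_ : _ <= P ^+ 2 * (2 + m%:R * K + M) * ((1 + Mb) * e)) _; last first.
  by rewrite le_eqVlt; apply/orP; left; apply/eqP; ring.
by apply: le_trans d3; rewrite mulrA.
Qed.

(** * Uniqueness in a backward cone *)

Lemma boxint_sum (R : realType) (r : R) (r0 : 0 < r) (n : nat) (I : Type) (s : seq I) (F : I -> 'rV[R]_n -> R) :
  (forall i, continuous (F i)) ->
  boxint r (fun x => \sum_(i <- s) F i x) = \sum_(i <- s) boxint r (F i).
Proof.
move=> cF; elim: s => [|i s IH].
  rewrite big_nil -[RHS](@boxint0 R r n); congr (boxint r _).
  by apply: funext => x; rewrite big_nil.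
rewrite big_cons -IH -(boxint_add r0) //; last first.
  by move=> x; apply: ctp_sum => j _; exact: cF.
by congr (boxint r _); apply: funext => x; rewrite big_cons.
Qed.

(** The derivative is only known in the open interval, as second derivatives of
    a solution need not exist at time 0; the mean value theorem needs no more
    for a function continuous at the ends. *)
Lemma nonpos_rate_le0 (R : realType) (A dA : R -> R) (K t : R) : 0 <= t ->
  (forall s, s <= t -> {for s, continuous A}) ->
  (forall s : R, 0 < s < t -> is_derive s (1 : R) A (dA s)) ->
  (forall s, 0 < s < t -> dA s <= K * A s) -> A 0 <= 0 -> A t <= 0.
Proof.
move=> t0 cA dA_ dAle A0.
have [t00|t00] := eqVneq 0 t; first by rewrite -t00.
have {t00}t0 : 0 < t by rewrite lt_neqAle t00.
pose E s := A s * expR (- (K * s)).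
have dE (s : R) : 0 < s < t -> is_derive s (1 : R) E ((dA s - K * A s) * expR (- (K * s))).
  by move=> st; have h := dA_ s st; rewrite /E; isder; ring.
have cE : {within `[0, t], continuous E}.
  apply: continuous_in_subspaceT => s; rewrite inE /= in_itv /= => /andP[_ st].
  apply: (@ctp_mul R R s); first exact: cA.
  have h (u : R) : is_derive u (1 : R) (fun s : R => expR (- (K * s))) (expR (- (K * u)) * - K).
    by isder; ring.
  exact: is_derive_cont (h s).
have dE' s : s \in `]0, t[%R -> is_derive s (1 : R) E ((dA s - K * A s) * expR (- (K * s))).
  by rewrite in_itv /=; exact: dE.
have [s] := MVT t0 dE' cE.
rewrite in_itv /= subr0 => st Et.
have : E t <= E 0.
  rewrite -subr_le0 Et mulr_le0_ge0 ?(ltW t0) // mulr_le0_ge0 ?expR_ge0 //.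
  by rewrite subr_le0 dAle.
rewrite /E mulr0 oppr0 expR0 mulr1 => /le_trans/(_ A0).
by rewrite pmulr_lle0 // expR_gt0.
Qed.

Section cone_uniqueness.
Variables (R : realType) (n m : nat).
Local Notation ST := (R^o * 'rV[R]_n)%type.
Variables (b db : R -> R) (t1 rho B K : R).
Variables (z zt ztt : 'I_m -> ST -> R) (zx zxt zxx : 'I_m -> 'I_n -> ST -> R).
Hypothesis n0 : (0 < n)%N.
Hypothesis b_derive : forall t : R, is_derive t (1 : R) b (db t).
Hypothesis db_cont : continuous db.
Hypothesis b0 : forall t, 0 < b t.
Hypothesis rho0 : 0 < rho.
Hypothesis bB : forall t, n%:R * b t <= B.
Hypothesis Bt1 : B * t1 <= rho.
Hypothesis K0 : 0 <= K.
Hypothesis z_cont : forall i p, p.1 < t1 -> {for p, continuous (z i)}.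
Hypothesis zt_cont : forall i p, p.1 < t1 -> {for p, continuous (zt i)}.
Hypothesis zx_cont : forall i k p, p.1 < t1 -> {for p, continuous (zx i k)}.
Hypothesis ztt_cont : forall i p, 0 < p.1 < t1 -> {for p, continuous (ztt i)}.
Hypothesis zxt_cont : forall i k p, 0 < p.1 < t1 -> {for p, continuous (zxt i k)}.
Hypothesis zxx_cont : forall i k p, 0 < p.1 < t1 -> {for p, continuous (zxx i k)}.
Hypothesis z_t : forall i p, 0 < p.1 < t1 -> is_derive p (dir_t R n) (z i : ST -> R^o) (zt i p).
Hypothesis zt_t : forall i p, 0 < p.1 < t1 -> is_derive p (dir_t R n) (zt i : ST -> R^o) (ztt i p).
Hypothesis zx_t : forall i k p, 0 < p.1 < t1 -> is_derive p (dir_t R n) (zx i k : ST -> R^o) (zxt i k p).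
Hypothesis zt_x : forall i k p, 0 < p.1 < t1 -> is_derive p (dir_x R k) (zt i : ST -> R^o) (zxt i k p).
Hypothesis zx_x : forall i k p, 0 < p.1 < t1 -> is_derive p (dir_x R k) (zx i k : ST -> R^o) (zxx i k p).
Hypothesis init : forall p : ST, p.1 <= 0 -> \sum_(k < n) p.2 0 k ^+ 2 < rho ^+ 2 ->
  forall i, [/\ z i p = 0, zt i p = 0 & forall k, zx i k p = 0].
Hypothesis eqn : forall i (p : ST), 0 < p.1 < t1 -> \sum_(k < n) p.2 0 k ^+ 2 < (rho - B * p.1) ^+ 2 ->
  (ztt i p - b p.1 ^+ 2 * \sum_(k < n) zxx i k p) ^+ 2 <=
  K * \sum_(j < m) (zt j p ^+ 2 + z j p ^+ 2 + \sum_(k < n) zx j k p ^+ 2).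

Let c (p : ST) := (rho - B * pospart (p.1 : R)) ^+ 2 - \sum_(k < n) p.2 0 k ^+ 2.
Let e (p : ST) := \sum_(i < m) (zt i p ^+ 2 + b p.1 ^+ 2 * \sum_(k < n) zx i k p ^+ 2 + z i p ^+ 2).
Let Psi (p : ST) := pospart (c p) ^+ 2 * e p.
Let dPsi (p : ST) :=
  2 * pospart (c p) * (2 * (rho - B * p.1) * - B) * e p + pospart (c p) ^+ 2 *
    \sum_(i < m) (2 * zt i p * ztt i p + 2 * b p.1 * db p.1 * \sum_(k < n) zx i k p ^+ 2 +
      b p.1 ^+ 2 * \sum_(k < n) (2 * zx i k p * zxt i k p) + 2 * z i p * zt i p).
Let Q (k : 'I_n) (p : ST) := pospart (c p) ^+ 2 * (b p.1 ^+ 2 * \sum_(i < m) (2 * zt i p * zx i k p)).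
Let dQ (k : 'I_n) (p : ST) :=
  2 * pospart (c p) * (- (2 * p.2 0 k)) * (b p.1 ^+ 2 * \sum_(i < m) (2 * zt i p * zx i k p)) +
  pospart (c p) ^+ 2 * (b p.1 ^+ 2 * \sum_(i < m) (2 * zxt i k p * zx i k p + 2 * zt i p * zxx i k p)).

Let t_cont (p : ST) : {for p, continuous (fun p : ST => p.1 : R)}.
Proof. exact: cvg_fst. Qed.
Let x_cont k (p : ST) : {for p, continuous (fun p : ST => p.2 0 k)}.
Proof. by apply: (@cvg_entry R _ _ 1 n); exact: cvg_snd. Qed.
Let b_cont : continuous b. Proof. by move=> t; exact: is_derive_cont (b_derive t). Qed.
Let bt_cont (p : ST) : {for p, continuous (fun p : ST => b p.1)}.
Proof. by apply: ctp_comp => //; exact: t_cont. Qed.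
Let dbt_cont (p : ST) : {for p, continuous (fun p : ST => db p.1)}.
Proof. by apply: ctp_comp => //; exact: t_cont. Qed.
Let c_cont (p : ST) : {for p, continuous c}.
Proof.
rewrite /c; ctp; last by exact: x_cont.
by apply: ctp_comp; [exact: t_cont|exact: pospart_continuous].
Qed.
Let ppc_cont (p : ST) : {for p, continuous (fun p => pospart (c p))}.
Proof. by apply: ctp_comp; [exact: c_cont|exact: pospart_continuous]. Qed.

Let Psi_cont (p : ST) : p.1 < t1 -> {for p, continuous Psi}.
Proof.
move=> pt; rewrite /Psi /e; ctp.
- exact: ppc_cont.
- exact: zt_cont.
- exact: bt_cont.
- exact: zx_cont.
- exact: z_cont.
Qed.

Let dPsi_cont (p : ST) : 0 < p.1 < t1 -> {for p, continuous dPsi}.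
Proof.
move=> pt; have /andP[pt0 pt1] := pt; rewrite /dPsi /e; ctp;
 by [exact: ppc_cont|exact: t_cont|exact: zt_cont|exact: bt_cont|exact: zx_cont|exact: z_cont|exact: dbt_cont
 |exact: ztt_cont|exact: zxt_cont].
Qed.

Let Q_cont k (p : ST) : 0 < p.1 < t1 -> {for p, continuous (Q k)}.
Proof.
move=> pt; have /andP[pt0 pt1] := pt; rewrite /Q; ctp;
 by [exact: ppc_cont|exact: zt_cont|exact: bt_cont|exact: zx_cont].
Qed.

Let dQ_cont k (p : ST) : 0 < p.1 < t1 -> {for p, continuous (dQ k)}.
Proof.
move=> pt; have /andP[pt0 pt1] := pt; rewrite /dQ.
apply: ctp_add; [apply: ctp_mul; [apply: ctp_mul; [ctp|]|]|].
- exact: ppc_cont.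
- apply: (@ctp_comp _ _ _ _ (fun y => - (2 * y))); first exact: x_cont.
  by move=> y; apply: cvgN; apply: cvgM; [exact: cvg_cst|exact: cvg_id].
- by ctp; by [exact: bt_cont|exact: zt_cont|exact: zx_cont].
- by ctp; by [exact: ppc_cont|exact: zt_cont|exact: bt_cont|exact: zx_cont|exact: zxt_cont|exact: zxx_cont].
Qed.

Let slice (F : ST -> R) (t : R) (x : 'rV[R]_n) : {for (t, x) : ST, continuous F} ->
  {for x, continuous (fun x => F (t, x))}.
Proof.
move=> cF; apply: (@continuous_comp _ _ _ (fun x : 'rV[R]_n => (t, x) : ST) F) => //.
by apply: (@cont_pair _ R^o); [exact: cst_continuous|exact: cvg_id].
Qed.

Let ppc_t (p : ST) : 0 < p.1 < t1 ->
  is_derive p (dir_t R n) (fun p => pospart (c p) ^+ 2 : R^o) (2 * pospart (c p) * (2 * (rho - B * p.1) * - B)).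
Proof.
move=> /andP[p0 _].
have hpp : is_derive (p.1 : R) (1 : R) (@pospart R) 1.
  apply: near_eq_is_derive (isd_id (p.1 : R)).
  have : \forall s \near (p.1 : R), 0 < s by exact: lt_nbhsr.
  by apply: filterS => s /ltW s0; rewrite pospart_pos.
have h1 := isd_time_t hpp.
have h2 := isd_space_t (fun x : 'rV[R]_n => \sum_(k < n) x 0 k ^+ 2) p.
have hc : is_derive p (dir_t R n) (c : ST -> R^o) (2 * (rho - B * p.1) * - B).
  have h3 : is_derive p (dir_t R n) (fun p : ST => (rho - B * pospart (p.1 : R)) ^+ 2 : R^o) (2 * (rho - B * p.1) * - B).
    by have E := pospart_pos (ltW p0); isder; rewrite E; ring.
  by apply: is_derive_eq (isd_sub h3 h2) _; rewrite subr0.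
by apply: is_derive_eq (is_derive_chain (pospart_sqr_is_derive (c p)) hc) _.
Qed.

Let ppc_x k (p : ST) :
  is_derive p (dir_x R k) (fun p => pospart (c p) ^+ 2 : R^o) (2 * pospart (c p) * - (2 * p.2 0 k)).
Proof.
have h1 := isd_time_x (fun t : R => (rho - B * pospart t) ^+ 2) p k.
have hc : is_derive p (dir_x R k) (c : ST -> R^o) (- (2 * p.2 0 k)).
  by apply: is_derive_eq (isd_sub h1 (isd_norm2_x p k)) _; rewrite sub0r.
by apply: is_derive_eq (is_derive_chain (pospart_sqr_is_derive (c p)) hc) _.
Qed.

Let Psi_t (p : ST) : 0 < p.1 < t1 -> is_derive p (dir_t R n) (Psi : ST -> R^o) (dPsi p).
Proof.
move=> pt.
have hb := isd_time_t (b_derive p.1).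
have he : is_derive p (dir_t R n) (e : ST -> R^o)
    (\sum_(i < m) (2 * zt i p * ztt i p + 2 * b p.1 * db p.1 * \sum_(k < n) zx i k p ^+ 2 +
      b p.1 ^+ 2 * \sum_(k < n) (2 * zx i k p * zxt i k p) + 2 * z i p * zt i p)).
  apply: isd_sum => i _; apply: isd_add; last exact: isd_sqr (z_t i pt).
  have hs : is_derive p (dir_t R n) (fun p => \sum_(k < n) zx i k p ^+ 2 : R^o) (\sum_(k < n) (2 * zx i k p * zxt i k p)).
    by apply: isd_sum => k _; exact: isd_sqr (zx_t i k pt).
  have h1 := isd_sqr (zt_t i pt).
  have h2 := isd_mul (isd_sqr hb) hs.
  by apply: is_derive_eq (isd_add h1 h2) _; rewrite addrA.
exact: isd_mul (ppc_t pt) he.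
Qed.

Let Q_x k (p : ST) : 0 < p.1 < t1 -> is_derive p (dir_x R k) (Q k : ST -> R^o) (dQ k p).
Proof.
move=> pt.
have hb := isd_time_x (fun t => b t ^+ 2) p k.
have hs : is_derive p (dir_x R k) (fun p => \sum_(i < m) (2 * zt i p * zx i k p) : R^o)
    (\sum_(i < m) (2 * zxt i k p * zx i k p + 2 * zt i p * zxx i k p)).
  apply: isd_sum => i _; have h1 := zt_x i k pt; have h2 := zx_x i k pt.
  by isder; ring.
apply: is_derive_eq (isd_mul (ppc_x k p) (isd_mul hb hs)) _.
by rewrite mul0r add0r.
Qed.

Let cone_ge (t : R) : 0 <= t <= t1 -> 0 <= B * t <= rho.
Proof.
move=> /andP[t0 tt].
have B0 : 0 <= B by apply: le_trans (bB 0); rewrite mulr_ge0 // ltW.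
rewrite mulr_ge0 //=; apply: le_trans Bt1; exact: ler_wpM2l.
Qed.

Let c_neg (t : R) (x : 'rV[R]_n) k : t <= t1 -> rho <= `|x 0 k| -> c (t, x) <= 0.
Proof.
move=> tt xk; rewrite /c /= subr_le0.
have h : rho ^+ 2 <= \sum_(k < n) x 0 k ^+ 2.
  rewrite (bigD1 k) //= -[X in X <= _]addr0; apply: lerD; last by apply: sumr_ge0 => j _; exact: sqr_ge0.
  by rewrite -[x 0 k ^+ 2]real_normK ?num_real // lerXn2r ?nnegrE // ltW.
apply: le_trans h; have := @cone_ge (pospart t).
have [t0|/ltW t0] := leP t 0.
  by rewrite pospart_neg // mulr0 subr0.
rewrite pospart_pos // t0 tt => /(_ isT) /andP[h1 h2].
by rewrite lerXn2r ?nnegrE ?subr_ge0 ?(ltW rho0) // gerBl.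
Qed.

Let A (t : R) := boxint rho (fun x => Psi (t, x)).

Let slice_fun (F : ST -> R) : (fun p : R * 'rV[R]_n => F (p.1, p.2)) = F.
Proof. by apply: funext => -[]. Qed.

Let A_cont (t : R) : t < t1 -> {for t, continuous A}.
Proof.
move=> tt; apply: (@boxint_continuous R rho rho0 n R [set t | t < t1] (fun t x => Psi (t, x))) => //.
by move=> s x st; rewrite (slice_fun Psi); exact: Psi_cont.
Qed.

Let A_derive (t : R) : 0 < t < t1 -> is_derive t (1 : R) A (boxint rho (fun x => dPsi (t, x))).
Proof.
move=> tt; apply: (@boxint_is_derive R rho rho0 n `]0, t1[%classic (fun t x => Psi (t, x)) (fun t x => dPsi (t, x))).
- exact: interval_open.
- by move=> s x; rewrite /= in_itv /= => /andP[_ st]; rewrite (slice_fun Psi); exact: Psi_cont.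
- by move=> s x; rewrite /= in_itv /= => st; rewrite (slice_fun dPsi); exact: dPsi_cont.
- move=> s x; rewrite /= in_itv /= => st.
  have /is_derive_line H := @Psi_t (s, x) st; apply/is_derive_line.
  apply: isd_ext H => h; congr Psi.
  by apply: injective_projections => //=; rewrite scaler0 add0r.
- by rewrite /= in_itv.
Qed.

Let dQ_int (t : R) k : 0 < t < t1 -> boxint rho (fun x => dQ k (t, x)) = 0.
Proof.
move=> tt; have /andP[t0 t1t] := tt.
apply: (@boxint_divergence R rho rho0 n k (fun x => Q k (t, x))).
- by move=> x; apply: slice; exact: Q_cont.
- by move=> x; apply: slice; exact: dQ_cont.
- move=> x; have /is_derive_line H := @Q_x k (t, x) tt; apply/is_derive_line.
  apply: isd_ext H => h; congr (Q k).
  by apply: injective_projections => //=; rewrite scaler0 add0r.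
- move=> x xk; rewrite /Q pospart_neg ?expr0n ?mul0r //; exact: c_neg (ltW t1t) xk.
Qed.

Let A_rate : exists K3 : R, forall t, 0 < t < t1 -> boxint rho (fun x => dPsi (t, x)) <= K3 * A t.
Proof.
have [M _ HM] := @segment_bounded R (fun t => 2 * b t * db t) 0 t1
  (fun t => ctp_mul (ctp_mul (@ctp_cst R R t 2) (@b_cont t)) (@db_cont t)).
have ci : continuous (fun t => b t ^- 2).
  by move=> t; apply: cvgV; [rewrite expf_neq0 // gt_eqF|apply: (@ctp_sqr R R t b); exact: b_cont].
have [Mb _ HMb] := segment_bounded 0 t1 ci.
exists ((2 + m%:R * K + M) * (1 + Mb)) => t tt; have /andP[/ltW t0 /ltW t1t] := tt.
have tseg : 0 <= t <= t1 by rewrite t0.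
pose S x := \sum_(k < n) dQ k (t, x).
have cS : continuous S.
  move=> x; apply: (@ctp_sum _ _ x _ _ _ (fun k x => dQ k (t, x))) => k _.
  by apply: slice; exact: dQ_cont.
have cP : continuous (fun x => dPsi (t, x)) by move=> x; apply: slice; exact: dPsi_cont.
have S0 : boxint rho S = 0.
  rewrite /S (@boxint_sum R rho rho0 n); last by move=> k x; apply: slice; exact: dQ_cont.
  by rewrite big1 // => k _; exact: dQ_int.
have -> : boxint rho (fun x => dPsi (t, x)) = boxint rho (fun x => dPsi (t, x) - S x).
  rewrite -[RHS]addr0 -[X in _ = _ + X]S0 -(boxint_add rho0) //.
    by congr (boxint rho _); apply: funext => x; rewrite subrK.
  by move=> x; apply: (@ctp_sub _ _ x (fun x => dPsi (t, x)) S); [exact: cP|exact: cS].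
have cA : continuous (fun x => Psi (t, x)).
  by move=> x; apply: slice; apply: Psi_cont; case/andP: tt.
rewrite /A -(boxint_scale rho0) //; apply: (boxint_le rho0) => //.
- by move=> x; apply: (@ctp_sub _ _ x (fun x => dPsi (t, x)) S); [exact: cP|exact: cS].
- by move=> x; apply: (@ctp_mul _ _ x _ (fun x => Psi (t, x))); [exact: ctp_cst|exact: cA].
move=> x; rewrite /dPsi /Psi /S /dQ /e.
apply: (@energy_density_ineq R n m (fun i => z i (t, x)) (fun i => zt i (t, x)) (fun i => ztt i (t, x))
  (fun i k => zx i k (t, x)) (fun i k => zxt i k (t, x)) (fun i k => zxx i k (t, x)) (fun k => x 0 k)
  (b t) (db t) (rho - B * t) (pospart (c (t, x))) B K M Mb) => //.
- by rewrite subr_ge0; case/andP: (cone_ge tseg).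
- exact: pospart_ge0.
- exact: HM.
- exact: HMb.
- move=> cp k; have {}cp : 0 < c (t, x) by rewrite ltNge; apply: contra_neqN cp => /pospart_neg.
  move: cp; rewrite /c /= pospart_pos // subr_gt0 => /ltW h.
  have r0 : 0 <= rho - B * t by rewrite subr_ge0; case/andP: (cone_ge tseg).
  rewrite -(@ler_pXn2r R 2) ?nnegrE // real_normK ?num_real //; apply: le_trans h.
  by rewrite (bigD1 k) //= lerDl sumr_ge0 // => j _; exact: sqr_ge0.
- move=> cp i; have {}cp : 0 < c (t, x) by rewrite ltNge; apply: contra_neqN cp => /pospart_neg.
  by move: cp; rewrite /c /= pospart_pos // subr_gt0 => h; exact: (@eqn i (t, x)).
Qed.

Let Psi_ge0 p : 0 <= Psi p.
Proof.
rewrite mulr_ge0 ?sqr_ge0 //; apply: sumr_ge0 => i _.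
by rewrite !addr_ge0 ?sqr_ge0 // mulr_ge0 ?sqr_ge0 // sumr_ge0 // => k _; exact: sqr_ge0.
Qed.

(** The integral A(t) of the energy density e with weight (pospart c)^2 over a
    cube containing the cone satisfies A' <= K3 A and A(0) <= 0. Integrating
    over a cube with a C^1 weight that vanishes outside the cone avoids
    integrals over balls and spheres. *)
Lemma cone_uniqueness i (p : ST) : 0 < p.1 < t1 ->
  \sum_(k < n) p.2 0 k ^+ 2 < (rho - B * p.1) ^+ 2 -> z i p = 0.
Proof.
case: p => t x /= tt xr; have /andP[t0 t1t] := tt.
have [K3 HK3] := A_rate.
have A0 : A 0 <= 0.
  rewrite /A (_ : (fun x => _) = fun=> 0) ?boxint0 //; apply: funext => y; rewrite /Psi.
  have [cy|cy] := leP (c (0, y)) 0; first by rewrite pospart_neg // expr0n mul0r.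
  rewrite [e _]big1 ?mulr0 // => j _.
  have yr : \sum_(k < n) y 0 k ^+ 2 < rho ^+ 2.
    by move: cy; rewrite /c /= pospart_pos // mulr0 subr0 subr_gt0.
  have [-> -> zx0] := @init (0, y) (lexx _) yr j.
  rewrite big1 ?expr0n ?mulr0 ?addr0 // => k _; by rewrite zx0 expr0n.
have At : A t <= 0.
  apply: (@nonpos_rate_le0 R A (fun t => boxint rho (fun x => dPsi (t, x))) K3 t (ltW t0)) => //.
  - by move=> s st; apply: A_cont; exact: le_lt_trans st t1t.
  - by move=> s /andP[s0 st]; apply: A_derive; rewrite s0 (lt_trans st).
  - by move=> s /andP[s0 st]; apply: HK3; rewrite s0 (lt_trans st).
have cA : continuous (fun x => Psi (t, x)) by move=> y; apply: slice; exact: Psi_cont.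
have /andP[h1 h2] : 0 <= B * t <= rho by apply: cone_ge; rewrite !ltW.
have xk k : `|x 0 k| < rho.
  rewrite -(@ltr_pXn2r R 2) ?nnegrE ?(ltW rho0) // real_normK ?num_real //.
  apply: (@lt_le_trans _ _ ((rho - B * t) ^+ 2)).
    by apply: le_lt_trans xr; rewrite (bigD1 k) //= lerDl sumr_ge0 // => j _; exact: sqr_ge0.
  by rewrite lerXn2r ?nnegrE ?subr_ge0 ?(ltW rho0) // gerBl.
have : Psi (t, x) = 0 by exact: (boxint_eq0 rho0 cA (fun y => Psi_ge0 (t, y)) At xk).
have cp : 0 < c (t, x) by rewrite /c /= pospart_pos ?(ltW t0) // subr_gt0.
move/eqP; rewrite /Psi mulf_eq0 sqrf_eq0 pospart_pos ?(ltW cp) // gt_eqF //= => /eqP.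
move/psumr_eq0P => H; have {H} := H _ i isT.
have y0 : 0 <= b t ^+ 2 * \sum_(k < n) zx i k (t, x) ^+ 2.
  by rewrite mulr_ge0 ?sqr_ge0 // sumr_ge0 // => k _; exact: sqr_ge0.
move=> H; have : z i (t, x) ^+ 2 <= 0.
  rewrite -H; last first.
    move=> j _; rewrite !addr_ge0 ?sqr_ge0 // mulr_ge0 ?sqr_ge0 // sumr_ge0 // => k _; exact: sqr_ge0.
  by rewrite lerDr addr_ge0 ?sqr_ge0.
by rewrite le_eqVlt ltNge sqr_ge0 orbF sqrf_eq0 => /eqP.
Qed.
End cone_uniqueness.

(** * Local Lipschitz comparison of Christoffel symbols *)

Section comparison.
Variables (R : realType) (T : topologicalType) (P : T) (d : T -> R).
Implicit Types F G : T -> R.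

(** Near P, the difference of F and G is bounded by a multiple of the gauge d.
    Unlike a Lipschitz condition, this passes to sums, products, determinants
    and inverses without tracking of constants, and a covering argument makes it
    uniform on compact sets. *)
Definition comparable_at F G :=
  [/\ {for P, continuous F}, {for P, continuous G} &
      exists2 C : R, 0 <= C & \forall q \near P, `|F q - G q| <= C * d q].

Lemma continuous_near_bounded F : {for P, continuous F} ->
  exists2 C : R, 0 <= C & \forall q \near P, `|F q| <= C.
Proof.
move=> cF; exists (`|F P| + 1); first by rewrite addr_ge0.
move/cvgrPdist_le: cF => /(_ 1 ltr01); apply: filterS => q h.
rewrite (_ : F q = F P - (F P - F q)); last by ring.
by apply: (le_trans (ler_normB _ _)); rewrite lerD2l.
Qed.

Lemma comparable_near F G F' G' : (\forall q \near P, F q = F' q) -> (\forall q \near P, G q = G' q) ->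
  comparable_at F G -> comparable_at F' G'.
Proof.
move=> FF' GG' [cF cG [C C0 HC]]; split.
- rewrite /prop_for /continuous_at -(nbhs_singleton FF'); apply: cvg_trans cF.
  exact: near_eq_cvg FF'.
- rewrite /prop_for /continuous_at -(nbhs_singleton GG'); apply: cvg_trans cG.
  exact: near_eq_cvg GG'.
by exists C => //; near do [idtac]; near=> q; rewrite -(near FF' q) // -(near GG' q) //; near: q.
Unshelve. all: by end_near. Qed.

Lemma comparable_cst (c : R) : comparable_at (fun=> c) (fun=> c).
Proof.
split; try exact: cst_continuous.
by exists 0 => //; apply: nearW => q; rewrite subrr normr0 mul0r.
Qed.

Lemma comparable_refl F : {for P, continuous F} -> comparable_at F F.
Proof.
move=> cF; split => //; exists 0 => //; apply: nearW => q.
by rewrite subrr normr0 mul0r.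
Qed.

Lemma comparable_gauge F G : {for P, continuous F} -> {for P, continuous G} ->
  (forall q, `|F q - G q| <= d q) -> comparable_at F G.
Proof.
by move=> cF cG FG; split => //; exists 1 => //; apply: nearW => q; rewrite mul1r.
Qed.

Lemma comparable_add F G F' G' : comparable_at F G -> comparable_at F' G' ->
  comparable_at (fun q => F q + F' q) (fun q => G q + G' q).
Proof.
move=> [cF cG [C C0 HC]] [cF' cG' [C' C0' HC']]; split; try exact: ctp_add.
exists (C + C'); first exact: addr_ge0.
near=> q; have h := near HC q; have h' := near HC' q.
rewrite (_ : _ - _ = (F q - G q) + (F' q - G' q)); last by ring.
by apply: (le_trans (ler_normD _ _)); rewrite mulrDl lerD ?h ?h' //; near: q.
Unshelve. all: by end_near. Qed.

Lemma comparable_mul F G F' G' : comparable_at F G -> comparable_at F' G' ->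
  comparable_at (fun q => F q * F' q) (fun q => G q * G' q).
Proof.
move=> [cF cG [C C0 HC]] [cF' cG' [C' C0' HC']]; split; try exact: ctp_mul.
have [A A0 HA] := continuous_near_bounded cF'; have [A' A0' HA'] := continuous_near_bounded cG.
exists (C * A + A' * C'); first by rewrite addr_ge0 ?mulr_ge0.
near=> q.
have h : `|F q - G q| <= C * d q by near: q.
have h' : `|F' q - G' q| <= C' * d q by near: q.
have b : `|F' q| <= A by near: q.
have b' : `|G q| <= A' by near: q.
rewrite (_ : _ - _ = (F q - G q) * F' q + G q * (F' q - G' q)); last by ring.
apply: (le_trans (ler_normD _ _)); rewrite [X in _ <= X]mulrDl lerD // normrM.
  by rewrite (_ : C * A * d q = (C * d q) * A) ?ler_pM //; ring.
by rewrite -mulrA ler_pM.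
Unshelve. all: by end_near. Qed.

Lemma comparable_opp F G : comparable_at F G -> comparable_at (fun q => - F q) (fun q => - G q).
Proof.
move=> [cF cG [C C0 HC]]; split; [exact: cvgN|exact: cvgN|exists C => //].
by apply: filterS HC => q; rewrite -opprD normrN.
Qed.

Lemma comparable_sum I (r : seq I) (Q : pred I) (F G : I -> T -> R) :
  (forall i, Q i -> comparable_at (F i) (G i)) ->
  comparable_at (fun q => \sum_(i <- r | Q i) F i q) (fun q => \sum_(i <- r | Q i) G i q).
Proof.
move=> H; elim: r => [|i r IH].
  by apply: (comparable_near _ _ (comparable_cst 0)); apply: nearW => q; rewrite big_nil.
have [Qi|Qi] := boolP (Q i).
  by apply: (comparable_near _ _ (comparable_add (H i Qi) IH)); apply: nearW => q; rewrite big_cons Qi.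
by apply: (comparable_near _ _ IH); apply: nearW => q; rewrite big_cons (negPf Qi).
Qed.

Lemma comparable_prod I (r : seq I) (F G : I -> T -> R) :
  (forall i, comparable_at (F i) (G i)) ->
  comparable_at (fun q => \prod_(i <- r) F i q) (fun q => \prod_(i <- r) G i q).
Proof.
move=> H; elim: r => [|i r IH].
  by apply: (comparable_near _ _ (comparable_cst 1)); apply: nearW => q; rewrite big_nil.
by apply: (comparable_near _ _ (comparable_mul (H i) IH)); apply: nearW => q; rewrite big_cons.
Qed.

Lemma comparable_inv F G : F P != 0 -> G P != 0 -> comparable_at F G ->
  comparable_at (fun q => (F q)^-1) (fun q => (G q)^-1).
Proof.
move=> F0 G0 [cF cG [C C0 HC]].
have iF : {for P, continuous (fun q => (F q)^-1)} by exact: cvgV.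
have iG : {for P, continuous (fun q => (G q)^-1)} by exact: cvgV.
split => //.
have [A A0 HA] := continuous_near_bounded iF; have [A' A0' HA'] := continuous_near_bounded iG.
exists (A * A' * C); first by rewrite !mulr_ge0.
have nF : \forall q \near P, F q != 0 by exact: (cvgr_neq0 (F P) cF F0).
have nG : \forall q \near P, G q != 0 by exact: (cvgr_neq0 (G P) cG G0).
near=> q.
have fq : F q != 0 by near: q.
have gq : G q != 0 by near: q.
have h : `|F q - G q| <= C * d q by near: q.
have b : `|(F q)^-1| <= A by near: q.
have b' : `|(G q)^-1| <= A' by near: q.
rewrite (_ : _ - _ = - ((F q)^-1 * (G q)^-1 * (F q - G q))); last by field; rewrite fq gq.
by rewrite normrN !normrM -[A * A' * C * d q]mulrA !ler_pM.
Unshelve. all: by end_near. Qed.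

Lemma comparable_det m (F G : T -> 'M[R]_m) :
  (forall i j, comparable_at (fun q => F q i j) (fun q => G q i j)) ->
  comparable_at (fun q => \det (F q)) (fun q => \det (G q)).
Proof.
move=> H; apply: comparable_sum => s _; apply: comparable_mul; first exact: comparable_cst.
by apply: (@comparable_prod _ _ (fun i q => F q i _) (fun i q => G q i _)) => i; exact: H.
Qed.

Lemma comparable_invmx m (F G : T -> 'M[R]_m) i j :
  (\forall q \near P, \det (F q) != 0) -> (\forall q \near P, \det (G q) != 0) ->
  (forall i j, comparable_at (fun q => F q i j) (fun q => G q i j)) ->
  comparable_at (fun q => invmx (F q) i j) (fun q => invmx (G q) i j).
Proof.
move=> dF dG H.
have inv (M : 'M[R]_m) : \det M != 0 -> (\det M)^-1 * ((-1) ^+ (j + i) * \det (row' j (col' i M))) = invmx M i j.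
  by move=> dM; rewrite /invmx unitmxE unitfE dM !mxE.
have D := comparable_inv (nbhs_singleton dF) (nbhs_singleton dG) (comparable_det H).
have D2 : comparable_at (fun q => \det (row' j (col' i (F q)))) (fun q => \det (row' j (col' i (G q)))).
  apply: comparable_det => p q; apply: comparable_near (H (lift j p) (lift i q)); apply: nearW => x; by rewrite !mxE.
have := comparable_mul D (comparable_mul (comparable_cst ((-1) ^+ (j + i))) D2).
by apply: comparable_near; [apply: filterS dF|apply: filterS dG] => q /inv.
Qed.

End comparison.

(** The coordinates of x are changed into those of y one at a time; the
    intermediate points stay in the ball, which is a cube for the norm of row
    vectors. *)
Lemma partials_lipschitz (R : realType) (m : nat) (f : 'rV[R]_m -> R) (g : 'I_m -> 'rV[R]_m -> R)
    (P : 'rV[R]_m) (r M : R) :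
  (forall k x, ball P r x -> is_derive x (delta_mx 0 k) (f : 'rV[R]_m -> R^o) (g k x)) ->
  (forall k x, ball P r x -> `|g k x| <= M) ->
  forall x y, ball P r x -> ball P r y -> `|f x - f y| <= M * \sum_(k < m) `|x 0 k - y 0 k|.
Proof.
move=> df gM x y Px Py.
have inball (z : 'rV[R]_m) : (forall k, `|P 0 k - z 0 k| < r) -> ball P r z.
  by case: Px => r0 _ h; split => // i j; rewrite ord1 -ball_normE /ball_ /=.
have ballE (z : 'rV[R]_m) : ball P r z -> forall k, `|P 0 k - z 0 k| < r.
  by move=> [_ h] k; have := h 0 k; rewrite -ball_normE /ball_ /=.
pose mix (s : seq 'I_m) : 'rV[R]_m := \row_j (if j \in s then y 0 j else x 0 j).
have mixP s : ball P r (mix s).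
  by apply: inball => k; rewrite mxE; case: ifP => _; apply: ballE.
suff step s : `|f x - f (mix s)| <= M * \sum_(k <- s) `|x 0 k - y 0 k|.
  have := step (index_enum _); congr (`|_ - f _| <= _).
  by apply/rowP => j; rewrite mxE mem_index_enum.
elim: s => [|k s IH].
  rewrite big_nil mulr0 (_ : mix [::] = x) ?subrr ?normr0 //.
  by apply/rowP => j; rewrite mxE in_nil.
rewrite big_cons mulrDr (_ : f x - _ = (f (mix s) - f (mix (k :: s))) + (f x - f (mix s))); last by ring.
apply: (le_trans (ler_normD _ _)); apply: lerD => //.
have M0 : 0 <= M := le_trans (normr_ge0 _) (gM k x Px).
pose c := mix s 0 k - y 0 k.
have ck : `|c| <= `|x 0 k - y 0 k|.
  by rewrite /c mxE; case: ifP => _ //; rewrite subrr normr0.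
have mixE : mix s = mix (k :: s) + c *: delta_mx 0 k.
  apply/rowP => j; rewrite !mxE eqxx /= in_cons.
  by have [->|jk] := eqVneq j k; rewrite ?mulr1 ?mulr0 ?addr0 // /c mxE addrC subrK.
pose line (h : R) : 'rV[R]_m := mix (k :: s) + (h * c) *: delta_mx 0 k.
have lineP h : 0 <= h <= 1 -> ball P r (line h).
  move=> /andP[h0 h1]; apply: inball => j; have := ballE _ (mixP s) j; have := ballE _ (mixP (k :: s)) j.
  have -> : line h 0 j = (1 - h) * mix (k :: s) 0 j + h * mix s 0 j.
    by rewrite [in mix s]mixE /line !mxE; ring.
  have -> : P 0 j - ((1 - h) * mix (k :: s) 0 j + h * mix s 0 j) =
     (1 - h) * (P 0 j - mix (k :: s) 0 j) + h * (P 0 j - mix s 0 j) by ring.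
  move: (P 0 j - mix (k :: s) 0 j) (P 0 j - mix s 0 j) => u v.
  rewrite !ltr_norml => /andP[u1 u2] /andP[v1 v2].
  have h1' : 0 <= 1 - h by rewrite subr_ge0.
  have r1 : u <= r := ltW u2.
  have [->|hh] := eqVneq h 0; first by rewrite subr0 !mul1r mul0r addr0 u1.
  have {hh} h0' : 0 < h by rewrite lt_neqAle eq_sym hh.
  by apply/andP; split; nra.
have dl (h : R) : 0 <= h <= 1 -> is_derive h (1 : R) (fun h => f (line h)) (c * g k (line h)).
  move=> hh; have /is_derive_line H := df k _ (lineP h hh); apply/is_derive_line.
  have hc : is_derive (0 : R) (1 : R) (fun u : R => u * c) c by isder; ring.
  have H' : is_derive ((0 : R) * c) (1 : R) (fun u : R => f (u *: delta_mx 0 k + line h)) (g k (line h)).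
    by rewrite mul0r.
  have K := @is_derive_chain R R (fun u : R => f (u *: delta_mx 0 k + line h)) (fun u : R => u * c) 0 1 _ _ H' hc.
  rewrite mulrC; apply: isd_ext K => u /=.
  by congr f; rewrite /line [u%:A]mulr1 mulrDl scalerDl addrCA addrA.
have := @deriv_norm_le R _ _ 0 1 (`|x 0 k - y 0 k| * M) ler01 dl.
have -> : line 1 = mix s by rewrite /line mul1r -mixE.
have -> : line 0 = mix (k :: s) by rewrite /line mul0r scale0r addr0.
move=> H; have {H} := H _; rewrite subr0 mulr1 => H.
apply: (@le_trans _ _ (`|x 0 k - y 0 k| * M)); last by rewrite mulrC.
apply: H => h hh.
by rewrite normrM; apply: ler_pM => //; apply: gM; exact: lineP.
Qed.

Section composition.
Variables (R : realType) (T : topologicalType) (m : nat) (P : T) (d : T -> R) (u U : T -> 'rV[R]_m).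
Hypothesis d_ge0 : forall q, 0 <= d q.
Hypothesis d_cont : {for P, continuous d}.
Hypothesis u_cont : {for P, continuous u}.
Hypothesis U_cont : {for P, continuous U}.
Hypothesis uU : forall q k, `|u q 0 k - U q 0 k| <= d q.
Variable Omega : set 'rV[R]_m.
Hypothesis openOmega : open Omega.
Hypothesis OmegauP : Omega (u P).
Hypothesis OmegaUP : Omega (U P).

Lemma near_Omega (v : T -> 'rV[R]_m) : {for P, continuous v} -> Omega (v P) -> \forall q \near P, Omega (v q).
Proof. by move=> cv Ov; apply: cv; apply: open_nbhs_nbhs; split. Qed.

(** If u P and U P differ, then d does not vanish near P and boundedness is
    enough. Otherwise both maps stay in a small ball around the common value,
    where the partial derivatives of f are bounded. *)
Lemma comparable_comp (f : 'rV[R]_m -> R) : Ck (W := R^o) 1 Omega f ->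
  comparable_at P d (fun q => f (u q)) (fun q => f (U q)).
Proof.
move=> [cf0 df].
have cf x : Omega x -> {for x, continuous f}.
  by move=> Ox; move: cf0; rewrite continuous_open_subspace //; apply; rewrite inE.
have cu : {for P, continuous (fun q => f (u q))}.
  by apply: (@continuous_comp _ _ _ u f) => //; exact: cf.
have cU : {for P, continuous (fun q => f (U q))}.
  by apply: (@continuous_comp _ _ _ U f) => //; exact: cf.
split => //.
have [uUP|uUP] := eqVneq (u P) (U P); last first.
  have dP : 0 < d P.
    rewrite lt_neqAle d_ge0 andbT; apply: contra_neq uUP => dP.
    by apply/rowP => k; apply/eqP; rewrite -subr_eq0 -normr_le0 dP.
  have [C C0 HC] := continuous_near_bounded (ctp_sub cu cU).
  exists (C / (d P / 2)); first by rewrite divr_ge0 // divr_ge0 // ltW.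
  have dq : \forall q \near P, d P / 2 < d q.
    by apply: (cvgr_gt (d P) d_cont); rewrite ltr_pdivrMr // mulr_natr mulr2n ltrDl.
  near=> q; have h : `|f (u q) - f (U q)| <= C by near: q.
  have h2 : d P / 2 < d q by near: q.
  by apply: (le_trans h); rewrite mulrAC ler_pdivlMr ?divr_gt0 //; apply: ler_wpM2l => //; exact: ltW.
have Oint x : Omega x -> Omega° x by move: openOmega => /interior_id ->.
have /choice[g Hg] : forall k : 'I_m, exists g : 'rV[R]_m -> R^o, Ck 0 Omega g /\
    (forall x, Omega° x -> is_derive x (delta_mx 0 k) (f : 'rV[R]_m -> R^o) (g x)).
  by move=> k; exact: df.
have [M M0 HM] : exists2 M : R, 0 <= M & \forall x \near u P, forall k, `|g k x| <= M.
  have /choice[M HM] : forall k, exists M : R, 0 <= M /\ \forall x \near u P, `|g k x| <= M.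
    move=> k; have [[cg _] _] := Hg k.
    have cgP : {for u P, continuous (g k : 'rV[R]_m -> R)}.
      by have := cg; rewrite (continuous_open_subspace _ openOmega); apply; rewrite inE.
    by have [M] := continuous_near_bounded cgP; exists M.
  exists (\sum_k M k); first by apply: sumr_ge0 => k _; case: (HM k).
  apply: (@filter_forall _ _ _ (nbhs (u P))) => k.
  have [_] := HM k; apply: filterS => x /le_trans; apply.
  rewrite (bigD1 k) //= lerDl sumr_ge0 // => j _; by case: (HM j).
have : \forall x \near u P, Omega x /\ forall k, `|g k x| <= M.
  near=> x; split; last by near: x.
  near: x; by apply: open_nbhs_nbhs; split.
move=> /nbhs_ballP[r /= r0 Hr].
have L := @partials_lipschitz R m f g (u P) r M
  (fun k x h => (Hg k).2 x (Oint _ (Hr x h).1)) (fun k x h => (Hr x h).2 k).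
exists (M * m%:R); first by rewrite mulr_ge0.
have nu : \forall q \near P, ball (u P) r (u q) by apply: u_cont; exact: nbhsx_ballx.
have nU : \forall q \near P, ball (u P) r (U q) by rewrite uUP; apply: U_cont; exact: nbhsx_ballx.
near=> q; apply: (le_trans (L _ _ _ _)); [by near: q|by near: q|].
rewrite -mulrA ler_wpM2l // (_ : m%:R * d q = \sum_(k < m) d q); first by apply: ler_sum => k _.
by rewrite sumr_const card_ord mulr_natl.
Unshelve. all: by end_near. Qed.

End composition.

(** A vector in the kernel would have length zero. *)
Lemma metric_det_neq0 (R : realType) (m : nat) (Omega : set 'rV[R]_m) (h : 'rV[R]_m -> 'M[R]_m) x :
  riemannian_metric Omega h -> Omega x -> \det (h x) != 0.
Proof.
move=> [_ _ _ pos] Ox; apply/negP => /eqP /eqP /det0P[v v0 vh].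
by have := pos x v Ox v0; rewrite vh mul0mx mxE ltxx.
Qed.

(** The Christoffel symbols are rational expressions in the metric and its first
    derivatives, with denominator the determinant of the metric. *)
Lemma christoffel_comparable (R : realType) (m : nat) (Omega : set 'rV[R]_m) (h : 'rV[R]_m -> 'M[R]_m)
  (T : topologicalType) (P : T) (d : T -> R) (u U : T -> 'rV[R]_m) i j k :
  riemannian_metric Omega h -> (forall q, 0 <= d q) -> {for P, continuous d} ->
  {for P, continuous u} -> {for P, continuous U} -> (forall q k, `|u q 0 k - U q 0 k| <= d q) ->
  Omega (u P) -> Omega (U P) ->
  comparable_at P d (fun q => christoffel h i j k (u q)) (fun q => christoffel h i j k (U q)).
Proof.
move=> rh d0 cd cu cU uU Ou OU; have [oO sh _ _] := rh.
have nu := near_Omega oO cu Ou; have nU := near_Omega oO cU OU.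
have D (l p q : 'I_m) : comparable_at P d
    (fun x => 'D_(delta_mx 0 l) (fun v : 'rV[R]_m => h v p q : R^o) (u x))
    (fun x => 'D_(delta_mx 0 l) (fun v : 'rV[R]_m => h v p q : R^o) (U x)).
  have [_ /(_ (delta_mx 0 l))[g [Cg dg]]] := sh p q 2%N.
  have E v : Omega v -> g v = 'D_(delta_mx 0 l) (fun v : 'rV[R]_m => h v p q : R^o) v.
    move=> Ov; have [//|_ ->//] := dg v.
    by move/interior_id : oO => ->.
  have := comparable_comp d0 cd cu cU uU oO Ou OU Cg.
  by apply: comparable_near; [move: nu|move: nU]; apply: filterS => x /E.
rewrite /christoffel; apply: comparable_mul; first exact: comparable_cst.
apply: comparable_sum => l _; apply: comparable_mul; last first.
  by apply: comparable_add; [apply: comparable_add|apply: comparable_opp]; exact: D.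
apply: comparable_invmx.
- by apply: filterS nu => q; exact: metric_det_neq0 rh.
- by apply: filterS nU => q; exact: metric_det_neq0 rh.
- by move=> p q; exact: (comparable_comp d0 cd cu cU uU oO Ou OU (sh p q 1%N)).
Qed.

(** * Uniqueness for the wave map system *)

Section nonlinear_uniqueness.
Variables (R : realType) (n m : nat).
Local Notation ST := (R^o * 'rV[R]_n)%type.

(** A map together with its derivatives up to order 2 as explicit functions. For
    a solution these are continuous extensions of the derivatives to t <= 0,
    where the derivatives themselves may not exist. *)
Record jet := Jet {
  jv : 'I_m -> ST -> R; jt : 'I_m -> ST -> R; jtt : 'I_m -> ST -> R;
  jx : 'I_m -> 'I_n -> ST -> R; jxt : 'I_m -> 'I_n -> ST -> R; jxx : 'I_m -> 'I_n -> ST -> R }.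

Definition regular_jet (t1 : R) (J : jet) :=
  [/\ forall i p, p.1 < t1 -> [/\ {for p, continuous (jv J i)}, {for p, continuous (jt J i)} &
        forall k, {for p, continuous (jx J i k)}],
      forall i p, 0 < p.1 < t1 -> {for p, continuous (jtt J i)} /\
        forall k, {for p, continuous (jxt J i k)} /\ {for p, continuous (jxx J i k)},
      forall i p, 0 < p.1 < t1 -> is_derive p (dir_t R n) (jv J i : ST -> R^o) (jt J i p) /\
        is_derive p (dir_t R n) (jt J i : ST -> R^o) (jtt J i p) &
      forall i k p, 0 < p.1 < t1 -> [/\ is_derive p (dir_t R n) (jx J i k : ST -> R^o) (jxt J i k p),
        is_derive p (dir_x R k) (jt J i : ST -> R^o) (jxt J i k p) &
        is_derive p (dir_x R k) (jx J i k : ST -> R^o) (jxx J i k p)]].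

Variables (b db : R -> R) (Omega : set 'rV[R]_m) (h : 'rV[R]_m -> 'M[R]_m).

Definition chart_point (J : jet) (p : ST) : 'rV[R]_m := \row_i jv J i p.

Definition nonlinearity (J : jet) (i : 'I_m) (p : ST) : R :=
  \sum_(j < m) \sum_(k < m) christoffel h i j k (chart_point J p) *
    (jt J j p * jt J k p - b p.1 ^+ 2 * \sum_(l < n) jx J j l p * jx J k l p).

Definition solves_wave_map (t1 : R) (J : jet) := forall i p, 0 < p.1 < t1 ->
  jtt J i p - n%:R * (db p.1 / b p.1) * jt J i p - b p.1 ^+ 2 * \sum_(k < n) jxx J i k p +
  nonlinearity J i p = 0.

Hypothesis b_derive : forall t : R, is_derive t (1 : R) b (db t).
Hypothesis db_cont : continuous db.
Hypothesis b0 : forall t, 0 < b t.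
Hypothesis rh : riemannian_metric Omega h.

Let b_cont : continuous b. Proof. by move=> t; exact: is_derive_cont (b_derive t). Qed.
Let bt_cont (p : ST) : {for p, continuous (fun p : ST => b p.1)}.
Proof. by apply: (@ctp_comp _ _ _ (fun p : ST => p.1)); [exact: cvg_fst|exact: b_cont]. Qed.

(** No second derivatives enter, as the nonlinearity is of first order. *)
Definition gap2 (J J' : jet) (p : ST) : R :=
  \sum_(j < m) ((jt J j p - jt J' j p) ^+ 2 + (jv J j p - jv J' j p) ^+ 2 +
    \sum_(k < n) (jx J j k p - jx J' j k p) ^+ 2).

Lemma gap2_ge0 J J' p : 0 <= gap2 J J' p.
Proof.
apply: sumr_ge0 => j _; rewrite !addr_ge0 ?sqr_ge0 // sumr_ge0 // => k _; exact: sqr_ge0.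
Qed.

Lemma gap2_le J J' j p :
  [/\ (jt J j p - jt J' j p) ^+ 2 <= gap2 J J' p, (jv J j p - jv J' j p) ^+ 2 <= gap2 J J' p &
    forall k, (jx J j k p - jx J' j k p) ^+ 2 <= gap2 J J' p].
Proof.
have h0 i : 0 <= (jt J i p - jt J' i p) ^+ 2 + (jv J i p - jv J' i p) ^+ 2 +
    \sum_(k < n) (jx J i k p - jx J' i k p) ^+ 2.
  rewrite !addr_ge0 ?sqr_ge0 // sumr_ge0 // => k _; exact: sqr_ge0.
have h1 : (jt J j p - jt J' j p) ^+ 2 + (jv J j p - jv J' j p) ^+ 2 +
    \sum_(k < n) (jx J j k p - jx J' j k p) ^+ 2 <= gap2 J J' p.
  by rewrite /gap2 (bigD1 j) //= lerDl sumr_ge0.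
have h2 : 0 <= \sum_(k < n) (jx J j k p - jx J' j k p) ^+ 2 by rewrite sumr_ge0 // => k _; exact: sqr_ge0.
split=> [||k]; apply: le_trans h1.
- by rewrite -addrA lerDl addr_ge0 ?sqr_ge0.
- by rewrite addrAC lerDr addr_ge0 ?sqr_ge0.
by rewrite (bigD1 k) //= addrCA lerDl !addr_ge0 ?sqr_ge0 // sumr_ge0 // => l _; exact: sqr_ge0.
Qed.

Let gap J J' p := Num.sqrt (gap2 J J' p).

Let sqr_le_gap J J' p (y : R) : y ^+ 2 <= gap2 J J' p -> `|y| <= gap J J' p.
Proof. by move=> H; rewrite -sqrtr_sqr ler_wsqrtr. Qed.

Section two_solutions.
Variables (t1 : R) (J J' : jet).
Hypothesis rJ : regular_jet t1 J.
Hypothesis rJ' : regular_jet t1 J'.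
Hypothesis OJ : forall p, p.1 < t1 -> Omega (chart_point J p).
Hypothesis OJ' : forall p, p.1 < t1 -> Omega (chart_point J' p).

Let gap_cont (p : ST) : p.1 < t1 -> {for p, continuous (gap J J')}.
Proof.
move=> pt; apply: (@ctp_comp _ _ _ (gap2 J J') Num.sqrt); last exact: sqrt_continuous.
rewrite /gap2; have [H _ _ _] := rJ; have [H' _ _ _] := rJ'.
have K j := H j _ pt; have K' j := H' j _ pt.
ctp; by [case: (K i)|case: (K' i)|case: (K i) => _ _; exact|case: (K' i) => _ _; exact].
Qed.

Let leaf (P : ST) (F G : ST -> R) : {for P, continuous F} -> {for P, continuous G} ->
  (forall q, (F q - G q) ^+ 2 <= gap2 J J' q) -> comparable_at P (gap J J') F G.
Proof.
by move=> cF cG FG; apply: comparable_gauge => // q; exact: sqr_le_gap.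
Qed.

Let chart_cont J0 (p : ST) : regular_jet t1 J0 -> p.1 < t1 -> {for p, continuous (chart_point J0)}.
Proof.
move=> [H _ _ _] pt; apply: cvg_mx_entries => i j; rewrite /chart_point mxE.
by under eq_fun do rewrite mxE; have [] := H j p pt.
Qed.

Lemma nonlinearity_comparable i (P : ST) : P.1 < t1 ->
  comparable_at P (gap J J') (nonlinearity J i) (nonlinearity J' i).
Proof.
move=> pt; have [H _ _ _] := rJ; have [H' _ _ _] := rJ'.
have tt j : comparable_at P (gap J J') (jt J j) (jt J' j).
  apply: leaf; [by have [] := H j P pt|by have [] := H' j P pt|].
  by move=> q; have [] := gap2_le J J' j q.
have xx j k : comparable_at P (gap J J') (jx J j k) (jx J' j k).
  apply: leaf; [by have [_ _] := H j P pt; exact|by have [_ _] := H' j P pt; exact|].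
  by move=> q; have [_ _] := gap2_le J J' j q; exact.
have bb : comparable_at P (gap J J') (fun p => b p.1 ^+ 2) (fun p => b p.1 ^+ 2).
  by apply: comparable_refl; apply: ctp_sqr; exact: bt_cont.
apply: comparable_sum => j _; apply: comparable_sum => k _; apply: comparable_mul.
  apply: (christoffel_comparable _ _ _ rh) => //.
  - by move=> q; exact: sqrtr_ge0.
  - exact: gap_cont.
  - exact: chart_cont.
  - exact: chart_cont.
  - by move=> q l; rewrite !mxE; apply: sqr_le_gap; have [] := gap2_le J J' l q.
  - exact: OJ.
  - exact: OJ'.
apply: comparable_add; first exact: comparable_mul.
apply: comparable_opp; apply: comparable_mul; first exact: bb.
by apply: comparable_sum => l _; exact: comparable_mul.
Qed.

(** Compactness of the box upgrades the comparison near each point to a uniform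
    constant. *)
Lemma nonlinearity_lipschitz (rho t2 : R) i : t2 < t1 -> exists2 C : R, 0 <= C & forall p : ST, 0 <= p.1 <= t2 ->
  (forall k, `|p.2 0 k| <= rho) -> (nonlinearity J i p - nonlinearity J' i p) ^+ 2 <= C * gap2 J J' p.
Proof.
move=> t21.
pose B : set ST := `[0, t2]%classic `*` [set x : 'rV[R]_n | forall k, `[- rho, rho]%classic (x 0 k)].
have /compact_near_coveringP cB : compact B.
  by apply: compact_setX; [exact: segment_compact|apply: (@rV_compact R n (fun=> `[- rho, rho]%classic)) => k; exact: segment_compact].
have [C] : \forall C \near +oo, B `<=` (fun p : ST => `|nonlinearity J i p - nonlinearity J' i p| <= C * gap J J' p).
  apply: cB => p [/=]; rewrite in_itv /= => /andP[_ pt] _.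
  have [_ _ [C C0 HC]] := nonlinearity_comparable i (le_lt_trans pt t21).
  (* The property at a larger constant follows from that at C, as the gap is
     nonnegative. *)
  exists ([set q | `|nonlinearity J i q - nonlinearity J' i q| <= C * gap J J' q], [set D | C < D]).
    by split; [exact: HC|exists C; split; [exact: num_real|]].
  move=> [q D] /= [h1 /ltW h2]; apply: (le_trans h1); apply: ler_wpM2r h2; exact: sqrtr_ge0.
move=> [_ HC]; pose D := Num.max C 0 + 1.
have CD : C < D by rewrite /D ltr_pwDr // le_max lexx.
have D0 : 0 <= D by rewrite /D addr_ge0 // le_max lexx orbT.
exists (D ^+ 2); first exact: sqr_ge0.
move=> p pt px.
have Bp : B p.
  by split => /=; [rewrite in_itv|move=> k; rewrite in_itv /= -ler_norml].
have H := HC _ CD p Bp.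
rewrite -(sqr_sqrtr (gap2_ge0 J J' p)) -exprMn -[X in X <= _]real_normK ?num_real //.
by rewrite lerXn2r // nnegrE ?mulr_ge0 // sqrtr_ge0.
Qed.

End two_solutions.

(** The difference of two solutions satisfies a linear wave inequality, in which
    the difference of the nonlinearities is of order zero and one. A time t2 <
    t1 is chosen because nothing is known of the jets at t1. *)
Lemma wave_map_uniqueness (t1 rho B : R) (J J' : jet) : (0 < n)%N -> 0 < rho ->
  (forall t, n%:R * b t <= B) -> B * t1 <= rho ->
  regular_jet t1 J -> regular_jet t1 J' ->
  (forall p, p.1 < t1 -> Omega (chart_point J p)) ->
  (forall p, p.1 < t1 -> Omega (chart_point J' p)) ->
  solves_wave_map t1 J -> solves_wave_map t1 J' ->
  (forall p : ST, p.1 <= 0 -> \sum_(k < n) p.2 0 k ^+ 2 < rho ^+ 2 ->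
     forall i, [/\ jv J i p = jv J' i p, jt J i p = jt J' i p & forall k, jx J i k p = jx J' i k p]) ->
  forall i (p : ST), 0 < p.1 < t1 -> \sum_(k < n) p.2 0 k ^+ 2 < (rho - B * p.1) ^+ 2 ->
  jv J i p = jv J' i p.
Proof.
move=> n0 rho0 bB Bt1 rJ rJ' OJ OJ' sJ sJ' init i p /andP[p0 pt1] px.
have [t2 pt2 t21] : exists2 t2, p.1 < t2 & t2 < t1.
  by exists ((p.1 + t1) / 2); lra.
have B0 : 0 < B by apply: lt_le_trans (bB 0); rewrite mulr_gt0 // ltr0n.
have Bt2 : B * t2 <= rho by apply: le_trans Bt1; rewrite ler_wpM2l // ltW.
have /choice[C HC] : forall i, exists C : R, 0 <= C /\ forall p : ST, 0 <= p.1 <= t2 ->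
  (forall k, `|p.2 0 k| <= rho) -> (nonlinearity J i p - nonlinearity J' i p) ^+ 2 <= C * gap2 J J' p.
  by move=> j; have [C C0 HC] := nonlinearity_lipschitz rJ rJ' OJ OJ' rho j t21; exists C.
have cq : continuous (fun t => n%:R * (db t / b t)).
  move=> t; apply: (@ctp_mul R R t (fun=> n%:R) (fun t => db t / b t)); first exact: ctp_cst.
  apply: (@ctp_mul R R t db (fun t => (b t)^-1)); first exact: db_cont.
  by apply: cvgV; [rewrite gt_eqF|exact: b_cont].
have [M M0 HM] := segment_bounded 0 t2 cq.
have [HJ1 HJ2 HJ3 HJ4] := rJ; have [HK1 HK2 HK3 HK4] := rJ'.
pose K := 2 * M ^+ 2 + 2 * \sum_j C j.
have K0 : 0 <= K.
  by rewrite addr_ge0 // mulr_ge0 ?sqr_ge0 // sumr_ge0 // => j _; case: (HC j).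
have lt1 (q : ST) : 0 < q.1 < t2 -> 0 < q.1 < t1.
  by move=> /andP[-> qt]; exact: lt_trans qt t21.
have lt1' (q : ST) : q.1 < t2 -> q.1 < t1 by move=> qt; exact: lt_trans qt t21.
apply/eqP; rewrite -subr_eq0; apply/eqP.
apply: (@cone_uniqueness R n m b db t2 rho B K
  (fun i p => jv J i p - jv J' i p) (fun i p => jt J i p - jt J' i p) (fun i p => jtt J i p - jtt J' i p)
  (fun i k p => jx J i k p - jx J' i k p) (fun i k p => jxt J i k p - jxt J' i k p)
  (fun i k p => jxx J i k p - jxx J' i k p)) => //.
- by move=> j q /lt1' qt; apply: ctp_sub; [case: (HJ1 j q qt)|case: (HK1 j q qt)].
- by move=> j q /lt1' qt; apply: ctp_sub; [case: (HJ1 j q qt)|case: (HK1 j q qt)].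
- move=> j k q /lt1' qt; apply: ctp_sub; [have [_ _] := HJ1 j q qt|have [_ _] := HK1 j q qt]; exact.
- by move=> j q /lt1 qt; apply: ctp_sub; [case: (HJ2 j q qt)|case: (HK2 j q qt)].
- move=> j k q /lt1 qt; apply: ctp_sub; [have [_ /(_ k)[]] := HJ2 j q qt|have [_ /(_ k)[]] := HK2 j q qt]; by [].
- move=> j k q /lt1 qt; apply: ctp_sub; [have [_ /(_ k)[]] := HJ2 j q qt|have [_ /(_ k)[]] := HK2 j q qt]; by [].
- by move=> j q /lt1 qt; have [h1 _] := HJ3 j q qt; have [h2 _] := HK3 j q qt; exact: isd_sub.
- by move=> j q /lt1 qt; have [_ h1] := HJ3 j q qt; have [_ h2] := HK3 j q qt; exact: isd_sub.
- by move=> j k q /lt1 qt; have [h1 _ _] := HJ4 j k q qt; have [h2 _ _] := HK4 j k q qt; exact: isd_sub.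
- by move=> j k q /lt1 qt; have [_ h1 _] := HJ4 j k q qt; have [_ h2 _] := HK4 j k q qt; exact: isd_sub.
- by move=> j k q /lt1 qt; have [_ _ h1] := HJ4 j k q qt; have [_ _ h2] := HK4 j k q qt; exact: isd_sub.
- move=> q q0 qx j; have [e1 e2 e3] := init q q0 qx j; rewrite e1 e2 !subrr.
  by split => // k; rewrite e3 subrr.
- move=> j q qt qx; have qt' := lt1 q qt; have /andP[q0 /ltW qt2] := qt.
  have E1 := sJ j q qt'; have E2 := sJ' j q qt'.
  have qk k : `|q.2 0 k| <= rho.
    rewrite -(@ler_pXn2r R 2) ?nnegrE ?(ltW rho0) // real_normK ?num_real //.
    apply: (@le_trans _ _ ((rho - B * q.1) ^+ 2)).
      by apply: le_trans (ltW qx); rewrite (bigD1 k) //= lerDl sumr_ge0 // => l _; exact: sqr_ge0.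
    have Bq : B * q.1 <= rho by apply: le_trans Bt2; rewrite ler_wpM2l // ltW.
    by rewrite lerXn2r ?nnegrE ?subr_ge0 ?(ltW rho0) // gerBl mulr_ge0 // ltW.
  have tq : 0 <= (q.1 : R) <= t2 by rewrite (ltW q0) qt2.
  have [C0 /(_ q tq qk) h1] := HC j; have h2 := HM _ tq.
  have [h3 _ _] := gap2_le J J' j q; rewrite -/(gap2 J J' q).
  set D := nonlinearity J j q - nonlinearity J' j q in h1.
  have -> : jtt J j q - jtt J' j q - b q.1 ^+ 2 * \sum_(k < n) (jxx J j k q - jxx J' j k q) =
     n%:R * (db q.1 / b q.1) * (jt J j q - jt J' j q) - D.
    have -> : \sum_(k < n) (jxx J j k q - jxx J' j k q) = \sum_(k < n) jxx J j k q - \sum_(k < n) jxx J' j k q.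
      by rewrite sumrB.
    by rewrite /D; move: E1 E2; move: (n%:R * _) (\sum_(k < n) jxx J j k q) (\sum_(k < n) jxx J' j k q) => c X Y; lra.
  set c := n%:R * _ in h2 *; set y := jt J j q - _ in h3 *.
  have h4 : (c * y) ^+ 2 <= M ^+ 2 * gap2 J J' q.
    rewrite exprMn ler_pM ?sqr_ge0 // -[c ^+ 2]real_normK ?num_real //.
    by rewrite lerXn2r ?nnegrE // ltW.
  have h5 : C j * gap2 J J' q <= (\sum_j C j) * gap2 J J' q.
    rewrite ler_wpM2r ?gap2_ge0 // (bigD1 j) //= lerDl sumr_ge0 // => l _; by case: (HC l).
  rewrite /K mulrDl -(mulrA 2 (M ^+ 2)) -(mulrA 2 (\sum_j C j)); have := sqr_ge0 (c * y + D).
  move: h1 h4 h5; move: (c * y) D (C j * _) ((\sum_j C j) * _) (M ^+ 2 * _) => X Y u v w; lra.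
- by rewrite p0.
Qed.

End nonlinear_uniqueness.

(** * Solutions on the half-space as jets *)

Section half_space_extension.
Variables (R : realType) (n : nat).
Local Notation ST := (R^o * 'rV[R]_n)%type.

(** Extension to negative times by the value at time 0; it makes one-sided
    continuity at t = 0 into continuity on the whole space. *)
Definition time_ext (g : ST -> R) (p : ST) : R := g (pospart (p.1 : R), p.2).

Lemma time_ext_pos g (p : ST) : 0 <= p.1 -> time_ext g p = g p.
Proof. by case: p => t x /= t0; rewrite /time_ext /= pospart_pos. Qed.

Lemma time_ext_neg g (p : ST) : p.1 <= 0 -> time_ext g p = g (0, p.2).
Proof. by case: p => t x /= t0; rewrite /time_ext /= pospart_neg. Qed.

Lemma pos_near (p : ST) : 0 < p.1 -> \forall q \near p, 0 < q.1.
Proof.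
by move=> p0; have c : {for p, continuous (fun p : ST => p.1 : R)} by [exact: cvg_fst];
  exact: (cvgr_gt _ c).
Qed.

Lemma half_space_interior (p : ST) : 0 < p.1 -> (@half_space R n)° p.
Proof. by move=> /pos_near; apply: filterS => q /ltW. Qed.

Lemma time_ext_continuous g : {within @half_space R n, continuous g} -> continuous (time_ext g).
Proof.
move=> /subspace_continuousP cg p.
have c : (fun p : ST => (pospart (p.1 : R), p.2) : ST) q @[q --> p] --> ((pospart (p.1 : R), p.2) : ST).
  apply: (@cont_pair ST R^o _ (fun p : ST => pospart (p.1 : R)) snd p); last exact: cvg_snd.
  by apply: (@ctp_comp R ST p (fun p : ST => p.1)); [exact: cvg_fst|exact: pospart_continuous].
have := cg (pospart (p.1 : R), p.2) (pospart_ge0 _); apply: cvg_trans => A HA.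
have /c : nbhs ((pospart (p.1 : R), p.2) : ST) [set q | half_space q -> A (g q)] by exact: HA.
move=> H; apply: (@filterS _ (nbhs p) _ _ _ _ H) => q /=; apply; exact: pospart_ge0.
Qed.

Lemma time_ext_is_derive g (p v : ST) l : 0 < p.1 ->
  is_derive p v (g : ST -> R^o) l -> is_derive p v (time_ext g : ST -> R^o) l.
Proof.
move=> p0; apply: near_eq_is_derive.
by apply: filterS (pos_near p0) => q /ltW q0; rewrite time_ext_pos.
Qed.

(** The two mixed derivatives given by the definition of C^2 in the half-space
    are different functions a priori; they agree in the open half-space by
    Clairaut. *)
Lemma scalar_jet (v : ST -> R) : Ck (W := R^o) 2 (@half_space R n) v ->
  exists w : (ST -> R) * (ST -> R) * ('I_n -> ST -> R) * ('I_n -> ST -> R) * ('I_n -> ST -> R),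
  let: (vt, vtt, vx, vxt, vxx) := w in
  [/\ [/\ continuous (time_ext v), continuous vt, continuous vtt & forall k,
        [/\ continuous (vx k), continuous (vxt k) & continuous (vxx k)]],
      forall p : ST, 0 < p.1 -> is_derive p (dir_t R n) (v : ST -> R^o) (vt p) /\
         is_derive p (dir_t R n) (vt : ST -> R^o) (vtt p),
      forall p : ST, p.1 <= 0 -> vt p = vt (0, p.2) /\ forall k, vx k p = vx k (0, p.2) &
      forall k (p : ST), 0 < p.1 -> [/\ is_derive p (dir_x R k) (v : ST -> R^o) (vx k p),
         is_derive p (dir_t R n) (vx k : ST -> R^o) (vxt k p),
         is_derive p (dir_x R k) (vt : ST -> R^o) (vxt k p) &
         is_derive p (dir_x R k) (vx k : ST -> R^o) (vxx k p)]].
Proof.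
move=> [cv Dv].
have [gt [[cgt Dgt] dgt]] := Dv (dir_t R n).
have [gtt [[cgtt _] dgtt]] := Dgt (dir_t R n).
have /choice[gx Hgx] := fun k => Dv (dir_x R k).
have /choice[gtx Hgtx] := fun k => Dgt (dir_x R k).
have /choice[gxt Hgxt] := fun k => (Hgx k).1.2 (dir_t R n).
have /choice[gxx Hgxx] := fun k => (Hgx k).1.2 (dir_x R k).
have I := half_space_interior.
exists (time_ext gt, time_ext gtt, fun k => time_ext (gx k), fun k => time_ext (gxt k), fun k => time_ext (gxx k)).
have cxt k : continuous (time_ext (gxt k)) by apply: time_ext_continuous; case: (Hgxt k) => [[]].
have ctx k : continuous (time_ext (gtx k)) by apply: time_ext_continuous; case: (Hgtx k) => [[]].
have E g p : 0 < p.1 -> time_ext g p = g p by move=> /ltW; exact: time_ext_pos.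
split.
- split; [exact: time_ext_continuous|exact: time_ext_continuous|exact: time_ext_continuous|move=> k].
  split => //; first by apply: time_ext_continuous; case: (Hgx k) => [[]].
  by apply: time_ext_continuous; case: (Hgxx k) => [[]].
- move=> p p0; rewrite !E //; split; first by apply: dgt; exact: I.
  by apply: time_ext_is_derive => //; apply: dgtt; exact: I.
- by move=> p p0; split=> [|k]; rewrite !(time_ext_neg _ p0) time_ext_pos.
move=> k p p0; rewrite !E //.
have dxt : is_derive p (dir_t R n) (gx k : ST -> R^o) (gxt k p) by apply: (Hgxt k).2; exact: I.
have dtx : is_derive p (dir_x R k) (gt : ST -> R^o) (gtx k p) by apply: (Hgtx k).2; exact: I.
have Ext : gxt k p = gtx k p.
  have npos := pos_near p0.
  rewrite -(E (gxt k)) // -(E (gtx k)) //.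
  apply: (@mixed_derivatives R ST v (gx k) gt (time_ext (gxt k)) (time_ext (gtx k)) (dir_x R k) (dir_t R n) p).
  - by apply: filterS npos => q q0; apply: (Hgx k).2; exact: I.
  - by apply: filterS npos => q q0; apply: dgt; exact: I.
  - by apply: filterS npos => q q0; rewrite E //; apply: (Hgxt k).2; exact: I.
  - by apply: filterS npos => q q0; rewrite E //; apply: (Hgtx k).2; exact: I.
  - exact: cxt.
  - exact: ctx.
split.
- by apply: (Hgx k).2; exact: I.
- exact: time_ext_is_derive.
- by rewrite Ext; exact: time_ext_is_derive.
by apply: time_ext_is_derive => //; apply: (Hgxx k).2; exact: I.
Qed.

(** The one-sided derivative at time 0 is the limit of the derivative at
    positive times, by the mean value theorem. *)
Lemma initial_velocity (v vt : ST -> R) (x : 'rV[R]_n) (l : R) :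
  continuous (time_ext v) -> continuous vt ->
  (forall p : ST, 0 < p.1 -> is_derive p (dir_t R n) (v : ST -> R^o) (vt p)) ->
  (t^-1 * (v (t, x) - v (0, x))) @[t --> (0 : R)^'+] --> l -> vt (0, x) = l.
Proof.
move=> cv cvt dv vl.
have cline (g : ST -> R) : continuous g -> continuous (fun t : R => g (t, x)).
  move=> cg t; apply: (@continuous_comp _ _ _ (fun t : R => (t, x) : ST) g); last exact: cg.
  by apply: (@cont_pair R R^o _ id (fun=> x) t); [exact: cvg_id|exact: cst_continuous].
apply/eqP; rewrite eq_sym -subr_eq0 -normr_le0; apply/ler_addgt0Pr => e e0; rewrite add0r.
have vl' : (fun t => t^-1 * (v (t, x) - v (0, x)) - vt (0, x)) t @[t --> (0 : R)^'+] --> l - vt (0, x).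
  by apply: cvgB => //; exact: cvg_cst.
apply: (norm_cvg_le _ vl').
have /cvgrPdist_le /(_ e e0) /nbhs_ballP[d /= d0 Hd] := cline _ cvt 0.
near=> t.
have t0 : 0 < t by [].
have td : t < d by near: t; exact: nbhs_right_lt.
have dE s : s \in `]0, t[%R -> is_derive s (1 : R) (fun s => time_ext v (s, x)) (vt (s, x)).
  rewrite in_itv /= => /andP[s0 _].
  have /is_derive_line H := @time_ext_is_derive v (s, x) _ _ s0 (dv (s, x) s0); apply/is_derive_line.
  apply: isd_ext H => h; congr time_ext.
  by apply: injective_projections => //=; rewrite scaler0 add0r.
have [|s] := MVT t0 dE.
  by apply: continuous_subspaceT; exact: cline.
rewrite in_itv /= => /andP[s0 st]; rewrite !time_ext_pos ?(ltW t0) //= => ->.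
rewrite subr0 mulrCA mulVf ?gt_eqF // mulr1 distrC; apply: Hd.
by rewrite -ball_normE /ball_ /= sub0r normrN gtr0_norm // (lt_trans st).
Unshelve. all: by end_near. Qed.

(** The space derivative is only given for positive times; its extension at t =
    0 is obtained from space increments of v(t, .) as t -> 0. *)
Lemma initial_gradient (v vx : ST -> R) (k : 'I_n) (x : 'rV[R]_n) :
  continuous (time_ext v) -> continuous vx ->
  (forall p : ST, 0 < p.1 -> is_derive p (dir_x R k) (v : ST -> R^o) (vx p)) ->
  (forall y, v (0, y) = 0) -> vx (0, x) = 0.
Proof.
move=> cv cvx dv v0.
apply/eqP; rewrite -normr_le0; apply/ler_addgt0Pr => e e0; rewrite add0r.
pose pt (q : R * R) : ST := (q.1, q.2 *: delta_mx 0 k + x).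
have cpt : continuous pt.
  move=> q; apply: (@cont_pair (R * R)%type R^o _ fst (fun q => q.2 *: delta_mx 0 k + x) q); first exact: cvg_fst.
  by apply: cvgD; [apply: cvgZr_tmp; exact: cvg_snd|exact: cvg_cst].
have cvp : {for (0, 0), continuous (fun q => vx (pt q))}.
  by apply: (@continuous_comp _ _ _ pt vx); [exact: cpt|exact: cvx].
have : \forall q \near ((0, 0) : R * R), `|vx (pt (0, 0)) - vx (pt q)| <= e.
  by move/cvgrPdist_le: cvp => /(_ e e0).
have -> : pt (0, 0) = (0, x) by rewrite /pt /= scale0r add0r.
move=> /nbhs_ballP[d /= d0 Hd]; pose h := d / 2.
have h0 : 0 < h by rewrite divr_gt0.
have hd : h < d by rewrite /h; lra.
have cl t : {for t, continuous (fun t : R => time_ext v (pt (t, h)))} .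
  apply: (@continuous_comp _ _ _ (fun t : R => pt (t, h)) (time_ext v)); last exact: cv.
  apply: (@continuous_comp _ _ _ (fun t : R => (t, h)) pt); last exact: cpt.
  by apply: cont_pair; [exact: cvg_id|exact: cst_continuous].
have cl0 t : {for t, continuous (fun t : R => time_ext v (pt (t, 0)))} .
  apply: (@continuous_comp _ _ _ (fun t : R => pt (t, 0)) (time_ext v)); last exact: cv.
  apply: (@continuous_comp _ _ _ (fun t : R => (t, 0)) pt); last exact: cpt.
  by apply: cont_pair; [exact: cvg_id|exact: cst_continuous].
have L : (fun t => time_ext v (pt (t, h)) - time_ext v (pt (t, 0)) - h * vx (0, x)) t @[t --> (0 : R)^'+] -->
   time_ext v (pt (0, h)) - time_ext v (pt (0, 0)) - h * vx (0, x).
  apply: cvg_at_right_filter; apply: cvgB; last exact: cvg_cst.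
  by apply: cvgB; [exact: cl|exact: cl0].
rewrite !time_ext_pos //= in L; rewrite /pt /= !v0 subrr sub0r in L.
have := norm_cvg_le _ L (M := h * e).
rewrite normrN normrM (gtr0_norm h0) ler_pM2l //; apply.
near=> t.
have t0 : 0 < t by [].
have td : t < d by near: t; exact: nbhs_right_lt.
have dE (s : R) : 0 <= s <= h -> is_derive s (1 : R) (fun s => time_ext v (pt (t, s))) (vx (pt (t, s))).
  move=> _; have /is_derive_line H := @time_ext_is_derive v (pt (t, s)) _ _ t0 (dv (pt (t, s)) t0); apply/is_derive_line.
  apply: isd_ext H => u; congr time_ext; rewrite /pt /dir_x /=.
  by apply: injective_projections; rewrite /= ?scaler0 ?add0r // [u%:A]mulr1 scalerDl addrA.
have [s sh E] := mvt (ltW h0) dE.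
rewrite -[X in time_ext v X - _ - _]/(pt (t, h)) -[X in _ - time_ext v X - _]/(pt (t, 0)) E subr0 [h * _]mulrC -mulrBl.
rewrite normrM (gtr0_norm h0) mulrC ler_pM2l // distrC; apply: Hd.
split; rewrite -ball_normE /ball_ /= sub0r normrN.
  by rewrite gtr0_norm.
by case/andP: sh => s0 sh; rewrite ger0_norm // (le_lt_trans sh).
Unshelve. all: by end_near. Qed.


Lemma solution_jet (m : nat) (Omega : set 'rV[R]_m) (h : 'rV[R]_m -> 'M[R]_m) (b db : R -> R)
    (u0 u1 : 'I_m -> 'rV[R]_n -> R) (u : 'I_m -> ST -> R) :
  (forall t : R, is_derive t (1 : R) b (db t)) -> (forall i x, u0 i x = 0) ->
  wave_map_solution Omega h b u0 u1 u ->
  exists J : jet R n m,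
  [/\ forall t1, regular_jet t1 J, forall p, Omega (chart_point J p),
      forall t1, solves_wave_map b db h t1 J,
      forall i (p : ST), p.1 <= 0 -> [/\ jv J i p = 0, jt J i p = u1 i p.2 & forall k, jx J i k p = 0] &
      forall i (p : ST), 0 <= p.1 -> jv J i p = u i p].
Proof.
move=> b_derive u00 [Cu Ou equ iu itu].
have /choice[w Hw] := fun i => scalar_jet (Cu i).
pose ut i := (w i).1.1.1.1; pose utt i := (w i).1.1.1.2.
pose ux i := (w i).1.1.2; pose uxt i := (w i).1.2; pose uxx i := (w i).2.
have {}Hw i : [/\ [/\ continuous (time_ext (u i)), continuous (ut i), continuous (utt i) & forall k,
        [/\ continuous (ux i k), continuous (uxt i k) & continuous (uxx i k)]],
      forall p : ST, 0 < p.1 -> is_derive p (dir_t R n) (u i : ST -> R^o) (ut i p) /\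
         is_derive p (dir_t R n) (ut i : ST -> R^o) (utt i p),
      forall p : ST, p.1 <= 0 -> ut i p = ut i (0, p.2) /\ forall k, ux i k p = ux i k (0, p.2) &
      forall k (p : ST), 0 < p.1 -> [/\ is_derive p (dir_x R k) (u i : ST -> R^o) (ux i k p),
         is_derive p (dir_t R n) (ux i k : ST -> R^o) (uxt i k p),
         is_derive p (dir_x R k) (ut i : ST -> R^o) (uxt i k p) &
         is_derive p (dir_x R k) (ux i k : ST -> R^o) (uxx i k p)]].
  by have := Hw i; rewrite /ut /utt /ux /uxt /uxx; case: (w i) => [[[[? ?] ?] ?] ?].
exists (Jet (fun i => time_ext (u i)) ut utt ux uxt uxx).
have u_0 i x : u i (0, x) = 0 by rewrite iu.
split.
- move=> t1; split.
  + move=> i p _; have [[c1 c2 _ c3] _ _ _] := Hw i; split; [exact: c1|exact: c2|move=> k].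
    by have [c _ _] := c3 k; exact: c.
  + move=> i p _; have [[_ _ c1 c2] _ _ _] := Hw i; split; first exact: c1.
    by move=> k; have [_ c3 c4] := c2 k; split; [exact: c3|exact: c4].
  + move=> i p /andP[p0 _]; have [_ /(_ p p0)[d1 d2] _ _] := Hw i; split => //.
    exact: time_ext_is_derive.
  + by move=> i k p /andP[p0 _]; have [_ _ _ /(_ k p p0)[_ d1 d2 d3]] := Hw i.
- move=> p; have := Ou (pospart (p.1 : R), p.2) (pospart_ge0 _).
  by congr (Omega _).
- move=> t1 i p /andP[p0 _].
  have Et j q : 0 < q.1 -> Dt (u j) q = ut j q.
    by move=> q0; have [_ /(_ q q0)[[_ <-] _] _ _] := Hw j.
  have Ex j k q : 0 < q.1 -> Dx k (u j) q = ux j k q.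
    by move=> q0; have [_ _ _ /(_ k q q0)[[_ <-] _ _ _]] := Hw j.
  have Ett : Dt (Dt (u i)) p = utt i p.
    have [_ /(_ p p0)[_ [_ <-]] _ _] := Hw i; apply: near_eq_derive.
    by apply: filterS (pos_near p0) => q; exact: Et.
  have Exx k : Dx k (Dx k (u i)) p = uxx i k p.
    have [_ _ _ /(_ k p p0)[_ _ _ [_ <-]]] := Hw i; apply: near_eq_derive.
    by apply: filterS (pos_near p0) => q; exact: Ex.
  have Eb : derive1 b p.1 = db p.1 by rewrite derive1E; have [_ ->] := b_derive p.1.
  case: p p0 Ett Exx Eb => t x p0 Ett Exx Eb.
  rewrite -[RHS](equ t x i p0) /= Ett Et // Eb; congr (_ - _ + _).
    by rewrite /laplacian; congr (_ * _); apply: eq_bigr => k _; rewrite Exx.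
  apply: eq_bigr => j _; apply: eq_bigr => k _; congr (christoffel h i j k _ * _).
    by apply/rowP => l; rewrite !mxE /= time_ext_pos // ltW.
  rewrite !Et //; congr (_ - _ * _); apply: eq_bigr => l _; by rewrite !Ex.
- move=> i p p0 /=; have [[c1 c2 _ c3] d1 /(_ p p0)[e1 e2] d2] := Hw i.
  split; first by rewrite time_ext_neg.
    rewrite e1; apply: (initial_velocity c1 c2 _ (itu i p.2)).
    by move=> q q0; have [] := d1 q q0.
  move=> k; rewrite e2; have [c4 _ _] := c3 k; apply: (@initial_gradient (u i) (ux i k) k p.2 c1 c4) => // q q0.
  by have [] := d2 k q q0.
by move=> i p p0 /=; exact: time_ext_pos.
Qed.

End half_space_extension.

(** * The wave map carried by a geodesic *)

Section geodesic_wave.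
Variables (R : realType) (n' m : nat).
Local Notation n := n'.+1.
Local Notation ST := (R^o * 'rV[R]_n)%type.
Variables (b db : R -> R) (z kappa g t1 : R) (S Sw : R -> R) (Phi phi1 phi2 f : R -> R).
Variables (Omega : set 'rV[R]_m) (h : 'rV[R]_m -> 'M[R]_m) (a : 'rV[R]_m).
Hypothesis b_derive : forall t : R, is_derive t (1 : R) b (db t).
Hypothesis db_cont : continuous db.
Hypothesis b0 : forall t, 0 < b t.
Hypothesis Smode : mode b n' z S Sw.
Hypothesis S0 : S 0 = 0.
Hypothesis g0 : 0 < g.
Hypothesis Sg : forall t, 0 <= t < t1 -> `|kappa * S t| < g.
Hypothesis Phi_derive : forall y : R, `|y| < g -> is_derive y (1 : R) Phi (phi1 y).
Hypothesis phi1_derive : forall y : R, `|y| < g -> is_derive y (1 : R) phi1 (phi2 y).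
Hypothesis phi2_cont : forall y : R, `|y| < g -> {for y, continuous phi2}.
Hypothesis phi2E : forall y, `|y| < g -> phi2 y = - f (Phi y) * phi1 y ^+ 2.
Hypothesis Phi0 : Phi 0 = 0.
Hypothesis af : associated_function Omega h a f.

Let S1 t := b t ^+ n * Sw t.
Let S2 t := n%:R * (db t / b t) * S1 t - z ^+ 2 * b t ^+ 2 * S t.

Let dS (t : R) : is_derive t (1 : R) S (S1 t).
Proof. by have [] := Smode t. Qed.

Let dS1 (t : R) : is_derive t (1 : R) S1 (S2 t).
Proof.
have [_ dw] := Smode t; have dbt := b_derive t.
have bn0 : b t != 0 by rewrite gt_eqF.
rewrite /S1 /S2; have bn := isd_exp n' dbt.
apply: is_derive_eq (isd_mul bn dw) _.
rewrite /beta /S1 !exprS expr0 mulr1.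
have : b t ^+ n' != 0 by rewrite expf_neq0.
by move: (b t ^+ n') => X X0; field; rewrite X0 bn0.
Qed.

Let S1_cont : continuous S1. Proof. by move=> t; exact: is_derive_cont (dS1 t). Qed.
Let S_cont : continuous S. Proof. by move=> t; exact: is_derive_cont (dS t). Qed.
Let b_cont' : continuous b. Proof. by move=> t; exact: is_derive_cont (b_derive t). Qed.

Let S2_cont : continuous S2.
Proof.
move=> t; rewrite /S2; ctp; [exact: db_cont| |exact: S1_cont|exact: b_cont'|exact: S_cont].
by apply: cvgV; [rewrite gt_eqF|exact: b_cont'].
Qed.

Let x0 (p : ST) : R := p.2 0 ord0.
Let w p := kappa * S (pospart (p.1 : R)) * cos (z * x0 p).
Let wt p := kappa * S1 (pospart (p.1 : R)) * cos (z * x0 p).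
Let wtt p := kappa * S2 (pospart (p.1 : R)) * cos (z * x0 p).
Let wx p := - (kappa * z * S (pospart (p.1 : R)) * sin (z * x0 p)).
Let wxt p := - (kappa * z * S1 (pospart (p.1 : R)) * sin (z * x0 p)).
Let wxx p := - (z ^+ 2 * w p).
Let e0 (k : 'I_n) : R := (ord0 == k)%:R.

Let e0K k : e0 k * e0 k = e0 k. Proof. by rewrite /e0 -natrM mulnb andbb. Qed.

(** The jet of Phi(w) a with w = kappa S(t) cos (z x_0). *)
Definition geodesic_jet : jet R n m := Jet
  (fun i p => a 0 i * Phi (w p)) (fun i p => a 0 i * (phi1 (w p) * wt p))
  (fun i p => a 0 i * (phi2 (w p) * wt p ^+ 2 + phi1 (w p) * wtt p))
  (fun i k p => a 0 i * (phi1 (w p) * (wx p * e0 k)))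
  (fun i k p => a 0 i * (phi2 (w p) * wt p * (wx p * e0 k) + phi1 (w p) * (wxt p * e0 k)))
  (fun i k p => a 0 i * (phi2 (w p) * (wx p * e0 k) ^+ 2 + phi1 (w p) * (wxx p * e0 k))).

Let time_cont (F : R -> R) (p : ST) : continuous F -> {for p, continuous (fun p : ST => F (pospart (p.1 : R)))}.
Proof.
move=> cF; apply: (@ctp_comp R ST p (fun p : ST => pospart (p.1 : R))); last exact: cF.
by apply: (@ctp_comp R ST p (fun p : ST => p.1)); [exact: cvg_fst|exact: pospart_continuous].
Qed.

Let zx_cont (p : ST) : {for p, continuous (fun p : ST => z * x0 p)}.
Proof. by apply: ctp_mul; [exact: ctp_cst|apply: (@cvg_entry R _ _ 1 n); exact: cvg_snd]. Qed.

Let cos_cont (p : ST) : {for p, continuous (fun p : ST => cos (z * x0 p))}.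
Proof. by apply: (@ctp_comp R ST p (fun p : ST => z * x0 p)); [exact: zx_cont|exact: continuous_cos]. Qed.
Let sin_cont (p : ST) : {for p, continuous (fun p : ST => sin (z * x0 p))}.
Proof. by apply: (@ctp_comp R ST p (fun p : ST => z * x0 p)); [exact: zx_cont|exact: continuous_sin]. Qed.

Let w_cont (p : ST) : {for p, continuous w}.
Proof. by rewrite /w; ctp; [exact: time_cont|exact: cos_cont]. Qed.
Let wt_cont (p : ST) : {for p, continuous wt}.
Proof. by rewrite /wt; ctp; [exact: time_cont|exact: cos_cont]. Qed.
Let wtt_cont (p : ST) : {for p, continuous wtt}.
Proof. by rewrite /wtt; ctp; [exact: time_cont|exact: cos_cont]. Qed.
Let wx_cont (p : ST) : {for p, continuous wx}.
Proof. by rewrite /wx; ctp; [exact: time_cont|exact: sin_cont]. Qed.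
Let wxt_cont (p : ST) : {for p, continuous wxt}.
Proof. by rewrite /wxt; ctp; [exact: time_cont|exact: sin_cont]. Qed.
Let wxx_cont (p : ST) : {for p, continuous wxx}.
Proof. by rewrite /wxx; ctp; exact: w_cont. Qed.

Let w_lt (p : ST) : p.1 < t1 -> `|w p| < g.
Proof.
move=> pt; rewrite /w normrM; apply: (@le_lt_trans _ _ `|kappa * S (pospart p.1)|).
  by rewrite -[leRHS]mulr1 ler_wpM2l // ler_norml cos_geN1 cos_le1.
have [pt0|pt0] := leP (p.1 : R) 0; first by rewrite pospart_neg // S0 mulr0 normr0.
by rewrite pospart_pos ?ltW //; apply: Sg; rewrite pt (ltW pt0).
Qed.

Let comp_cont (F : R -> R) (p : ST) : (forall y, `|y| < g -> {for y, continuous F}) -> p.1 < t1 ->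
  {for p, continuous (fun p => F (w p))}.
Proof.
by move=> cF pt; apply: (@continuous_comp _ _ _ w F); [exact: w_cont|apply: cF; exact: w_lt].
Qed.

Let cPhi y : `|y| < g -> {for y, continuous Phi}.
Proof. by move=> /Phi_derive H; exact: is_derive_cont H. Qed.
Let cphi1 y : `|y| < g -> {for y, continuous phi1}.
Proof. by move=> /phi1_derive H; exact: is_derive_cont H. Qed.

Let x0_x k (p : ST) : is_derive p (dir_x R k) (x0 : ST -> R^o) (e0 k).
Proof. exact: isd_coord_x. Qed.
Let x0_t (p : ST) : is_derive p (dir_t R n) (x0 : ST -> R^o) 0.
Proof. exact: (isd_space_t (fun x : 'rV[R]_n => x 0 ord0)). Qed.

Let time_t (F : R -> R) l (p : ST) : 0 < p.1 -> is_derive (p.1 : R) (1 : R) F l ->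
  is_derive p (dir_t R n) (fun p : ST => F (pospart (p.1 : R)) : R^o) l.
Proof.
move=> p0 dF; apply: isd_time_t (fun t => F (pospart t)) _ _ _.
apply: near_eq_is_derive dF.
have : \forall s \near (p.1 : R), 0 < s by exact: lt_nbhsr.
by apply: filterS => s /ltW s0; rewrite pospart_pos.
Qed.

Let time_x (F : R -> R) k (p : ST) :
  is_derive p (dir_x R k) (fun p : ST => F (pospart (p.1 : R)) : R^o) 0.
Proof. exact: (isd_time_x (fun t => F (pospart t))). Qed.

Let w_t (p : ST) : 0 < p.1 -> is_derive p (dir_t R n) (w : ST -> R^o) (wt p) /\
  is_derive p (dir_t R n) (wt : ST -> R^o) (wtt p) /\ is_derive p (dir_t R n) (wx : ST -> R^o) (wxt p).
Proof.
move=> p0; have hx := x0_t p; have E := pospart_pos (ltW p0).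
have h1 := time_t p0 (dS p.1); have h2 := time_t p0 (dS1 p.1).
by rewrite /w /wt /wtt /wx /wxt E; split; [|split]; isder; ring.
Qed.

Let w_x k (p : ST) : is_derive p (dir_x R k) (w : ST -> R^o) (wx p * e0 k) /\
  is_derive p (dir_x R k) (wt : ST -> R^o) (wxt p * e0 k) /\ is_derive p (dir_x R k) (wx : ST -> R^o) (wxx p * e0 k).
Proof.
have hx := x0_x k p; have h1 := time_x S k p; have h2 := time_x S1 k p.
by rewrite /wxx /w /wt /wx /wxt; split; [|split]; isder; ring.
Qed.

Lemma geodesic_jet_regular : regular_jet t1 geodesic_jet.
Proof.
split=> /=.
- move=> i p pt; split=> [||k]; ctp; by [exact: comp_cont|exact: wt_cont|exact: wx_cont].
- move=> i p /andP[_ pt]; split=> [|k]; last split; ctp;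
    by [exact: comp_cont|exact: wt_cont|exact: wx_cont|exact: wtt_cont|exact: wxt_cont|exact: wxx_cont].
- move=> i p /andP[p0 pt]; have [h1 [h2 _]] := w_t p0.
  have h3 := is_derive_chain (Phi_derive (w_lt pt)) h1.
  have h4 := is_derive_chain (phi1_derive (w_lt pt)) h1.
  by split; isder; ring.
- move=> i k p /andP[p0 pt]; have [h1 [h2 h5]] := w_t p0; have [k1 [k2 k5]] := w_x k p.
  have h3 := is_derive_chain (Phi_derive (w_lt pt)) h1.
  have h4 := is_derive_chain (phi1_derive (w_lt pt)) h1.
  have k3 := is_derive_chain (Phi_derive (w_lt pt)) k1.
  have k4 := is_derive_chain (phi1_derive (w_lt pt)) k1.
  split; isder; try ring.
  by ring: (e0K k).
Qed.

Lemma geodesic_jet_chart p : chart_point geodesic_jet p = Phi (w p) *: a.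
Proof. by apply/rowP => i; rewrite !mxE /= mulrC. Qed.

(** The wave operator applied to Phi(w) gives Phi'(w) times that of w, which is
    0, plus Phi''(w) (w_t^2 - b^2 w_x^2). On the ray the Christoffel terms
    contract to a f(Phi) Phi'^2 (w_t^2 - b^2 w_x^2), and Phi'' = - f(Phi)
    Phi'^2. *)
Lemma geodesic_jet_solves : solves_wave_map b db h t1 geodesic_jet.
Proof.
move=> i p /andP[p0 pt]; have p0' := ltW p0; rewrite /nonlinearity geodesic_jet_chart /=.
have sume (c : R) : \sum_(k < n) c * e0 k = c.
  by rewrite (bigD1 ord0) //= /e0 eqxx mulr1 big1 ?addr0 // => k; rewrite eq_sym => /negPf ->; rewrite mulr0.
have [_ geo] := af (Phi (w p)).
have -> : \sum_(j < m) \sum_(k < m) christoffel h i j k (Phi (w p) *: a) *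
     (a 0 j * (phi1 (w p) * wt p) * (a 0 k * (phi1 (w p) * wt p)) -
      b p.1 ^+ 2 * \sum_(l < n) a 0 j * (phi1 (w p) * (wx p * e0 l)) * (a 0 k * (phi1 (w p) * (wx p * e0 l)))) =
   phi1 (w p) ^+ 2 * (wt p ^+ 2 - b p.1 ^+ 2 * wx p ^+ 2) * (a 0 i * f (Phi (w p))).
  rewrite -geo mulr_sumr; apply: eq_bigr => j _; rewrite mulr_sumr; apply: eq_bigr => k _.
  have -> : \sum_(l < n) a 0 j * (phi1 (w p) * (wx p * e0 l)) * (a 0 k * (phi1 (w p) * (wx p * e0 l))) =
     a 0 j * a 0 k * phi1 (w p) ^+ 2 * wx p ^+ 2.
    rewrite -[RHS]sume; apply: eq_bigr => l _; rewrite -[in RHS]e0K; ring.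
  ring.
have -> : \sum_(k < n) a 0 i * (phi2 (w p) * (wx p * e0 k) ^+ 2 + phi1 (w p) * (wxx p * e0 k)) =
   a 0 i * (phi2 (w p) * wx p ^+ 2 + phi1 (w p) * wxx p).
  by rewrite -[RHS]sume; apply: eq_bigr => k _; rewrite exprMn expr2 [e0 k ^+ 2]expr2 e0K; ring.
rewrite phi2E ?w_lt //.
have -> : wtt p = n%:R * (db p.1 / b p.1) * wt p + b p.1 ^+ 2 * wxx p.
  by rewrite /wtt /wxx /wt /w /S2 pospart_pos //; ring.
ring.
Qed.

Lemma geodesic_jet_init i (p : ST) : p.1 <= 0 ->
  [/\ jv geodesic_jet i p = 0,
      jt geodesic_jet i p = a 0 i * (phi1 0 * (kappa * (b 0 ^+ n * Sw 0) * cos (z * p.2 0 ord0))) &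
      forall k, jx geodesic_jet i k p = 0].
Proof.
move=> p0 /=; rewrite /w /wt /wx /x0 pospart_neg // S0 !(mulr0, mul0r) Phi0 mulr0 oppr0; split => //.
by move=> k; rewrite !(mulr0, mul0r).
Qed.

Lemma geodesic_jet_axis i (t : R) : 0 <= t -> jv geodesic_jet i (t, 0) = a 0 i * Phi (kappa * S t).
Proof. by move=> t0 /=; rewrite /w /x0 /= mxE mulr0 cos0 mulr1 pospart_pos. Qed.

End geodesic_wave.

(** * Smooth cut-off functions *)

Section chains.
Variable R : realType.
Implicit Types F G : nat -> R -> R.

(** A smooth function of one variable given with all its derivatives, which
    spares any selection of derivatives in products and compositions. *)
Definition chain F := forall k (t : R), is_derive t (1 : R) (F k) (F k.+1 t).

Lemma chain_continuous F k : chain F -> continuous (F k).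
Proof. by move=> cF t; exact: is_derive_cont (cF k t). Qed.

(** The Leibniz rule without collecting equal terms: a list of pairs of orders.
    *)
Fixpoint leibniz_terms (k : nat) : seq (nat * nat) :=
  if k is k'.+1 then [seq (p.1.+1, p.2) | p <- leibniz_terms k'] ++ [seq (p.1, p.2.+1) | p <- leibniz_terms k']
  else [:: (0, 0)]%N.

Definition chain_mul F G k t := \sum_(p <- leibniz_terms k) F p.1 t * G p.2 t.

Lemma chain_mulP F G : chain F -> chain G -> chain (chain_mul F G).
Proof.
move=> cF cG k t.
have H : is_derive t (1 : R) (chain_mul F G k)
   (\sum_(p <- leibniz_terms k) (F p.1.+1 t * G p.2 t + F p.1 t * G p.2.+1 t)).
  by apply: isd_sum => p _; have h1 := cF p.1 t; have h2 := cG p.2 t; exact: isd_mul.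
by apply: is_derive_eq H _; rewrite /chain_mul /= big_cat !big_map big_split.
Qed.

Lemma chain_mul0 F G t : chain_mul F G 0 t = F 0%N t * G 0%N t.
Proof. by rewrite /chain_mul big_seq1. Qed.

Lemma chain_mul_eq0 F G k t : (forall i, F i t = 0) \/ (forall i, G i t = 0) -> chain_mul F G k t = 0.
Proof. by move=> [H|H]; rewrite /chain_mul big1 // => p _; rewrite H ?mul0r ?mulr0. Qed.

Lemma chain_affine F (a c : R) : chain F -> chain (fun k t => c ^+ k * F k (a + c * t)).
Proof.
move=> cF k t; have H := cF k (a + c * t).
have ha : is_derive t (1 : R) (fun t : R => a + c * t) c by isder; ring.
have hc := @is_derive_chain R R (F k) (fun t : R => a + c * t) t 1 _ _ H ha.
by isder; rewrite exprS; ring.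
Qed.

(** The k-th derivative of exp (- 1/t) is p_k(1/t) exp (- 1/t), where p_(k+1) =
    X^2 (p_k - p_k'). *)
Definition flat_poly (k : nat) : {poly R} := iter k (fun p => 'X^2 * (p - p^`())) 1.

Definition flat (k : nat) (t : R) : R := if 0 < t then (flat_poly k).[t^-1] * expR (- t^-1) else 0.

Lemma expR_poly_bound (j : nat) (s : R) : 0 <= s -> s ^+ j.+1 <= (j.+1%:R) ^+ j.+1 * expR s.
Proof.
move=> s0; have -> : expR s = expR (s / j.+1%:R) ^+ j.+1.
  by rewrite -expRM_natl mulrC divfK // pnatr_eq0.
rewrite -exprMn; apply: lerXn2r; rewrite ?nnegrE ?mulr_ge0 ?expR_ge0 //.
rewrite -ler_pdivrMl ?ltr0n // mulrC; apply: le_trans (expR_ge1Dx _); by rewrite lerDr.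
Qed.

(** With decay of order s^-2 at s = 1/t, the functions flat k are O(t^2) at 0+,
    so they and their derivatives vanish at 0. *)
Lemma poly_exp_bound (p : {poly R}) : exists2 C : R, 0 <= C & forall s, 1 <= s -> `|p.[s]| * expR (- s) <= C / s ^+ 2.
Proof.
pose N := size p; pose C := (\sum_(i < N) `|p`_i|) * (N.+2%:R) ^+ N.+2.
exists C; first by rewrite mulr_ge0 ?exprn_ge0 // sumr_ge0.
move=> s s1; have s0 : 0 < s by exact: lt_le_trans s1.
have h1 : `|p.[s]| <= (\sum_(i < N) `|p`_i|) * s ^+ N.
  rewrite horner_coef; apply: le_trans (ler_norm_sum _ _ _) _; rewrite mulr_suml; apply: ler_sum => i _.
  rewrite normrM ler_wpM2l // normrX ger0_norm ?(ltW s0) //.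
  by rewrite ler_weXn2l // ltnW.
have h2 := expR_poly_bound N.+1 (ltW s0).
rewrite expRN -ler_pdivlMr ?invr_gt0 ?expR_gt0 // invrK; apply: (le_trans h1).
move: h2; rewrite /C; move: (N.+2%:R ^+ N.+2) => A h2.
rewrite -[_ / _ * _]mulrA -[_ * A * _]mulrA; apply: ler_wpM2l; first by rewrite sumr_ge0.
by rewrite mulrA mulrAC ler_pdivlMr ?exprn_gt0 // -exprD addn2.
Qed.

Lemma flat_chain : chain flat.
Proof.
move=> k t; have [t0|t0|->] := ltgtP t 0.
- rewrite [flat k.+1 t]/flat ltNge (ltW t0) /=.
  apply: near_eq_is_derive (isd_cst t 1 (0:R)).
  have : \forall s \near t, s < 0 by exact: lt_nbhsl.
  by apply: filterS => s /ltW s0; rewrite /flat ltNge s0.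
- have tn0 : t != 0 by rewrite gt_eqF.
  have hi : is_derive t (1 : R) (fun t : R => t^-1) (- t ^- 2).
    have h := isd_inv tn0 (isd_id t); by apply: is_derive_eq h _; rewrite mulN1r.
  have hp : is_derive t (1 : R) (fun t : R => (flat_poly k).[t^-1]) ((flat_poly k)^`().[t^-1] * (- t ^- 2)).
    exact: (@is_derive_chain R R (horner (flat_poly k)) (fun t => t^-1) t 1 _ _ (is_derive_poly _ _) hi).
  have H : is_derive t (1 : R) (fun t : R => (flat_poly k).[t^-1] * expR (- t^-1)) (flat k.+1 t).
    rewrite /flat t0 /= !hornerE.
    by isder; rewrite exprVn; ring.
  apply: near_eq_is_derive H.
  have : \forall s \near t, 0 < s by exact: lt_nbhsr.
  by apply: filterS => s s0; rewrite /flat s0.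
rewrite [flat k.+1 0]/flat ltxx.
suff L : (fun h : R => h^-1 *: (flat k h - flat k 0)) @ 0^' --> (0 : R).
  have E : (fun h : R => h^-1 *: ((flat k \o shift 0) (h *: (1:R^o)) - flat k 0)) =
           (fun h : R => h^-1 *: (flat k h - flat k 0)).
    by apply: funext => h /=; rewrite [_%:A]mulr1 addr0.
  apply: DeriveDef; first by rewrite /derivable E; apply/cvg_ex; exists 0.
  by rewrite /derive E; apply/cvg_lim.
have [C C0 HC] := poly_exp_bound (flat_poly k).
apply/cvgrPdist_le => e e0; near=> h.
rewrite sub0r normrN {2}/flat ltxx subr0 normrM.
rewrite /flat; case: ifP => h0; last by rewrite normr0 mulr0 ltW.
have h1 : h < 1 by near: h; apply: nbhs_dnbhs; exact: lt_nbhsl.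
have hC : h < e / (C + 1).
  near: h; apply: nbhs_dnbhs; by apply: lt_nbhsl; rewrite divr_gt0 //; apply: ltr_wpDl.
have h1' : 1 <= h^-1 by rewrite invf_ge1 // ltW.
have := HC _ h1'; rewrite normrM (ger0_norm (expR_ge0 _)) (gtr0_norm (_ : 0 < h^-1)) ?invr_gt0 //.
rewrite exprVn invrK => H; rewrite ler_pdivrMl //; apply: (le_trans H).
rewrite expr2 mulrA mulrC ler_wpM2l ?(ltW h0) //.
move: hC; rewrite ltr_pdivlMr ?ltr_wpDl // mulrDr mulr1 => hC.
by rewrite mulrC ltW // (lt_trans _ hC) // ltrDl.
Unshelve. all: by end_near. Qed.

Lemma flat_ge0 t : 0 <= flat 0 t.
Proof. by rewrite /flat; case: ifP => // _; rewrite /= hornerC mul1r expR_ge0. Qed.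

Lemma flat_gt0 t : 0 < t -> 0 < flat 0 t.
Proof. by move=> t0; rewrite /flat t0 /= hornerC mul1r expR_gt0. Qed.

Lemma flat_eq0 k t : t <= 0 -> flat k t = 0.
Proof. by move=> t0; rewrite /flat ltNge t0. Qed.

(** The normalized primitive of the bump exp (- 1/t) exp (- 1/(1-t)). *)
Lemma smooth_step : exists2 eta : nat -> R -> R, chain eta &
  (forall k t, t <= 0 -> eta k t = 0) /\ (forall t, 1 <= t -> eta 0%N t = 1).
Proof.
pose flat' := fun k t => (-1) ^+ k * flat k (1 + (-1) * t).
have cf' : chain flat' by exact: chain_affine flat_chain.
pose psi := chain_mul flat flat'.
have cpsi : chain psi by exact: chain_mulP flat_chain cf'.
have psi_neg k t : t <= 0 -> psi k t = 0.
  by move=> t0; apply: chain_mul_eq0; left => i; exact: flat_eq0.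
have psi_big k t : 1 <= t -> psi k t = 0.
  by move=> t1; apply: chain_mul_eq0; right => i; rewrite /flat' flat_eq0 ?mulr0 // mulN1r subr_le0.
have psi_ge t : 0 <= psi 0%N t by rewrite /psi chain_mul0 /flat' expr0 mul1r mulr_ge0 ?flat_ge0.
have cp : continuous (psi 0%N) by exact: chain_continuous.
pose I := integral_from0 (psi 0%N).
have dI (t : R) : is_derive t (1 : R) I (psi 0%N t) by exact: integral_from0_is_derive.
have I_0 : I 0 = 0 by exact: integral_from00.
have Iconst (t u : R) : t <= u -> (forall s, t <= s <= u -> psi 0%N s = 0) -> I u = I t.
  move=> tu H; have [s /H E] := mvt tu (fun x _ => dI x).
  by rewrite E mul0r => /eqP; rewrite subr_eq0 => /eqP.
have Ineg t : t <= 0 -> I t = 0.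
  move=> t0; rewrite -(Iconst t 0) // => s /andP[_]; exact: psi_neg.
have I1 : 0 < I 1.
  have I10 : I 0 <= I 1 by apply: (deriv_ge0_le ler01 (fun x _ => dI x)) => s _; exact: psi_ge.
  rewrite lt_neqAle I_0 in I10 *; rewrite -{1}I_0 I10 andbT; apply/negP => /eqP E.
  have h1 : (0 : R) < 2^-1 by rewrite invr_gt0.
  have h2 : (2^-1 : R) < 1 by rewrite invf_lt1 // ltr1n.
  have I10' : I 1 <= I 0 by rewrite -E I_0.
  have := flat_derivative ltr01 dI psi_ge I10'; move/(_ 2^-1); rewrite h1 h2 => /(_ isT).
  apply/eqP; rewrite gt_eqF // /psi chain_mul0 /flat' expr0 mul1r mulr_gt0 ?flat_gt0 //.
  by rewrite mulN1r subr_gt0.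
exists (fun k t => if k is k'.+1 then (I 1)^-1 * psi k' t else (I 1)^-1 * I t).
  by case=> [|k] t; [have h := dI t|have h := cpsi k t]; isder; ring.
split=> [[|k] t t0|t t1].
- by rewrite (Ineg t) // mulr0.
- by rewrite psi_neg // mulr0.
 rewrite (Iconst 1) ?mulVf ?gt_eqF // => s /andP[s1 _]; exact: psi_big.
Qed.

(** Product of a rising and a falling step. *)
Lemma smooth_plateau : exists2 chi : nat -> R -> R, chain chi &
  (forall k t, 2 <= `|t| -> chi k t = 0) /\ (forall t, `|t| <= 1 -> chi 0%N t = 1).
Proof.
have [eta ceta [eta0 eta1]] := smooth_step.
exists (chain_mul (fun k t => (-1) ^+ k * eta k (2 + (-1) * t)) (fun k t => 1 ^+ k * eta k (2 + 1 * t))).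
  by apply: chain_mulP; exact: chain_affine.
split=> [k t|t].
  have [t0|t0] := leP 0 t => t2; apply: chain_mul_eq0; [left|right] => i; rewrite eta0 ?mulr0 //.
    by move: t2; rewrite mulN1r ger0_norm // subr_le0.
  by move: t2; rewrite mul1r ltr0_norm // lerNr => t2; rewrite addrC -lerBrDr sub0r.
rewrite ler_norml => /andP[t1 t2]; rewrite chain_mul0 !expr0 !mul1r mulN1r !eta1 ?mul1r //.
  by move: t1; lra.
by move: t2; lra.
Qed.
End chains.

Section product_functions.
Variables (R : realType) (n : nat) (F : 'I_n -> nat -> R -> R).
Hypothesis F_chain : forall k, chain (F k).

Definition product_terms := seq (R * {ffun 'I_n -> nat}).

(** Linear combinations of products of functions of one variable. This class is
    closed under all directional derivatives, which gives smoothness in n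
    variables. *)
Definition product_fun (L : product_terms) (x : 'rV[R]_n) : R :=
  \sum_(p <- L) p.1 * \prod_(k < n) F k (p.2 k) (x 0 k).

Definition bump_index (j : 'I_n) (e : {ffun 'I_n -> nat}) : {ffun 'I_n -> nat} :=
  [ffun k => (e k + (k == j))%N].

Definition product_derive (v : 'rV[R]_n) (L : product_terms) : product_terms :=
  [seq (p.1 * v 0 j, bump_index j p.2) | p <- L, j <- index_enum 'I_n].

Lemma isd_prod_coord (v x : 'rV[R]_n) (e : {ffun 'I_n -> nat}) (s : seq 'I_n) : uniq s ->
  is_derive x v (fun x : 'rV[R]_n => \prod_(k <- s) F k (e k) (x 0 k) : R^o)
    (\sum_(j <- s) v 0 j * \prod_(k <- s) F k (bump_index j e k) (x 0 k)).
Proof.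
elim: s => [_|i s IH /= /andP[iS us]].
  by rewrite big_nil; apply: isd_ext (isd_cst x v 1) => y; rewrite big_nil.
have h1 : is_derive x v (fun x : 'rV[R]_n => x 0 i : R^o) (v 0 i).
  by apply: isd_affine => h; rewrite !mxE.
have h2 := @is_derive_chain R _ (F i (e i)) (fun x : 'rV[R]_n => x 0 i) x v _ _ (F_chain i (e i) (x 0 i)) h1.
have h3 := isd_mul h2 (IH us).
have h4 := @isd_ext R _ _ _ _ (fun x : 'rV[R]_n => \prod_(k <- i :: s) F k (e k) (x 0 k)) _ (fun y => esym (big_cons _ _ _ _ _ _)) h3.
apply: is_derive_eq h4 _; rewrite big_cons; congr (_ + _).
  rewrite big_cons !ffunE eqxx addn1 mulrAC mulrC; congr (_ * (_ * _)).
  rewrite !big_seq; apply: eq_bigr => k ks; rewrite ffunE.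
  by have [ki|_] := eqVneq k i; [rewrite ki (negPf iS) in ks|rewrite addn0].
rewrite mulr_sumr !big_seq; apply: eq_bigr => j js.
rewrite big_cons ffunE; have [ij|_] := eqVneq i j; first by rewrite -ij (negPf iS) in js.
by rewrite addn0 mulrCA.
Qed.

Lemma product_fun_derive (L : product_terms) (v x : 'rV[R]_n) :
  is_derive x v (product_fun L : 'rV[R]_n -> R^o) (product_fun (product_derive v L) x).
Proof.
have H : is_derive x v (product_fun L : 'rV[R]_n -> R^o)
   (\sum_(p <- L) p.1 * \sum_(j < n) v 0 j * \prod_(k < n) F k (bump_index j p.2 k) (x 0 k)).
  apply: isd_sum => p _; have h := isd_prod_coord v x p.2 (index_enum_uniq 'I_n).
  by isder; ring.
apply: is_derive_eq H _; rewrite /product_fun /product_derive big_allpairs_dep /=.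
apply: eq_bigr => p _; rewrite mulr_sumr; apply: eq_bigr => j _; by rewrite mulrA.
Qed.

Lemma product_fun_continuous (L : product_terms) : continuous (product_fun L).
Proof.
move=> x; apply: ctp_sum => p _; apply: ctp_mul; first exact: ctp_cst.
elim: (index_enum _) => [|k s IH].
  rewrite (_ : (fun x => _) = fun=> 1); first exact: ctp_cst.
  by apply: funext => y; rewrite big_nil.
rewrite (_ : (fun x => _) = fun x : 'rV[R]_n => F k (p.2 k) (x 0 k) * \prod_(k <- s) F k (p.2 k) (x 0 k)); last first.
  by apply: funext => y; rewrite big_cons.
apply: ctp_mul => //.
apply: (@ctp_comp _ _ _ (fun x : 'rV[R]_n => x 0 k) (F k (p.2 k))); first exact: coord_continuous.
exact: chain_continuous.
Qed.

Lemma product_fun_smooth (L : product_terms) : smooth (W := R^o) [set: 'rV[R]_n] (product_fun L).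
Proof.
move=> k; elim: k L => [|k IH] L; split=> //; try exact: continuous_subspaceT (@product_fun_continuous L).
move=> v; exists (product_fun (product_derive v L)); split; first exact: IH.
by move=> x _; exact: product_fun_derive.
Qed.

Lemma product_test_function (L : product_terms) (r : R) :
  (forall k i t, r <= `|t| -> F k i t = 0) -> test_function (product_fun L).
Proof.
move=> F0; split; first exact: product_fun_smooth.
pose B : set 'rV[R]_n := [set x | forall k, `[- r, r]%classic (x 0 k)].
have cB : compact B.
  by apply: (@rV_compact R n (fun=> `[- r, r]%classic)) => k; exact: segment_compact.
apply: (subclosed_compact _ cB); first exact: closed_closure.
have clB : closed B by apply: compact_closed => //; exact: norm_hausdorff.
rewrite (iffLR (closure_id B) clB); apply: closureS.
move=> x /= xn0 k; rewrite /= in_itv /= -ler_norml leNgt; apply: contraNN xn0 => /ltW rk.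
rewrite /product_fun big1 // => p _; rewrite (bigD1 k) //= F0 ?mul0r ?mulr0 //.
Qed.
End product_functions.

(** * Fourier transforms of products *)

Section line_integrals.
Variable R : realType.
Local Notation leb := (@lebesgue_measure R).

(** The integral of a nonnegative function is a supremum over simple functions
    below it, so it is monotone for all functions; this avoids proving that
    partial integrals are measurable. *)
Lemma nonneg_integral_le (f g : R -> \bar R) : (forall x, 0 <= f x)%E -> (forall x, f x <= g x)%E ->
  (\int[leb]_(x in setT) f x <= \int[leb]_(x in setT) g x)%E.
Proof.
move=> f0 fg; rewrite !ge0_integralTE //; last by move=> x; exact: le_trans (f0 x) (fg x).
apply: le_ereal_sup => _ [h hf <-]; exists h => // x; exact: le_trans (hf x) (fg x).
Qed.

Lemma integral_segment (g G : R -> R) (r : R) : 0 < r -> continuous g ->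
  (forall t : R, is_derive t (1 : R) G (g t)) ->
  (\int[leb]_(t in `[(- r)%R, r]) (g t)%:E = (G r - G (- r))%:E)%E.
Proof.
move=> r0 cg dG; have rr : - r < r by lra.
have cG : continuous G by move=> t; exact: is_derive_cont (dG t).
rewrite (@continuous_FTC2 R g G (- r) r rr) //.
- exact: continuous_subspaceT.
- split.
  + by move=> t _; have [] := dG t.
  + by apply: cvg_at_right_filter; exact: cG.
  + by apply: cvg_at_left_filter; exact: cG.
by move=> t _; rewrite derive1E; have [_ ->] := dG t.
Qed.

Lemma integral_compact_support (g : R -> R) (r : R) : 0 < r -> continuous g ->
  (forall t, r <= `|t| -> g t = 0) ->
  (\int[leb]_(t in setT) (g t)%:E = (int1 r g)%:E)%E.
Proof.
move=> r0 cg gr; rewrite -(integral_segment r0 cg (fun t => integral_from0_is_derive t cg)).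
rewrite [RHS]integral_mkcond; apply: eq_integral => t _; rewrite patchE.
case: ifPn => //; rewrite notin_setE /= in_itv /= -ler_norml => /negP; rewrite -ltNge => /ltW tr.
by rewrite gr.
Qed.

(** Monotone convergence along the segments [-k, k]. *)
Lemma nonneg_integral_bounded (f F : R -> R) (L : R) : continuous f -> (forall t, 0 <= f t) ->
  (forall t : R, is_derive t (1 : R) F (f t)) -> (forall r, 0 < r -> F r - F (- r) <= L) ->
  (\int[leb]_(t in setT) (f t)%:E <= L%:E)%E.
Proof.
move=> cf f0 dF FL.
pose I (k : nat) : set R := `[- k.+1%:R, k.+1%:R]%classic.
have IE : \bigcup_k I k = setT.
  apply/seteqP; split=> // t _; exists (Num.truncn `|t|) => //.
  by rewrite /I /= in_itv /= -ler_norml ltW // truncnS_gt.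
have ndI : nondecreasing_seq I.
  move=> i j ij; rewrite subsetEset => t; rewrite /I /= !in_itv /= -!ler_norml => /le_trans; apply.
  by rewrite ler_nat.
have mI k : measurable (I k) by exact: measurable_itv.
have H : (\int[leb]_(t in I k) (f t)%:E)%E @[k --> \oo] --> (\int[leb]_(t in setT) (f t)%:E)%E.
  rewrite -IE; apply: ge0_nondecreasing_set_cvg_integral => //.
    move=> k; apply/measurable_EFinP; apply: measurable_funTS; exact: continuous_measurable_fun.
  by move=> k t _; rewrite lee_fin.
rewrite -(cvg_lim _ H) //.
apply: lime_le.
  by apply/cvg_ex; eexists; exact: H.
apply: nearW => k; rewrite (integral_segment _ cf dF) ?ltr0n // lee_fin FL //.
Qed.
End line_integrals.

Section transforms.
Variables (R : realType) (r : R).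
Hypothesis r0 : 0 < r.

Definition cos_transform (g : R -> R) (xi : R) := int1 r (fun t => g t * cos (t * xi)).
Definition sin_transform (g : R -> R) (xi : R) := int1 r (fun t => g t * sin (t * xi)).
Definition spectral_power (g : R -> R) (xi : R) := cos_transform g xi ^+ 2 + sin_transform g xi ^+ 2.

Lemma power_ge0 g xi : 0 <= spectral_power g xi.
Proof. by rewrite addr_ge0 ?sqr_ge0. Qed.

Lemma cos_scale_continuous (xi : R) : continuous (fun t : R => cos (t * xi)).
Proof.
move=> t; apply: (@ctp_comp R R t (fun t => t * xi)); last exact: continuous_cos.
by apply: (@ctp_mul R R t id (fun=> xi)); [exact: cvg_id|exact: ctp_cst].
Qed.

Lemma sin_scale_continuous (xi : R) : continuous (fun t : R => sin (t * xi)).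
Proof.
move=> t; apply: (@ctp_comp R R t (fun t => t * xi)); last exact: continuous_sin.
by apply: (@ctp_mul R R t id (fun=> xi)); [exact: cvg_id|exact: ctp_cst].
Qed.

Lemma transform_cos_continuous (g : R -> R) (xi : R) : continuous g -> continuous (fun t => g t * cos (t * xi)).
Proof.
by move=> cg t; apply: (@ctp_mul R R t g (fun t => cos (t * xi))); [exact: cg|exact: cos_scale_continuous].
Qed.

Lemma transform_sin_continuous (g : R -> R) (xi : R) : continuous g -> continuous (fun t => g t * sin (t * xi)).
Proof.
by move=> cg t; apply: (@ctp_mul R R t g (fun t => sin (t * xi))); [exact: cg|exact: sin_scale_continuous].
Qed.

Lemma transform_comb (g : R -> R) (A B xi : R) : continuous g ->
  int1 r (fun t => A * (g t * cos (t * xi)) + B * (g t * sin (t * xi))) =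
  A * cos_transform g xi + B * sin_transform g xi.
Proof.
move=> cg; have c1 := @transform_cos_continuous _ xi cg; have c2 := @transform_sin_continuous _ xi cg.
rewrite (@int1_add R r (fun t => A * (g t * cos (t * xi))) (fun t => B * (g t * sin (t * xi)))).
- by rewrite !int1_scale.
- by move=> t; apply: (@ctp_mul R R t (fun=> A)); [exact: ctp_cst|exact: c1].
- by move=> t; apply: (@ctp_mul R R t (fun=> B)); [exact: ctp_cst|exact: c2].
Qed.

(** Integration by parts: up to sign, the transform of the derivative is xi
    times the transform, with cosine and sine exchanged. *)
Lemma power_derive (F : nat -> R -> R) (k : nat) (xi : R) : chain F ->
  (forall k t, r <= `|t| -> F k t = 0) -> spectral_power (F k.+1) xi = xi ^+ 2 * spectral_power (F k) xi.
Proof.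
move=> cF F0.
have Fr j : F j r = 0 by apply: F0; exact: ler_norm.
have FNr j : F j (- r) = 0 by apply: F0; rewrite normrN ler_norm.
have cc j := @chain_continuous R F j cF.
have E1 : cos_transform (F k.+1) xi = xi * sin_transform (F k) xi.
  apply/eqP; rewrite -subr_eq0 -mulNr -[X in X + _]mul1r; apply/eqP.
  pose D t := 1 * (F k.+1 t * cos (t * xi)) + (- xi) * (F k t * sin (t * xi)).
  have dD (t : R) : is_derive t (1 : R) (fun t => F k t * cos (t * xi)) (D t).
    by have h := cF k t; rewrite /D; isder; ring.
  have cD : continuous D.
    move=> t; apply: (@ctp_add R R t (fun t => 1 * (F k.+1 t * cos (t * xi))) (fun t => - xi * (F k t * sin (t * xi)))).
      by apply: (@ctp_mul R R t (fun=> 1)); [exact: ctp_cst|exact: transform_cos_continuous].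
    by apply: (@ctp_mul R R t (fun=> - xi)); [exact: ctp_cst|exact: transform_sin_continuous].
  have H := int1_primitive r cD dD.
  have c1 := @transform_cos_continuous _ xi (cc k.+1); have c2 := @transform_sin_continuous _ xi (cc k).
  rewrite -(_ : int1 r D = 0); last by rewrite H Fr FNr !mul0r subrr.
  rewrite /D (@int1_add R r (fun t => 1 * (F k.+1 t * cos (t * xi))) (fun t => - xi * (F k t * sin (t * xi)))).
  - by rewrite !int1_scale.
  - by move=> t; apply: (@ctp_mul R R t (fun=> 1)); [exact: ctp_cst|exact: c1].
  - by move=> t; apply: (@ctp_mul R R t (fun=> - xi)); [exact: ctp_cst|exact: c2].
have E2 : sin_transform (F k.+1) xi = - xi * cos_transform (F k) xi.
  apply/eqP; rewrite -subr_eq0 -mulNr opprK -[X in X + _]mul1r; apply/eqP.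
  pose D t := 1 * (F k.+1 t * sin (t * xi)) + xi * (F k t * cos (t * xi)).
  have dD (t : R) : is_derive t (1 : R) (fun t => F k t * sin (t * xi)) (D t).
    by have h := cF k t; rewrite /D; isder; ring.
  have c1 := @transform_sin_continuous _ xi (cc k.+1); have c2 := @transform_cos_continuous _ xi (cc k).
  have cD1 : continuous (fun t => 1 * (F k.+1 t * sin (t * xi))).
    by move=> t; apply: (@ctp_mul R R t (fun=> 1)); [exact: ctp_cst|exact: c1].
  have cD2 : continuous (fun t => xi * (F k t * cos (t * xi))).
    by move=> t; apply: (@ctp_mul R R t (fun=> xi)); [exact: ctp_cst|exact: c2].
  have cD : continuous D by move=> t; exact: (@ctp_add R R t _ _ (cD1 t) (cD2 t)).
  have H := int1_primitive r cD dD.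
  rewrite -(_ : int1 r D = 0); last by rewrite H Fr FNr !mul0r subrr.
  by rewrite /D (int1_add r cD1 cD2) !int1_scale.
by rewrite /spectral_power E1 E2; ring.
Qed.

Lemma power_bound (g : R -> R) (M xi : R) : continuous g -> (forall t, `|g t| <= M) ->
  spectral_power g xi <= 8 * M ^+ 2 * r ^+ 2.
Proof.
move=> cg gM; have M0 : 0 <= M := le_trans (normr_ge0 _) (gM 0).
have h1 : `|cos_transform g xi| <= M * (2 * r).
  apply: (int1_norm_le r0); first exact: transform_cos_continuous.
  by move=> t _; rewrite normrM -[M]mulr1 ler_pM // ler_norml cos_geN1 cos_le1.
have h2 : `|sin_transform g xi| <= M * (2 * r).
  apply: (int1_norm_le r0); first exact: transform_sin_continuous.
  by move=> t _; rewrite normrM -[M]mulr1 ler_pM // ler_norml sin_geN1 sin_le1.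
have sq (y : R) : `|y| <= M * (2 * r) -> y ^+ 2 <= 4 * M ^+ 2 * r ^+ 2.
  move=> hy; rewrite -[y ^+ 2]real_normK ?num_real // (_ : 4 * M ^+ 2 * r ^+ 2 = (M * (2 * r)) ^+ 2); last by ring.
  by rewrite lerXn2r // nnegrE ?mulr_ge0 // ltW.
rewrite (_ : 8 * M ^+ 2 * r ^+ 2 = 4 * M ^+ 2 * r ^+ 2 + 4 * M ^+ 2 * r ^+ 2); last by ring.
by apply: lerD; apply: sq.
Qed.

(** The product formulas write the transform as the mean of two translates;
    convexity of the square does the rest. *)
Lemma power_modulate (g : R -> R) (z xi : R) : continuous g ->
  spectral_power (fun t => cos (z * t) * g t) xi <= 2^-1 * (spectral_power g (xi + z) + spectral_power g (xi - z)).
Proof.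
move=> cg.
have cc y := @transform_cos_continuous _ y cg; have cs y := @transform_sin_continuous _ y cg.
have hc (c : R) (u : R -> R) : continuous u -> continuous (fun t => c * u t).
  by move=> cu t; apply: (@ctp_mul R R t (fun=> c) u); [exact: ctp_cst|exact: cu].
have E1 : cos_transform (fun t => cos (z * t) * g t) xi = 2^-1 * cos_transform g (xi + z) + 2^-1 * cos_transform g (xi - z).
  rewrite /cos_transform -!int1_scale // -int1_add; try exact: hc.
  congr (int1 r _); apply: funext => t.
  by rewrite mulrDr mulrBr cosD cosB [z * t]mulrC; field.
have E2 : sin_transform (fun t => cos (z * t) * g t) xi = 2^-1 * sin_transform g (xi + z) + 2^-1 * sin_transform g (xi - z).
  rewrite /sin_transform -!int1_scale // -int1_add; try exact: hc.
  congr (int1 r _); apply: funext => t.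
  by rewrite mulrDr mulrBr sinD sinB [z * t]mulrC; field.
rewrite /spectral_power E1 E2.
move: (cos_transform g (xi + z)) (cos_transform g (xi - z)) (sin_transform g (xi + z)) (sin_transform g (xi - z)) => u v w y.
have := sqr_ge0 (u - v); have := sqr_ge0 (w - y); lra.
Qed.

(** Angle addition turns the transform of a product of functions of one variable
    into a product of rotations, whose moduli multiply. The phase th carries the
    contribution of the earlier variables through the induction. *)
Lemma transform_product (n : nat) (G : 'I_n -> R -> R) (xi : 'rV[R]_n) :
  (forall k, continuous (G k)) -> (forall k t, r <= `|t| -> G k t = 0) ->
  exists al be : R, al ^+ 2 + be ^+ 2 = \prod_(k < n) spectral_power (G k) (xi 0 k) /\
  forall c th : R,
    integral_Rn (fun x : 'rV[R]_n => (c * (\prod_(k < n) G k (x 0 k)) * cos (dot x xi + th))%:E) =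
      (c * (al * cos th - be * sin th))%:E /\
    integral_Rn (fun x : 'rV[R]_n => (c * (\prod_(k < n) G k (x 0 k)) * sin (dot x xi + th))%:E) =
      (c * (al * sin th + be * cos th))%:E.
Proof.
elim: n G xi => [|n IH] G xi cG G0.
  exists 1, 0; split; first by rewrite big_ord0; ring.
  by move=> c th /=; rewrite /dot !big_ord0 !add0r !mulr1; split; congr EFin; ring.
pose xi' : 'rV[R]_n := \row_k xi 0 (lift 0 k).
have [al [be [E H]]] := IH (fun k => G (lift 0 k)) xi' (fun k => cG _) (fun k => G0 _).
set x0 := xi 0 ord0; set u := cos_transform (G ord0) x0; set v := sin_transform (G ord0) x0.
exists (al * u - be * v), (al * v + be * u); split.
  rewrite big_ord_recl /= (eq_bigr (fun k => spectral_power (G (lift 0 k)) (xi' 0 k))); last by move=> k _; rewrite mxE.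
  by rewrite -E /spectral_power -/u -/v; ring.
have prodE t (x : 'rV[R]_n) : \prod_(k < n.+1) G k ((row_mx (t%:M : 'rV[R]_1) x : 'rV[R]_n.+1) 0 k) =
    G ord0 t * \prod_(k < n) G (lift 0 k) (x 0 k).
  rewrite big_ord_recl; congr (G _ _ * _); last by apply: eq_bigr => k _; rewrite cons_lift.
  have -> : ord0 = lshift n (0 : 'I_1) :> 'I_n.+1 by exact: val_inj.
  by have := @row_mxEl R 1 1 n t%:M x 0 0; rewrite [in RHS]mxE /= mulr1n.
have dotE t (x : 'rV[R]_n) : dot (row_mx (t%:M : 'rV[R]_1) x : 'rV[R]_n.+1) xi = t * x0 + dot x xi'.
  rewrite /dot big_ord_recl; congr (_ * _ + _); last by apply: eq_bigr => k _; rewrite cons_lift mxE.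
  have -> : ord0 = lshift n (0 : 'I_1) :> 'I_n.+1 by exact: val_inj.
  by have := @row_mxEl R 1 1 n t%:M x 0 0; rewrite [in RHS]mxE /= mulr1n.
have cG0 := cG ord0.
have line A B : (\int[lebesgue_measure]_(t in setT) (A * (G ord0 t * cos (t * x0)) + B * (G ord0 t * sin (t * x0)))%:E)%E
    = (A * u + B * v)%:E.
  rewrite (integral_compact_support r0) ?transform_comb //.
    move=> t; apply: (@ctp_add R R t (fun t => A * (G ord0 t * cos (t * x0))) (fun t => B * (G ord0 t * sin (t * x0)))).
      by apply: (@ctp_mul R R t (fun=> A)); [exact: ctp_cst|exact: transform_cos_continuous].
    by apply: (@ctp_mul R R t (fun=> B)); [exact: ctp_cst|exact: transform_sin_continuous].
  by move=> t rt; rewrite G0 // !(mul0r, mulr0) addr0.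
move=> c th; split => /=.
- rewrite (_ : (fun t => integral_Rn _) = fun t => ((c * (al * cos th - be * sin th)) * (G ord0 t * cos (t * x0)) +
     (- c * (al * sin th + be * cos th)) * (G ord0 t * sin (t * x0)))%:E).
    by rewrite line; congr EFin; ring.
  apply: funext => t; have [H1 _] := H (c * G ord0 t) (t * x0 + th).
  transitivity ((c * G ord0 t * (al * cos (t * x0 + th) - be * sin (t * x0 + th)))%:E).
    rewrite -H1; congr integral_Rn; apply: funext => x; rewrite prodE dotE; congr (_%:E); congr (_ * cos _).
      by rewrite mulrA.
    by ring.
  by rewrite cosD sinD; congr EFin; ring.
rewrite (_ : (fun t => integral_Rn _) = fun t => ((c * (al * sin th + be * cos th)) * (G ord0 t * cos (t * x0)) +
     (c * (al * cos th - be * sin th)) * (G ord0 t * sin (t * x0)))%:E).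
  by rewrite line; congr EFin; ring.
apply: funext => t; have [_ H1] := H (c * G ord0 t) (t * x0 + th).
transitivity ((c * G ord0 t * (al * sin (t * x0 + th) + be * cos (t * x0 + th)))%:E).
  rewrite -H1; congr integral_Rn; apply: funext => x; rewrite prodE dotE; congr (_%:E); congr (_ * sin _).
    by rewrite mulrA.
  by ring.
by rewrite cosD sinD; congr EFin; ring.
Qed.

Lemma fourier_sqnorm_product (n : nat) (G : 'I_n -> R -> R) (c : R) (xi : 'rV[R]_n) :
  (forall k, continuous (G k)) -> (forall k t, r <= `|t| -> G k t = 0) ->
  fourier_sqnorm (fun x => c * \prod_(k < n) G k (x 0 k)) xi = c ^+ 2 * \prod_(k < n) spectral_power (G k) (xi 0 k).
Proof.
move=> cG G0; have [al [be [E H]]] := transform_product xi cG G0.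
have [H1 H2] := H c 0; rewrite /fourier_sqnorm -E.
under [in X in X ^+ 2 + _]eq_fun => x do rewrite -[dot x xi]addr0.
under [in X in _ + X ^+ 2]eq_fun => x do rewrite -[dot x xi]addr0.
by rewrite H1 H2 /= cos0 sin0; ring.
Qed.
End transforms.

(** * Sobolev norm of a wave packet *)

Section iterated_bounds.
Variable R : realType.

Lemma integral_Rn_le (n : nat) (F G : 'rV[R]_n -> \bar R) : (forall x, 0 <= F x)%E -> (forall x, F x <= G x)%E ->
  (0 <= integral_Rn F /\ integral_Rn F <= integral_Rn G)%E.
Proof.
elim: n F G => [|n IH] F G F0 FG /=; first by split; [exact: F0|exact: FG].
have H t := IH (fun x => F (row_mx (t%:M : 'rV[R]_1) x)) (fun x => G (row_mx (t%:M : 'rV[R]_1) x))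
  (fun x => F0 _) (fun x => FG _).
split; first by apply: integral_ge0 => t _; have [] := H t.
by apply: nonneg_integral_le => t; have [] := H t.
Qed.

(** Only an inequality for the iterated integral is needed, so Tonelli is
    replaced by monotonicity in each variable. *)
Lemma integral_Rn_product_le (n : nat) (phi : 'I_n -> R -> R) (I : 'I_n -> R) :
  (forall k, continuous (phi k)) -> (forall k t, 0 <= phi k t) -> (forall k, 0 <= I k) ->
  (forall k, \int[lebesgue_measure]_(t in setT) (phi k t)%:E <= (I k)%:E)%E ->
  forall c : R, 0 <= c ->
  (integral_Rn (fun x : 'rV[R]_n => (c * \prod_(k < n) phi k (x 0 k))%:E) <= (c * \prod_(k < n) I k)%:E)%E.
Proof.
elim: n phi I => [|n IH] phi I cphi phi0 I0 Iphi c c0 /=; first by rewrite !big_ord0.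
have P0 : 0 <= \prod_(k < n) I (lift 0 k) by apply: prodr_ge0.
have step t : (integral_Rn (fun x : 'rV[R]_n => (c * \prod_(k < n.+1) phi k ((row_mx (t%:M : 'rV[R]_1) x : 'rV[R]_n.+1) 0 k))%:E)
    <= ((c * \prod_(k < n) I (lift 0 k)) * phi ord0 t)%:E)%E.
  have := IH (fun k => phi (lift 0 k)) (fun k => I (lift 0 k)) (fun k => cphi _) (fun k => phi0 _)
     (fun k => I0 _) (fun k => Iphi _) (c * phi ord0 t) (mulr_ge0 c0 (phi0 _ _)).
  rewrite (_ : c * phi ord0 t * _ = c * (\prod_(k < n) I (lift 0 k)) * phi ord0 t); last by rewrite mulrAC.
  congr (_ <= _)%E; congr integral_Rn; apply: funext => x; rewrite big_ord_recl -mulrA; congr (_ * (phi _ _ * _))%:E.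
    have -> : ord0 = lshift n (0 : 'I_1) :> 'I_n.+1 by exact: val_inj.
    by have := @row_mxEl R 1 1 n t%:M x 0 0; rewrite [in RHS]mxE /= mulr1n.
  by apply: eq_bigr => k _; rewrite cons_lift.
have nn t : (0 <= integral_Rn (fun x : 'rV[R]_n => (c * \prod_(k < n.+1) phi k ((row_mx (t%:M : 'rV[R]_1) x : 'rV[R]_n.+1) 0 k))%:E))%E.
  have h (x : 'rV[R]_n) : (0 <= (c * \prod_(k < n.+1) phi k ((row_mx (t%:M : 'rV[R]_1) x : 'rV[R]_n.+1) 0 k))%:E)%E.
    by rewrite lee_fin mulr_ge0 // prodr_ge0.
  by have [] := integral_Rn_le h (fun x => lexx _).
apply: (le_trans (nonneg_integral_le nn step)).
rewrite big_ord_recl [I ord0 * _]mulrC mulrA EFinM.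
under eq_integral do rewrite EFinM.
rewrite ge0_integralZl_EFin //.
- by apply: lee_wpmul2l; [rewrite lee_fin mulr_ge0|exact: Iphi].
- by move=> t _; rewrite lee_fin.
- by apply/measurable_EFinP; exact: continuous_measurable_fun.
- by rewrite mulr_ge0.
Qed.

(** It separates the variables in the Sobolev weight. *)
Lemma bracket_prod (n : nat) (xi : 'rV[R]_n) : 1 + dot xi xi <= \prod_(k < n) (1 + xi 0 k ^+ 2).
Proof.
rewrite /dot; elim: (index_enum _) => [|k s IH]; first by rewrite !big_nil addr0.
rewrite !big_cons -expr2; set q := xi 0 k ^+ 2 in IH *; have q0 : 0 <= q by exact: sqr_ge0.
have S0 : 0 <= \sum_(j <- s) xi 0 j * xi 0 j by apply: sumr_ge0 => j _; rewrite -expr2 sqr_ge0.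
apply: (@le_trans _ _ ((1 + q) * (1 + \sum_(j <- s) xi 0 j * xi 0 j))).
  by have := mulr_ge0 q0 S0; move: (\sum_(j <- s) _) => S; lra.
by rewrite ler_wpM2l // addr_ge0.
Qed.

(** It transfers the weight from the frequency xi to the distance from the
    carrier frequency - z. *)
Lemma peetre (xi z : R) : 1 + xi ^+ 2 <= 2 * (1 + z ^+ 2) * (1 + (xi + z) ^+ 2).
Proof.
have h1 : xi ^+ 2 <= 2 * (xi + z) ^+ 2 + 2 * z ^+ 2 by have := sqr_ge0 (xi + 2 * z); lra.
have h2 := mulr_ge0 (sqr_ge0 z) (sqr_ge0 (xi + z)).
have h3 := sqr_ge0 z; have h4 := sqr_ge0 (xi + z).
move: h1 h2 h3 h4; move: (xi ^+ 2) (z ^+ 2) ((xi + z) ^+ 2) => u v w; lra.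
Qed.

Lemma isd_atan (t a b : R) : is_derive t (1 : R) (fun t : R => atan (a * (t + b))) (a / (1 + (a * (t + b)) ^+ 2)).
Proof.
have h : is_derive (a * (t + b)) (1 : R) (@atan R) (1 + (a * (t + b)) ^+ 2)^-1.
  by apply: DeriveDef; [exact: derivable_atan|rewrite -derive1E derive1_atan].
have h2 : is_derive t (1 : R) (fun t : R => a * (t + b)) a by isder; ring.
have := @is_derive_chain R R (@atan R) (fun t : R => a * (t + b)) t 1 _ _ h h2.
by move=> H; apply: is_derive_eq H _; rewrite mulrC.
Qed.

Lemma lorentz_neq0 (L t y : R) : 1 + (L * (t + y)) ^+ 2 != 0.
Proof. by rewrite gt_eqF // ltr_pwDl // sqr_ge0. Qed.

Lemma lorentz_continuous (B L y : R) : continuous (fun t => B * (1 + (L * (t + y)) ^+ 2)^-1).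
Proof.
move=> t; apply: (@ctp_mul R R t (fun=> B) (fun t => (1 + (L * (t + y)) ^+ 2)^-1)); first exact: ctp_cst.
apply: cvgV; first exact: lorentz_neq0.
have h : is_derive t (1 : R) (fun t : R => 1 + (L * (t + y)) ^+ 2) (2 * (L * (t + y)) * L) by isder; ring.
exact: is_derive_cont h.
Qed.

(** The primitive is an arctangent, of total variation pi. *)
Lemma lorentz_integral (B L z : R) : 0 <= B -> 0 < L ->
  (\int[lebesgue_measure]_(t in setT) (B * (1 + (L * (t + z)) ^+ 2)^-1 + B * (1 + (L * (t - z)) ^+ 2)^-1)%:E
     <= (2 * B * pi / L)%:E)%E.
Proof.
move=> B0 L0.
have dn (t y : R) : 1 + (L * (t + y)) ^+ 2 != 0 by exact: lorentz_neq0.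
have cq (y : R) := @lorentz_continuous B L y.
apply: (@nonneg_integral_bounded R _ (fun t => B / L * atan (L * (t + z)) + B / L * atan (L * (t + - z)))).
- by move=> t; apply: (@ctp_add R R t _ _ (cq z t) (cq (- z) t)).
- by move=> t; rewrite addr_ge0 // mulr_ge0 // invr_ge0 addr_ge0 ?sqr_ge0.
- move=> t; have h1 := isd_atan t L z; have h2 := isd_atan t L (- z).
  have := dn t z; have := dn t (- z) => d1 d2.
  by isder; field; rewrite d2 d1 gt_eqF.
move=> r _.
have b1 := atan_ltpi2 (L * (r + z)); have b2 := atan_ltpi2 (L * (r - z)).
have b3 := atan_gtNpi2 (L * (- r + z)); have b4 := atan_gtNpi2 (L * (- r - z)).
have BL : 0 <= B / L by rewrite divr_ge0 // ltW.
rewrite (_ : _ - _ = B / L * (atan (L * (r + z)) + atan (L * (r - z)) - atan (L * (- r + z)) - atan (L * (- r - z)))); last by ring.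
rewrite (_ : 2 * B * pi / L = B / L * (2 * pi)); last by ring.
by apply: ler_wpM2l => //; lra.
Qed.
End iterated_bounds.

Section wave_packet.
Variables (R : realType) (chi : nat -> R -> R).
Hypothesis chi_chain : chain chi.
Hypothesis chi_supp : forall k t, 2 <= `|t| -> chi k t = 0.

(** The k-th derivative of t |-> chi(t / L); the summand 0 makes it an instance
    of the affine change of variable for chains. *)
Definition dilate (L : R) (k : nat) (t : R) : R := L^-1 ^+ k * chi k (0 + L^-1 * t).

Lemma dilate_chain L : chain (dilate L). Proof. exact: chain_affine. Qed.

Lemma dilate_supp L k t : 0 < L -> 2 * L <= `|t| -> dilate L k t = 0.
Proof.
move=> L0 tL; rewrite /dilate chi_supp ?mulr0 // add0r normrM ger0_norm ?invr_ge0 ?(ltW L0) //.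
by rewrite ler_pdivlMl // mulrC.
Qed.

Lemma chi_bounded k : exists2 M : R, 0 < M & forall t, `|chi k t| <= M.
Proof.
have [M M0 HM] := segment_bounded (-2) 2 (@chain_continuous R chi k chi_chain).
exists M => // t; have [t2|t2] := leP 2 `|t|; first by rewrite chi_supp // normr0 ltW.
by apply: HM; rewrite -ler_norml ltW.
Qed.

(** The dilated plateau has its spectrum in a window of width 1/L. Decay of
    order N costs N derivatives, each gaining 1/L. *)
Lemma power_decay (N : nat) : exists2 C : R, 0 <= C & forall L xi, 1 <= L ->
  (1 + (L * xi) ^+ 2) ^+ N * spectral_power (2 * L) (dilate L 0) xi <= C * L ^+ 2.
Proof.
have [M0 M00 HM0] := chi_bounded 0; have [M MN0 HM] := chi_bounded N.
exists (2 ^+ N * (32 * M0 ^+ 2 + 32 * M ^+ 2)); first by apply: mulr_ge0;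
    [exact: exprn_ge0|apply: addr_ge0; apply: mulr_ge0 => //; exact: sqr_ge0].
move=> L xi L1; have L0 : 0 < L := lt_le_trans ltr01 L1; have LL : 0 < 2 * L by rewrite mulr_gt0.
set x := (L * xi) ^+ 2; have x0 : 0 <= x by exact: sqr_ge0.
set P := spectral_power _ _ _; have P0 : 0 <= P by exact: power_ge0.
have h1 : (1 + x) ^+ N <= 2 ^+ N * (1 + x ^+ N).
  have m0 : 0 <= Num.max 1 x by rewrite le_max ler01.
  apply: (@le_trans _ _ ((2 * Num.max 1 x) ^+ N)).
    have m1 : 1 <= Num.max 1 x by rewrite le_max lexx.
    have m2 : x <= Num.max 1 x by rewrite le_max lexx orbT.
    apply: lerXn2r; rewrite ?nnegrE; [exact: addr_ge0|exact: mulr_ge0|].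
    by apply: le_trans (lerD m1 m2) _; rewrite -mulr2n mulr_natl.
  rewrite exprMn ler_wpM2l ?exprn_ge0 //.
  have xN : 0 <= x ^+ N by exact: exprn_ge0.
  by have [_|_] := leP 1 x; [rewrite lerDr|rewrite expr1n lerDl].
have cd k : continuous (dilate L k) by exact: chain_continuous (dilate_chain L).
have h2 : P <= 32 * M0 ^+ 2 * L ^+ 2.
  apply: (le_trans (@power_bound R (2 * L) LL (dilate L 0) M0 xi (cd 0%N) _)).
    by move=> t; rewrite /dilate expr0 mul1r.
  by rewrite le_eqVlt; apply/orP; left; apply/eqP; ring.
have h3 : x ^+ N * P <= 32 * M ^+ 2 * L ^+ 2.
  have E k : spectral_power (2 * L) (dilate L k) xi = xi ^+ 2 ^+ k * P.
    elim: k => [|k IH]; first by rewrite mul1r.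
    rewrite (power_derive _ _ (dilate_chain L)) ?IH ?exprS ?mulrA //.
    by move=> j t; exact: dilate_supp.
  have Lk0 : 0 <= (L ^+ N) ^+ 2 by exact: sqr_ge0.
  have hN : spectral_power (2 * L) (dilate L N) xi <= 8 * (L^-1 ^+ N * M) ^+ 2 * (2 * L) ^+ 2.
    apply: (@power_bound R (2 * L) LL (dilate L N) (L^-1 ^+ N * M)) => // t.
    by rewrite /dilate normrM ger0_norm ?exprn_ge0 ?invr_ge0 ?(ltW L0) // ler_wpM2l // exprn_ge0 // invr_ge0 ltW.
  have := ler_wpM2l Lk0 hN; rewrite E.
  have LN : L ^+ N != 0 by rewrite expf_neq0 // gt_eqF.
  rewrite (_ : (L ^+ N) ^+ 2 * (xi ^+ 2 ^+ N * P) = x ^+ N * P); last first.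
    have e : (L ^+ N) ^+ 2 = (L ^+ 2) ^+ N by rewrite -!exprM mulnC.
    by rewrite e /x (exprMn 2 L xi) (exprMn N (L ^+ 2) (xi ^+ 2)) mulrA.
  by rewrite exprVn (_ : (L ^+ N) ^+ 2 * _ = 32 * M ^+ 2 * L ^+ 2) //; field.
have h4 := ler_wpM2r P0 h1; apply: (le_trans h4).
rewrite -!mulrA ler_wpM2l ?exprn_ge0 // mulrDl mul1r [X in _ <= X]mulrDl; exact: lerD.
Qed.

Definition packet (L z : R) (t : R) : R := cos (z * t) * dilate L 0 t.

(** The weight (1 + xi^2)^N is moved to the two spectral windows at z and - z;
    one extra power of decay is kept to make the bound integrable. *)
Lemma packet_power_bound (z : R) (N : nat) : exists2 C : R, 0 <= C & forall L xi, 1 <= L ->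
  (1 + xi ^+ 2) ^+ N * spectral_power (2 * L) (packet L z) xi <=
  C * L ^+ 2 * (1 + (L * (xi + z)) ^+ 2)^-1 + C * L ^+ 2 * (1 + (L * (xi - z)) ^+ 2)^-1.
Proof.
have [C C0 HC] := power_decay N.+1.
exists (2^-1 * (2 * (1 + z ^+ 2)) ^+ N * C).
  by rewrite !mulr_ge0 ?invr_ge0 // exprn_ge0 // mulr_ge0 // addr_ge0 // sqr_ge0.
move=> L xi L1; have L0 : 0 < L := lt_le_trans ltr01 L1.
have cd : continuous (dilate L 0) by exact: chain_continuous (dilate_chain L).
have one (y : R) : y ^+ 2 = z ^+ 2 -> (1 + xi ^+ 2) ^+ N * spectral_power (2 * L) (dilate L 0) (xi + y) <=
   (2 * (1 + z ^+ 2)) ^+ N * C * L ^+ 2 * (1 + (L * (xi + y)) ^+ 2)^-1.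
  move=> yz; set x := (L * (xi + y)) ^+ 2; have x0 : 0 <= x by exact: sqr_ge0.
  have px : 0 < 1 + x by rewrite ltr_pwDl.
  have p2 : 0 <= 2 * (1 + z ^+ 2).
    by apply: mulr_ge0; [by []|apply: addr_ge0; [exact: ler01|exact: sqr_ge0]].
  have h1 : (1 + xi ^+ 2) ^+ N <= (2 * (1 + z ^+ 2)) ^+ N * (1 + x) ^+ N.
    have p1 : 0 <= 1 + xi ^+ 2 by apply: addr_ge0; [exact: ler01|exact: sqr_ge0].
    rewrite -exprMn; apply: lerXn2r; rewrite ?nnegrE //; first by apply: mulr_ge0 => //; exact: ltW.
    apply: (le_trans (peetre xi y)); rewrite yz; apply: ler_wpM2l => //.
    rewrite lerD2l /x exprMn ler_peMl ?sqr_ge0 //.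
    by rewrite expr_ge1 // ltW.
  apply: (le_trans (ler_wpM2r (power_ge0 _ _ _) h1)).
  rewrite (_ : _ * C * L ^+ 2 * _ = (2 * (1 + z ^+ 2)) ^+ N * (C * L ^+ 2 * (1 + x)^-1)); last by rewrite !mulrA.
  rewrite -(mulrA ((2 * (1 + z ^+ 2)) ^+ N)); apply: ler_wpM2l; first exact: exprn_ge0.
  rewrite ler_pdivlMr //.
  by have := HC L (xi + y) L1; rewrite exprS -/x -mulrA [_ * (1 + x)]mulrC.
have h := ler_wpM2l (_ : 0 <= (1 + xi ^+ 2) ^+ N) (@power_modulate R (2 * L) (dilate L 0) z xi cd).
apply: (le_trans (h _)); first by rewrite exprn_ge0 // addr_ge0 // sqr_ge0.
have h1 := one z erefl; have h2 := one (- z) (sqrrN z).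
rewrite (_ : (1 + xi ^+ 2) ^+ N * _ = 2^-1 * ((1 + xi ^+ 2) ^+ N * spectral_power (2 * L) (dilate L 0) (xi + z)) +
   2^-1 * ((1 + xi ^+ 2) ^+ N * spectral_power (2 * L) (dilate L 0) (xi + - z))); last by ring.
have i2 : 0 <= 2^-1 :> R by rewrite invr_ge0.
apply: lerD.
  by apply: (le_trans (ler_wpM2l i2 h1)); rewrite !mulrA.
by apply: (le_trans (ler_wpM2l i2 h2)); rewrite !mulrA.
Qed.

(** Each variable contributes an integral of order L^2 / L, that is, the squared
    norm is of order c^2 L^n for every s: the carrier frequency is fixed, and
    the envelope only becomes flatter as L grows. *)
Lemma packet_sobolev_bound (n : nat) (s : R) (z : 'I_n -> R) : exists2 E : R, 0 <= E &
  forall L c : R, 1 <= L ->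
  (sobolev_norm s (fun x : 'rV[R]_n => c * \prod_(k < n) packet L (z k) (x 0 k))%R <=
     (E * `|c| * Num.sqrt (L ^+ n))%:E)%E.
Proof.
pose N := (Num.truncn `|s|).+1.
have sN : s <= N%:R by apply: le_trans (ler_norm _) _; rewrite ltW // truncnS_gt.
have /choice[C HC] : forall k : 'I_n, exists C : R, 0 <= C /\ forall L xi, 1 <= L ->
  (1 + xi ^+ 2) ^+ N * spectral_power (2 * L) (packet L (z k)) xi <=
  C * L ^+ 2 * (1 + (L * (xi + z k)) ^+ 2)^-1 + C * L ^+ 2 * (1 + (L * (xi - z k)) ^+ 2)^-1.
  by move=> k; have [C C0 H] := packet_power_bound (z k) N; exists C.
pose E2 := (2 * pi) ^- n * \prod_(k < n) (2 * C k * pi).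
have pi0 : (0 : R) <= pi := pi_ge0 R.
have E20 : 0 <= E2.
  rewrite mulr_ge0 ?invr_ge0 ?exprn_ge0 ?mulr_ge0 //; apply: prodr_ge0 => k _.
  by have [C0 _] := HC k; rewrite !mulr_ge0.
exists (Num.sqrt E2); first exact: sqrtr_ge0.
move=> L c L1; have L0 : 0 < L := lt_le_trans ltr01 L1; have LL : 0 < 2 * L by rewrite mulr_gt0.
pose phi k t := C k * L ^+ 2 * (1 + (L * (t + z k)) ^+ 2)^-1 + C k * L ^+ 2 * (1 + (L * (t - z k)) ^+ 2)^-1.
have CL k : 0 <= C k * L ^+ 2 by have [C0 _] := HC k; rewrite mulr_ge0 ?sqr_ge0.
have phi0 k t : 0 <= phi k t.
  by rewrite addr_ge0 // mulr_ge0 // invr_ge0 addr_ge0 ?sqr_ge0.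
have cphi k : continuous (phi k).
  by move=> t; apply: (@ctp_add R R t _ _ (@lorentz_continuous _ _ _ _ t) (@lorentz_continuous _ _ _ (- z k) t)).
have cpk k : continuous (packet L (z k)).
  move=> t; apply: (@ctp_mul R R t (fun t => cos (z k * t)) (dilate L 0)); last first.
    have cd : continuous (dilate L 0) by exact: chain_continuous (dilate_chain L).
    exact: cd.
  have -> : (fun t => cos (z k * t)) = (fun t => cos (t * z k)) by apply: funext => u; rewrite mulrC.
  exact: cos_scale_continuous.
have pk0 k t : 2 * L <= `|t| -> packet L (z k) t = 0.
  by move=> tL; rewrite /packet dilate_supp ?mulr0.
pose H (xi : 'rV[R]_n) := (1 + dot xi xi) `^ s * fourier_sqnorm (fun x : 'rV[R]_n => c * \prod_(k < n) packet L (z k) (x 0 k)) xi.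
have HE xi : 0 <= H xi <= c ^+ 2 * \prod_(k < n) phi k (xi 0 k).
  rewrite /H (@fourier_sqnorm_product R (2 * L) LL n (fun k => packet L (z k)) c xi cpk pk0).
  have Pp : 0 <= \prod_(k < n) spectral_power (2 * L) (packet L (z k)) (xi 0 k) by apply: prodr_ge0 => k _; exact: power_ge0.
  apply/andP; split; first by rewrite mulr_ge0 ?powR_ge0 // mulr_ge0 ?sqr_ge0.
  rewrite mulrCA ler_wpM2l ?sqr_ge0 //.
  have d1 : 1 <= 1 + dot xi xi by rewrite lerDl sumr_ge0 // => k _; rewrite -expr2 sqr_ge0.
  have w1 : (1 + dot xi xi) `^ s <= \prod_(k < n) (1 + xi 0 k ^+ 2) ^+ N.
    apply: (le_trans (ler_powR d1 sN)); rewrite powR_mulrn ?(le_trans ler01) // prodrXl.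
    have d0 := le_trans ler01 d1; have b0 := le_trans d0 (bracket_prod xi).
    by apply: lerXn2r; rewrite ?nnegrE //; exact: bracket_prod.
  apply: (le_trans (ler_wpM2r Pp w1)); rewrite -big_split /=; apply: ler_prod => k _.
  rewrite mulr_ge0 ?power_ge0 ?exprn_ge0 ?addr_ge0 ?sqr_ge0 //=.
  by have [_] := HC k; apply.
have c20 := sqr_ge0 c.
have I0 k : 0 <= 2 * (C k * L ^+ 2) * pi / L 
  by apply: divr_ge0; [apply: mulr_ge0 => //; apply: mulr_ge0 => //; exact: CL|exact: ltW].
have J := @integral_Rn_product_le R n phi (fun k => 2 * (C k * L ^+ 2) * pi / L) cphi phi0 I0
  (fun k => lorentz_integral (z k) (CL k) L0) (c ^+ 2) c20.
have [_ K] := @integral_Rn_le R n (fun xi => (H xi)%:E) (fun xi => (c ^+ 2 * \prod_(k < n) phi k (xi 0 k))%:E)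
  (fun xi => ltac:(by rewrite lee_fin; case/andP: (HE xi))) (fun xi => ltac:(by rewrite lee_fin; case/andP: (HE xi))).
have -> : (Num.sqrt E2 * `|c| * Num.sqrt (L ^+ n))%:E = sqrte (E2 * c ^+ 2 * L ^+ n)%:E :> \bar R.
  rewrite -[RHS]/((Num.sqrt (E2 * c ^+ 2 * L ^+ n))%:E); congr EFin.
  have Ec : 0 <= E2 * c ^+ 2 by exact: mulr_ge0.
  by rewrite (sqrtrM (L ^+ n) Ec) (sqrtrM (c ^+ 2) E20) sqrtr_sqr.
rewrite /sobolev_norm lee_sqrt; last first.
  rewrite lee_fin; apply: mulr_ge0; first exact: mulr_ge0.
  by apply: exprn_ge0; exact: ltW.
apply: (@le_trans _ _ (((2 * pi) ^- n)%:E * (c ^+ 2 * \prod_(k < n) (2 * (C k * L ^+ 2) * pi / L))%:E)%E).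
  apply: lee_wpmul2l; last exact: le_trans K J.
  by rewrite lee_fin invr_ge0 exprn_ge0 // mulr_ge0.
rewrite -EFinM lee_fin le_eqVlt; apply/orP; left; apply/eqP.
rewrite (_ : \prod_(k < n) (2 * (C k * L ^+ 2) * pi / L) = (\prod_(k < n) (2 * C k * pi)) * L ^+ n); last first.
  transitivity (\prod_(k < n) (2 * C k * pi * L)); last by rewrite big_split /= prodr_const card_ord.
  by apply: eq_bigr => k _; field; rewrite gt_eqF.
by rewrite /E2; ring.
Qed.
End wave_packet.

(** * The geodesic and its critical amplitude *)

(** Divide one of the defining equations by a nonzero component of a. *)
Lemma associated_continuous (R : realType) (m : nat) (Omega : set 'rV[R]_m) (h : 'rV[R]_m -> 'M[R]_m)
    (a : 'rV[R]_m) (f : R -> R) :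
  riemannian_metric Omega h -> a != 0 -> associated_function Omega h a f -> continuous f.
Proof.
move=> rh a0 af.
have [i ai] : exists i, a 0 i != 0.
  apply/existsP; rewrite -[X in is_true X]negbK negb_exists; apply: contra a0 => /forallP H.
  by apply/eqP/rowP => i; rewrite mxE; apply/eqP; have := H i; rewrite negbK.
have cline : continuous (fun t : R => t *: a) by move=> t; exact: scalel_continuous.
have cG j k (t : R) : {for t, continuous (fun t : R => christoffel h i j k (t *: a))}.
  have [] := @christoffel_comparable R m Omega h R t (fun=> 0) (fun t => t *: a) (fun t => t *: a) i j k rh
    (fun=> lexx 0) (@cst_continuous _ _ _ _) (cline t) (cline t) _ (af t).1 (af t).1 => //.
  by move=> q l; rewrite subrr normr0.
have -> : f = fun t => (a 0 i)^-1 * \sum_(j < m) \sum_(k < m) christoffel h i j k (t *: a) * a 0 j * a 0 k.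
  by apply: funext => t; have [_ ->] := af t; rewrite mulKf.
by move=> t; ctp; exact: cG.
Qed.

Section blow_up_profile.
Variables (R : realType) (f : R -> R).
Hypothesis cf : continuous f.

Let F := integral_from0 f.
Let E s := expR (F s).
Let G := integral_from0 E.

Let dF (t : R) : is_derive t (1 : R) F (f t).
Proof. exact: integral_from0_is_derive. Qed.
Let dE (t : R) : is_derive t (1 : R) E (E t * f t).
Proof. by have h := dF t; rewrite /E; isder; ring. Qed.
Let cE : continuous E. Proof. by move=> t; exact: is_derive_cont (dE t). Qed.
Let dG (t : R) : is_derive t (1 : R) G (E t).
Proof. exact: integral_from0_is_derive. Qed.
Let cG : continuous G. Proof. by move=> t; exact: is_derive_cont (dG t). Qed.
Let G_0 : G 0 = 0. Proof. exact: integral_from00. Qed.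
Let E_gt0 s : 0 < E s. Proof. exact: expR_gt0. Qed.

Let G_lt x y : x < y -> G x < G y.
Proof.
move=> xy; have [c _ ceq] := mvt (ltW xy) (fun x _ => dG x).
by rewrite -subr_gt0 ceq mulr_gt0 ?subr_gt0.
Qed.

Let G_inj : injective G.
Proof. by move=> x y Gxy; apply/eqP; case: ltgtP => // /G_lt; rewrite Gxy ltxx. Qed.

Let G_between x1 x2 y : G x1 <= y <= G x2 -> exists x, G x = y.
Proof.
move=> /andP[h1 h2]; have x12 : x1 <= x2.
  by rewrite leNgt; apply/negP => /G_lt; rewrite ltNge (le_trans h1 h2).
have [|c _ <-] := @IVT R G x1 x2 y x12 (continuous_subspaceT cG); last by exists c.
by rewrite ge_min le_max h1 h2 orbT.
Qed.

Hypothesis half_finite :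
  (\int[lebesgue_measure]_(s in `[0%R, +oo[) (expR (integral_from0 f s))%:E < +oo)%E \/
  (\int[lebesgue_measure]_(s in `]-oo, 0%R]) (expR (integral_from0 f s))%:E < +oo)%E.

Let G_bounded : exists B : R, (forall x, G x <= B) \/ (forall x, - B <= G x).
Proof.
have seg (x y : R) : x < y -> (\int[lebesgue_measure]_(s in `[x, y]) (E s)%:E = (G y - G x)%:E)%E.
  move=> xy; rewrite (@continuous_FTC2 R E G x y xy) //.
  - exact: continuous_subspaceT.
  - split.
    + by move=> t _; have [] := dG t.
    + by apply: cvg_at_right_filter; exact: cG.
    + by apply: cvg_at_left_filter; exact: cG.
  by move=> t _; rewrite derive1E; have [_ ->] := dG t.
have bnd (D : set R) (x y : R) : measurable D -> `[x, y]%classic `<=` D -> x < y ->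
   (\int[lebesgue_measure]_(s in D) (E s)%:E < +oo)%E ->
   G y - G x <= fine (\int[lebesgue_measure]_(s in D) (E s)%:E)%E.
  move=> mD xyD xy I.
  have I0 : (0 <= \int[lebesgue_measure]_(s in D) (E s)%:E)%E.
    by apply: integral_ge0 => s _; rewrite lee_fin ltW.
  rewrite -lee_fin fineK ?ge0_fin_numE // -seg //; apply: ge0_subset_integral => //.
  - apply/measurable_EFinP; apply: measurable_funTS; exact: continuous_measurable_fun.
  - by move=> s _; rewrite lee_fin ltW.
case: half_finite => I.
  exists (fine (\int[lebesgue_measure]_(s in `[0%R, +oo[) (E s)%:E)%E); left => x.
  have Bx y : 0 < y -> G y <= fine (\int[lebesgue_measure]_(s in `[0%R, +oo[) (E s)%:E)%E.
    move=> y0; have := bnd `[0%R, +oo[%classic 0 y; rewrite G_0 subr0; apply => //.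
    by move=> s /=; rewrite !in_itv /= => /andP[-> _].
  have [x0|x0] := ltP 0 x; first exact: Bx.
  apply: le_trans (Bx 1 ltr01); apply: ltW; apply: G_lt; exact: le_lt_trans x0 ltr01.
exists (fine (\int[lebesgue_measure]_(s in `]-oo, 0%R]) (E s)%:E)%E); right => x; rewrite lerNl.
have Bx y : y < 0 -> - G y <= fine (\int[lebesgue_measure]_(s in `]-oo, 0%R]) (E s)%:E)%E.
  move=> y0; have := bnd `]-oo, 0%R]%classic y 0; rewrite G_0 sub0r; apply => //.
  by move=> s /=; rewrite !in_itv /= => /andP[_ ->].
have [x0|x0] := ltP x 0; first exact: Bx.
have m1 : -1 < 0 :> R by rewrite oppr_lt0.
apply: le_trans (Bx (-1) m1); rewrite lerN2; apply: ltW; apply: G_lt; exact: lt_le_trans m1 x0.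
Qed.

(** Take g = sup of the y such that both y and - y are values of G; it is finite
    since the range is bounded on one side. If both g and - g were values, then,
    the range being open, slightly larger ones would be values as well, against
    the choice of g. *)
Lemma critical_amplitude : exists g sg : R, [/\ 0 < g, sg ^+ 2 = 1,
  forall y, `|y| < g -> exists x, G x = y & forall x, sg * G x < g].
Proof.
have [B HB] := G_bounded.
(* The set of symmetric amplitudes. *)
pose A := [set y : R | 0 <= y /\ (exists x, G x = y) /\ exists x, G x = - y].
have bA : ubound A B.
  move=> y [_ [[x1 E1] [x2 E2]]]; case: HB => HB; first by rewrite -E1.
  by rewrite -lerN2 -E2.
have A0 : A !=set0 by exists 0; split=> //; rewrite oppr0; split; exists 0.
have hsA : has_sup A by split => //; exists B.
have memA x1 x2 : x1 < 0 -> 0 < x2 -> A (Num.min (G x2) (- G x1)).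
  move=> /G_lt h1 /G_lt h2; rewrite G_0 in h1 h2.
  have h3 : 0 < - G x1 by rewrite oppr_gt0.
  set y := Num.min _ _; have y1 : y <= G x2 by rewrite ge_min lexx.
  have y2 : y <= - G x1 by rewrite ge_min lexx orbT.
  have y0 : 0 < y by rewrite lt_min h2 h3.
  split; first exact: ltW.
  split; apply: (@G_between x1 x2); apply/andP; split => //.
  - by rewrite (le_trans (ltW h1)) // ltW.
  - by rewrite lerNr.
  - by rewrite (le_trans _ (ltW h2)) // oppr_le0 ltW.
pose g := sup A.
have gmax x1 x2 : x1 < 0 -> 0 < x2 -> Num.min (G x2) (- G x1) <= g.
  by move=> h1 h2; apply: ub_le_sup; [exists B|exact: memA].
have g0 : 0 < g.
  apply: (lt_le_trans _ (gmax (-1) 1 _ ltr01)); rewrite ?oppr_lt0 // lt_min -{1}G_0 G_lt ?ltr01 //=.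
  by rewrite oppr_gt0 -G_0 G_lt // oppr_lt0.
have range y : `|y| < g -> exists x, G x = y.
  move=> yg; have yg' : 0 < g - `|y| by rewrite subr_gt0.
  have [w [w0 [[x1 E1] [x2 E2]]] yw] := sup_adherent yg' hsA.
  rewrite -/g opprB addrCA subrr addr0 in yw.
  apply: (@G_between x2 x1); rewrite E1 E2; move: yw; rewrite ltr_norml => /andP[h1 h2].
  by rewrite !ltW.
have [H|/existsNP[x1 /negP]] := pselect (forall x, 1 * G x < g).
  by exists g, 1; rewrite expr1n.
rewrite mul1r -leNgt => h1.
have [H|/existsNP[x2 /negP]] := pselect (forall x, -1 * G x < g).
  by exists g, (-1); rewrite sqrrN expr1n.
rewrite mulN1r -leNgt => h2.
(* If both signs failed, moving one unit further along the line on both sides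
   would give a symmetric amplitude beyond g, G being strictly increasing. *)
have x10 : 0 < x1 + 1.
  rewrite ltNge; apply/negP => h; have h3 : x1 < 0 by rewrite (lt_le_trans _ h) // ltrDl.
  by have := G_lt h3; rewrite G_0 ltNge (le_trans (ltW g0) h1).
have x20 : x2 - 1 < 0.
  rewrite ltNge; apply/negP => h; have h3 : 0 < x2 by move: h; lra.
  by have := G_lt h3; rewrite G_0 ltNge -oppr_ge0 (le_trans (ltW g0) h2).
have := gmax _ _ x20 x10; rewrite leNgt lt_min (le_lt_trans h1) ?G_lt ?ltrDl //=.
by rewrite (le_lt_trans h2) // ltrN2 G_lt // ltrBlDr ltrDl.
Qed.

(** Phi is the inverse of G on ]-g, g[. As G' = exp (\int f), one has Phi' = exp
    (- \int_0^Phi f) and Phi'' = - f(Phi) Phi'^2. The left inverse H is G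
    itself, which is defined and continuous on all of R: it measures the
    position of an arbitrary solution on the line. *)
Lemma geodesic_profile : exists g sg : R, exists Phi phi1 phi2 : R -> R,
  [/\ 0 < g, sg ^+ 2 = 1,
      [/\ forall y : R, `|y| < g -> is_derive y (1 : R) Phi (phi1 y),
      forall y : R, `|y| < g -> is_derive y (1 : R) phi1 (phi2 y),
      forall y : R, `|y| < g -> {for y, continuous phi2},
      forall y, `|y| < g -> phi2 y = - f (Phi y) * phi1 y ^+ 2 & Phi 0 = 0 /\ phi1 0 = 1] &
      exists2 H : R -> R, continuous H & (forall y, `|y| < g -> H (Phi y) = y) /\ forall x, sg * H x < g].
Proof.
have [g [sg [g0 sg1 range sgG]]] := critical_amplitude.
pose Phi y := get [set x | G x = y].
have PhiK y : `|y| < g -> G (Phi y) = y by move=> /range[x Gx]; exact: (getI (P := [set x | G x = y]) Gx).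
have GK x : `|G x| < g -> Phi (G x) = x by move=> h; apply: G_inj; exact: PhiK.
pose phi1 y := (E (Phi y))^-1; pose phi2 y := - f (Phi y) * phi1 y ^+ 2.
have En0 x : E x != 0 by rewrite gt_eqF.
have dPhi (y : R) : `|y| < g -> is_derive y (1 : R) Phi (phi1 y).
  move=> yg; rewrite -{1}(PhiK y yg); apply: (@is_derive_inverse R G Phi (E (Phi y)) (Phi y)) => //.
  - have c : {for Phi y, continuous (fun x => `|G x|)}.
      by apply: (@ctp_comp R R (Phi y) G); [exact: cG|exact: norm_continuous].
    have : \forall x \near Phi y, `|G x| < g by apply: (cvgr_lt _ c); rewrite PhiK.
    by apply: filterS => x; exact: GK.
  - by apply: filterE => x; exact: cG.
have dphi1 (y : R) : `|y| < g -> is_derive y (1 : R) phi1 (phi2 y).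
  move=> yg; have h := @is_derive_chain R R E Phi y 1 _ _ (dE (Phi y)) (dPhi y yg).
  have H := @isd_inv R R y 1 (fun y => E (Phi y)) _ (En0 (Phi y)) h.
  have -> : phi2 y = - (E (Phi y) * f (Phi y) * phi1 y) / E (Phi y) ^+ 2.
    by rewrite /phi2 /phi1; field.
  exact: H.
exists g, sg, Phi, phi1, phi2; split => //; last by exists G.
split => //.
- move=> y yg; have cPhi := is_derive_cont (dPhi y yg); have cphi := is_derive_cont (dphi1 y yg).
  apply: (@ctp_mul R R y (fun y => - f (Phi y)) (fun y => phi1 y ^+ 2)).
    apply: (@ctp_opp R R y (fun y => f (Phi y))).
    by apply: (@continuous_comp _ _ _ Phi f); [exact: cPhi|exact: cf].
  exact: (@ctp_sqr R R y phi1).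
have P0 : Phi 0 = 0 by rewrite -{1}G_0 GK // G_0 normr0.
by split => //; rewrite /phi1 P0 /E /F integral_from00 expR0 invr1.
Qed.

End blow_up_profile.

(** * Nonexistence of the wave map *)

Lemma smooth_C1 (R : realType) (b : R -> R) : smooth (V := R^o) (W := R^o) [set: R] b ->
  exists2 db : R -> R, continuous db & forall t : R, is_derive t (1 : R) b (db t).
Proof.
move=> /(_ 1%N)[_ /(_ 1)[db [[cdb _] dbP]]]; exists db.
  move: cdb; rewrite continuous_open_subspace; last exact: openT.
  by move=> H t; apply: H; rewrite inE.
by move=> t; apply: dbP; rewrite interiorT.
Qed.

Section packet_data.
Variables (R : realType) (chi : nat -> R -> R).
Hypothesis chi_chain : chain chi.
Hypothesis chi_supp : forall k t, 2 <= `|t| -> chi k t = 0.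

Lemma cosine_chain : chain (fun k t => cos (t + k%:R * (pi / 2)) : R).
Proof.
move=> k t; have h : is_derive t (1 : R) (fun t : R => cos (t + k%:R * (pi / 2))) (- sin (t + k%:R * (pi / 2)) * 1).
  by apply: isd_cos; isder; ring.
have -> : t + k.+1%:R * (pi / 2) = t + k%:R * (pi / 2) + pi / 2 by rewrite -(@natr1 R k); ring.
by apply: is_derive_eq h _; rewrite cosDpihalf mulr1.
Qed.

Definition packet_chain (L z : R) : nat -> R -> R :=
  chain_mul (fun k t => z ^+ k * cos ((0 + z * t) + k%:R * (pi / 2))) (dilate chi L).

Lemma packet_chainP L z : chain (packet_chain L z).
Proof.
apply: chain_mulP; last exact: dilate_chain.
exact: (chain_affine 0 z cosine_chain).
Qed.

Lemma packet_test_function (n : nat) (L c : R) (z : 'I_n -> R) : 0 < L ->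
  test_function (fun x : 'rV[R]_n => c * \prod_(k < n) packet chi L (z k) (x 0 k)).
Proof.
move=> L0; have := @product_test_function R n (fun k => packet_chain L (z k)) (fun k => packet_chainP L (z k))
  [:: (c, [ffun=> 0%N])] (2 * L).
rewrite (_ : product_fun _ _ = (fun x : 'rV[R]_n => c * \prod_(k < n) packet chi L (z k) (x 0 k))).
  apply => k i t tL; apply: chain_mul_eq0; right => j; exact: dilate_supp.
apply: funext => x; rewrite /product_fun big_seq1 /=; congr (_ * _); apply: eq_bigr => k _.
by rewrite ffunE /packet_chain chain_mul0 expr0 mul1r mul0r addr0 add0r.
Qed.
End packet_data.

(** The infimum of the closed set of times at which |S| >= g. *)
Lemma first_exit (R : realType) (g t0 : R) (S : R -> R) : continuous S -> S 0 = 0 -> 0 < g -> 0 <= t0 -> g <= `|S t0| ->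
  exists ts : R, [/\ 0 < ts, ts <= t0, g <= `|S ts| & forall t, 0 <= t < ts -> `|S t| < g].
Proof.
move=> cS S0 g0 t00 gt0.
pose A := [set t : R | 0 <= t /\ g <= `|S t|].
have iA : has_inf A by split; [exists t0|exists 0 => t []].
pose ts := inf A.
have ts0 : 0 <= ts by apply: lb_le_inf; [exists t0|move=> t []].
have Sts : g <= `|S ts|.
  rewrite leNgt; apply/negP => lt.
  have c : {for ts, continuous (fun t => `|S t|)}.
    by apply: (@ctp_comp R R ts S); [exact: cS|exact: norm_continuous].
  have : \forall t \near ts, `|S t| < g by exact: (cvgr_lt _ c).
  move=> /nbhs_ballP[d /= d0 Hd]; have [t At td] := inf_adherent d0 iA.
  have tst : ts <= t by apply: ge_inf => //; exact: iA.2.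
  have := Hd t; rewrite /= ltNge At.2 -ball_normE /ball_ /= => /(_ _)/negP; apply => //.
  by rewrite ler0_norm ?subr_le0 // opprB ltrBlDl.
exists ts; split => //.
- by rewrite lt_neqAle ts0 andbT; apply: contraTneq Sts => <-; rewrite S0 normr0 -ltNge.
- by apply: ge_inf; [exact: iA.2|split].
move=> t /andP[t1 t2]; rewrite ltNge; apply/negP => h.
by move: t2; rewrite ltNge => /negP; apply; apply: ge_inf; [exact: iA.2|split].
Qed.

Section nonexistence.
Variables (R : realType) (n' m : nat) (b db : R -> R) (Omega : set 'rV[R]_m) (h : 'rV[R]_m -> 'M[R]_m).
Variables (a : 'rV[R]_m) (f : R -> R) (z kappa g sg B L ts : R) (S Sw : R -> R) (Phi phi1 phi2 H : R -> R).
Local Notation n := n'.+1.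
Local Notation ST := (R^o * 'rV[R]_n)%type.
Hypothesis b_derive : forall t : R, is_derive t (1 : R) b (db t).
Hypothesis db_cont : continuous db.
Hypothesis b0 : forall t, 0 < b t.
Hypothesis bB : forall t, n%:R * b t <= B.
Hypothesis rh : riemannian_metric Omega h.
Hypothesis a0 : a != 0.
Hypothesis af : associated_function Omega h a f.
Hypothesis Smode : mode b n' z S Sw.
Hypothesis S0 : S 0 = 0.
Hypothesis Sw0 : Sw 0 = 1.
Hypothesis g0 : 0 < g.
Hypothesis ts0 : 0 < ts.
Hypothesis BL : B * ts < L.
Hypothesis Sg : forall t, 0 <= t < ts -> `|kappa * S t| < g.
Hypothesis Sts : g <= sg * (kappa * S ts).
Hypothesis Phi_derive : forall y : R, `|y| < g -> is_derive y (1 : R) Phi (phi1 y).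
Hypothesis phi1_derive : forall y : R, `|y| < g -> is_derive y (1 : R) phi1 (phi2 y).
Hypothesis phi2_cont : forall y : R, `|y| < g -> {for y, continuous phi2}.
Hypothesis phi2E : forall y, `|y| < g -> phi2 y = - f (Phi y) * phi1 y ^+ 2.
Hypothesis Phi0 : Phi 0 = 0.
Hypothesis phi10 : phi1 0 = 1.
Hypothesis H_cont : continuous H.
Hypothesis HK : forall y, `|y| < g -> H (Phi y) = y.
Hypothesis Hg : forall x, sg * H x < g.

(** On the axis the solution is Phi(kappa S) a before the time ts. Applying H to
    a nonzero component gives kappa S, and this identity between continuous
    functions persists at ts, where it contradicts sg H < g. *)
Lemma no_wave_map_solution (u1 : 'I_m -> 'rV[R]_n -> R) :
  (forall i (x : 'rV[R]_n), (forall k, `|x 0 k| <= L) -> u1 i x = a 0 i * (kappa * b 0 ^+ n * cos (z * x 0 ord0))) ->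
  ~ exists u, wave_map_solution Omega h b (fun=> fun=> 0) u1 u.
Proof.
move=> u1E [u sol].
have [J [rJ OJ sJ iJ _]] := solution_jet b_derive (fun i x => erefl) sol.
pose J' := geodesic_jet n' b db z kappa S Sw Phi phi1 phi2 a.
have rJ' : regular_jet ts J' by exact: geodesic_jet_regular.
have B0 : 0 <= B by apply: le_trans (bB 0); rewrite mulr_ge0 // ltW.
have L0 : 0 < L by apply: le_lt_trans BL; rewrite mulr_ge0 // ltW.
have init (p : ST) : p.1 <= 0 -> \sum_(k < n) p.2 0 k ^+ 2 < L ^+ 2 ->
     forall i, [/\ jv J i p = jv J' i p, jt J i p = jt J' i p & forall k, jx J i k p = jx J' i k p].
  move=> p0 pL i; have [e1 e2 e3] := iJ i p p0.
  have [e1' e2' e3'] := @geodesic_jet_init R n' m b db z kappa S Sw Phi phi1 phi2 a S0 Phi0 i p p0.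
  rewrite e1 e1' e2 e2' phi10 mul1r Sw0 mulr1; split => //; last by move=> k; rewrite e3 e3'.
  apply: u1E => k; rewrite -(@ler_pXn2r R 2) ?nnegrE ?(ltW L0) // real_normK ?num_real //.
  by apply: le_trans (ltW pL); rewrite (bigD1 k) //= lerDl sumr_ge0 // => l _; exact: sqr_ge0.
have Ju t i : 0 < t < ts -> jv J i (t, 0) = a 0 i * Phi (kappa * S t).
  move=> tt; have /andP[t0 tts] := tt.
  rewrite -(@geodesic_jet_axis R n' m b db z kappa S Sw Phi phi1 phi2 a i t (ltW t0)).
  apply: (@wave_map_uniqueness R n m b db Omega h b_derive db_cont b0 rh ts L B J J') => //.
  - exact: ltW.
  - by move=> p _; rewrite /J' geodesic_jet_chart; exact: (af _).1.
  - exact: (geodesic_jet_solves b db z Sw S0 g0 Sg phi2E af).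
  - rewrite big1 ?exprn_gt0 //= ?subr_gt0.
      by apply: le_lt_trans BL; rewrite ler_wpM2l // ltW.
    by move=> k _; rewrite mxE expr0n.
have [i ai] : exists i, a 0 i != 0.
  apply/existsP; rewrite -[X in is_true X]negbK negb_exists; apply: contra a0 => /forallP HH.
  by apply/eqP/rowP => i; rewrite mxE; apply/eqP; have := HH i; rewrite negbK.
pose D t := H ((a 0 i)^-1 * jv J i (t, 0)) - kappa * S t.
have cS : continuous S by move=> t; have [dS _] := Smode t; exact: is_derive_cont dS.
have cD : continuous D.
  move=> t; apply: (@ctp_sub R R t (fun t => H ((a 0 i)^-1 * jv J i (t, 0))) (fun t => kappa * S t)).
    apply: (@ctp_comp R R t (fun t => (a 0 i)^-1 * jv J i (t, 0)) H); last exact: H_cont.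
    apply: (@ctp_mul R R t (fun=> (a 0 i)^-1) (fun t => jv J i (t, 0))); first exact: ctp_cst.
    apply: (@continuous_comp _ _ _ (fun t : R => (t, 0) : ST) (jv J i)).
      by apply: (@cont_pair R R^o _ id (fun=> (0 : 'rV[R]_n)) t); [exact: cvg_id|exact: cst_continuous].
    have [c _ _ _] := rJ (t + 1); have [] := c i (t, 0); rewrite //= ltrDl //.
  by apply: (@ctp_mul R R t (fun=> kappa) S); [exact: ctp_cst|exact: cS].
have D0 t : 0 < t < ts -> D t = 0.
  move=> tt; have /andP[/ltW t0 tts] := tt; rewrite /D Ju // mulKf // HK ?subrr //.
  by apply: Sg; rewrite t0.
have Dts : D ts = 0.
  apply/eqP; rewrite -normr_le0.
  have : D t @[t --> ts^'-] --> D ts by apply: cvg_at_left_filter; exact: cD.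
  move/norm_cvg_le; apply; near=> t.
  rewrite D0 ?normr0 //; apply/andP; split; last by [].
  by near: t; exact: nbhs_left_gt.
move/eqP: Dts; rewrite subr_eq0 => /eqP E.
by have := Hg ((a 0 i)^-1 * jv J i (ts, 0)); rewrite E ltNge Sts.
Unshelve. all: by end_near. Qed.
End nonexistence.

Lemma plateau_packet (R : realType) (chi : nat -> R -> R) (n : nat) (L z : R) (x : 'rV[R]_n.+1) : 0 < L ->
  (forall t, `|t| <= 1 -> chi 0%N t = 1) -> (forall k, `|x 0 k| <= L) ->
  \prod_(k < n.+1) packet chi L (if k == ord0 then z else 0) (x 0 k) = cos (z * x 0 ord0).
Proof.
move=> L0 chi1 xL.
have d1 k : dilate chi L 0 (x 0 k) = 1.
  rewrite /dilate expr0 mul1r add0r chi1 // normrM ger0_norm ?invr_ge0 ?(ltW L0) //.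
  by rewrite ler_pdivrMl // mulr1.
rewrite big_ord_recl eqxx /packet d1 mulr1 big1 ?mulr1 // => k _.
by rewrite d1 mulr1 mul0r cos0.
Qed.

Theorem theorem1 (R : realType) (n m : nat) (b : R -> R) (T : R)
    (Omega : set 'rV[R]_m) (h : 'rV[R]_m -> 'M[R]_m)
    (a : 'rV[R]_m) (f : R -> R) :
  (0 < n)%N ->
  smooth (V := R^o) (W := R^o) [set: R] b ->
  (forall t, 0 < b t) ->
  0 < T -> (forall t, b (t + T) = b t) ->
  (exists t1 t2, b t1 != b t2) ->
  ISIN n b T ->
  riemannian_metric Omega h ->
  intrinsic_self_coherence Omega h a ->
  associated_function Omega h a f ->
  (\int[lebesgue_measure]_(s in `[0%R, +oo[) (expR (integral_from0 f s))%:E < +oo)%E \/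
  (\int[lebesgue_measure]_(s in `]-oo, 0%R]) (expR (integral_from0 f s))%:E < +oo)%E ->
  forall s delta : R, 0 < delta ->
  exists u0 u1 : 'I_m -> 'rV[R]_n -> R,
    [/\ (forall i, test_function (u0 i) /\ test_function (u1 i)),
        (forall x, Omega (\row_i u0 i x)),
        (\sum_(i < m) (sobolev_norm (s + 1) (u0 i) + sobolev_norm s (u1 i))
           <= delta%:E)%E &
        ~ (exists u : 'I_m -> R^o * 'rV[R]_n -> R,
             wave_map_solution Omega h b u0 u1 u)].
Proof.
move=> n0 sb b0 T0 bT nonconst _ rh [a0 _] af half s delta d0.
case: n n0 => // n' _.
have [db cdb bd] := smooth_C1 sb.
have cb : continuous b by move=> t; exact: is_derive_cont (bd t).
have [M M0 bM] := periodic_bounded T0 bT cb.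
have cf := associated_continuous rh a0 af.
have [g [sg [Phi [phi1 [phi2 [g0 sg1 [dPhi dphi1 cphi2 phi2E [Phi0 phi10]] [H cH [HK Hg]]]]]]]] := geodesic_profile cf half.
have [z [S [Sw [Smode S0 Sw0 growth]]]] := superdiffusive_mode n' bd cdb b0 T0 bT nonconst.
have [chi cchi [chi0 chi1]] := smooth_plateau R.
pose zz (k : 'I_n'.+1) : R := if k == ord0 then z else 0.
have [E E0 HE] := packet_sobolev_bound cchi chi0 s zz.
have [E' _ HE'] := packet_sobolev_bound cchi chi0 (s + 1) zz.
have cS : continuous S by move=> t; have [dS _] := Smode t; exact: is_derive_cont dS.
pose B := n'.+1%:R * M; have B0 : 0 <= B by rewrite mulr_ge0 // ltW.
have bB t : n'.+1%:R * b t <= B by rewrite /B ler_wpM2l // (le_trans (ler_norm _)).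
pose A := (\sum_i `|a 0 i|) * E * b 0 ^+ n'.+1 * g.
have A0 : 0 <= A.
  by rewrite !mulr_ge0 ?exprn_ge0 ?(ltW g0) ?(ltW (b0 0)) // sumr_ge0.
(* The growth of S^2 relative to (1 + t)^n that makes the norm of the data at
   most delta. The final + 1 makes K positive. *)
pose K := A ^+ 2 * (B + 1) ^+ n'.+1 / delta ^+ 2 + 1.
have K0 : 0 < K.
  by rewrite ltr_wpDl // divr_ge0 ?sqr_ge0 // mulr_ge0 ?sqr_ge0 // exprn_ge0 // addr_ge0.
have [t0 t00 Kt] := growth K.
have t1n : 0 < (1 + t0) ^+ n'.+1 by rewrite exprn_gt0 // ltr_pwDl.
have S2 : 0 < S t0 ^+ 2 by apply: lt_le_trans Kt; rewrite mulr_gt0.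
have aS : 0 < `|S t0| by rewrite normr_gt0 -sqrf_eq0 gt_eqF.
(* The amplitude that reaches g at time t0, and possibly earlier; ts is the
   first such time. *)
pose eps := g / `|S t0|; have eps0 : 0 < eps by rewrite divr_gt0.
(* The cone over the plateau |x_k| <= L has speed B >= n b and must contain the
   axis up to time t0. *)
pose L := B * t0 + 1; have Bt0 : 0 <= B * t0 by rewrite mulr_ge0.
have L1 : 1 <= L by rewrite lerDr.
have L0 : 0 < L by apply: lt_le_trans L1.
have cS' : continuous (fun t => eps * S t).
  by move=> t; apply: (@ctp_mul R R t (fun=> eps) S); [exact: ctp_cst|exact: cS].
have exit0 : g <= `|eps * S t0| by rewrite normrM (gtr0_norm eps0) /eps divfK ?gt_eqF.
have S'0 : eps * S 0 = 0 by rewrite S0 mulr0.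
have [ts [ts0 tst0 Sts Slt]] := first_exit cS' S'0 g0 t00 exit0.
(* The sign th directs the wave at ts towards the end of the range which is not
   attained. *)
have [th th2 thS] : exists2 th : R, th ^+ 2 = 1 & sg * th * S ts = `|S ts|.
  have [St|St] := leP 0 (S ts).
    by exists sg => //; rewrite -expr2 sg1 mul1r ger0_norm.
  by exists (- sg); rewrite ?sqrrN // mulrN -expr2 sg1 mulN1r ltr0_norm.
have th1 : `|th| = 1.
  by have := sqrf_eq1 th; rewrite th2 eqxx => /esym/orP[]/eqP->; rewrite ?normrN normr1.
pose kappa := th * eps.
have kS t : `|kappa * S t| = `|eps * S t| by rewrite /kappa -mulrA normrM th1 mul1r.
pose c i := a 0 i * (kappa * b 0 ^+ n'.+1).
exists (fun=> fun=> 0), (fun i x => c i * \prod_(k < n'.+1) packet chi L (zz k) (x 0 k)); split.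
- move=> i; split; last exact: packet_test_function.
  have := @packet_test_function R chi cchi chi0 n'.+1 L 0 zz L0.
  by congr test_function; apply: funext => x; rewrite mul0r.
- by move=> x; have := (af 0).1; congr (Omega _); apply/rowP => i; rewrite !mxE mul0r.
- apply: (@le_trans _ _ (\sum_(i < m) (E * `|c i| * Num.sqrt (L ^+ n'.+1))%:E)%E).
    apply: lee_sum => i _; rewrite -[X in (_ <= X)%E]add0e; apply: leeD; last exact: HE.
    have -> : (fun _ : 'rV[R]_n'.+1 => 0 : R) = (fun x => 0 * \prod_(k < n'.+1) packet chi L (zz k) (x 0 k)).
      by apply: funext => x; rewrite mul0r.
    by apply: (le_trans (HE' L 0 L1)); rewrite normr0 mulr0 mul0r.
  rewrite sumEFin lee_fin -mulr_suml -mulr_sumr.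
  have -> : \sum_(i < m) `|c i| = (\sum_i `|a 0 i|) * (eps * b 0 ^+ n'.+1).
    rewrite mulr_suml; apply: eq_bigr => i _; rewrite /c normrM [X in _ * X]normrM /kappa normrM th1 mul1r.
    by rewrite (gtr0_norm eps0) (ger0_norm (exprn_ge0 _ (ltW (b0 0)))).
  have -> : E * ((\sum_i `|a 0 i|) * (eps * b 0 ^+ n'.+1)) * Num.sqrt (L ^+ n'.+1) =
     A * Num.sqrt (L ^+ n'.+1) / `|S t0| by rewrite /A /eps; ring.
  have Ln : 0 <= L ^+ n'.+1 by rewrite exprn_ge0 // ltW.
  have nA : 0 <= A * Num.sqrt (L ^+ n'.+1) by apply: mulr_ge0 => //; exact: sqrtr_ge0.
  have nd : 0 <= delta * `|S t0| by apply: mulr_ge0 => //; exact: ltW.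
  rewrite ler_pdivrMr // -(@ler_pXn2r R 2) ?nnegrE //.
  rewrite (exprMn 2 A) (exprMn 2 delta) sqr_sqrtr // real_normK ?num_real //.
  have Lle : L ^+ n'.+1 <= (B + 1) ^+ n'.+1 * (1 + t0) ^+ n'.+1.
    rewrite -exprMn; apply: lerXn2r; rewrite ?nnegrE ?(ltW L0) //.
      by rewrite mulr_ge0 ?addr_ge0.
    by rewrite /L; nra.
  apply: (@le_trans _ _ (delta ^+ 2 * (K * (1 + t0) ^+ n'.+1))); last by rewrite ler_wpM2l ?sqr_ge0.
  apply: (le_trans (ler_wpM2l (sqr_ge0 A) Lle)).
  have dn : delta ^+ 2 != 0 by rewrite expf_neq0 // gt_eqF.
  rewrite (_ : delta ^+ 2 * _ = A ^+ 2 * ((B + 1) ^+ n'.+1 * (1 + t0) ^+ n'.+1) + delta ^+ 2 * (1 + t0) ^+ n'.+1).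
    by rewrite lerDl mulr_ge0 ?sqr_ge0 // ltW.
  rewrite /K; move: (A ^+ 2) ((B + 1) ^+ n'.+1) ((1 + t0) ^+ n'.+1) (delta ^+ 2) dn => u v w y y0.
  by field.
apply: (@no_wave_map_solution R n' m b db Omega h a f z kappa g sg B L ts S Sw Phi phi1 phi2 H) => //.
- by apply: le_lt_trans (_ : B * t0 < L); [exact: ler_wpM2l|rewrite /L ltrDl].
- by move=> t /Slt; rewrite kS.
- rewrite (_ : sg * _ = eps * (sg * th * S ts)); last by rewrite /kappa; ring.
  by move: Sts; rewrite normrM (gtr0_norm eps0) thS.
- by move=> i x xL; rewrite plateau_packet // /c !mulrA.
Qed.
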